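(* Let $Q_T=(0,T)\times\mathbb T^d$ and $Q=(0,T)\times\mathbb T^d\times\mathbb T^d$. Let $U_1,U_2$ be two classical solutions of the master equation (see context) with the same Hamiltonian $H$ and running cost $F$ and terminal costs $G_1,G_2$; let $m_1,m_2$ be the measure flows generated by $U_1,U_2$ from the same initial distribution $m_0$, and let $K_i,b_i,A_i$ ($i=1,2$), $\overline K=K_1-K_2$, the operator $\mathcal L_K$ and the source term $R(\overline U,\overline m)$ be as defined in the context. Assume that there is a constant $M>0$ such that, for $i=1,2$, $$\|b_i\|_{L^\infty(Q_T)}+\|A_i\|_{L^\infty(Q_T)}+\|m_i\|_{L^\infty(Q_T)}+\|D_xK_i\|_{L^\infty(Q)}+\|D_yK_i\|_{L^\infty(Q)}\le M .$$ Let $a>0$, $\nu>1$. Then there exist constants $\lambda_1=\lambda_1(T,a,\nu,d,M)\ge1$ and $C=C(T,a,\nu,d,M)>0$ such that, for every $V=V(t,x,y)\in L^2(0,T;H^2(\mathbb T^d\times\mathbb T^d))\cap H^1(0,T;L^2(\mathbb T^d\times\mathbb T^d))$ and all $\lambda\ge\lambda_1$, $$\begin{aligned}&\lambda\int_Qe^{2\lambda(t+a)^\nu}\big(|D_xV|^2+|D_yV|^2\big)\,dx\,dy\,dt+\lambda^2\int_Qe^{2\lambda(t+a)^\nu}|V|^2\,dx\,dy\,dt\\&\le C\int_Qe^{2\lambda(t+a)^\nu}|\mathcal L_KV|^2\,dx\,dy\,dt\\&\quad+Ce^{2\lambda(T+a)^\nu}\int_{\mathbb T^d\times\mathbb T^d}\big(|D_xV(T,x,y)|^2+|D_yV(T,x,y)|^2+\lambda|V(T,x,y)|^2\big)\,dx\,dy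 .\end{aligned}$$ In particular, taking $V=\overline K$ (assuming $\overline K\in L^2(0,T;H^2(\mathbb T^d\times\mathbb T^d))\cap H^1(0,T;L^2(\mathbb T^d\times\mathbb T^d))$) and using $\mathcal L_K\overline K=R(\overline U,\overline m)$, $$\begin{aligned}&\lambda\int_Qe^{2\lambda(t+a)^\nu}\big(|D_x\overline K|^2+|D_y\overline K|^2\big)\,dx\,dy\,dt+\lambda^2\int_Qe^{2\lambda(t+a)^\nu}|\overline K|^2\,dx\,dy\,dt\\&\le C\int_Qe^{2\lambda(t+a)^\nu}|R(\overline U,\overline m)|^2\,dx\,dy\,dt\\&\quad+Ce^{2\lambda(T+a)^\nu}\int_{\mathbb T^d\times\mathbb T^d}\big(|D_x\overline K(T,x,y)|^2+|D_y\overline K(T,x,y)|^2+\lambda|\overline K(T,x,y)|^2\big)\,dx\,dy .\end{aligned}$$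
   Context: **Measure derivatives.** $\mathbb T^d$ is the flat torus, $\mathcal P(\mathbb T^d)$ the Borel probability measures on it (with the Monge–Kantorovich distance). $\Phi:\mathcal P(\mathbb T^d)\to\mathbb R$ is differentiable ($C^1$) in $m$ if there is a continuous $\frac{\delta\Phi}{\delta m}:\mathcal P(\mathbb T^d)\times\mathbb T^d\to\mathbb R$ with $\lim_{s\to0^+}\frac{\Phi((1-s)m+sm')-\Phi(m)}{s}=\int\frac{\delta\Phi}{\delta m}(m,y)\,d(m'-m)(y)$ for all $m,m'$, normalized by $\int\frac{\delta\Phi}{\delta m}(m,y)\,dm(y)=0$. The intrinsic derivative is $D_m\Phi(m,y)=D_y\frac{\delta\Phi}{\delta m}(m,y)$. The same symbol denotes an absolutely continuous measure and its density. **Master equation** (Hamiltonian $H(x,p)$ with continuous $D_pH,D^2_{pp}H$; costs $F(x,m),G(x,m)$ differentiable in $m$): for $(t,x,m)\in(0,T)\times\mathbb T^d\times\mathcal P(\mathbb T^d)$, $$-\partial_tU-\Delta_xU+H(x,D_xU)-\int\operatorname{div}_y(D_mU(t,x,m,y))\,dm(y)+\int D_mU(t,x,m,y)\cdot D_pH(y,D_xU(t,y,m))\,dm(y)=F(x,m),$$ with $U(T,x,m)=G(x,m)$. **Classical solution**: $U$ is continuous, $C^1$ in $t$ and $C^2$ in $x$ (derivatives continuous in all variables), $C^1$ in $m$ with $\delta U/\delta m$ continuous in all variables and twice differentiable in $y$ with derivatives continuous in all variables, and $U$ satisfies the master equation. **Flows and coefficients.** $m_i$ (probability densities) solves $\partial_tm_i-\Delta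 m_i-\operatorname{div}\big(m_iD_pH(x,D_xU_i(t,x,m_i(t)))\big)=0$ in $Q_T$, $m_i(0)=m_0$. Put $u_i(t,x)=U_i(t,x,m_i(t))$, $K_i(t,x,y)=\frac{\delta U_i}{\delta m}(t,x,m_i(t),y)$, $b_i(t,x)=D_pH(x,D_xu_i(t,x))$, $A_i(t,x)=D^2_{pp}H(x,D_xu_i(t,x))$, and $\overline U=U_1-U_2$, $\overline m=m_1-m_2$, $\overline b=b_1-b_2$, $\overline A=A_1-A_2$. $D_x,D_y$ of a function of $(t,x,y)$ denote the gradients in the first and second spatial slot. **Standing setting for $K_i$.** $U_i$ is sufficiently regular that each $K_i$ satisfies on $Q$ $$-\partial_tK_i-\Delta_xK_i-\Delta_yK_i+b_i(t,x)\cdot D_xK_i+b_i(t,y)\cdot D_yK_i+\int_{\mathbb T^d}m_i(t,z)\,D_yK_i(t,x,z)\cdot A_i(t,z)D_xK_i(t,z,y)\,dz=\frac{\delta F}{\delta m}(x,m_i(t),y).$$ **Operator.** $$\begin{aligned}\mathcal L_KV={}&-\partial_tV-\Delta_xV-\Delta_yV+b_1(t,x)\cdot D_xV+b_1(t,y)\cdot D_yV\\&+\int_{\mathbb T^d}m_1(t,z)D_yV(t,x,z)\cdot A_1(t,z)D_xK_1(t,z,y)\,dz+\int_{\mathbb T^d}m_1(t,z)D_yK_2(t,x,z)\cdot A_1(t,z)D_xV(t,z,y)\,dz.\end{aligned}$$ **Source.** $$\begin{aligned}R(\overline U,\overline m)={}&\tfrac{\delta F}{\delta m}(x,m_1(t),y)-\tfrac{\delta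 F}{\delta m}(x,m_2(t),y)-\overline b(t,x)\cdot D_xK_2(t,x,y)-\overline b(t,y)\cdot D_yK_2(t,x,y)\\&-\int_{\mathbb T^d}\overline m(t,z)D_yK_2(t,x,z)\cdot A_1(t,z)D_xK_2(t,z,y)\,dz-\int_{\mathbb T^d}m_2(t,z)D_yK_2(t,x,z)\cdot\overline A(t,z)D_xK_2(t,z,y)\,dz.\end{aligned}$$ *)

(* Defs.v *)
From HB Require Import structures.
From mathcomp Require Import all_boot all_order all_algebra.
From mathcomp Require Import all_classical all_reals all_analysis.
Set Implicit Arguments.
Unset Strict Implicit.
Unset Printing Implicit Defensive.
Import Order.TTheory GRing.Theory Num.Theory.
Import numFieldNormedType.Exports.
Local Open Scope classical_set_scope.
Local Open Scope ring_scope.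

(* The flat torus T^d = R^d / Z^d: functions on T^d are Z^d-periodic functions
   on 'rV[R]_d, and Borel measures on T^d are Borel measures on R^d carried by
   the fundamental cell [0, 1)^d. *)

(* The sigma-algebra generated by the coordinates, as the library does for
   tuples; it is the Borel sigma-algebra of R^n. *)
Definition row_display : measure_display.
Proof. exact: default_measure_display. Qed.

Section borel_row.
Context (R : realType) (n : nat).

Definition row_coord (i : 'I_n) (x : 'rV[R]_n) : measurableTypeR R := x 0 i.

Let row_set0 : g_sigma_preimage row_coord set0.
Proof. exact: sigma_algebra0. Qed.

Let row_setC A :
  g_sigma_preimage row_coord A -> g_sigma_preimage row_coord (~` A).
Proof. exact: sigma_algebraC. Qed.

Let row_bigcup (F : (set 'rV[R]_n)^nat) :
  (forall i, g_sigma_preimage row_coord (F i)) ->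
  g_sigma_preimage row_coord (\bigcup_i (F i)).
Proof. exact: sigma_algebra_bigcup. Qed.

HB.instance Definition _ := @isMeasurable.Build row_display
  'rV[R]_n (g_sigma_preimage row_coord) row_set0 row_setC row_bigcup.

End borel_row.

Section torus_lebesgue.
Context (R : realType).
Local Notation RR := (measurableTypeR R).

Definition tuple_cons n (p : RR * n.-tuple RR) : n.+1.-tuple RR :=
  [the n.+1.-tuple RR of p.1 :: p.2].

Lemma measurable_tuple_cons n : measurable_fun setT (@tuple_cons n).
Proof. by apply: measurable_cons; [exact: measurable_fst|exact: measurable_snd]. Qed.

HB.instance Definition _ n := isMeasurableFun.Build _ _ _ _ (@tuple_cons n)
  (@measurable_tuple_cons n).

Definition tuple_row n (p : n.-tuple RR) : 'rV[R]_n := \row_i tnth p i.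

Lemma measurable_tuple_row n : measurable_fun setT (@tuple_row n).
Proof.
move=> _ A mA; rewrite setTI.
suff : g_sigma_preimage (fun i => @row_coord R n i \o @tuple_row n)
    (@tuple_row n @^-1` A).
  congr (g_sigma_preimage _ _).
  by apply/funext => i; apply/funext => p /=; rewrite /row_coord /tuple_row mxE.
by rewrite g_sigma_preimage_comp; exists A => //; rewrite setTI.
Qed.

HB.instance Definition _ n := isMeasurableFun.Build _ _ _ _ (@tuple_row n)
  (@measurable_tuple_row n).

Fixpoint unit_cube n : probability (n.-tuple RR) R :=
  match n with
  | 0 => dirac [tuple]
  | n'.+1 => distribution (uniform_prob (@ltr01 R) \x unit_cube n')%E (@tuple_cons n')
  end.

Definition torus_leb n : probability 'rV[R]_n R :=
  distribution (unit_cube n) (@tuple_row n).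

End torus_lebesgue.

Section calculus.
Context (R : realType).

Definition dot n (u v : 'rV[R]_n) : R := \sum_i u 0 i * v 0 i.

(* Euclidean (Frobenius) norm; the library's norm on matrices is the sup norm. *)
Definition fnorm m n (A : 'M[R]_(m, n)) : R :=
  Num.sqrt (\sum_i \sum_j A i j ^+ 2).

Definition torus_periodic n (X : Type) (f : 'rV[R]_n -> X) : Prop :=
  forall x i, f (x + delta_mx 0 i) = f x.

Definition grad n (f : 'rV[R]_n -> R) (x : 'rV[R]_n) : 'rV[R]_n :=
  \row_i 'D_(delta_mx 0 i) f x.

Definition div n (v : 'rV[R]_n -> 'rV[R]_n) (x : 'rV[R]_n) : R :=
  \sum_i 'D_(delta_mx 0 i) (fun z => v z 0 i) x.

Definition lap n (f : 'rV[R]_n -> R) (x : 'rV[R]_n) : R := div (grad f) x.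

Definition hess n (f : 'rV[R]_n -> R) (x : 'rV[R]_n) : 'M[R]_n :=
  \matrix_(i, j) 'D_(delta_mx 0 j) (fun z => grad f z 0 i) x.

Definition has_grad n (f : 'rV[R]_n -> R) (x : 'rV[R]_n) : Prop :=
  forall i, derivable f x (delta_mx 0 i).

Definition has_hess n (f : 'rV[R]_n -> R) (x : 'rV[R]_n) : Prop :=
  forall i, has_grad (fun z => grad f z 0 i) x.

(* Partial derivatives of a function of (t, x, y). *)
Definition Dt n (f : R -> 'rV[R]_n -> 'rV[R]_n -> R) (t : R) (x y : 'rV[R]_n) : R :=
  derive1 (fun s => f s x y) t.

Definition Dx n (f : R -> 'rV[R]_n -> 'rV[R]_n -> R) (t : R) (x y : 'rV[R]_n) :=
  grad (fun z => f t z y) x.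

Definition Dy n (f : R -> 'rV[R]_n -> 'rV[R]_n -> R) (t : R) (x y : 'rV[R]_n) :=
  grad (f t x) y.

End calculus.

Section probability_torus.
Context (R : realType) (d : nat).

Definition unit_cell : set 'rV[R]_d := [set x | forall i, 0 <= x 0 i < 1].

Record prob_torus := ProbTorus {
  prob_torus_measure :> probability 'rV[R]_d R;
  prob_torus_cell : prob_torus_measure unit_cell = 1%E }.

HB.instance Definition _ := gen_eqMixin prob_torus.
HB.instance Definition _ := gen_choiceMixin prob_torus.

Definition lip1 (f : 'rV[R]_d -> R) : Prop :=
  torus_periodic f /\ forall x y, `|f x - f y| <= fnorm (x - y).

(* The Monge-Kantorovich distance
   d_1(m, m') = sup { int f d(m - m') | f 1-Lipschitz on T^d }. *)
Definition MK_dist (m m' : prob_torus) : \bar R :=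
  ereal_sup [set (`| \int[m]_y f y - \int[m']_y f y |)%:E | f in lip1].

Let mk_ball (m : prob_torus) (e : R) (m' : prob_torus) : Prop :=
  (MK_dist m m' < e%:E)%E.

Let mk_ball_center m (e : R) : 0 < e -> mk_ball m e m.
Proof.
move=> e0; apply: (@le_lt_trans _ _ 0%E); last by rewrite lte_fin.
by apply: ub_ereal_sup => _ [f _ <-]; rewrite subrr normr0.
Qed.

Let mk_ball_sym m m' (e : R) : mk_ball m e m' -> mk_ball m' e m.
Proof.
apply: le_lt_trans; apply: ub_ereal_sup => _ [f lf <-].
by rewrite distrC; apply: ereal_sup_ubound; exists f.
Qed.

Let mk_ball_triangle m1 m2 m3 (e1 e2 : R) :
  mk_ball m1 e1 m2 -> mk_ball m2 e2 m3 -> mk_ball m1 (e1 + e2) m3.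
Proof.
rewrite /mk_ball => h1 h2; rewrite EFinD.
apply: (le_lt_trans _ (lteD h1 h2)); apply: ub_ereal_sup => _ [f lf <-].
apply: (@le_trans _ _ ((`| \int[m1]_y f y - \int[m2]_y f y |)%:E +
  (`| \int[m2]_y f y - \int[m3]_y f y |)%:E)%E).
  by rewrite -EFinD lee_fin ler_distD.
by apply: leeD; apply: ereal_sup_ubound; exists f.
Qed.

HB.instance Definition _ := hasNbhs.Build prob_torus (nbhs_ (entourage_ mk_ball)).
HB.instance Definition _ := @Nbhs_isPseudoMetric.Build R prob_torus
  (entourage_ mk_ball) erefl mk_ball mk_ball_center mk_ball_sym mk_ball_triangle
  erefl.

End probability_torus.

Section measure_derivative.
Context (R : realType) (d : nat).
Local Notation prob_torus := (prob_torus R d).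
Local Notation unit_cell := (@unit_cell R d).

(* (1 - s) m + s m', with s truncated to [0, 1] so as to be total in s. *)
Definition clamp01 (s : R) : R := Num.min (Num.max s 0) 1.

Lemma clamp01_ge0 s : 0 <= clamp01 s.
Proof. by rewrite /clamp01 le_min ler01 le_max lexx orbT. Qed.

Lemma onem_clamp01_ge0 s : 0 <= 1 - clamp01 s.
Proof. by rewrite subr_ge0 /clamp01 ge_min lexx orbT. Qed.

Section mix.
Context (s : R) (m m' : prob_torus).

Definition mix_measure : set 'rV[R]_d -> \bar R :=
  measure_add (mscale (NngNum (onem_clamp01_ge0 s)) m)
              (mscale (NngNum (clamp01_ge0 s)) m').

HB.instance Definition _ := Measure.on mix_measure.

Let mix_one A : m A = 1%E -> m' A = 1%E -> mix_measure A = 1%E.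
Proof.
move=> mA m'A; transitivity
    ((1 - clamp01 s)%:E * m A + (clamp01 s)%:E * m' A)%E.
  by rewrite /mix_measure measure_addE.
by rewrite mA m'A !mule1 -EFinD subrK.
Qed.

Let mix_setT : mix_measure setT = 1%E.
Proof. by apply: mix_one; exact: probability_setT. Qed.

HB.instance Definition _ := Measure_isProbability.Build _ _ _ mix_measure mix_setT.

Lemma mix_cell : mix_measure unit_cell = 1%E.
Proof. by apply: mix_one; exact: prob_torus_cell. Qed.

Definition mix : prob_torus := ProbTorus mix_cell.

End mix.

(* dPhi is the (normalized) derivative of Phi with respect to the measure. *)
Definition is_measure_derivative (Phi : prob_torus -> R)
    (dPhi : prob_torus -> 'rV[R]_d -> R) : Prop :=
  [/\ forall m : prob_torus, torus_periodic (dPhi m),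
      continuous (fun w : prob_torus * 'rV[R]_d => dPhi w.1 w.2),
      forall m m' : prob_torus, (Phi (mix s m m') - Phi m) / s @[s --> 0^'+] -->
        \int[m']_y dPhi m y - \int[m]_y dPhi m y
    & forall m : prob_torus, \int[m]_y dPhi m y = 0].

Definition measure_differentiable (Phi : prob_torus -> R) : Prop :=
  exists dPhi, is_measure_derivative Phi dPhi.

End measure_derivative.

Section mean_field_game.
Context (R : realType) (d : nat) (T : R).
Local Notation X := 'rV[R]_d.
Local Notation P := (prob_torus R d).
Implicit Types (H : X -> X -> R) (F G : X -> P -> R) (U : R -> X -> P -> R)
  (dU : R -> X -> P -> X -> R) (mu : R -> P) (m : R -> X -> R).

Definition DpH H (x p : X) : X := grad (H x) p.
Definition DppH H (x p : X) : 'M[R]_d := hess (H x) p.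

Record hamiltonian H : Prop := {
  hamiltonian_per : forall p, torus_periodic (H ^~ p);
  hamiltonian_grad : forall x p, has_grad (H x) p;
  hamiltonian_hess : forall x p, has_hess (H x) p;
  hamiltonian_DpH : continuous (fun w : X * X => DpH H w.1 w.2);
  hamiltonian_DppH : continuous (fun w : X * X => DppH H w.1 w.2) }.

Definition DxU U (t : R) (x : X) (mm : P) : X := grad (fun z => U t z mm) x.

Definition DmU dU (t : R) (x : X) (mm : P) (y : X) : X := grad (dU t x mm) y.

Definition running_cost F (dF : X -> P -> X -> R) : Prop :=
  (forall mm, torus_periodic (fun x => F x mm)) /\
  (forall mm y, torus_periodic (fun x => dF x mm y)) /\
  forall x, is_measure_derivative (F x) (dF x).

Definition terminal_cost G : Prop :=
  (forall mm, torus_periodic (fun x => G x mm)) /\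
  forall x, measure_differentiable (G x).

Definition master_equation H F U dU : Prop :=
  forall t x (mm : P), 0 < t < T ->
    - derive1 (fun s => U s x mm) t - lap (fun z => U t z mm) x
    + H x (DxU U t x mm)
    - \int[mm]_y div (DmU dU t x mm) y
    + \int[mm]_y dot (DmU dU t x mm y) (DpH H y (DxU U t y mm))
    = F x mm.

Record classical_solution H F G U dU : Prop := {
  cs_per : forall t mm, 0 <= t <= T -> torus_periodic (fun x => U t x mm);
  cs_cont : {within [set w : R * X * P | 0 <= w.1.1 <= T],
    continuous (fun w => U w.1.1 w.1.2 w.2)};
  cs_dt : forall t x mm, 0 < t < T -> derivable (fun s => U s x mm) t 1;
  cs_dt_cont : {within [set w : R * X * P | 0 < w.1.1 < T],
    continuous (fun w => derive1 (fun s => U s w.1.2 w.2) w.1.1)};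
  cs_grad : forall t x mm, 0 <= t <= T -> has_grad (fun z => U t z mm) x;
  cs_grad_cont : {within [set w : R * X * P | 0 <= w.1.1 <= T],
    continuous (fun w => DxU U w.1.1 w.1.2 w.2)};
  cs_hess : forall t x mm, 0 <= t <= T -> has_hess (fun z => U t z mm) x;
  cs_hess_cont : {within [set w : R * X * P | 0 <= w.1.1 <= T],
    continuous (fun w => hess (fun z => U w.1.1 z w.2) w.1.2)};
  cs_dm : forall t x, 0 <= t <= T -> is_measure_derivative (U t x) (dU t x);
  cs_dm_per : forall t mm y, 0 <= t <= T -> torus_periodic (fun x => dU t x mm y);
  cs_dm_cont : {within [set w : R * X * P * X | 0 <= w.1.1.1 <= T],
    continuous (fun w => dU w.1.1.1 w.1.1.2 w.1.2 w.2)};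
  cs_dm_grad : forall t x mm y, 0 <= t <= T -> has_grad (dU t x mm) y;
  cs_dm_grad_cont : {within [set w : R * X * P * X | 0 <= w.1.1.1 <= T],
    continuous (fun w => DmU dU w.1.1.1 w.1.1.2 w.1.2 w.2)};
  cs_dm_hess : forall t x mm y, 0 <= t <= T -> has_hess (dU t x mm) y;
  cs_dm_hess_cont : {within [set w : R * X * P * X | 0 <= w.1.1.1 <= T],
    continuous (fun w => hess (dU w.1.1.1 w.1.1.2 w.1.2) w.2)};
  cs_master : master_equation H F U dU;
  cs_terminal : forall x mm, U T x mm = G x mm }.

Definition value U mu (t : R) (x : X) : R := U t x (mu t).

Definition coef_b H U mu (t : R) (x : X) : X :=
  DpH H x (grad (value U mu t) x).

Definition coef_A H U mu (t : R) (x : X) : 'M[R]_d :=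
  DppH H x (grad (value U mu t) x).

Definition flow_kernel dU mu (t : R) (x y : X) : R := dU t x (mu t) y.

Definition QT : set (measurableTypeR R * X) := [set q | 0 < q.1 < T].
Definition leb_QT : {measure set (measurableTypeR R * X) -> \bar R} :=
  (@lebesgue_measure R \x torus_leb R d)%E.

Definition Q : set (measurableTypeR R * X * X) := [set q | 0 < q.1.1 < T].
Definition leb_Q : {measure set (measurableTypeR R * X * X) -> \bar R} :=
  (@lebesgue_measure R \x torus_leb R d \x torus_leb R d)%E.

Definition leb_TT : {measure set (X * X) -> \bar R} :=
  (torus_leb R d \x torus_leb R d)%E.

Record test_QT (phi : R -> X -> R) : Prop := {
  test_QT_per : forall t, torus_periodic (phi t);
  test_QT_supp : exists s s' : R, [/\ 0 < s, s' < T &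
    forall t x, ~~ (s <= t <= s') -> phi t x = 0];
  test_QT_dt : forall t x, derivable (phi ^~ x) t 1;
  test_QT_grad : forall t x, has_grad (phi t) x;
  test_QT_hess : forall t x, has_hess (phi t) x;
  test_QT_dt_cont : continuous (fun w : R * X => derive1 (phi ^~ w.2) w.1);
  test_QT_grad_cont : continuous (fun w : R * X => grad (phi w.1) w.2);
  test_QT_hess_cont : continuous (fun w : R * X => hess (phi w.1) w.2) }.

(* mu is the flow of measures, m its density; the Fokker-Planck equation
   d_t m - Delta m - div(m b) = 0 is understood in the sense of distributions. *)
Record flow H U (m0 : P) mu m : Prop := {
  flow_cont : {within [set t : R | 0 <= t <= T], continuous mu};
  flow_init : mu 0 = m0;
  flow_meas : measurable_fun QT (fun q => m q.1 q.2);
  flow_ge0 : forall t x, 0 < t < T -> 0 <= m t x;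
  flow_density : forall t, 0 < t < T -> measurable_fun setT (m t) /\
    forall B, measurable B -> mu t B = (\int[torus_leb R d]_(x in B) (m t x)%:E)%E;
  flow_FP : forall phi, test_QT phi ->
    \int[leb_QT]_(q in QT) ((derive1 (phi ^~ q.2) q.1 + lap (phi q.1) q.2
      - dot (coef_b H U mu q.1 q.2) (grad (phi q.1) q.2)) * m q.1 q.2) = 0 }.

(* int m(t,z) p(t,x,z) . A(t,z) q(t,z,y) dz *)
Definition nonlocal m (A : R -> X -> 'M[R]_d) (p q : R -> X -> X -> X)
    (t : R) (x y : X) : R :=
  \int[torus_leb R d]_z (m t z * dot (p t x z) (q t z y *m (A t z)^T)).

Definition lapx (K : R -> X -> X -> R) (t : R) (x y : X) : R :=
  lap (fun z => K t z y) x.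
Definition lapy (K : R -> X -> X -> R) (t : R) (x y : X) : R := lap (K t x) y.

Record C12_Q (K : R -> X -> X -> R) : Prop := {
  C12_dt : forall t x y, 0 < t < T -> derivable (fun s => K s x y) t 1;
  C12_gradx : forall t x y, 0 < t < T -> has_grad (fun z => K t z y) x;
  C12_grady : forall t x y, 0 < t < T -> has_grad (K t x) y;
  C12_hessx : forall t x y, 0 < t < T -> has_hess (fun z => K t z y) x;
  C12_hessy : forall t x y, 0 < t < T -> has_hess (K t x) y;
  C12_dt_cont : {within [set w : R * X * X | 0 < w.1.1 < T],
    continuous (fun w => Dt K w.1.1 w.1.2 w.2)};
  C12_gradx_cont : {within [set w : R * X * X | 0 < w.1.1 < T],
    continuous (fun w => Dx K w.1.1 w.1.2 w.2)};
  C12_grady_cont : {within [set w : R * X * X | 0 < w.1.1 < T],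
    continuous (fun w => Dy K w.1.1 w.1.2 w.2)};
  C12_hessx_cont : {within [set w : R * X * X | 0 < w.1.1 < T],
    continuous (fun w => hess (fun z => K w.1.1 z w.2) w.1.2)};
  C12_hessy_cont : {within [set w : R * X * X | 0 < w.1.1 < T],
    continuous (fun w => hess (K w.1.1 w.1.2) w.2)} }.

Definition kernel_equation (dF : X -> P -> X -> R) (b : R -> X -> X)
    (A : R -> X -> 'M[R]_d) mu m (K : R -> X -> X -> R) : Prop :=
  forall t x y, 0 < t < T ->
    - Dt K t x y - lapx K t x y - lapy K t x y
    + dot (b t x) (Dx K t x y) + dot (b t y) (Dy K t x y)
    + nonlocal m A (Dy K) (Dx K) t x y
    = dF x (mu t) y.

Definition norm_Linf_QT (f : R -> X -> R) : \bar R :=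
  Lnorm leb_QT +oo (EFin \o (fun q => f q.1 q.2) \_ QT).

Definition norm_Linf_Q (f : R -> X -> X -> R) : \bar R :=
  Lnorm leb_Q +oo (EFin \o (fun q => f q.1.1 q.1.2 q.2) \_ Q).

Definition coefficient_bound (M : R) (b : R -> X -> X) (A : R -> X -> 'M[R]_d)
    m (K : R -> X -> X -> R) : Prop :=
  (norm_Linf_QT (fun t x => fnorm (b t x)) +
   norm_Linf_QT (fun t x => fnorm (A t x)) +
   norm_Linf_QT m +
   norm_Linf_Q (fun t x y => fnorm (Dx K t x y)) +
   norm_Linf_Q (fun t x y => fnorm (Dy K t x y)) <= M%:E)%E.

Definition source (dF : X -> P -> X -> R) mu1 mu2 m1 m2 (b1 b2 : R -> X -> X)
    (A1 A2 : R -> X -> 'M[R]_d) (K2 : R -> X -> X -> R)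
    (t : R) (x y : X) : R :=
  dF x (mu1 t) y - dF x (mu2 t) y
  - dot (b1 t x - b2 t x) (Dx K2 t x y) - dot (b1 t y - b2 t y) (Dy K2 t x y)
  - nonlocal (fun t z => m1 t z - m2 t z) A1 (Dy K2) (Dx K2) t x y
  - nonlocal m2 (fun t z => A1 t z - A2 t z) (Dy K2) (Dx K2) t x y.

End mean_field_game.

Section sobolev.
Context (R : realType) (d : nat) (T : R).
Local Notation X := 'rV[R]_d.
Implicit Types (f g V : R -> X -> X -> R) (Gv : R -> X -> X -> X).

Record test_Q (phi : R -> X -> X -> R) : Prop := {
  test_Q_perx : forall t y, torus_periodic (fun x => phi t x y);
  test_Q_pery : forall t x, torus_periodic (phi t x);
  test_Q_supp : exists s s' : R, [/\ 0 < s, s' < T &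
    forall t x y, ~~ (s <= t <= s') -> phi t x y = 0];
  test_Q_dt : forall t x y, derivable (fun s => phi s x y) t 1;
  test_Q_gradx : forall t x y, has_grad (fun z => phi t z y) x;
  test_Q_grady : forall t x y, has_grad (phi t x) y;
  test_Q_dt_cont : continuous (fun w : R * X * X => Dt phi w.1.1 w.1.2 w.2);
  test_Q_gradx_cont : continuous (fun w : R * X * X => Dx phi w.1.1 w.1.2 w.2);
  test_Q_grady_cont : continuous (fun w : R * X * X => Dy phi w.1.1 w.1.2 w.2) }.

Definition int_Q (f : R -> X -> X -> R) : R :=
  \int[leb_Q R d]_(q in @Q R d T) f q.1.1 q.1.2 q.2.

(* g (resp. Gv) is the weak derivative (resp. gradient) of f on Q; as the
   functions are square integrable, C^1 test functions give the same notion
   as smooth ones. *)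
Definition weak_Dt f g : Prop := forall phi, test_Q phi ->
  int_Q (fun t x y => f t x y * Dt phi t x y) =
  - int_Q (fun t x y => g t x y * phi t x y).

Definition weak_Dx f Gv : Prop := forall phi i, test_Q phi ->
  int_Q (fun t x y => f t x y * Dx phi t x y 0 i) =
  - int_Q (fun t x y => Gv t x y 0 i * phi t x y).

Definition weak_Dy f Gv : Prop := forall phi i, test_Q phi ->
  int_Q (fun t x y => f t x y * Dy phi t x y 0 i) =
  - int_Q (fun t x y => Gv t x y 0 i * phi t x y).

Record test_TT (psi : X -> X -> R) : Prop := {
  test_TT_perx : forall y, torus_periodic (psi ^~ y);
  test_TT_pery : forall x, torus_periodic (psi x);
  test_TT_gradx : forall x y, has_grad (psi ^~ y) x;
  test_TT_grady : forall x y, has_grad (psi x) y;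
  test_TT_gradx_cont : continuous (fun w : X * X => grad (psi ^~ w.2) w.1);
  test_TT_grady_cont : continuous (fun w : X * X => grad (psi w.1) w.2) }.

Definition int_TT (f : X -> X -> R) : R := \int[leb_TT R d]_q f q.1 q.2.

Definition weak_gradient_TT (f : X -> X -> R) (fx fy : X -> X -> X) : Prop :=
  forall psi i, test_TT psi ->
    int_TT (fun x y => f x y * grad (psi ^~ y) x 0 i) =
      - int_TT (fun x y => fx x y 0 i * psi x y) /\
    int_TT (fun x y => f x y * grad (psi x) y 0 i) =
      - int_TT (fun x y => fy x y 0 i * psi x y).

Definition L2_Q f : Prop :=
  measurable_fun (@Q R d T) (fun q => f q.1.1 q.1.2 q.2) /\
  (\int[leb_Q R d]_(q in @Q R d T) (f q.1.1 q.1.2 q.2 ^+ 2)%:E < +oo)%E.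

Definition L2_TT (f : X -> X -> R) : Prop :=
  measurable_fun setT (fun q : X * X => f q.1 q.2) /\
  (\int[leb_TT R d]_q (f q.1 q.2 ^+ 2)%:E < +oo)%E.

(* A witness that V belongs to L^2(0,T; H^2) `&` H^1(0,T; L^2): the weak
   derivatives of V. As usual, V is the representative of its class that is
   continuous from [0, T] to L^2, which gives a meaning to V(T, ., .); the
   gradients at time T are the weak gradients of that function. *)
Record sobolev V := Sobolev {
  sob_t : R -> X -> X -> R;
  sob_x : R -> X -> X -> X;
  sob_y : R -> X -> X -> X;
  sob_xx : R -> X -> X -> 'M[R]_d;
  sob_xy : R -> X -> X -> 'M[R]_d;
  sob_yy : R -> X -> X -> 'M[R]_d;
  sob_L2 : L2_Q V;
  sob_t_L2 : L2_Q sob_t;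
  sob_x_L2 : forall i, L2_Q (fun t x y => sob_x t x y 0 i);
  sob_y_L2 : forall i, L2_Q (fun t x y => sob_y t x y 0 i);
  sob_xx_L2 : forall i j, L2_Q (fun t x y => sob_xx t x y i j);
  sob_xy_L2 : forall i j, L2_Q (fun t x y => sob_xy t x y i j);
  sob_yy_L2 : forall i j, L2_Q (fun t x y => sob_yy t x y i j);
  sob_t_weak : weak_Dt V sob_t;
  sob_x_weak : weak_Dx V sob_x;
  sob_y_weak : weak_Dy V sob_y;
  sob_xx_weak : forall i,
    weak_Dx (fun t x y => sob_x t x y 0 i) (fun t x y => row i (sob_xx t x y));
  sob_xy_weak : forall i,
    weak_Dy (fun t x y => sob_x t x y 0 i) (fun t x y => row i (sob_xy t x y));
  sob_yy_weak : forall i,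
    weak_Dy (fun t x y => sob_y t x y 0 i) (fun t x y => row i (sob_yy t x y));
  sob_slice_L2 : forall t, 0 <= t <= T -> L2_TT (V t);
  sob_slice_cont : forall t, 0 <= t <= T ->
    (\int[leb_TT R d]_q ((V s q.1 q.2 - V t q.1 q.2) ^+ 2)%:E)%E
      @[s --> within [set s | 0 <= s <= T] (nbhs t)] --> 0%E;
  sob_xT_L2 : forall i, L2_TT (fun x y => sob_x T x y 0 i);
  sob_yT_L2 : forall i, L2_TT (fun x y => sob_y T x y 0 i);
  sob_T_weak : weak_gradient_TT (V T) (sob_x T) (sob_y T) }.

Definition LK (b1 : R -> X -> X) (A1 : R -> X -> 'M[R]_d) (m1 : R -> X -> R)
    (K1 K2 : R -> X -> X -> R) V (S : sobolev V) (t : R) (x y : X) : R :=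
  - sob_t S t x y - \tr (sob_xx S t x y) - \tr (sob_yy S t x y)
  + dot (b1 t x) (sob_x S t x y) + dot (b1 t y) (sob_y S t x y)
  + nonlocal m1 A1 (sob_y S) (Dx K1) t x y
  + nonlocal m1 A1 (Dy K2) (sob_x S) t x y.

Definition carleman (a nu lam C : R) V (S : sobolev V)
    (f : R -> X -> X -> R) : Prop :=
  let w t := expR (2 * lam * ((t + a) `^ nu)) in
  (lam%:E * (\int[leb_Q R d]_(q in @Q R d T)
     (w q.1.1 * (fnorm (sob_x S q.1.1 q.1.2 q.2) ^+ 2 +
                 fnorm (sob_y S q.1.1 q.1.2 q.2) ^+ 2))%:E) +
   (lam ^+ 2)%:E * (\int[leb_Q R d]_(q in @Q R d T)
     (w q.1.1 * V q.1.1 q.1.2 q.2 ^+ 2)%:E)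
   <=
   C%:E * (\int[leb_Q R d]_(q in @Q R d T)
     (w q.1.1 * f q.1.1 q.1.2 q.2 ^+ 2)%:E) +
   (C * w T)%:E * (\int[leb_TT R d]_q
     (fnorm (sob_x S T q.1 q.2) ^+ 2 + fnorm (sob_y S T q.1 q.2) ^+ 2 +
      lam * V T q.1 q.2 ^+ 2)%:E))%E.

End sobolev.

(* Main.v *)
(* The weight depends on time only, so an energy argument suffices. Put
   Z = -V_t - Delta_x V - Delta_y V and expand V(t) in the tensor trigonometric
   basis (E_j) of T^d x T^d, with eigenvalues mu_j of -Delta. The coefficients
   f_j of V are continuous on [0, T] and satisfy f_j' = mu_j f_j - Z_j weakly;
   multiplying by w f_j, with w = exp(2 lam (t + a)^nu) and
   w' >= 2 lam c w for c = nu a^(nu - 1), gives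
     (lam c + 2 mu_j) int w f_j^2 <= w(T) f_j(T)^2 + (lam c)^-1 int w Z_j^2.
   Summing over j with Parseval's identity controls lam int w V^2 and
   int w (|D_x V|^2 + |D_y V|^2) by lam^-1 int w Z^2. By Jensen's inequality in
   the integrated variable, the first order and nonlocal terms of L_K are
   bounded, at each time, by |D_x V|^2 + |D_y V|^2 in L^2, so they are absorbed
   once lam is large.
   For V = K_1 - K_2 the classical derivatives have the same Fourier
   coefficients as the weak ones, and L_K V = R follows by subtracting the two
   kernel equations. Time integrals are normalized: the uniform probability on
   [0, T] replaces Lebesgue measure. *)

Require Import Defs.
From HB Require Import structures.
From mathcomp Require Import all_boot all_order all_algebra.
From mathcomp Require Import all_classical all_reals all_analysis.
From mathcomp Require Import measurable_realfun ess_sup_inf.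
From mathcomp Require Import ring lra zify.
Set Implicit Arguments.
Unset Strict Implicit.
Unset Printing Implicit Defensive.
Import Order.TTheory GRing.Theory Num.Theory.
Import numFieldNormedType.Exports.
Import HBSimple HBNNSimple.
Local Open Scope classical_set_scope.
Local Open Scope ring_scope.

(** * Square-integrable functions on a probability space *)

(** One cannot simply multiply by [w V] and integrate by parts: [V] has weak derivatives only, and
    the time derivative and Hessians of [K] are only known to be continuous on the open time
    interval. Fourier coefficients remove this obstacle. A mode times a C^1 cutoff in time is an
    admissible test function, and the weak equation makes each coefficient a primitive. The product
    rule for primitives is Fubini on a square cut along its diagonal, so it needs no derivative at
    any point. The price is completeness of the trigonometric system, proved with step polynomials
    on half-circles and Dynkin's theorem. The core estimate [carleman_of_heat] asks only for a
    splitting [f = Z + L], with [Z] satisfying the heat equation mode by mode and [L] controlled by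
    the gradients. It is run twice, with weak derivatives for [LK] and with classical ones for
    [source], so the two kinds of derivative are never compared pointwise. An infinite right-hand
    side is trivial; otherwise [Z = f - L] is square integrable, as Parseval demands. The energy
    inequality gives the gradients a factor 2: one half absorbs [L], the other half stays in the
    estimate. *)

Section square_integrable.
Context {disp : measure_display} {X : measurableType disp} {R : realType}.
Variable P : {measure set X -> \bar R}.
Implicit Types f g h : X -> R.

(** Functions are kept as representatives rather than classes: later they are sliced at a fixed
    time, which has no meaning for a class. *)
Definition sqint f :=
  measurable_fun setT f /\ (\int[P]_x (f x ^+ 2)%:E < +oo)%E.

Lemma meas_sq f : measurable_fun setT f ->
  measurable_fun setT (fun x => (f x ^+ 2)%:E).
Proof. by move=> mf; apply/measurable_EFinP; apply: measurable_funX. Qed.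

Lemma sqint_integrable f : sqint f ->
  P.-integrable setT (EFin \o (fun x => f x ^+ 2)).
Proof.
move=> [mf f2]; apply/integrableP; split; first exact: meas_sq.
by under eq_integral do rewrite /= ger0_norm ?sqr_ge0//.
Qed.

Lemma integrable_dom f g : measurable_fun setT f -> (forall x, `|f x| <= g x) ->
  P.-integrable setT (EFin \o g) -> P.-integrable setT (EFin \o f).
Proof.
move=> mf fg; apply: le_integrable => //; first exact/measurable_EFinP.
by move=> x _ /=; rewrite lee_fin (le_trans (fg x))// ler_norm.
Qed.

Lemma integrableDr f g : P.-integrable setT (EFin \o f) ->
  P.-integrable setT (EFin \o g) ->
  P.-integrable setT (EFin \o (fun x => f x + g x)).
Proof. by move=> f1 g1; apply: (integrableD _ f1 g1). Qed.

Lemma integrableBr f g : P.-integrable setT (EFin \o f) ->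
  P.-integrable setT (EFin \o g) ->
  P.-integrable setT (EFin \o (fun x => f x - g x)).
Proof. by move=> f1 g1; apply: (integrableB _ f1 g1). Qed.

Lemma integrableZlr k f : P.-integrable setT (EFin \o f) ->
  P.-integrable setT (EFin \o (fun x => k * f x)).
Proof. by move=> f1; apply: (integrableZl _ _ f1). Qed.

Lemma integrable_sumr (I : Type) (s : seq I) (f : I -> X -> R) :
  (forall i, P.-integrable setT (EFin \o f i)) ->
  P.-integrable setT (EFin \o (fun x => \sum_(i <- s) f i x)).
Proof.
move=> fi; rewrite (_ : _ \o _ = fun x => (\sum_(i <- s) (f i x)%:E)%E); last first.
  by apply/funext => x /=; rewrite sumEFin.
exact: (@integrable_sum _ _ _ _ _ _ _ _ _ (fun i => EFin \o f i)).
Qed.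

Lemma Rintegral_sum (I : Type) (s : seq I) (f : I -> X -> R) :
  (forall i, P.-integrable setT (EFin \o f i)) ->
  \int[P]_x (\sum_(i <- s) f i x) = \sum_(i <- s) \int[P]_x f i x.
Proof.
move=> fi; elim: s => [|i s ih].
  by under eq_Rintegral do rewrite big_nil; rewrite big_nil Rintegral_cst// mul0r.
under eq_Rintegral do rewrite big_cons.
by rewrite big_cons RintegralD// ?ih//; exact: integrable_sumr.
Qed.

Lemma sqint_mul f g : sqint f -> sqint g ->
  P.-integrable setT (EFin \o (fun x => f x * g x)).
Proof.
move=> f2 g2; apply: (@integrable_dom _ (fun x => f x ^+ 2 + g x ^+ 2)).
- by apply: measurable_funM; [case: f2|case: g2].
- by move=> x; rewrite ler_norml; apply/andP; split; nra.
- by apply: integrableDr; apply: sqint_integrable.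
Qed.

Lemma sqint_dom f g : measurable_fun setT f -> sqint g ->
  (forall x, `|f x| <= `|g x|) -> sqint f.
Proof.
move=> mf [mg g2] fg; split => //; apply: le_lt_trans g2.
apply: ge0_le_integral => //; try exact: meas_sq.
  by move=> x _; rewrite lee_fin sqr_ge0.
by move=> x _; rewrite lee_fin -[f x ^+ 2]ger0_norm ?sqr_ge0// normrX -[g x ^+ 2]ger0_norm ?sqr_ge0// normrX lerXn2r ?nnegrE.
Qed.

Lemma sqintD f g : sqint f -> sqint g -> sqint (fun x => f x + g x).
Proof.
move=> f2 g2; have mfg : measurable_fun setT (fun x => f x + g x).
  by apply: measurable_funD; [case: f2|case: g2].
split=> //; have : (\int[P]_x (2 * (f x ^+ 2) + 2 * (g x ^+ 2))%:E < +oo)%E.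
  have /integrableP[_] : P.-integrable setT
    (EFin \o (fun x => 2 * (f x ^+ 2) + 2 * (g x ^+ 2))).
    by apply: integrableDr; apply: integrableZlr; apply: sqint_integrable.
  apply: le_lt_trans; rewrite le_eqVlt; apply/orP; left; apply/eqP.
  by apply: eq_integral => x _; rewrite /= ger0_norm// addr_ge0// mulr_ge0// ?sqr_ge0.
apply: le_lt_trans; apply: ge0_le_integral => //.
- by move=> x _; rewrite lee_fin sqr_ge0.
- exact: meas_sq.
- apply/measurable_EFinP; apply: measurable_funD; apply: measurable_funM => //;
  apply: measurable_funX; [by case: f2|by case: g2].
- by move=> x _; rewrite lee_fin; have := sqr_ge0 (f x - g x); nra.
Qed.

Lemma sqintZ k f : sqint f -> sqint (fun x => k * f x).
Proof.
move=> f2; split; first by apply: measurable_funM => //; case: f2.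
have /integrableP[_] := integrableZlr (k ^+ 2) (sqint_integrable f2).
apply: le_lt_trans; rewrite le_eqVlt; apply/orP; left; apply/eqP.
by apply: eq_integral => x _; rewrite /= ger0_norm ?exprMn// mulr_ge0 ?sqr_ge0.
Qed.

Lemma sqintB f g : sqint f -> sqint g -> sqint (fun x => f x - g x).
Proof.
move=> f2 g2; have := sqintD f2 (sqintZ (-1) g2).
by under eq_fun do rewrite mulN1r.
Qed.

Lemma sqint0 : sqint (fun=> 0).
Proof. by split => //; under eq_integral do rewrite expr0n/=; rewrite integral0. Qed.

Lemma sqint_sum (I : Type) (s : seq I) (f : I -> X -> R) :
  (forall i, sqint (f i)) -> sqint (fun x => \sum_(i <- s) f i x).
Proof.
move=> fi; elim: s => [|i s ih]; first by under eq_fun do rewrite big_nil; exact: sqint0.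
by under eq_fun do rewrite big_cons; apply: sqintD.
Qed.

Definition ip f g : R := \int[P]_x (f x * g x).

Lemma ip_EFin f : sqint f -> (ip f f)%:E = (\int[P]_x (f x ^+ 2)%:E)%E.
Proof.
move=> f2; rewrite /ip /Rintegral; under eq_integral do rewrite -expr2.
by rewrite fineK//; apply: integrable_fin_num => //; exact: sqint_integrable.
Qed.

Lemma ip_ge0 f : 0 <= ip f f.
Proof. by apply: Rintegral_ge0 => x _; rewrite -expr2 sqr_ge0. Qed.

Lemma ipC f g : ip f g = ip g f.
Proof. by apply: eq_Rintegral => x _; rewrite mulrC. Qed.

Lemma ipDl f g h : sqint f -> sqint g -> sqint h ->
  ip (fun x => f x + g x) h = ip f h + ip g h.
Proof.
move=> f2 g2 h2; rewrite /ip; under eq_Rintegral do rewrite mulrDl.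
by rewrite RintegralD//; exact: sqint_mul.
Qed.

Lemma ipZl k f h : sqint f -> sqint h -> ip (fun x => k * f x) h = k * ip f h.
Proof.
move=> f2 h2; rewrite /ip; under eq_Rintegral do rewrite -mulrA.
by rewrite RintegralZl//; exact: sqint_mul.
Qed.

Lemma ipBl f g h : sqint f -> sqint g -> sqint h ->
  ip (fun x => f x - g x) h = ip f h - ip g h.
Proof.
move=> f2 g2 h2; rewrite /ip; under eq_Rintegral do rewrite mulrBl.
by rewrite RintegralB//; exact: sqint_mul.
Qed.

Lemma ip_suml (I : Type) (s : seq I) (f : I -> X -> R) h :
  (forall i, sqint (f i)) -> sqint h ->
  ip (fun x => \sum_(i <- s) f i x) h = \sum_(i <- s) ip (f i) h.
Proof.
move=> f2 h2; rewrite /ip; under eq_Rintegral do rewrite mulr_suml.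
by rewrite Rintegral_sum// => i; exact: sqint_mul.
Qed.

Lemma ip_sqD f g : sqint f -> sqint g ->
  ip (fun x => f x + g x) (fun x => f x + g x) <= 2 * ip f f + 2 * ip g g.
Proof.
move=> f2 g2; rewrite -[2 * ip f f]ipZl// -[2 * ip g g]ipZl// /ip -RintegralD//.
- apply: le_Rintegral => //.
  + by have := sqintD f2 g2 => h2; exact: sqint_mul.
  + by apply: integrableDr; apply: sqint_mul => //; exact: sqintZ.
  + by move=> x _; have := sqr_ge0 (f x - g x); nra.
- by apply: sqint_mul => //; exact: sqintZ.
- by apply: sqint_mul => //; exact: sqintZ.
Qed.

Definition approx (E : set (X -> R)) g :=
  forall e, 0 < e -> exists2 p, E p & ip (fun x => g x - p x) (fun x => g x - p x) <= e.

Section dense.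
Variable E : set (X -> R).
Hypothesis E_sq : forall p, E p -> sqint p.
Hypothesis E_D : forall p q, E p -> E q -> E (fun x => p x + q x).
Hypothesis E_Z : forall k p, E p -> E (fun x => k * p x).

Lemma approxD f g : sqint f -> sqint g -> approx E f -> approx E g ->
  approx E (fun x => f x + g x).
Proof.
move=> f2 g2 af ag e e0; have e4 : 0 < e / 4 by lra.
have [p Ep pe] := af _ e4; have [q Eq qe] := ag _ e4.
exists (fun x => p x + q x); first exact: E_D.
have := ip_sqD (sqintB f2 (E_sq Ep)) (sqintB g2 (E_sq Eq)).
rewrite (_ : (fun x => f x - p x + (g x - q x)) = (fun x => f x + g x - (p x + q x))).
  by move=> /le_trans; apply; lra.
by apply/funext => x; ring.
Qed.

Lemma approxZ k f : sqint f -> approx E f -> approx E (fun x => k * f x).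
Proof.
move=> f2 af e e0; have k0 : 0 < k ^+ 2 + 1 by have := sqr_ge0 k; lra.
have [p Ep pe] := af (e / (k ^+ 2 + 1)) (divr_gt0 e0 k0).
exists (fun x => k * p x); first exact: E_Z.
have s2 := sqintB f2 (E_sq Ep).
rewrite (_ : (fun x => k * f x - k * p x) = (fun x => k * (f x - p x))); last first.
  by apply/funext => x; ring.
rewrite ipZl//; last exact: sqintZ.
rewrite ipC ipZl// mulrA -expr2.
have := ip_ge0 (fun x => f x - p x); move: pe; rewrite ler_pdivlMr//.
by have := sqr_ge0 k; nra.
Qed.

(** Closedness in [L^2], which carries approximability through increasing limits of simple functions
    and through countable disjoint unions. *)
Lemma approx_lim g : sqint g ->
  (forall e, 0 < e -> exists2 h, sqint h /\ approx E h &
    ip (fun x => g x - h x) (fun x => g x - h x) <= e) -> approx E g.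
Proof.
move=> g2 ag e e0; have e4 : 0 < e / 4 by lra.
have [h [h2 ah] he] := ag _ e4; have [p Ep pe] := ah _ e4.
exists p => //; have := ip_sqD (sqintB g2 h2) (sqintB h2 (E_sq Ep)).
rewrite (_ : (fun x => g x - h x + (h x - p x)) = (fun x => g x - p x)).
  by move=> /le_trans; apply; lra.
by apply/funext => x; ring.
Qed.

Lemma approx_sum (I : Type) (s : seq I) (f : I -> X -> R) : E (fun=> 0) ->
  (forall i, sqint (f i)) -> (forall i, approx E (f i)) ->
  approx E (fun x => \sum_(i <- s) f i x).
Proof.
move=> E0 f2 fi; elim: s => [|i s ih].
  under eq_fun do rewrite big_nil; move=> e e0; exists (fun=> 0) => //.
  by rewrite /ip; under eq_Rintegral do rewrite subrr mul0r; rewrite Rintegral_cst// mul0r ltW.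
by under eq_fun do rewrite big_cons; apply: approxD => //; exact: sqint_sum.
Qed.

End dense.
End square_integrable.

Lemma ae_imp {disp : measure_display} {X : measurableType disp} {R : realType}
    (P : {measure set X -> \bar R}) (A B : X -> Prop) :
  (forall x, A x -> B x) -> {ae P, forall x, A x} -> {ae P, forall x, B x}.
Proof. by move=> AB; apply: (@filterS _ _ (ae_filter_ringOfSetsType P)). Qed.

Lemma ae_eq_Rintegral {disp : measure_display} {X : measurableType disp} {R : realType}
    (P : {measure set X -> \bar R}) (f g : X -> R) :
  measurable_fun setT f -> measurable_fun setT g ->
  {ae P, forall x, f x = g x} -> \int[P]_x f x = \int[P]_x g x.
Proof.
move=> mf mg fg; rewrite /Rintegral; congr fine; apply: ae_eq_integral => //.
- exact/measurable_EFinP.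
- exact/measurable_EFinP.
- by apply: (@filterS _ _ (ae_filter_ringOfSetsType P) _ _ _ fg) => x ->.
Qed.

Lemma ae_le_Rintegral {disp : measure_display} {X : measurableType disp} {R : realType}
    (P : {measure set X -> \bar R}) (f g : X -> R) :
  P.-integrable setT (EFin \o f) -> P.-integrable setT (EFin \o g) ->
  {ae P, forall x, f x <= g x} -> \int[P]_x f x <= \int[P]_x g x.
Proof.
move=> fi gi fg; rewrite -subr_ge0 -RintegralB//.
have mf : measurable_fun setT f by have := measurable_int _ fi; move/measurable_EFinP.
have mg : measurable_fun setT g by have := measurable_int _ gi; move/measurable_EFinP.
rewrite (@ae_eq_Rintegral _ _ _ _ _ (fun x => `|g x - f x|)).
- by apply: Rintegral_ge0.
- exact: measurable_funB.
- by apply: measurableT_comp => //; exact: measurable_funB.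
- by apply: ae_imp fg => x fgx; rewrite ger0_norm// subr_ge0.
Qed.

(** * Probability spaces: Jensen's inequality, and density deduced from indicators *)

Section dense_indic.
Context {disp : measure_display} {X : measurableType disp} {R : realType}.
Variable P : probability X R.
Implicit Types f g h : X -> R.

Lemma sqint_bounded f B : measurable_fun setT f -> (forall x, `|f x| <= B) -> sqint P f.
Proof.
move=> mf fB; split => //; have -> : (+oo = +oo :> \bar R)%E by [].
apply: (@le_lt_trans _ _ (\int[P]_x (B ^+ 2)%:E)%E).
  apply: ge0_le_integral => //; first by move=> x _; rewrite lee_fin sqr_ge0.
    exact: meas_sq.
  move=> x _; rewrite lee_fin -[f x ^+ 2]ger0_norm ?sqr_ge0// normrX lerXn2r ?nnegrE//.
  by rewrite (le_trans _ (fB x)).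
by rewrite integral_cst//= probability_setT mule1 ltry.
Qed.

Lemma integrable_bounded f B : measurable_fun setT f -> (forall x, `|f x| <= B) ->
  P.-integrable setT (EFin \o f).
Proof.
move=> mf fB; apply: (integrable_dom mf fB).
by apply/finite_measure_integrable_cst.
Qed.

(** The variance of [f] is nonnegative; when the second moment is infinite the bound is trivial. *)
Lemma jensen_sq f : measurable_fun setT f ->
  (((\int[P]_x f x) ^+ 2)%:E <= \int[P]_x (f x ^+ 2)%:E)%E.
Proof.
move=> mf; have [foo|] := ltP (\int[P]_x (f x ^+ 2)%:E)%E +oo%E; last first.
  by rewrite leye_eq => /eqP ->; rewrite leey.
have f2 : sqint P f by [].
have one2 : sqint P (fun=> 1) by apply: (@sqint_bounded _ 1) => // x; rewrite normr1.
rewrite -ip_EFin// lee_fin; set c := \int[P]_x f x.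
have fc : ip P f (fun=> 1) = c by apply: eq_Rintegral => x _; rewrite mulr1.
have fc' : ip P (fun=> 1) f = c by rewrite ipC.
have one1 : ip P (fun=> 1) (fun=> 1) = 1.
  rewrite /ip Rintegral_cst//.
  by rewrite /= probability_setT/= !mulr1.
have := ip_ge0 P (fun x => f x - c * 1).
have cc : sqint P (fun x : X => c * 1) by exact: sqintZ.
have fcB : sqint P (fun x => f x - c * 1) by exact: sqintB.
rewrite ipBl// ipC ipBl// ipZl// (ipC P (fun=> c * 1)) ipBl// ipZl// (ipC P f) ipZl//.
rewrite (ipC P (fun=> 1) (fun=> c * 1)) ipZl// fc' one1 => h; nra.
Qed.

Variable E : set (X -> R).
Hypothesis E_sq : forall p, E p -> sqint P p.
Hypothesis E_D : forall p q, E p -> E q -> E (fun x => p x + q x).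
Hypothesis E_Z : forall k p, E p -> E (fun x => k * p x).
Hypothesis E_0 : E (fun=> 0).
Hypothesis E_indic : forall A, measurable A -> approx P E (\1_A : X -> R).

Lemma sqint_indic (A : set X) : measurable A -> sqint P (\1_A : X -> R).
Proof.
move=> mA; apply: (@sqint_bounded _ 1) => // x.
by rewrite indicE; case: (x \in A); rewrite ?normr1 ?normr0.
Qed.

Lemma approx_sfun (f : {sfun X >-> R}) : approx P E f.
Proof.
have fE : (f : X -> R) = (fun x => \sum_(y <- finmap.enum_fset (fset_set (range f))) (y * \1_(f @^-1` [set y]) x)).
  by apply/funext => x; rewrite {1}fimfunE fsbig_finite//.
rewrite fE; apply: approx_sum => // y; first exact/sqintZ/sqint_indic.
by apply: approxZ => //; [exact: sqint_indic|exact: E_indic].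
Qed.

(** Increasing simple approximations [h n] satisfy [0 <= f - h n <= f], so [f ^+ 2] dominates the
    squared errors. *)
Lemma approx_ge0 f : sqint P f -> (forall x, 0 <= f x) -> approx P E f.
Proof.
move=> f2 f0; apply: approx_lim => // e e0.
have mf : measurable_fun setT (EFin \o f) by apply/measurable_EFinP; case: f2.
pose h := nnsfun_approx measurableT mf.
have hf n x : ((h n x)%:E <= (f x)%:E)%E.
  have := @cvg_nnsfun_approx _ _ _ setT measurableT _ mf (fun x _ => f0 x) x I.
  move=> hc; have := ereal_nondecreasing_cvgn (u_ := EFin \o h ^~ x).
  have nd : {homo (EFin \o h ^~ x) : n m / (n <= m)%N >-> (n <= m)%E}.
    by move=> i j ij /=; rewrite lee_fin; exact/lefP/nd_nnsfun_approx.
  move=> /(_ nd) hs.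
  have <- : ereal_sup (range (EFin \o h ^~ x)) = (f x)%:E.
    by apply: (cvg_unique _ hs hc); exact: ereal_hausdorff.
  by apply: ereal_sup_ubound; exists n.
have hb n x : `|f x - h n x| <= `|f x|.
  rewrite !ger0_norm//; last by rewrite subr_ge0 -lee_fin.
  by rewrite gerBl fun_ge0.
have h2 n : sqint P (h n).
  apply: (sqint_dom _ f2) => // x.
  by rewrite !ger0_norm ?fun_ge0// -lee_fin.
have [] := @dominated_convergence _ _ _ P setT measurableT
  (fun n => EFin \o (fun x => (f x - h n x) ^+ 2)) (cst 0)
  (EFin \o (fun x => f x ^+ 2)).
- move=> n; apply: meas_sq; apply: measurable_funB => //; by case: f2.
- exact: measurable_cst.
- apply: aeW => x _ /=.
  have := @cvg_nnsfun_approx _ _ _ setT measurableT _ mf (fun x _ => f0 x) x I.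
  move=> /fine_cvgP[_ /= hc]; apply/fine_cvgP; split; first by near=> n.
  have hc' : (f x - h n x) @[n --> \oo] --> f x - f x.
    by apply: cvgB => //; exact: cvg_cst.
  have -> : 0 = (f x - f x) * (f x - f x) :> R by rewrite subrr mul0r.
  by under eq_cvg do rewrite /= expr2; apply: cvgM.
- exact: sqint_integrable.
- apply: aeW => x n _ /=; rewrite lee_fin ger0_norm ?sqr_ge0//.
  by rewrite -[leLHS]ger0_norm ?sqr_ge0// normrX -[leRHS]ger0_norm ?sqr_ge0// normrX lerXn2r ?nnegrE.
move=> _ _; rewrite /= integral0 => /fine_cvgP[_ /cvgrPdist_le /(_ _ e0)[N _ hN]].
exists (h N); first by split => //; exact: approx_sfun.
have := hN N (leqnn N); rewrite /= sub0r normrN => /(le_trans (ler_norm _)).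
rewrite /ip /Rintegral; under [X in _ -> (fine X <= _)]eq_integral do rewrite -expr2.
by [].
Unshelve. all: by end_near.
Qed.

Lemma approx_sqint g : sqint P g -> approx P E g.
Proof.
move=> g2; have mg := g2.1.
have p2 : sqint P (g^\+).
  apply: (sqint_dom _ g2); first exact: measurable_funrpos.
  by move=> x; rewrite ger0_norm ?funrpos_ge0// /funrpos ge_max ler_norm normr_ge0.
have n2 : sqint P (g^\-).
  apply: (sqint_dom _ g2); first exact: measurable_funrneg.
  by move=> x; rewrite ger0_norm ?funrneg_ge0// /funrneg ge_max normr_ge0 andbT -normrN ler_norm.
have -> : g = (fun x => g^\+ x + (-1) * g^\- x).
  by apply/funext => x; rewrite mulN1r -[in LHS](funrposBneg g).
apply: approxD => //; first exact: sqintZ.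
  by apply: approx_ge0 => // x; exact: funrpos_ge0.
by apply: approxZ => //; apply: approx_ge0 => // x; exact: funrneg_ge0.
Qed.

End dense_indic.

(** * The trigonometric system on the circle *)

(** Only the identity is demanded, not orthonormality. A null function may then belong to the
    system, and the property is stable under products, image measures and reindexing. The bound on
    each [e j] keeps pairings with square integrable functions under control. *)
Definition parseval {disp : measure_display} {X : measurableType disp} {R : realType}
    (P : {measure set X -> \bar R}) (J : choiceType) (e : J -> X -> R) : Prop :=
  [/\ forall j, measurable_fun setT (e j),
      forall j, exists B, forall x, `|e j x| <= B &
      forall g, sqint P g ->
        (\int[P]_x (g x ^+ 2)%:E = \esum_(j in [set: J]) ((ip P g (e j)) ^+ 2)%:E)%E].

Section trig_basis.
Context {R : realType}.
Local Notation RR := (measurableTypeR R).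

(** Index [2k] stands for the cosine and [2k + 1] for the sine of frequency [2 pi k]. Keeping index
    1, whose sine is zero, makes [trig_swap] an involution of the whole of [nat]. *)
Definition freq (n : nat) : R := 2 * pi * (n./2)%:R.

Definition trig_cst (n : nat) : R := if n is 0 then 1 else Num.sqrt 2.

Definition trig_basis (n : nat) (x : R) : R :=
  trig_cst n * (if odd n then sin (freq n * x) else cos (freq n * x)).

(** Differentiation exchanges sine and cosine of the same frequency; [trig_sgn] records the sign
    that appears. *)
Definition trig_swap (n : nat) : nat := if odd n then n.-1 else n.+1.

Definition trig_sgn (n : nat) : R := if odd n then 1 else -1.

Lemma trig_swapK : involutive trig_swap.
Proof.
move=> n; rewrite /trig_swap; case on : (odd n); last by rewrite /= on.
by case: n on => //= n /negbTE ->.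
Qed.

Lemma half_trig_swap n : (trig_swap n)./2 = n./2.
Proof.
rewrite /trig_swap; case: ifP => on; last by rewrite -[in LHS]addn1 halfD on/= addn0.
by case: n on => //= n; rewrite uphalf_half => /negbTE ->.
Qed.

Lemma freq_swap n : freq (trig_swap n) = freq n.
Proof. by rewrite /freq half_trig_swap. Qed.

Lemma odd_trig_swap n : odd (trig_swap n) = ~~ odd n.
Proof.
rewrite /trig_swap; case: ifP => on; last by rewrite /= on.
by case: n on => //= n /negbTE ->.
Qed.

Lemma is_derive_sinM (k x : R) :
  is_derive x 1 (fun z => sin (k * z)) (k * cos (k * x)).
Proof.
have : is_derive x 1 (sin \o (fun z => k * z)) (k * cos (k * x)); last by [].
have h1 : is_derive x 1 (fun z : R => k * z) k.
  by apply: is_derive_eq; rewrite /GRing.scale/= mulr1.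
rewrite mulrC; apply: is_derive1_comp.
Qed.

Lemma is_derive_cosM (k x : R) :
  is_derive x 1 (fun z => cos (k * z)) (- k * sin (k * x)).
Proof.
have : is_derive x 1 (cos \o (fun z => k * z)) (- k * sin (k * x)); last by [].
have h1 : is_derive x 1 (fun z : R => k * z) k.
  by apply: is_derive_eq; rewrite /GRing.scale/= mulr1.
by rewrite mulNr mulrC -mulNr; apply: is_derive1_comp.
Qed.

Lemma is_derive_trig n (x : R) : is_derive x 1 (trig_basis n)
  (trig_sgn n * freq n * trig_basis (trig_swap n) x).
Proof.
(* The normalizing constants of swapped indices differ only for the pair 0, 1, and there the
   frequency is 0. *)
have cE : freq n * trig_cst (trig_swap n) = freq n * trig_cst n.
  by rewrite /freq; case: n => [|[|n]]/=; rewrite ?mulr0 ?mul0r//= /trig_swap; case: ifP.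
rewrite /trig_basis mulrA -(mulrA (trig_sgn n)) cE freq_swap odd_trig_swap /trig_sgn.
case: ifP => on /=.
  by have h := is_derive_sinM (freq n) x; apply: is_derive_eq; rewrite /GRing.scale/=; ring.
have h := is_derive_cosM (freq n) x.
by apply: is_derive_eq; rewrite /GRing.scale/=; ring.
Qed.

Lemma continuous_trig n : continuous (trig_basis n).
Proof.
move=> x; apply: differentiable_continuous; apply/derivable1_diffP.
by have [] := is_derive_trig n x.
Qed.

Lemma trig_periodic n x : trig_basis n (x + 1) = trig_basis n x.
Proof.
have sk k y : sin (y + (2 * pi * k%:R)) = sin y :> R /\ cos (y + (2 * pi * k%:R)) = cos y :> R.
  elim: k y => [|k ih] y; first by rewrite mulr0 addr0.
  rewrite -natr1 (_ : y + _ = y + 2 * pi * k%:R + pi *+ 2); last by rewrite -mulr_natl; ring.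
  have [s c] := ih y.
  by rewrite sinD2pi cosD2pi.
by rewrite /trig_basis mulrDr mulr1 {2 4}/freq; have [-> ->] := sk n./2 (freq n * x).
Qed.

Lemma trig_bounded n x : `|trig_basis n x| <= 2.
Proof.
rewrite /trig_basis normrM -[2]mulr1; apply: ler_pM => //.
  rewrite /trig_cst; case: n => [|n]; first by rewrite normr1; lra.
  by rewrite ger0_norm ?sqrtr_ge0// -[leRHS]ger0_norm// -sqrtr_sqr ler_sqrt; lra.
by case: ifP => _; rewrite ler_norml ?sin_geN1 ?sin_le1 ?cos_geN1 ?cos_le1.
Qed.

Lemma measurable_trig n : measurable_fun setT (trig_basis n).
Proof. by apply: continuous_measurable_fun; exact: continuous_trig. Qed.

End trig_basis.

(** * The algebra of trigonometric polynomials *)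

Section trig_span.
Context {R : realType}.
Local Notation e := (@trig_basis R).

Inductive trig : (R -> R) -> Prop :=
| trig_e n : trig (e n)
| trig_0 : trig (fun=> 0)
| trig_D p q : trig p -> trig q -> trig (fun x => p x + q x)
| trig_Z k p : trig p -> trig (fun x => k * p x).

Lemma trig_eq p q : trig p -> p =1 q -> trig q.
Proof. by move=> tp /funext <-. Qed.

Lemma trig_B p q : trig p -> trig q -> trig (fun x => p x - q x).
Proof.
by move=> tp tq; apply: (trig_eq (trig_D tp (trig_Z (-1) tq))) => x; rewrite mulN1r.
Qed.

Lemma trig_1 : trig (fun=> 1).
Proof.
by apply: (trig_eq (trig_e 0)) => x; rewrite /trig_basis /freq/= mulr0 mul0r cos0 mulr1.
Qed.

Lemma sqrt2_neq0 : Num.sqrt 2 != 0 :> R.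
Proof. by rewrite gt_eqF// sqrtr_gt0. Qed.

Lemma trig_cos k : trig (fun x => cos (2 * pi * k%:R * x)).
Proof.
apply: (trig_eq (trig_Z (trig_cst k.*2)^-1 (trig_e k.*2))) => x.
rewrite /trig_basis /freq odd_double doubleK mulrA mulVf ?mul1r//.
by rewrite /trig_cst; case: (k.*2); rewrite ?oner_eq0 ?sqrt2_neq0.
Qed.

Lemma trig_sin k : trig (fun x => sin (2 * pi * k%:R * x)).
Proof.
apply: (trig_eq (trig_Z (Num.sqrt 2)^-1 (trig_e k.*2.+1))) => x.
by rewrite /trig_basis /freq /= odd_double/= uphalf_double mulrA mulVf ?mul1r// sqrt2_neq0.
Qed.

Lemma freqD k l (x : R) :
  2 * pi * (k + l)%:R * x = 2 * pi * k%:R * x + 2 * pi * l%:R * x.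
Proof. by rewrite natrD; ring. Qed.

Lemma freqB k l (x : R) : (l <= k)%N ->
  2 * pi * (k - l)%:R * x = 2 * pi * k%:R * x - 2 * pi * l%:R * x.
Proof. by move=> kl; rewrite natrB//; ring. Qed.

Lemma trig_cc k l : trig (fun x => cos (2 * pi * k%:R * x) * cos (2 * pi * l%:R * x)).
Proof.
wlog kl : k l / (l <= k)%N.
  move=> h; have [/h//|/ltnW/h] := leqP l k.
  by move=> /trig_eq; apply => x; rewrite mulrC.
apply: (trig_eq (trig_Z (2^-1) (trig_D (trig_cos (k - l)) (trig_cos (k + l))))) => x.
by rewrite freqB// freqD cosB cosD; field.
Qed.

Lemma trig_ss k l : trig (fun x => sin (2 * pi * k%:R * x) * sin (2 * pi * l%:R * x)).
Proof.
wlog kl : k l / (l <= k)%N.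
  move=> h; have [/h//|/ltnW/h] := leqP l k.
  by move=> /trig_eq; apply => x; rewrite mulrC.
apply: (trig_eq (trig_Z (2^-1) (trig_B (trig_cos (k - l)) (trig_cos (k + l))))) => x.
by rewrite freqB// freqD cosB cosD; field.
Qed.

Lemma trig_sc k l : trig (fun x => sin (2 * pi * k%:R * x) * cos (2 * pi * l%:R * x)).
Proof.
have [kl|/ltnW kl] := leqP l k.
  apply: (trig_eq (trig_Z (2^-1) (trig_D (trig_sin (k + l)) (trig_sin (k - l))))) => x.
  by rewrite freqB// freqD sinB sinD; field.
apply: (trig_eq (trig_Z (2^-1) (trig_B (trig_sin (k + l)) (trig_sin (l - k))))) => x.
by rewrite freqB// freqD sinB sinD; field.
Qed.

(** The product-to-sum formulas, one for each combination of parities, are what turns the linear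
    span into an algebra. *)
Lemma trig_ee n m : trig (fun x => e n x * e m x).
Proof.
rewrite /trig_basis /freq; case: (odd n); case: (odd m).
- apply: (trig_eq (trig_Z (trig_cst n * trig_cst m) (trig_ss n./2 m./2))) => x; ring.
- apply: (trig_eq (trig_Z (trig_cst n * trig_cst m) (trig_sc n./2 m./2))) => x; ring.
- apply: (trig_eq (trig_Z (trig_cst n * trig_cst m) (trig_sc m./2 n./2))) => x; ring.
- apply: (trig_eq (trig_Z (trig_cst n * trig_cst m) (trig_cc n./2 m./2))) => x; ring.
Qed.

Lemma trig_M p q : trig p -> trig q -> trig (fun x => p x * q x).
Proof.
move=> tp; elim: tp q => [n| |p1 p2 _ ih1 _ ih2|k p1 _ ih1] q tq.
- elim: tq => [m| |q1 q2 _ ih1 _ ih2|k q1 _ ih1].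
  + exact: trig_ee.
  + by apply: (trig_eq trig_0) => x; rewrite mulr0.
  + by apply: (trig_eq (trig_D ih1 ih2)) => x; rewrite mulrDr.
  + by apply: (trig_eq (trig_Z k ih1)) => x; rewrite mulrCA.
- by apply: (trig_eq trig_0) => x; rewrite mul0r.
- by apply: (trig_eq (trig_D (ih1 _ tq) (ih2 _ tq))) => x; rewrite mulrDl.
- by apply: (trig_eq (trig_Z k (ih1 _ tq))) => x; rewrite mulrA.
Qed.

Lemma trig_X p n : trig p -> trig (fun x => p x ^+ n).
Proof.
move=> tp; elim: n => [|n ih]; first exact: (trig_eq trig_1).
by apply: (trig_eq (trig_M tp ih)) => x; rewrite exprS.
Qed.

Lemma trig_continuous p : trig p -> continuous p.
Proof.
elim=> [n||p1 p2 _ h1 _ h2|k q _ ih]; first exact: continuous_trig.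
- by move=> x; exact: cvg_cst.
- by move=> x; apply: (@cvgD _ R^o); [exact: h1|exact: h2].
- by move=> x; apply: cvgM; [exact: cvg_cst|exact: ih].
Qed.

Lemma trig_bound p : trig p -> exists B, forall x, `|p x| <= B.
Proof.
elim=> [n||p1 p2 _ [B1 h1] _ [B2 h2]|k q _ [B h]].
- by exists 2 => x; exact: trig_bounded.
- by exists 0 => x; rewrite normr0.
- by exists (B1 + B2) => x; rewrite (le_trans (ler_normD _ _))// lerD.
- by exists (`|k| * B) => x; rewrite normrM ler_wpM2l.
Qed.

End trig_span.

(** * The uniform law on an interval and orthogonality *)

Section unit_interval.
Context {R : realType}.
Local Notation RR := (measurableTypeR R).
Local Notation U := (uniform_prob (@ltr01 R)).
Local Notation mu := (@lebesgue_measure R).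

(** The change of measure is first made for nonnegative functions, on the positive and the negative
    part. A positive factor commutes with subtraction in the extended reals, infinite values
    included, so the two parts can be put together again. *)
Lemma uniform_Rintegral (a b : R) (ab : a < b) (f : R -> R) : measurable_fun setT f ->
  \int[uniform_prob ab]_x f x = (b - a)^-1 * \int[mu]_(x in `[a, b]) f x.
Proof.
move=> mf; have mf' : measurable_fun setT (EFin \o f) by exact/measurable_EFinP.
have c0 : 0 < (b - a)^-1 by rewrite invr_gt0 subr_gt0.
have fineZ (x : \bar R) : fine ((b - a)^-1%:E * x) = (b - a)^-1 * fine x.
  by case: x => [r| |]//=; rewrite ?gt0_muley ?gt0_muleNy ?lte_fin//= mulr0.
rewrite /Rintegral -fineZ; congr fine; rewrite [LHS]integralE [X in (_ * X)%E]integralE.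
rewrite !integral_uniform//; [|exact: measurable_funeneg|exact: measurable_funepos].
have mB (x y : \bar R) : ((b - a)^-1%:E * (x - y) = (b - a)^-1%:E * x - (b - a)^-1%:E * y)%E.
  case: x => [x| |]; case: y => [y| |]; rewrite /= ?gt0_muley ?gt0_muleNy ?lte_fin//.
  by rewrite -EFinB -!EFinM -EFinB mulrBr.
by rewrite -mB.
Qed.

Lemma unif_Rintegral (f : R -> R) : measurable_fun setT f ->
  \int[U]_x f x = \int[mu]_(x in `[0, 1]) f x.
Proof. by move=> mf; rewrite uniform_Rintegral// subr0 invr1 mul1r. Qed.

Lemma unif_Rintegral_derive0 (F f : R -> R) : continuous f ->
  (forall x : R, is_derive x (1 : R) F (f x)) -> F 0 = F 1 -> \int[U]_x f x = 0.
Proof.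
move=> cf dF F01; rewrite unif_Rintegral; last exact: continuous_measurable_fun.
have cF : continuous F.
  by move=> x; apply: differentiable_continuous; apply/derivable1_diffP; have [] := dF x.
rewrite /Rintegral (@continuous_FTC2 _ f F)//.
- by rewrite F01 subee.
- exact: continuous_subspaceT.
- split=> [x _||]; first by have [] := dF x.
    exact/cvg_at_right_filter/cF.
  exact/cvg_at_left_filter/cF.
- by move=> x _; rewrite derive1E; exact: derive_val.
Qed.

(** Endpoints are null. This is used at every turn, since most data on the cylinder are controlled
    for [0 < t < T] only. *)
Lemma uniform_itv (a b : R) (ab : a < b) : {ae uniform_prob ab, forall x : R, a < x < b}.
Proof.
pose f := fun x : R => (\1_(~` [set x | a < x < b]) x : R)%:E.
have mA : measurable (~` [set x : RR | a < x < b]).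
  apply: measurableC; rewrite (_ : [set _ | _] = `]a, b[%classic)//.
exists (~` [set x | a < x < b]); split => //.
have uA := @integral_indic _ _ _ (uniform_prob ab) setT measurableT _ mA.
rewrite setIT in uA; rewrite -[LHS]uA integral_uniform//; last first.
  by apply/measurable_EFinP; exact: measurable_indic.
have mf (b1 b2 : itv_bound R) : measurable_fun [set` Interval b1 b2] f.
  by apply: measurable_funTS; apply/measurable_EFinP; exact: measurable_indic.
rewrite -integral_itv_bndo_bndc// -integral_itv_obnd_cbnd//.
rewrite integral0_eq ?mule0// => x /=; rewrite in_itv/= => xab.
by rewrite indicE memNset//= => /(_ xab).
Qed.

Lemma unif_trig n : \int[U]_x trig_basis n x = (n == 0%N)%:R.
Proof.
have [->|n0] := eqVneq n 0%N.
  under eq_Rintegral do rewrite /trig_basis /freq/= mulr0 mul0r cos0 mulr1.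
  by rewrite Rintegral_cst//= mul1r (@probability_setT _ _ _ U).
have [->|n1] := eqVneq n 1%N.
  under eq_Rintegral do rewrite /trig_basis /freq/= mulr0 mul0r sin0 mulr0.
  by rewrite Rintegral_cst// mul0r.
have w0 : freq n != 0 :> R.
  rewrite /freq !mulf_neq0// ?gt_eqF ?pi_gt0// ltr0n.
  by case: n n0 n1 => [|[|n]].
(* The swapped function has derivative [- trig_sgn n * freq n] times the original one, so [k] times
   it is a primitive; periodicity equates its values at 0 and 1. *)
pose k : R := (- (trig_sgn n * freq n))^-1.
have s2 : (trig_sgn n) ^+ 2 = 1 :> R by rewrite /trig_sgn; case: ifP; rewrite ?sqrrN expr1n.
have sN : trig_sgn (trig_swap n) = - trig_sgn n :> R.
  by rewrite /trig_sgn odd_trig_swap; case: (odd n); rewrite ?opprK.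
have s0 : trig_sgn n != 0 :> R by rewrite -sqrf_eq0 s2 oner_eq0.
apply: (@unif_Rintegral_derive0 (fun x => k * trig_basis (trig_swap n) x)).
- exact: continuous_trig.
- move=> x; have h := is_derive_trig (trig_swap n) x.
  apply: is_derive_eq; rewrite trig_swapK /GRing.scale/= freq_swap sN /k; field.
  by rewrite w0 s0.
- by rewrite -[in RHS](add0r 1) trig_periodic.
Qed.

Lemma trig_basis1 x : trig_basis 1 x = 0 :> R.
Proof. by rewrite /trig_basis /freq/= mulr0 mul0r sin0 mulr0. Qed.

Lemma unif_cos k : \int[U]_x cos (2 * pi * k%:R * x) = (k == 0%N)%:R.
Proof.
have /(congr1 (fun r => (@trig_cst R k.*2)^-1 * r)) := unif_trig k.*2.
have h : trig_cst k.*2 != 0 :> R by rewrite /trig_cst; case: (k.*2); rewrite ?oner_eq0 ?sqrt2_neq0.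
rewrite -RintegralZl//; last first.
  apply: (@integrable_bounded _ _ _ U _ 2); [exact: measurable_trig|exact: trig_bounded].
under eq_Rintegral do
  rewrite /trig_basis /freq odd_double doubleK mulrA mulVf// mul1r.
move=> ->; rewrite double_eq0; case: eqP => [->|]; last by rewrite mulr0.
by rewrite /= invr1 mulr1.
Qed.

Lemma unif_sin k : \int[U]_x sin (2 * pi * k%:R * x) = 0.
Proof.
have /(congr1 (fun r => (Num.sqrt 2 : R)^-1 * r)) := unif_trig k.*2.+1.
rewrite -RintegralZl//; last first.
  apply: (@integrable_bounded _ _ _ U _ 2); [exact: measurable_trig|exact: trig_bounded].
under eq_Rintegral do
  rewrite /trig_basis /freq/= odd_double/= uphalf_double mulrA mulVf ?sqrt2_neq0// mul1r.
by rewrite mulr0.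
Qed.

Lemma sqint_trig n : sqint U (trig_basis n).
Proof. by apply: (@sqint_bounded _ _ _ U _ 2); [exact: measurable_trig|exact: trig_bounded]. Qed.

Lemma integrable_trigp p : trig p -> U.-integrable setT (EFin \o p).
Proof.
move=> tp; have [B hB] := trig_bound tp.
by apply: (@integrable_bounded _ _ _ U _ B) => //; apply: continuous_measurable_fun; exact: trig_continuous.
Qed.

Lemma unif_cc k l : (l <= k)%N ->
  \int[U]_x (cos (2 * pi * k%:R * x) * cos (2 * pi * l%:R * x)) =
  2^-1 * ((k - l == 0)%N%:R + (k + l == 0)%N%:R).
Proof.
move=> kl; rewrite -!unif_cos -RintegralD ?integrable_trigp//; [|exact: trig_cos..].
rewrite -RintegralZl//; last by apply: integrableDr; apply: integrable_trigp; exact: trig_cos.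
apply: eq_Rintegral => x _.
by rewrite freqB// freqD cosB cosD; field.
Qed.

Lemma unif_ss k l : (l <= k)%N ->
  \int[U]_x (sin (2 * pi * k%:R * x) * sin (2 * pi * l%:R * x)) =
  2^-1 * ((k - l == 0)%N%:R - (k + l == 0)%N%:R).
Proof.
move=> kl; rewrite -!unif_cos -RintegralB ?integrable_trigp//; [|exact: trig_cos..].
rewrite -RintegralZl//; last by apply: integrableBr; apply: integrable_trigp; exact: trig_cos.
apply: eq_Rintegral => x _.
by rewrite freqB// freqD cosB cosD; field.
Qed.

Lemma unif_sc k l :
  \int[U]_x (sin (2 * pi * k%:R * x) * cos (2 * pi * l%:R * x)) = 0.
Proof.
have [kl|/ltnW kl] := leqP l k.
  transitivity (2^-1 * (\int[U]_x sin (2 * pi * (k - l)%:R * x) + \int[U]_x sin (2 * pi * (k + l)%:R * x))); last first.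
    by rewrite !unif_sin addr0 mulr0.
  rewrite -RintegralD ?integrable_trigp//; [|exact: trig_sin..].
  rewrite -RintegralZl//; last by apply: integrableDr; apply: integrable_trigp; exact: trig_sin.
  apply: eq_Rintegral => x _.
  by rewrite freqB// freqD sinB sinD; field.
transitivity (2^-1 * (\int[U]_x sin (2 * pi * (k + l)%:R * x) - \int[U]_x sin (2 * pi * (l - k)%:R * x))); last first.
  by rewrite !unif_sin subr0 mulr0.
rewrite -RintegralB ?integrable_trigp//; [|exact: trig_sin..].
rewrite -RintegralZl//; last by apply: integrableBr; apply: integrable_trigp; exact: trig_sin.
apply: eq_Rintegral => x _.
by rewrite freqB// freqD sinB sinD; field.
Qed.

(* [trig_basis 1] is the null function, which is harmless for Parseval's identity. *)
Lemma ip_trig n m : ip U (trig_basis n) (trig_basis m) = ((n == m) && (n != 1%N))%:R.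
Proof.
wlog nm : n m / (m./2 <= n./2)%N.
  move=> h; have [/h//|/ltnW/h mn] := leqP m./2 n./2.
  rewrite ipC mn eq_sym; case: eqP => [->|//]; done.
have two : Num.sqrt 2 * Num.sqrt 2 = 2 :> R by rewrite -expr2 sqr_sqrtr.
have pull f g : trig (fun x => f x * g x) ->
    \int[U]_x (trig_cst n * f x * (trig_cst m * g x)) =
    trig_cst n * trig_cst m * \int[U]_x (f x * g x).
  move=> fg; rewrite -RintegralZl//; last exact: integrable_trigp.
  by apply: eq_Rintegral => x _; ring.
rewrite /ip /trig_basis /freq.
have halfE : n = (odd n + n./2.*2)%N by rewrite odd_double_half.
have halfE' : m = (odd m + m./2.*2)%N by rewrite odd_double_half.
have c2 k : (0 < k)%N -> trig_cst k = Num.sqrt 2 :> R by case: k.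
case on : (odd n); case om : (odd m); rewrite pull.
- rewrite unif_ss//; move: halfE halfE'; rewrite on om /= => nE mE.
  rewrite subn_eq0 [RHS](_ : _ = ((n./2 <= m./2)%N && (n./2 + m./2 != 0)%N)%:R); last first.
    congr (_%:R); congr nat_of_bool; rewrite {1 3}nE {1}mE eqn_add2l -!mul2n eqn_pmul2l//; lia.
  rewrite !c2 ?two; [|lia..]; case: (leqP n./2 m./2) => /= h.
    by case: eqP => //= h'; rewrite ?subrr ?mulr0// subr0; field.
  have -> : (n./2 + m./2 == 0)%N = false by lia.
  by rewrite subrr !mulr0.
- exact: trig_ss.
- rewrite unif_sc mulr0; case: eqP => // nm'; move: on; by rewrite nm' om.
- exact: trig_sc.
- under eq_Rintegral do rewrite mulrC.
  rewrite unif_sc mulr0; case: eqP => // nm'; move: on; by rewrite nm' om.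
- by apply: (trig_eq (trig_sc m./2 n./2)) => x; rewrite mulrC.
- rewrite unif_cc//; move: halfE halfE'; rewrite on om /= !add0n => nE mE.
  have -> : (n != 1)%N by lia.
  rewrite andbT; case: (@eqP _ n m) => [->|nm'].
    rewrite subnn eqxx /=; case: (posnP m) => [->|m0]; first by rewrite /=; field.
    have -> : (m./2 + m./2 == 0)%N = false by lia.
    by rewrite !c2// two addr0; field.
  have -> : (n./2 - m./2 == 0)%N = false by lia.
  have -> : (n./2 + m./2 == 0)%N = false by lia.
  by rewrite addr0 !mulr0.
- exact: trig_cc.
Qed.

End unit_interval.

(** * Completeness of the trigonometric system *)

Section trig_density.
Context {R : realType}.
Local Notation RR := (measurableTypeR R).
Local Notation U := (uniform_prob (@ltr01 R)).

(** With [y = z * z], one power absorbs the factor [n]: [n z^n] stays below [1 / (1 - z)], while the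
    other [z^n] tends to 0. *)
Lemma cvg_natX (y : R) : 0 <= y < 1 -> (n%:R * y ^+ n) @[n --> \oo] --> (0 : R).
Proof.
move=> /andP[y0 y1]; pose z := Num.sqrt y.
have z0 : 0 <= z by exact: sqrtr_ge0.
have yz : y = z * z by rewrite -expr2 sqr_sqrtr.
have z1 : z < 1 by rewrite ltNge; apply/negP => h; move: y1; rewrite yz; nra.
have bern n : n%:R * z ^+ n * (1 - z) <= 1 - z ^+ n.
  elim: n => [|n ih]; first by rewrite !mul0r expr0 subrr.
  have zn : 0 <= z ^+ n by exact: exprn_ge0.
  have zn1 : z ^+ n <= 1 by apply: exprn_ile1 => //; exact: ltW.
  have h1 : z * (n%:R * z ^+ n * (1 - z)) <= z * (1 - z ^+ n) by exact: ler_wpM2l.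
  have h2 : 0 <= (1 - z) * (1 - z * z ^+ n) by apply: mulr_ge0; nra.
  by rewrite exprS -natr1; lra.
have cz : (z ^+ n) @[n --> \oo] --> (0 : R) by apply: cvg_expr; rewrite ger0_norm.
have cz' : ((1 - z)^-1 * z ^+ n) @[n --> \oo] --> ((1 - z)^-1 * 0 : R).
  by apply: cvgM => //; exact: cvg_cst.
rewrite mulr0 in cz'.
apply: (squeeze_cvgr _ (cvg_cst (0 : R)) cz').
apply: nearW => n; rewrite mulr_ge0 ?exprn_ge0//= yz exprMn mulrA.
apply: ler_wpM2r; first exact: exprn_ge0.
rewrite -[leRHS]mul1r ler_pdivlMr ?subr_gt0// (le_trans (bern n))//.
by rewrite gerBl exprn_ge0.
Qed.

(* The polynomials in the Brosowski-Deutsch proof of the Stone-Weierstrass theorem. *)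
Definition step_poly (n : nat) (v : R) : R := (1 - v ^+ n) ^+ (n * 2 ^ n).

Lemma bernoulli_ineq (x : R) n : -1 <= x -> 1 + n%:R * x <= (1 + x) ^+ n.
Proof.
move=> x1; elim: n => [|n ih]; first by rewrite mul0r addr0 expr0.
rewrite exprS -natr1; apply: (@le_trans _ _ ((1 + x) * (1 + n%:R * x))).
  have : 0 <= n%:R * x ^+ 2 by rewrite mulr_ge0// sqr_ge0.
  by rewrite expr2; nra.
by apply: ler_wpM2l => //; lra.
Qed.

Lemma step_poly01 n v : 0 <= v <= 1 -> 0 <= step_poly n v <= 1.
Proof.
move=> v01; have /andP[a b] : 0 <= v ^+ n <= 1.
  by case/andP: v01 => v0 v1; rewrite exprn_ge0//= exprn_ile1.
by rewrite /step_poly exprn_ge0 ?exprn_ile1//; lra.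
Qed.

(** Bernoulli's inequality on both sides of 1/2, with [N = n 2^n]. Below,
    [(1 - v^n)^N >= 1 - n (2v)^n], which tends to 1. From 1/2 on, [(1 + v^n)^N >= 1 + n] while its
    product with [(1 - v^n)^N] is at most 1, so the value is at most [1 / (1 + n)]. *)
Lemma cvg_step_poly (v : R) : 0 <= v <= 1 ->
  step_poly n v @[n --> \oo] --> (if v < 2^-1 then 1 else 0 : R).
Proof.
move=> v01; case/andP: (v01) => v0 v1.
have vn n : 0 <= v ^+ n <= 1 by rewrite exprn_ge0//= exprn_ile1.
case: ltP => hv.
  have c1 : (1 - n%:R * (2 * v) ^+ n) @[n --> \oo] --> (1 - 0 : R).
    by apply: cvgB; [exact: cvg_cst|apply: cvg_natX; lra].
  rewrite subr0 in c1; apply: (squeeze_cvgr _ c1 (cvg_cst (1 : R))).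
  apply: nearW => n; rewrite (andP (step_poly01 n v01)).2 andbT /step_poly.
  have := @bernoulli_ineq (- v ^+ n) (n * 2 ^ n).
  have := vn n => /andP[a b].
  rewrite lerN2 b => /(_ isT); apply: le_trans.
  by rewrite natrM natrX exprMn mulrN lerD2l lerN2 mulrA.
have hb n : step_poly n v <= (1 + n%:R)^-1.
  have /andP[a b] := vn n.
  have pos : 0 < (1 + v ^+ n) ^+ (n * 2 ^ n) by rewrite exprn_gt0//; lra.
  have le1 : step_poly n v * (1 + v ^+ n) ^+ (n * 2 ^ n) <= 1.
    by rewrite /step_poly -exprMn exprn_ile1//; nra.
  have ge : 1 + n%:R <= (1 + v ^+ n) ^+ (n * 2 ^ n).
    apply: le_trans (@bernoulli_ineq (v ^+ n) (n * 2 ^ n) _); last by lra.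
    rewrite lerD2l natrM natrX -mulrA -exprMn ler_peMr// exprn_ege1//.
    by rewrite mulrC -ler_pdivrMr// mul1r.
  rewrite -[leRHS]mul1r ler_pdivlMr; last by rewrite ltr_pwDl.
  apply: le_trans le1; apply: ler_wpM2l => //.
  by case/andP: (step_poly01 n v01).
have c0 : ((1 + n%:R)^-1 : R) @[n --> \oo] --> (0 : R).
  have := @cvg_harmonic R; rewrite /harmonic.
  by under eq_fun do rewrite -nat1r.
apply: (squeeze_cvgr _ (cvg_cst (0 : R)) c0).
by apply: nearW => n; rewrite hb andbT; case/andP: (step_poly01 n v01).
Qed.

Lemma indicC (X : Type) (A : set X) x : \1_(~` A) x = 1 - \1_A x :> R.
Proof. by rewrite !indicE in_setC; case: (x \in A); rewrite ?subrr ?subr0. Qed.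

(** The bounds 0 and 1 keep the class stable under products and complements and supply the
    domination for [L^2] convergence. Only the open interval matters, its endpoints being null. *)
Definition trig_set (A : set R) := exists p : nat -> R -> R,
  [/\ forall n, trig (p n), forall n x, 0 <= p n x <= 1 &
      forall x, 0 < x < 1 -> p n x @[n --> \oo] --> (\1_A x : R)].

Lemma trig_setC A : trig_set A -> trig_set (~` A).
Proof.
move=> [p [tp p01 pA]]; exists (fun n x => 1 - p n x); split.
- by move=> n; exact: trig_B (trig_1) (tp n).
- by move=> n x; have := p01 n x; lra.
- move=> x x01; rewrite indicC.
  by apply: cvgB; [exact: cvg_cst|exact: pA].
Qed.

Lemma trig_setI A B : trig_set A -> trig_set B -> trig_set (A `&` B).
Proof.
move=> [p [tp p01 pA]] [q [tq q01 qB]]; exists (fun n x => p n x * q n x); split.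
- by move=> n; exact: trig_M.
- by move=> n x; have := p01 n x; have := q01 n x; nra.
- by move=> x x01; rewrite indicI; apply: cvgM; [exact: pA|exact: qB].
Qed.

Lemma trig_set_ext A B : trig_set A -> (forall x, 0 < x < 1 -> A x <-> B x) -> trig_set B.
Proof.
move=> [p [tp p01 pA]] AB; exists p; split=> // x x01.
have -> : \1_B x = \1_A x :> R; last exact: pA.
by rewrite !indicE; have [h1 h2] := AB x x01; congr (_%:R); congr nat_of_bool; apply/idP/idP => /set_mem h; apply/mem_set; [exact: h2|exact: h1].
Qed.

Lemma trig_sin_shift c : trig (fun x : R => sin (2 * pi * (x - c))).
Proof.
apply: (trig_eq (trig_B (trig_Z (cos (2 * pi * c)) (trig_sin 1))
  (trig_Z (sin (2 * pi * c)) (trig_cos 1)))) => x.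
by rewrite !mulr1 mulrBr sinB; ring.
Qed.

(** The set is the open half-circle that starts at [c]. With [v = (1 - sin) / 2], lying in it means
    [v < 1/2], which is where the step polynomials tend to 1. *)
Lemma trig_set_arc c : trig_set [set x : R | 0 < sin (2 * pi * (x - c))].
Proof.
pose v x : R := 2^-1 * (1 - sin (2 * pi * (x - c))).
have v01 x : 0 <= v x <= 1.
  by rewrite /v; have := sin_geN1 (2 * pi * (x - c)); have := sin_le1 (2 * pi * (x - c)); lra.
have tv : trig v by apply: trig_Z; apply: trig_B; [exact: trig_1|exact: trig_sin_shift].
exists (fun n x => step_poly n (v x)); split.
- by move=> n; apply: trig_X; apply: trig_B; [exact: trig_1|exact: trig_X].
- by move=> n x; exact: step_poly01.
- move=> x _; have -> : \1_[set x : R | 0 < sin (2 * pi * (x - c))] x = if v x < 2^-1 then 1 else 0 :> R.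
    rewrite indicE; case: ifPn => h; first by rewrite mem_set//= /v; move: h; rewrite /v; lra.
    by rewrite memNset//=; move: h; rewrite /v; lra.
  exact: cvg_step_poly.
Qed.

(** Within [(0, 1)], rays are combinations of half-circles. For [c >= 1/2], [(c, 1)] is the
    intersection of those starting at [c] and at [1/2]. For [c < 1/2], [(0, c]] is the half-circle
    starting at 0 minus the one starting at [c], and the ray is its complement. *)
Lemma trig_set_ray (c : R) : trig_set `]c, +oo[.
Proof.
have pi0 := @pi_gt0 R.
have pos (y : R) : 0 < y < 2^-1 -> 0 < sin (2 * pi * y).
  by move=> y01; apply: sin_gt0_pi; rewrite !mulr_gt0//=; nra.
have neg (y : R) : - 2^-1 < y < 0 -> sin (2 * pi * y) < 0.
  move=> y01; rewrite -oppr_gt0 -sinN -mulrN; apply: pos; lra.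
have [c0|c0] := leP c 0.
  exists (fun _ _ => 1); split => [n|n x|x x01].
  - exact: trig_1.
  - by rewrite ler01 lexx.
  - rewrite indicE mem_set; first exact: cvg_cst.
    by rewrite /= in_itv/= andbT; lra.
have [c1|c1] := leP 1 c.
  exists (fun _ _ => 0); split => [n|n x|x x01].
  - exact: trig_0.
  - by rewrite ler01 lexx.
  - rewrite indicE memNset; first exact: cvg_cst.
    by rewrite /= in_itv/= andbT; lra.
have [c2|c2] := leP 2^-1 c.
  apply: (trig_set_ext (trig_setI (trig_set_arc c) (trig_set_arc 2^-1))) => x x01.
  rewrite /= in_itv/= andbT; split=> [[h1 h2]|cx].
    rewrite ltNge; apply/negP; rewrite le_eqVlt => /orP[/eqP xc|xc].
      by move: h1; rewrite xc subrr mulr0 sin0 ltxx.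
    have [xl|xl] := leP x 2^-1.
      move: xl; rewrite le_eqVlt => /orP[/eqP xe|xl].
        by move: h2; rewrite xe subrr mulr0 sin0 ltxx.
      have : sin (2 * pi * (x - 2^-1)) < 0 by apply: neg; lra.
      by lra.
    have : sin (2 * pi * (x - c)) < 0 by apply: neg; lra.
    by lra.
  by split; apply: pos; lra.
apply: (trig_set_ext (trig_setC (trig_setI (trig_setC (trig_set_arc c)) (trig_set_arc 0)))) => x x01.
rewrite /= in_itv/= andbT subr0; split=> [h|cx].
  rewrite ltNge; apply/negP => xc; apply: h; split; last by apply: pos; lra.
  move: xc; rewrite le_eqVlt => /orP[/eqP ->|xc]; first by rewrite subrr mulr0 sin0 ltxx.
  have : sin (2 * pi * (x - c)) < 0 by apply: neg; lra.
  by lra.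
move=> [h1 h2]; apply: h1; apply: pos.
suff : x < 2^-1 by lra.
rewrite ltNge; apply/negP; rewrite le_eqVlt => /orP[/eqP xe|xl].
  by move: h2; rewrite -xe -mulrA mulrC -mulrA mulVf// mulr1 sinpi ltxx.
have : sin (2 * pi * (x - 1)) < 0 by apply: neg; lra.
rewrite mulrBr mulr1 -(sinD2pi (_ - _)) -[pi *+ 2]mulr_natl subrK.
by lra.
Qed.

Lemma trig_set_approx (A : set RR) : measurable A -> trig_set A -> approx U trig (\1_A : R -> R).
Proof.
move=> mA [p [tp p01 pA]] e e0.
have mp n : measurable_fun setT (p n : RR -> R).
  by apply: continuous_measurable_fun; exact: trig_continuous.
have mi : measurable_fun setT (\1_A : RR -> R) by exact: measurable_indic.
have i01 x : 0 <= (\1_A x : R) <= 1 by rewrite indicE; case: (x \in A); rewrite /=; lra.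
have [] := @dominated_convergence _ _ _ U setT measurableT
  (fun n => EFin \o (fun x => (\1_A x - p n x) ^+ 2)) (cst 0) (cst (1 : R)%:E).
- by move=> n; apply: meas_sq; apply: measurable_funB.
- exact: measurable_cst.
- apply: (@filterS _ _ (ae_filter_ringOfSetsType U) _ _ _ (uniform_itv (@ltr01 R))) => x /pA pAx _; apply/fine_cvgP; split; first exact: nearW.
  have -> : 0 = (\1_A x - \1_A x) * (\1_A x - \1_A x) :> R by rewrite subrr mul0r.
  have pAx' : (\1_A x - p n x) @[n --> \oo] --> ((\1_A x : R) - \1_A x).
    by apply: cvgB => //; exact: cvg_cst.
  by under eq_cvg do rewrite /= expr2; apply: cvgM.
- exact/finite_measure_integrable_cst.
- apply: aeW => x n _ /=; rewrite lee_fin ger0_norm ?sqr_ge0//.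
  by have := i01 x; have := p01 n x; nra.
move=> _ _; rewrite /= integral0 => /fine_cvgP[_ /cvgrPdist_le /(_ _ e0)[N _ hN]].
exists (p N) => //; have := hN N (leqnn N); rewrite /= sub0r normrN => /(le_trans (ler_norm _)).
rewrite /ip /Rintegral; under [X in _ -> (fine X <= _)]eq_integral do rewrite -expr2.
by [].
Qed.

Lemma sqint_trigp p : trig p -> sqint U p.
Proof.
move=> tp; have [B hB] := trig_bound tp.
by apply: (@sqint_bounded _ _ _ U _ B) => //; apply: continuous_measurable_fun; exact: trig_continuous.
Qed.

(** Dynkin's theorem: measurable [trig_set]s are stable under intersection and contain the rays,
    which generate the Borel sets, while approximability in [L^2] passes to complements and
    countable disjoint unions. *)
Lemma approx_trig_indic (A : set RR) : measurable A -> approx U trig (\1_A : R -> R).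
Proof.
move=> mA; pose G : set (set RR) := [set B | measurable B /\ trig_set B].
have mG : @measurable _ RR = <<s G >>.
  apply/seteqP; split.
    rewrite [X in X `<=` _](@RGenOInfty.measurableE R).
    apply: smallest_sub; first exact: smallest_sigma_algebra.
    move=> _ [c ->]; apply: sub_sigma_algebra; split; last exact: trig_set_ray.
    exact: measurable_itv.
  apply: smallest_sub; last by move=> B [].
  exact: sigma_algebra_measurable.
apply: (@dynkin_induction _ RR G (fun A => approx U trig (\1_A : R -> R)) mG) => //.
- by move=> B C [mB tB] [mC tC]; split; [exact: measurableI|exact: trig_setI].
- apply: trig_set_approx => //; exists (fun _ _ => 1); split => [n|n x|x x01].
  + exact: trig_1.
  + by rewrite ler01 lexx.
  + by rewrite indicE mem_set//; exact: cvg_cst.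
- by move=> B [mB tB]; exact: trig_set_approx.
- move=> B mB aB.
  have -> : \1_(~` B) = (fun x => 1 + (-1) * \1_B x) :> (R -> R).
    by apply/funext => x; rewrite indicC mulN1r.
  apply: approxD => //.
  + exact: sqint_trigp.
  + exact: trig_D.
  + exact: sqint_trigp trig_1.
  + by apply: sqintZ; exact: sqint_indic.
  + move=> e e0; exists (fun=> 1); first exact: trig_1.
    rewrite /ip; under eq_Rintegral do rewrite subrr mul0r.
    by rewrite Rintegral_cst// mul0r ltW.
  + apply: approxZ => //; [exact: sqint_trigp|exact: trig_Z|exact: sqint_indic].
- move=> F mF tF aF.
  apply: (approx_lim (P := U) (E := trig)) => //; first exact: sqint_trigp.
    exact/sqint_indic/bigcup_measurable.
  (* The finite unions [S n] increase to the whole union. The measure of what is missing tends to 0,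
     and it is the squared distance between the two indicators. *)
  move=> e e0; pose S n := \bigcup_(i < n) F i.
  have mS n : measurable (S n : set RR) by exact: bigcup_measurable.
  have cS : U (S n) @[n --> \oo] --> U (\bigcup_i F i).
    rewrite (_ : \bigcup_i F i = \bigcup_n S n).
      apply: nondecreasing_cvg_mu => //; first exact: bigcup_measurable.
      move=> i j ij; apply/subsetPset => x [k ki Fx]; exists k => //.
      exact: leq_trans ij.
    apply/seteqP; split => [x [i _ Fx]|x [n _ [i _ Fx]]]; last by exists i.
    by exists i.+1 => //; exists i => /=.
  have fU (B : set RR) : measurable B -> U B \is a fin_num by move=> mB; exact: fin_num_measure.
  have mSI := bigcup_measurable (fun i _ => mF i) : measurable (\bigcup_i F i : set RR).
  have [N hN] : exists N, fine (U ((\bigcup_i F i) `\` S N)) <= e.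
    rewrite -(fineK (fU _ mSI)) in cS; move/fine_cvgP : cS => [_ /cvgrPdist_le /(_ _ e0)[N _ hN]]; exists N.
    have := hN N (leqnn N) => /=.
    rewrite measureD//; last by rewrite ltey_eq fU.
    rewrite setIidr; last by move=> x [i _ Fx]; exists i.
    by move=> h; apply: le_trans h; rewrite fineB ?fU// ler_norm.
  exists (\1_(S N) : R -> R).
    split; first exact: sqint_indic.
    elim: N {hN} => [|N ih].
      rewrite /S; have -> : \bigcup_(i < 0) F i = set0 by apply/seteqP; split => // x [].
      rewrite indic0 => e' e'0; exists (fun=> 0); first exact: trig_0.
      rewrite /ip; under eq_Rintegral do rewrite subrr mul0r.
      by rewrite Rintegral_cst// mul0r ltW.
    have -> : \1_(S N.+1) = (fun x => \1_(S N) x + \1_(F N) x) :> (R -> R).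
      apply/funext => x; rewrite !indicE.
      have [xF|xF] := boolP (x \in F N).
        rewrite [x \in S N]memNset ?add0r; last first.
          move=> [i /= iN Fx]; have := tF i N I I.
          rewrite -[_ = _]/(_) => h.
          have : i = N by apply: h; exists x; split => //; exact: set_mem.
          by move=> iN'; move: iN; rewrite iN' ltnn.
        by rewrite mem_set//; exists N => //=; exact: set_mem.
      rewrite addr0; congr (_%:R); congr nat_of_bool.
      apply/idP/idP; rewrite !inE.
        move=> [i /= iN Fx]; exists i => //=; rewrite ltn_neqAle -ltnS iN andbT.
        by apply/eqP => iN'; move/negP: xF; apply; rewrite inE -iN'.
      by move=> [i /= iN Fx]; exists i => //=; exact: ltnW.
    apply: approxD => //.
    + exact: sqint_trigp.
    + exact: trig_D.
    + exact: sqint_indic.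
    + exact: sqint_indic.
  have uD := @integral_indic _ _ _ U setT measurableT _ (measurableD mSI (mS N)).
  rewrite setIT in uD.
  have hN' : fine (\int[U]_x (\1_((\bigcup_i F i) `\` S N) x)%:E) <= e by rewrite uD.
  apply: le_trans hN'; rewrite /ip /Rintegral.
  rewrite le_eqVlt; apply/orP; left; apply/eqP; congr fine; apply: eq_integral => x _.
  rewrite !indicE; congr EFin.
  have [xS|xS] := boolP (x \in S N).
    have /mem_set -> : (\bigcup_i F i) x by move: xS; rewrite inE => -[i _ ?]; exists i.
    by rewrite memNset ?subrr ?mul0r//= => -[_]; apply; rewrite inE in xS.
  rewrite subr0 -natrM mulnb andbb; congr (_%:R); congr nat_of_bool.
  apply/idP/idP; rewrite !inE; last by case.
  by move=> h; split => // h'; move/negP: xS; apply; rewrite inE.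
- by rewrite -mG.
Qed.

Lemma approx_trig (g : RR -> R) : sqint U g -> approx U trig g.
Proof.
apply: approx_sqint.
- exact: sqint_trigp.
- exact: trig_D.
- exact: trig_Z.
- exact: trig_0.
- exact: approx_trig_indic.
Qed.

End trig_density.

(** * Parseval's identity on the torus *)

Section parseval_trig.
Context {R : realType}.
Local Notation RR := (measurableTypeR R).
Local Notation U := (uniform_prob (@ltr01 R)).
Local Notation e := (@trig_basis R).

Let S N (g : R -> R) x := \sum_(0 <= n < N) ip U g (e n) * e n x.

Let sqS N g : sqint U (S N g).
Proof. by apply: sqint_sum => n; apply/sqintZ/sqint_trig. Qed.

Let ip_e1 g : ip U g (e 1) = 0.
Proof.
by rewrite /ip; under eq_Rintegral do rewrite trig_basis1 mulr0; rewrite Rintegral_cst// mul0r.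
Qed.

Let ip_S N g h : sqint U h -> ip U (S N g) h = \sum_(0 <= n < N) ip U g (e n) * ip U h (e n).
Proof.
move=> h2; rewrite ip_suml//; last by move=> n; apply/sqintZ/sqint_trig.
by apply: eq_bigr => n _; rewrite ipZl ?(ipC _ h)//; exact: sqint_trig.
Qed.

Let ip_Se N g n : (n < N)%N -> ip U (S N g) (e n) = ip U g (e n).
Proof.
move=> nN; rewrite ip_S; last exact: sqint_trig.
rewrite (bigD1_seq n) ?mem_index_iota ?iota_uniq//= big1 ?addr0 => [|m mn].
  (* Index 1 is not normalized, but then both sides are 0. *)
  rewrite ip_trig eqxx/=; case: eqP => [->|_]; rewrite ?mulr1//.
  by rewrite mulr0 ip_e1.
by rewrite ip_trig eq_sym (negbTE mn) mulr0.
Qed.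

(** Pythagoras, as the remainder is orthogonal to the partial sum; nonnegativity of the left side is
    Bessel's inequality. *)
Let ip_SS N g : sqint U g -> ip U (fun x => g x - S N g x) (fun x => g x - S N g x) =
  ip U g g - \sum_(0 <= n < N) ip U g (e n) ^+ 2.
Proof.
move=> g2; have s := sqS N g; have gs := sqintB g2 s.
rewrite ipBl// !(ipC _ _ (fun x => g x - S N g x)) !ipBl// [ip U g (S N g)]ipC !ip_S//.
have -> : \sum_(0 <= n < N) ip U g (e n) * ip U (S N g) (e n) = \sum_(0 <= n < N) ip U g (e n) ^+ 2.
  by apply: eq_big_nat => n /andP[_ nN]; rewrite ip_Se// expr2.
under [X in _ - X - _]eq_bigr do rewrite -expr2.
by rewrite subrr subr0.
Qed.

Let S_trig p : trig p -> exists N0, forall N, (N0 <= N)%N -> S N p = p.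
Proof.
elim=> [n||p1 p2 t1 [N1 h1] t2 [N2 h2]|k q tq [N0 h]].
- exists n.+1 => N nN; apply/funext => x; rewrite /S.
  rewrite (bigD1_seq n) ?mem_index_iota ?iota_uniq//= big1 ?addr0 => [|m mn].
    rewrite ip_trig eqxx/=; case: eqP => [->|_]; rewrite ?mul1r//.
    by rewrite trig_basis1 mulr0.
  by rewrite ip_trig eq_sym (negbTE mn) mul0r.
- exists 0%N => N _; apply/funext => x; rewrite /S big1// => n _.
  rewrite /ip; under eq_Rintegral do rewrite mul0r.
  by rewrite Rintegral_cst// mul0r mul0r.
- exists (maxn N1 N2) => N; rewrite geq_max => /andP[n1 n2].
  apply/funext => x; rewrite -[in RHS](h1 N n1) -[in RHS](h2 N n2) /S -big_split/=.
  by apply: eq_bigr => n _; rewrite -mulrDl ipDl//; [exact: sqint_trigp..|exact: sqint_trig].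
- exists N0 => N n0; apply/funext => x; rewrite -[in RHS](h N n0) /S mulr_sumr.
  by apply: eq_bigr => n _; rewrite mulrA ipZl//; [exact: sqint_trigp|exact: sqint_trig].
Qed.

(** Partial sums fix a trigonometric polynomial [p] from some rank on. From there the remainder of
    [g] is that of [g - p], whose square norm is at most the squared distance from [g] to [p], and
    this is small by density. *)
Lemma parseval_trig : parseval U (e : nat -> R -> R).
Proof.
split; [exact: measurable_trig|by move=> n; exists 2 => x; exact: trig_bounded|].
move=> g g2; rewrite -ip_EFin//.
pose s N := \sum_(0 <= n < N) ip U g (e n) ^+ 2.
have sle N : s N <= ip U g g.
  by rewrite -subr_ge0 -ip_SS// ip_ge0.
have snd n m : (n <= m)%N -> s n <= s m.
  move=> nm; rewrite /s (@big_cat_nat _ _ _ n 0 m)//= lerDl.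
  by apply: sumr_ge0 => i _; exact: sqr_ge0.
have cs : s N @[N --> \oo] --> ip U g g.
  apply/cvgrPdist_le => eps e0.
  have [p tp pe] := approx_trig g2 e0; have [N0 hN0] := S_trig tp.
  near=> N; rewrite ger0_norm ?subr_ge0// -ip_SS//.
  apply: le_trans pe; have p2 := sqint_trigp tp; have gp := sqintB g2 p2.
  rewrite (_ : (fun x => g x - S N g x) =
      (fun x => (g x - p x) - S N (fun x => g x - p x) x)); last first.
    apply/funext => x; rewrite -[in X in (_ - X) - _](hN0 N); last by near: N; exists N0.
    rewrite -addrA -opprD; congr (_ - _); rewrite /S -big_split/=.
    apply: eq_bigr => n _; rewrite ipBl//; last exact: sqint_trig.
    by rewrite mulrBl addrC subrK.
  rewrite ip_SS// gerBl; apply: sumr_ge0 => i _; exact: sqr_ge0.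
rewrite -nneseries_esumT; last by move=> n; rewrite lee_fin sqr_ge0.
apply/esym/cvg_lim => //.
rewrite (_ : (fun n => _) = (fun N => (s N)%:E)); last by apply/funext => N; rewrite sumEFin.
by apply: cvg_EFin => //; exact: nearW.
Unshelve. all: by end_near.
Qed.

End parseval_trig.

(** * Countable sums of nonnegative functions *)

Section esum_integral.
Context {R : realType}.

(** Enumeration turns the unordered sum into a series, to which monotone convergence applies; codes
    outside the image of [pickle] contribute 0. *)
Lemma esum_pickle (J : countType) (a : J -> \bar R) : (forall j, (0 <= a j)%E) ->
  ((\esum_(j in [set: J]) a j) = \sum_(n <oo) (if @pickle_inv J n is Some j then a j else 0))%E.
Proof.
move=> a0; rewrite nneseries_esumT; last by move=> n; case: (@pickle_inv J n).
pose b n := (if @pickle_inv J n is Some j then a j else 0)%E.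
have bp j : b (pickle j) = a j by rewrite /b pickleK_inv.
under eq_esum do rewrite -bp.
rewrite -(@esum_image _ _ _ setT (@pickle J) b); last first.
  by move=> x y _ _ /(pcan_inj pickleK).
rewrite esum_mkcond; apply: eq_esum => n _; case: ifPn => // h.
have : @pickle_inv J n = None.
  have := @pickle_invK J n; case: (@pickle_inv J n) => //= j jn.
  by move/negP: h; case; rewrite inE; exists j.
by move=> ->.
Qed.

Context {disp : measure_display} {X : measurableType disp}.
Variable P : {measure set X -> \bar R}.

Lemma integral_esum (J : countType) (f : J -> X -> \bar R) :
  (forall j, measurable_fun setT (f j)) -> (forall j x, (0 <= f j x)%E) ->
  (\int[P]_x (\esum_(j in [set: J]) f j x) = \esum_(j in [set: J]) \int[P]_x f j x)%E.
Proof.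
move=> mf f0; under eq_integral do rewrite esum_pickle//.
rewrite esum_pickle//; last by move=> j; exact: integral_ge0.
rewrite integral_nneseries//.
- by apply: eq_eseriesr => n _; case: (@pickle_inv J n) => // ; rewrite integral0.
- by move=> n; case: (@pickle_inv J n) => // .
- by move=> n x _; case: (@pickle_inv J n).
Qed.

Lemma measurable_esum (J : countType) (f : J -> X -> \bar R) :
  (forall j, measurable_fun setT (f j)) -> (forall j x, (0 <= f j x)%E) ->
  measurable_fun setT (fun x => \esum_(j in [set: J]) f j x)%E.
Proof.
move=> mf f0; under eq_fun do rewrite esum_pickle//.
apply: ge0_emeasurable_sum => //.
- by move=> n x _ _; case: (@pickle_inv J n).
- by move=> n _; case: (@pickle_inv J n).
Qed.

End esum_integral.

(** * Fubini for real-valued integrals *)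

Section fubini_real.
Context {R : realType} {d1 d2 : measure_display}.
Context {X1 : measurableType d1} {X2 : measurableType d2}.
Variable m2 : {sigma_finite_measure set X2 -> \bar R}.

(** Positive and negative parts have measurable partial integrals by Tonelli, and [fine] of their
    difference stays measurable, also where it takes the default value 0. *)
Lemma measurable_Rintegral (f : X1 * X2 -> R) : measurable_fun setT f ->
  measurable_fun setT (fun x => \int[m2]_y f (x, y)).
Proof.
move=> mf; have mf' : measurable_fun setT (EFin \o f) by exact/measurable_EFinP.
rewrite /Rintegral; under eq_fun do rewrite integralE.
apply: (measurableT_comp (fine_measurable measurableT)) => //.
apply: emeasurable_funB.
- have mfp : measurable_fun setT (EFin \o f)^\+%E by exact: measurable_funepos.
  have := @measurable_fun_fubini_tonelli_F _ _ _ _ _ m2 _ mfp (funepos_ge0 _).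
  by apply: eq_measurable_fun => x _; apply: eq_integral => y _; rewrite !funeposE.
- have mfn : measurable_fun setT (EFin \o f)^\-%E by exact: measurable_funeneg.
  have := @measurable_fun_fubini_tonelli_F _ _ _ _ _ m2 _ mfn (funeneg_ge0 _).
  by apply: eq_measurable_fun => x _; apply: eq_integral => y _; rewrite !funenegE.
Qed.

Variable m1 : {sigma_finite_measure set X1 -> \bar R}.

Lemma Rintegral_prod (f : X1 * X2 -> R) :
  (m1 \x m2)%E.-integrable setT (EFin \o f) ->
  \int[(m1 \x m2)%E]_z f z = \int[m1]_x \int[m2]_y f (x, y).
Proof.
move=> fi; rewrite /Rintegral; congr fine; rewrite -integral12_prod_meas1//.
have h := integrable_fubini_F fi; have /integrableP[mh _] := h.
apply: ae_eq_integral => //.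
  apply/measurable_EFinP; apply: (measurableT_comp (fine_measurable measurableT)) => //.
have := integrable_ae measurableT h; apply: filterS => x xf _.
by rewrite fineK//; exact: xf.
Qed.

End fubini_real.

(** * Parseval systems under products, image measures and reindexing *)

Section parseval_ops.
Context {R : realType} {d1 d2 : measure_display}.
Context {X1 : measurableType d1} {X2 : measurableType d2}.

(** For almost every [x] the slice [g (x, _)] is square integrable and Parseval holds for it in [y].
    The coefficients [h j], as functions of [x], are then expanded in turn, and Fubini identifies
    the double coefficients. *)
Lemma parseval_prod (P1 : probability X1 R) (P2 : probability X2 R) (J1 J2 : countType)
    (e1 : J1 -> X1 -> R) (e2 : J2 -> X2 -> R) :
  parseval P1 e1 -> parseval P2 e2 ->
  parseval (P1 \x P2)%E (fun (j : J1 * J2) z => e1 j.1 z.1 * e2 j.2 z.2).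
Proof.
move=> [me1 be1 p1] [me2 be2 p2].
have me j : measurable_fun setT (fun z : X1 * X2 => e1 j.1 z.1 * e2 j.2 z.2).
  by apply: measurable_funM; [exact: (measurableT_comp (me1 _) measurable_fst)|exact: (measurableT_comp (me2 _) measurable_snd)].
have be (j : J1 * J2) : exists B, forall z : X1 * X2, `|e1 j.1 z.1 * e2 j.2 z.2| <= B.
  have [B1 h1] := be1 j.1; have [B2 h2] := be2 j.2; exists (B1 * B2) => z.
  by rewrite normrM ler_pM.
split => // g g2; have mg := g2.1.
have mgx x : measurable_fun setT (fun y => g (x, y)).
  by apply: (measurableT_comp mg); exact: measurable_pair1.
have mg2 := meas_sq mg.
rewrite fubini_tonelli1//; last by move=> z; rewrite lee_fin sqr_ge0.
have mG : measurable_fun setT (fun x => \int[P2]_y (g (x, y) ^+ 2)%:E)%E.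
  by apply: (@measurable_fun_fubini_tonelli_F _ _ _ _ _ P2 _ mg2) => z; rewrite lee_fin sqr_ge0.
pose h (j : J2) x := \int[P2]_y (g (x, y) * e2 j y).
have mge j : measurable_fun setT (fun z : X1 * X2 => g z * e2 j z.2).
  by apply: measurable_funM => //; exact: (measurableT_comp (me2 _) measurable_snd).
have mh j : measurable_fun setT (h j) by exact: (@measurable_Rintegral _ _ _ _ _ P2 _ (mge j)).
have Gfin : (\int[P1]_x \int[P2]_y (g (x, y) ^+ 2)%:E < +oo)%E.
  by rewrite -(@fubini_tonelli1 _ _ _ _ _ P1 P2 (fun z => (g z ^+ 2)%:E))//;
    [case: g2|move=> z; rewrite lee_fin sqr_ge0].
(* Jensen in [y], together with the uniform bound on [e2 j]. *)
have h2 j : sqint P1 (h j).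
  split=> //; have [B hB] := be2 j.
  have : (\int[P1]_x ((B ^+ 2)%:E * \int[P2]_y (g (x, y) ^+ 2)%:E) < +oo)%E.
    rewrite ge0_integralZl ?lee_fin ?sqr_ge0//; last first.
      by move=> x _; apply: integral_ge0 => y _; rewrite lee_fin sqr_ge0.
    by rewrite lte_mul_pinfty ?lee_fin ?sqr_ge0.
  apply: le_lt_trans; apply: ge0_le_integral => //.
  - by move=> x _; rewrite lee_fin sqr_ge0.
  - exact: meas_sq.
  - exact: measurable_funeM.
  - move=> x _; apply: le_trans (jensen_sq _ _) _.
      by apply: measurable_funM.
    rewrite -ge0_integralZl ?lee_fin ?sqr_ge0//; last 2 first.
      exact: meas_sq.
      by move=> y _; rewrite lee_fin sqr_ge0.
    apply: ge0_le_integral => //.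
    + by move=> y _; rewrite lee_fin sqr_ge0.
    + by apply: meas_sq; apply: measurable_funM.
    + by apply: measurable_funeM; exact: meas_sq.
    + move=> y _; rewrite -EFinM lee_fin exprMn mulrC ler_wpM2r ?sqr_ge0//.
      rewrite -[leLHS]ger0_norm ?sqr_ge0// normrX lerXn2r ?nnegrE//.
      by rewrite (le_trans _ (hB y)).
have aeG : {ae P1, forall x, sqint P2 (fun y => g (x, y))}.
  have Gi : P1.-integrable setT (fun x => \int[P2]_y (g (x, y) ^+ 2)%:E)%E.
    apply/integrableP; split => //; apply: le_lt_trans Gfin.
    rewrite le_eqVlt; apply/orP; left; apply/eqP; apply: eq_integral => x _.
    by rewrite gee0_abs// integral_ge0// => y _; rewrite lee_fin sqr_ge0.
  have := integrable_ae measurableT Gi.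
  by apply: filterS => x /(_ I) xf; split => //; rewrite ltey_eq xf.
transitivity (\int[P1]_x (\esum_(j in [set: J2]) ((h j x) ^+ 2)%:E))%E.
  apply: ae_eq_integral => //.
  - by apply: measurable_esum => [j|j x]; [exact: meas_sq|rewrite lee_fin sqr_ge0].
  - by apply: filterS aeG => x xf _; exact: (p2 (fun y => g (x, y)) xf).
rewrite integral_esum; last 2 first.
  by move=> j; exact: meas_sq.
  by move=> j x; rewrite lee_fin sqr_ge0.
under eq_esum do rewrite p1//.
rewrite (esum_esum (J := fun=> setT)); last by move=> i j _ _; rewrite lee_fin sqr_ge0.
(* The expansion was done in [y] first, so the pairs come in the opposite order. *)
rewrite (@reindex_esum _ (J1 * J2)%type (J2 * J1)%type setT _ (fun j => (j.2, j.1))); last first.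
  split => [[i j]//|[i j] [k l] _ _ [-> ->]//|[i j] _]; by exists (j, i).
apply: eq_esum => -[i j] _ /=; congr (((_ : R) ^+ 2)%:E).
have [B1 hB1] := be1 i; have [B2 hB2] := be2 j.
have s2 : sqint (P1 \x P2)%E (fun z => e1 i z.1 * e2 j z.2).
  have [B hB] := be (i, j).
  exact: (@sqint_bounded _ _ _ (P1 \x P2)%E _ B (me (i, j)) hB).
rewrite /ip Rintegral_prod; last exact: sqint_mul.
have e22 : sqint P2 (e2 j) by exact: (@sqint_bounded _ _ _ P2 _ B2).
apply: ae_eq_Rintegral.
- by apply: measurable_funM.
- apply: (@measurable_Rintegral _ _ _ _ _ P2 (fun z => g z * (e1 i z.1 * e2 j z.2))).
  by apply: measurable_funM => //; exact: (me (i, j)).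
- apply: filterS aeG => x xf; rewrite /h mulrC -RintegralZl//; last exact: sqint_mul.
  by apply: eq_Rintegral => y _; rewrite mulrCA.
Qed.

Lemma Rintegral_distribution (P : probability X1 R) (phi : {mfun X1 >-> X2}) (f : X2 -> R) :
  measurable_fun setT f ->
  \int[distribution P phi]_y f y = \int[P]_x f (phi x).
Proof.
move=> mf; rewrite /Rintegral; congr fine.
have mf' : measurable_fun setT (EFin \o f) by exact/measurable_EFinP.
rewrite [LHS]integralE [RHS]integralE.
congr (_ - _)%E.
- transitivity (\int[P]_x ((EFin \o f)^\+ (phi x)))%E.
    by rewrite /distribution ge0_integral_pushforward//; exact: measurable_funepos.
  by apply: eq_integral => x _; rewrite !funeposE.
- transitivity (\int[P]_x ((EFin \o f)^\- (phi x)))%E.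
    by rewrite /distribution ge0_integral_pushforward//; exact: measurable_funeneg.
  by apply: eq_integral => x _; rewrite !funenegE.
Qed.

Lemma parseval_distribution (P : probability X1 R) (phi : {mfun X1 >-> X2}) (J : countType)
    (e : J -> X2 -> R) :
  (forall j, measurable_fun setT (e j)) -> (forall j, exists B, forall x, `|e j x| <= B) ->
  parseval P (fun j x => e j (phi x)) -> parseval (distribution P phi) e.
Proof.
move=> me be [_ _ p]; split => // g [mg g2].
have sqE : (\int[distribution P phi]_x (g x ^+ 2)%:E = \int[P]_x (g (phi x) ^+ 2)%:E)%E.
  rewrite ge0_integral_pushforward//; first exact: meas_sq.
  by move=> y _; rewrite lee_fin sqr_ge0.
rewrite sqE p; last by split; [exact: (measurableT_comp mg)|rewrite -sqE].
apply: eq_esum => j _; rewrite /ip Rintegral_distribution//.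
exact: measurable_funM.
Qed.

Lemma parseval_reindex (P : {measure set X1 -> \bar R}) (J J' : countType) (h : J' -> J)
    (e : J -> X1 -> R) : bijective h ->
  parseval P (fun j => e (h j)) -> parseval P e.
Proof.
move=> [k hk kh] [me be p]; split.
- by move=> j; rewrite -(kh j).
- by move=> j; rewrite -(kh j).
- move=> g g2; rewrite p//; apply/esym; apply: reindex_esum.
  split => [//|x y _ _ xy|j _]; first exact: (can_inj hk).
  by exists (k j).
Qed.

End parseval_ops.

(** * The tensor trigonometric basis of the torus *)

Section torus_basis.
Context {R : realType}.
Local Notation RR := (measurableTypeR R).

Definition tuple_basis n (k : n.-tuple nat) (x : n.-tuple RR) : R :=
  \prod_(i < n) trig_basis (tnth k i) (tnth x i).

Definition row_basis n (k : n.-tuple nat) (x : 'rV[R]_n) : R :=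
  \prod_(i < n) trig_basis (tnth k i) (x 0 i).

Lemma prod_trig_bounded n (k : n.-tuple nat) (x : 'I_n -> R) :
  `|\prod_(i < n) trig_basis (tnth k i) (x i)| <= 2 ^+ n.
Proof.
rewrite normr_prod; have -> : 2 ^+ n = \prod_(i < n) (2 : R) by rewrite prodr_const card_ord.
by apply: ler_prod => i _; rewrite normr_ge0 trig_bounded.
Qed.

Lemma measurable_row_coord n (i : 'I_n) : measurable_fun setT (fun x : 'rV[R]_n => x 0 i : RR).
Proof.
move=> _ B mB; rewrite setTI.
suff : g_sigma_preimage (@row_coord R n) ((fun x : 'rV[R]_n => x 0 i) @^-1` B) by [].
apply: sub_sigma_algebra; case: n i => [[] []//|n i].
rewrite -bigcup_mkord_ord.
exists i; first exact: ltn_ord.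
by exists B => //; rewrite inord_val setTI.
Qed.

Lemma measurable_row_basis n (k : n.-tuple nat) : measurable_fun setT (row_basis k).
Proof.
apply: measurable_prod => i _.
exact: (measurableT_comp (measurable_trig _) (measurable_row_coord i)).
Qed.

(** Induction along the recursive construction of the cube measure. In dimension 0 the measure is a
    Dirac mass and the only index, the empty tuple, gives the constant 1. *)
Lemma parseval_tuple n : parseval (unit_cube R n) (@tuple_basis n).
Proof.
elim: n => [|n ih].
  split.
  - move=> j; rewrite /tuple_basis; under eq_fun do rewrite big_ord0.
    exact: measurable_cst.
  - by move=> j; exists 1 => x; rewrite /tuple_basis big_ord0 normr1.
  - move=> g [mg _]; rewrite integral_dirac//; last exact: meas_sq.
    rewrite diracE mem_set// mul1e.
    have -> : [set: 0.-tuple nat] = [set [tuple]].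
      by apply/seteqP; split => // x _; rewrite [x]tuple0.
    rewrite esum_set1 ?lee_fin ?sqr_ge0//; congr ((_ ^+ 2)%:E).
    rewrite /ip; under eq_Rintegral do rewrite /tuple_basis big_ord0 mulr1.
    rewrite /Rintegral integral_dirac//; last exact/measurable_EFinP.
    by rewrite diracE mem_set// mul1e.
apply: (@parseval_distribution _ _ _ _ _ _ (@tuple_cons R n)).
- move=> k; apply: measurable_prod => i _.
  exact: (measurableT_comp (measurable_trig _) (measurable_tnth i)).
- by move=> k; exists (2 ^+ n.+1) => x; exact: (prod_trig_bounded k (tnth x)).
- apply: (@parseval_reindex _ _ _ _ _ (nat * n.-tuple nat)%type (fun j => [tuple of j.1 :: j.2])).
    exists (fun t => (thead t, [tuple of behead t])) => [[k t]|t] /=.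
      by rewrite theadE; congr (_, _); apply: val_inj.
    by rewrite [in RHS](tuple_eta t).
  have := parseval_prod (@parseval_trig R) ih.
  congr parseval; apply/funext => -[k t]; apply/funext => -[x p].
  rewrite /tuple_basis big_ord_recl/= !tnth0; congr (_ * _).
  by apply: eq_bigr => i _; rewrite !tnthS.
Qed.

Lemma parseval_row n : parseval (torus_leb R n) (@row_basis n).
Proof.
apply: (@parseval_distribution _ _ _ _ _ _ (@tuple_row R n)).
- exact: measurable_row_basis.
- by move=> k; exists (2 ^+ n) => x; exact: (prod_trig_bounded k (x 0)).
- have := parseval_tuple n; congr parseval.
  apply/funext => k; apply/funext => x; rewrite /tuple_basis /row_basis.
  by apply: eq_bigr => i _; rewrite /tuple_row mxE.
Qed.

Lemma parseval_TT n : parseval (leb_TT R n)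
  (fun (j : n.-tuple nat * n.-tuple nat) q => row_basis j.1 q.1 * row_basis j.2 q.2).
Proof. exact: parseval_prod (parseval_row n) (parseval_row n). Qed.

End torus_basis.

(** * Weak derivatives in time *)

Section smooth_step.
Context {R : realType}.

Definition pos_sq (u : R) : R := u * Num.max u 0.

Lemma is_derive_pos_sq (u : R) : is_derive u (1 : R) pos_sq (2 * Num.max u 0).
Proof.
have [u0|u0|->] := ltgtP u 0.
- rewrite mulr0; apply: (@near_eq_is_derive _ _ _ (cst 0)).
  near=> x; rewrite /pos_sq max_r ?mulr0//; apply: ltW.
  by near: x; exact: lt_nbhsl.
- apply: (@near_eq_is_derive _ _ _ (fun x : R => x * x)).
    near=> x; rewrite /pos_sq max_l//; apply: ltW.
    by near: x; exact: lt_nbhsr.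
  by apply: is_derive_eq; rewrite /GRing.scale/=; ring.
- rewrite mulr0.
  (* At the kink the difference quotient is [Num.max h 0]. *)
  have H : h^-1 *: (pos_sq (h *: 1 + 0) - pos_sq 0) @[h --> (0 : R)^'] --> (0 : R).
    have c0 : Num.max h 0 @[h --> (0 : R)^'] --> (0 : R).
      rewrite -[X in _ --> X](maxxx (0 : R)); apply: cvg_within_filter.
      by apply: continuous_max; [exact: cvg_id|exact: cvg_cst].
    apply: cvg_trans c0; apply: near_eq_cvg; near=> h.
    rewrite /pos_sq mul0r subr0 addr0 /GRing.scale/= mulr1 mulrA mulVf ?mul1r//.
    by near: h; exact: nbhs_dnbhs_neq.
  by apply: DeriveDef; [apply/cvg_ex; exists 0|apply/cvg_lim].
Unshelve. all: by end_near.
Qed.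

(** A quadratic spline with knots 0, 1/2 and 1. Its derivative [smooth_bump] is the hat function of
    height 2 on [[0, 1]], of integral 1, so the step climbs from 0 to 1. *)
Definition smooth_step (u : R) : R :=
  2 * pos_sq u - 4 * pos_sq (u - 2^-1) + 2 * pos_sq (u - 1).

Definition smooth_bump (u : R) : R :=
  4 * Num.max u 0 - 8 * Num.max (u - 2^-1) 0 + 4 * Num.max (u - 1) 0.

Lemma smooth_step_le0 u : u <= 0 -> smooth_step u = 0.
Proof. by move=> u0; rewrite /smooth_step /pos_sq !max_r; lra. Qed.

Lemma smooth_step_ge1 u : 1 <= u -> smooth_step u = 1.
Proof. by move=> u0; rewrite /smooth_step /pos_sq !max_l; lra. Qed.

Lemma smooth_step01 u : 0 <= smooth_step u <= 1.
Proof.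
have [u0|u0] := leP u 0; first by rewrite smooth_step_le0// lexx ler01.
have [u1|u1] := leP 1 u; first by rewrite smooth_step_ge1// lexx ler01.
have m1 : Num.max (u - 1) 0 = 0 by apply: max_r; lra.
rewrite /smooth_step /pos_sq (max_l (ltW u0)) m1.
have [u2|u2] := leP u 2^-1.
  by rewrite max_r; [nra|lra].
by rewrite max_l; [nra|lra].
Qed.

Lemma smooth_bump_ge0 u : 0 <= smooth_bump u.
Proof.
rewrite /smooth_bump; have [u0|u0] := leP u 0; first by rewrite !max_r; lra.
have [u1|u1] := leP 1 u; first by rewrite !max_l; lra.
have m1 : Num.max (u - 1) 0 = 0 by apply: max_r; lra.
rewrite m1; have [u2|u2] := leP u 2^-1.
  by rewrite [Num.max (u - _) 0]max_r; lra.
by rewrite [Num.max (u - _) 0]max_l; lra.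
Qed.

Lemma smooth_bump_supp u : ~~ (0 <= u <= 1) -> smooth_bump u = 0.
Proof.
rewrite negb_and -!ltNge => /orP[u0|u0]; rewrite /smooth_bump.
  by rewrite !max_r; lra.
by rewrite !max_l; lra.
Qed.

Lemma continuous_smooth_bump : continuous smooth_bump.
Proof.
have cs (c : R) : continuous (fun u : R => Num.max (u - c) 0).
  move=> u; apply: (@continuous_max _ _ (fun u => u - c)); last exact: cvg_cst.
  by apply: cvgB; [exact: cvg_id|exact: cvg_cst].
have -> : smooth_bump = fun u => 4 * Num.max (u - 0) 0 - 8 * Num.max (u - 2^-1) 0 + 4 * Num.max (u - 1) 0.
  by apply/funext => u; rewrite subr0.
move=> u; apply: cvgD; first apply: cvgB;
  by apply: cvgM; [exact: cvg_cst|exact: cs].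
Qed.

Lemma is_derive_smooth_step (u : R) : is_derive u (1 : R) smooth_step (smooth_bump u).
Proof.
have h1 := is_derive_pos_sq u.
have sh (c : R) : is_derive u (1 : R) (fun u => u - c) 1.
  by apply: is_derive_eq; rewrite subr0.
have h2 c : is_derive u (1 : R) (fun u => pos_sq (u - c)) (2 * Num.max (u - c) 0).
  have h := is_derive_pos_sq (u - c); have s := sh c.
  by rewrite -[X in is_derive _ _ _ X]mulr1; exact: (@is_derive1_comp _ pos_sq (fun u => u - c)).
have h3 := h2 2^-1; have h4 := h2 1.
rewrite /smooth_step; apply: is_derive_eq.
by rewrite /smooth_bump /GRing.scale/=; ring.
Qed.

Lemma is_derive_step_scale (n s r : R) :
  is_derive r (1 : R) (fun r => smooth_step (n * (r - s))) (n * smooth_bump (n * (r - s))).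
Proof.
have s1 : is_derive r (1 : R) (fun r => n * (r - s)) n.
  by apply: is_derive_eq; rewrite /GRing.scale/= subr0 mulr1.
have h := is_derive_smooth_step (n * (r - s)).
by rewrite mulrC; exact: (@is_derive1_comp _ smooth_step (fun r => n * (r - s))).
Qed.

End smooth_step.

Lemma norm_bool_mul (R : realType) (b : bool) (x : R) : `|b%:R * x| <= `|x|.
Proof. by case: b; rewrite ?mul1r// mul0r normr0. Qed.

(** * Primitives with respect to the uniform law *)

Section primitive.
Context {R : realType} (T : R) (T0 : 0 < T).
Local Notation RR := (measurableTypeR R).
Local Notation U := (uniform_prob T0).
Local Notation mu := (@lebesgue_measure R).
Implicit Types (h k f : RR -> R).

(** On [[0, T]] this is [1 / T] times the usual primitive vanishing at 0, whence the factor [T] in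
    the formulas that follow. *)
Definition prim h (t : R) : R := \int[U]_r ((r <= t)%R%:R * h r).

Lemma measurable_le_ind (t : R) : measurable_fun setT (fun r : RR => (r <= t)%R%:R : R).
Proof.
rewrite (_ : (fun r : RR => (r <= t)%R%:R : R) = \1_`]-oo, t]).
  by apply: measurable_indic; exact: measurable_itv.
by apply/funext => r; rewrite indicE mem_setE/= in_itv.
Qed.

Lemma integrable_le_ind h (t : R) : U.-integrable setT (EFin \o h) ->
  U.-integrable setT (EFin \o (fun r => (r <= t)%R%:R * h r)).
Proof.
move=> hi; have mh := measurable_int _ hi; move/measurable_EFinP in mh.
apply: (@integrable_dom _ _ _ _ _ (fun r => `|h r|)).
- by apply: measurable_funM => //; exact: measurable_le_ind.
- by move=> r; exact: norm_bool_mul.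
- exact: integrable_norm.
Qed.

Lemma measurable_lt_ind (t : R) : measurable_fun setT (fun r : RR => (r < t)%R%:R : R).
Proof.
rewrite (_ : (fun r : RR => (r < t)%R%:R : R) = \1_`]-oo, t[).
  by apply: measurable_indic; exact: measurable_itv.
by apply/funext => r; rewrite indicE mem_setE/= in_itv.
Qed.

Lemma integrable_lt_ind h (t : R) : U.-integrable setT (EFin \o h) ->
  U.-integrable setT (EFin \o (fun r => (r < t)%R%:R * h r)).
Proof.
move=> hi; have mh := measurable_int _ hi; move/measurable_EFinP in mh.
apply: (@integrable_dom _ _ _ _ _ (fun r => `|h r|)).
- by apply: measurable_funM => //; exact: measurable_lt_ind.
- by move=> r; exact: norm_bool_mul.
- exact: integrable_norm.
Qed.

Lemma unif_null (t : R) : {ae U, forall r, r != t}.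
Proof.
exists [set t]; split; first exact: measurable_set1.
  have := @integral_indic _ _ _ U setT measurableT _ (measurable_set1 t).
  rewrite setIT => <-; rewrite integral_uniform//; last first.
    by apply/measurable_EFinP; exact: measurable_indic.
  rewrite (@integral_indic _ _ _ mu _ (measurable_itv _) _ (measurable_set1 t)).
  have : (mu ([set t] `&` `[0%R, T]) <= mu [set t])%E by apply: le_measure; rewrite ?inE//; exact: measurableI.
  by rewrite lebesgue_measure_set1 measure_le0 => /eqP ->; rewrite mule0.
by move=> r /=; case: (eqVneq r t) => [-> _ //|_] /(_ isT).
Qed.

(** The uniform law has no atoms; this takes care of the diagonal in [prim_mul]. *)
Lemma primE_lt h (t : R) : measurable_fun setT h ->
  \int[U]_r ((r < t)%R%:R * h r) = prim h t.
Proof.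
move=> mh; apply: ae_eq_Rintegral.
- by apply: measurable_funM => //; exact: measurable_lt_ind.
- by apply: measurable_funM => //; exact: measurable_le_ind.
- apply: (@filterS _ _ (ae_filter_ringOfSetsType U) _ _ _ (unif_null t)) => r rt.
  by rewrite lt_neqAle rt.
Qed.

Lemma prim0 h : measurable_fun setT h -> prim h 0 = 0.
Proof.
move=> mh; transitivity (\int[U]_r (0 : R)); last by rewrite Rintegral_cst// mul0r.
apply: ae_eq_Rintegral.
- by apply: measurable_funM => //; exact: measurable_le_ind.
- exact: measurable_cst.
- apply: (@filterS _ _ (ae_filter_ringOfSetsType U) _ _ _ (uniform_itv T0)) => r /andP[r0 _].
  by rewrite leNgt r0 mul0r.
Qed.

Lemma primT h : measurable_fun setT h -> prim h T = \int[U]_r h r.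
Proof.
move=> mh; apply: ae_eq_Rintegral => //.
- by apply: measurable_funM => //; exact: measurable_le_ind.
- apply: (@filterS _ _ (ae_filter_ringOfSetsType U) _ _ _ (uniform_itv T0)) => r /andP[_ rT].
  by rewrite ltW// mul1r.
Qed.

Lemma prim_bound h t : U.-integrable setT (EFin \o h) -> `|prim h t| <= \int[U]_r `|h r|.
Proof.
move=> hi; apply: le_trans (le_normr_Rintegral _ (integrable_le_ind t hi)) _ => //.
apply: le_Rintegral => //.
- by apply: integrable_norm; exact: integrable_le_ind.
- exact: integrable_norm.
- by move=> r _; exact: norm_bool_mul.
Qed.

Lemma measurable_prim h : measurable_fun setT h -> measurable_fun setT (prim h : RR -> R).
Proof.
move=> mh; apply: (@measurable_Rintegral _ _ _ _ _ U (fun z => (z.2 <= z.1)%R%:R * h z.2)).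
apply: measurable_funM; last exact: (measurableT_comp mh measurable_snd).
rewrite (_ : (fun z : RR * RR => (z.2 <= z.1)%R%:R : R) = \1_[set z | z.2 <= z.1]).
  apply: measurable_indic; rewrite -[X in measurable X]setTI.
  exact: measurable_fun_le.
by apply/funext => z; rewrite indicE mem_setE.
Qed.

Lemma Rintegral_swap (F : RR * RR -> R) : (U \x U)%E.-integrable setT (EFin \o F) ->
  \int[U]_r \int[U]_s F (r, s) = \int[U]_s \int[U]_r F (r, s).
Proof.
move=> Fi; rewrite -Rintegral_prod// /Rintegral; congr fine.
rewrite -integral21_prod_meas1//.
have mG := measurable_fubini_G Fi.
apply: ae_eq_integral => //.
  apply/measurable_EFinP; exact: (measurableT_comp (fine_measurable measurableT) mG).
have := ae_integrable2 Fi; apply: filterS => x xf _.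
by rewrite fineK//; exact: integrable_fin_num.
Qed.

Lemma integrable_tensor h k : U.-integrable setT (EFin \o h) ->
  U.-integrable setT (EFin \o k) ->
  (U \x U)%E.-integrable setT (EFin \o (fun z : RR * RR => h z.1 * k z.2)).
Proof.
move=> hi ki; have mh := measurable_int _ hi; move/measurable_EFinP in mh.
have mk := measurable_int _ ki; move/measurable_EFinP in mk.
have mhk : measurable_fun setT (fun z : RR * RR => h z.1 * k z.2).
  by apply: measurable_funM; [exact: (measurableT_comp mh measurable_fst)|exact: (measurableT_comp mk measurable_snd)].
apply/integrableP; split; first exact/measurable_EFinP.
rewrite fubini_tonelli1//=; last by apply/measurable_EFinP; exact: measurableT_comp.
rewrite /fubini_F /=.
have kE : (\int[U]_y `|(k y)%:E| < +oo)%E by case/integrableP: ki.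
have hE : (\int[U]_y `|(h y)%:E| < +oo)%E by case/integrableP: hi.
have E x y : (`|h x * k y|)%:E = (`|h x|%:E * `|k y|%:E)%E by rewrite normrM EFinM.
under eq_integral do under eq_integral do rewrite E.
rewrite (_ : (fun x => _) = fun x => `|h x|%:E * \int[U]_y `|k y|%:E)%E; last first.
  apply/funext => x; rewrite -ge0_integralZl//.
  by apply/measurable_EFinP; exact: measurableT_comp.
rewrite ge0_integralZr//; last 2 first.
  by apply/measurable_EFinP; exact: measurableT_comp.
  exact: integral_ge0.
by rewrite lte_mul_pinfty// ?integral_ge0// ge0_fin_numE ?integral_ge0.
Qed.

(** The product of the primitives is the integral of [h r * k s] over [r, s <= t]. Cutting this
    square along the diagonal and integrating each half in the smaller variable first gives the two
    terms: integration by parts for integrable derivatives. *)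
Lemma prim_mul h k t : U.-integrable setT (EFin \o h) -> U.-integrable setT (EFin \o k) ->
  prim h t * prim k t = prim (fun r => h r * prim k r + k r * prim h r) t.
Proof.
move=> hi ki.
have mh : measurable_fun setT h by have := measurable_int _ hi; move/measurable_EFinP.
have mk : measurable_fun setT k by have := measurable_int _ ki; move/measurable_EFinP.
have hti := integrable_le_ind t hi; have kti := integrable_le_ind t ki.
have hki := integrable_tensor hti kti.
pose F (z : RR * RR) := (z.1 <= t)%R%:R * h z.1 * ((z.2 <= t)%R%:R * k z.2).
have mle : measurable_fun setT (fun z : RR * RR => (z.2 <= z.1)%R%:R : R).
  rewrite (_ : (fun z : RR * RR => (z.2 <= z.1)%R%:R : R) = \1_[set z | z.2 <= z.1]).
    apply: measurable_indic; rewrite -[X in measurable X]setTI.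
    exact: measurable_fun_le.
  by apply/funext => z; rewrite indicE mem_setE.
have mlt : measurable_fun setT (fun z : RR * RR => (z.1 < z.2)%R%:R : R).
  rewrite (_ : (fun z => _) = fun z => 1 - (z.2 <= z.1)%R%:R); last first.
    by apply/funext => z; rewrite ltNge; case: (_ <= _); rewrite /= ?subrr ?subr0.
  exact: measurable_funB.
have mF : measurable_fun setT F by have := measurable_int _ hki; move/measurable_EFinP.
have Fi1 : (U \x U)%E.-integrable setT (EFin \o (fun z => (z.2 <= z.1)%R%:R * F z)).
  apply: (@integrable_dom _ _ _ _ _ (fun z => `|F z|)).
  - exact: measurable_funM.
  - by move=> z; exact: norm_bool_mul.
  - exact: integrable_norm.
have Fi2 : (U \x U)%E.-integrable setT (EFin \o (fun z => (z.1 < z.2)%R%:R * F z)).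
  apply: (@integrable_dom _ _ _ _ _ (fun z => `|F z|)).
  - exact: measurable_funM.
  - by move=> z; exact: norm_bool_mul.
  - exact: integrable_norm.
have -> : prim h t * prim k t = \int[(U \x U)%E]_z F z.
  rewrite Rintegral_prod//= /prim -RintegralZr//.
  by apply: eq_Rintegral => r _; rewrite /F /= RintegralZl.
have -> : \int[(U \x U)%E]_z F z =
    \int[(U \x U)%E]_z ((z.2 <= z.1)%R%:R * F z) + \int[(U \x U)%E]_z ((z.1 < z.2)%R%:R * F z).
  rewrite -RintegralD//; apply: eq_Rintegral => z _.
  by rewrite -mulrDl ltNge; case: (_ <= _); rewrite /= ?addr0 ?add0r mul1r.
have pki : U.-integrable setT (EFin \o (fun r => h r * prim k r)).
  apply: (@integrable_dom _ _ _ _ _ (fun r => (\int[U]_r `|k r|) * `|h r|)).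
  - by apply: measurable_funM => //; exact: measurable_prim.
  - by move=> r; rewrite normrM mulrC ler_wpM2r// prim_bound.
  - by apply: integrableZlr; exact: integrable_norm.
have phi' : U.-integrable setT (EFin \o (fun r => k r * prim h r)).
  apply: (@integrable_dom _ _ _ _ _ (fun r => (\int[U]_r `|h r|) * `|k r|)).
  - by apply: measurable_funM => //; exact: measurable_prim.
  - by move=> r; rewrite normrM mulrC ler_wpM2r// prim_bound.
  - by apply: integrableZlr; exact: integrable_norm.
rewrite [RHS](_ : _ = prim (fun r => h r * prim k r) t + prim (fun r => k r * prim h r) t); last first.
  rewrite /prim -RintegralD//; [|exact: integrable_le_ind..].
  by apply: eq_Rintegral => r _; rewrite mulrDr.
congr (_ + _).
  rewrite Rintegral_prod//; apply: eq_Rintegral => r _.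
  rewrite /prim -!RintegralZl//; [|by apply: integrableZlr; exact: integrable_le_ind|exact: integrable_le_ind].
  apply: eq_Rintegral => s _; rewrite /F/=.
  have [sr|_] := leP s r; last by rewrite !mul0r !mulr0.
  have [rt|_] := leP r t; last by rewrite !mul0r mulr0.
  by rewrite (le_trans sr rt) !mul1r.
rewrite Rintegral_prod// (Rintegral_swap Fi2); apply: eq_Rintegral => s _.
rewrite -(primE_lt s mh) -!RintegralZl//=; last 2 first.
  by apply: integrableZlr; exact: integrable_lt_ind.
  exact: integrable_lt_ind.
apply: eq_Rintegral => r _; rewrite /F/=.
have [rs|_] := ltP r s; last by rewrite !mul0r !mulr0.
have [st|_] := leP s t; last by rewrite !mul0r !mulr0.
by rewrite (ltW (lt_le_trans rs st)) !mul1r mulrC.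
Qed.

End primitive.

(** * Weak derivatives of functions of time *)

Section weak_derivative.
Context {R : realType} (T : R) (T0 : 0 < T).
Local Notation RR := (measurableTypeR R).
Local Notation U := (uniform_prob T0).
Local Notation mu := (@lebesgue_measure R).
Local Notation prim := (prim T0).
Implicit Types (f h : RR -> R).

Record time_test (th : R -> R) : Prop := {
  time_test_derivable : forall t, derivable th t 1;
  time_test_continuous : continuous (derive1 th);
  time_test_supp : exists s s', [/\ 0 < s, s' < T & forall t, ~~ (s <= t <= s') -> th t = 0] }.

Lemma cvg_unif_dom (F : nat -> RR -> R) (f g : RR -> R) :
  (forall n, measurable_fun setT (F n)) -> measurable_fun setT f ->
  U.-integrable setT (EFin \o g) ->
  {ae U, forall r, F n r @[n --> \oo] --> f r} ->
  {ae U, forall r n, `|F n r| <= g r} ->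
  \int[U]_r F n r @[n --> \oo] --> \int[U]_r f r.
Proof.
move=> mF mf gi Ff Fg.
have [|||||fi _ h] := @dominated_convergence _ _ _ U setT measurableT
  (fun n => EFin \o F n) (EFin \o f) (EFin \o g).
- by move=> n; exact/measurable_EFinP.
- exact/measurable_EFinP.
- by apply: ae_imp Ff => x hx _; apply: cvg_EFin => //; exact: nearW.
- by [].
- by apply: ae_imp Fg => x hx n _; exact: hx.
rewrite /Rintegral; apply: fine_cvg; rewrite fineK; last exact: integrable_fin_num.
exact: h.
Qed.

(** A C^1 approximation of the indicator of []s, t]], as difference of two steps of width
    [1 / n]. *)
Definition plateau (n : nat) (s t r : R) : R :=
  smooth_step (n%:R * (r - s)) - smooth_step (n%:R * (r - t)).

Lemma is_derive_plateau n s t (r : R) : is_derive r (1 : R) (plateau n s t)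
  (n%:R * smooth_bump (n%:R * (r - s)) - n%:R * smooth_bump (n%:R * (r - t))).
Proof.
have h1 := is_derive_step_scale n%:R s r; have h2 := is_derive_step_scale n%:R t r.
by apply: is_derive_eq.
Qed.

Lemma continuous_bump_scale (n s : R) : continuous (fun r : R => n * smooth_bump (n * (r - s))).
Proof.
move=> r; apply: cvgM; first exact: cvg_cst.
apply: (@cvg_comp _ _ _ (fun r : R => n * (r - s)) smooth_bump _ (nbhs (n * (r - s)))).
  by apply: cvgM; [exact: cvg_cst|apply: cvgB; [exact: cvg_id|exact: cvg_cst]].
exact: continuous_smooth_bump.
Qed.

Lemma time_test_plateau n s t : 0 < s -> s < t -> t + n.+1%:R^-1 < T ->
  time_test (plateau n.+1 s t).
Proof.
move=> s0 st tT; split.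
- by move=> r; have [] := is_derive_plateau n.+1 s t r.
- have -> : derive1 (plateau n.+1 s t) = fun r => n.+1%:R * smooth_bump (n.+1%:R * (r - s)) -
      n.+1%:R * smooth_bump (n.+1%:R * (r - t)).
    by apply/funext => r; rewrite derive1E; have h := is_derive_plateau n.+1 s t r; rewrite derive_val.
  by move=> r; apply: cvgB; exact: continuous_bump_scale.
(* The falling step occupies an interval of length [1 / (n + 1)] to the right of [t]. *)
- exists s, (t + n.+1%:R^-1); split => // r.
  rewrite negb_and -!ltNge => /orP[rs|rt]; rewrite /plateau.
    by rewrite !smooth_step_le0 ?subrr//; rewrite pmulr_rle0//; lra.
  have n1 : n.+1%:R * n.+1%:R^-1 = 1 :> R by rewrite mulfV.
  have h : 0 <= n.+1%:R * (r - t - n.+1%:R^-1) by rewrite mulr_ge0//; move: (n.+1%:R^-1) rt => v; lra.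
  have h2 : 0 <= n.+1%:R * (t - s) by rewrite mulr_ge0//; lra.
  rewrite mulrBr n1 in h.
  have e : n.+1%:R * (r - s) = n.+1%:R * (r - t) + n.+1%:R * (t - s) by ring.
  by rewrite !smooth_step_ge1 ?subrr//; lra.
Qed.

Lemma cvg_smooth_step (s r : R) :
  smooth_step (n.+1%:R * (r - s)) @[n --> \oo] --> ((s < r)%R%:R : R).
Proof.
case: ltP => rs.
  rewrite /=; apply: cvg_near_cst; have rs0 : 0 < r - s by lra.
  near=> n; apply: smooth_step_ge1; rewrite -ler_pdivrMr// mul1r.
  apply: (@le_trans _ _ n%:R); last by rewrite ler_nat.
  by near: n; exact: nbhs_infty_ger.
rewrite /=; apply: cvg_near_cst; apply: nearW => n.
by apply: smooth_step_le0; rewrite pmulr_rle0//; lra.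
Unshelve. all: by end_near.
Qed.

Lemma cvg_prim_seq h (u : nat -> R) (l : R) : U.-integrable setT (EFin \o h) ->
  {ae U, forall r, (r <= u n)%R%:R @[n --> \oo] --> ((r <= l)%R%:R : R)} ->
  prim h (u n) @[n --> \oo] --> prim h l.
Proof.
move=> hi ul; have mh : measurable_fun setT h by have := measurable_int _ hi; move/measurable_EFinP.
apply: (@cvg_unif_dom _ _ (fun r => `|h r|)).
- by move=> n; apply: measurable_funM => //; exact: measurable_le_ind.
- by apply: measurable_funM => //; exact: measurable_le_ind.
- exact: integrable_norm.
- by apply: ae_imp ul => r hr; apply: cvgM => //; exact: cvg_cst.
- by apply: aeW => r n; exact: norm_bool_mul.
Qed.

Section ac.
Variables f h : RR -> R.
Hypothesis f_cont : {within `[0, T], continuous f}.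
Hypothesis mf : measurable_fun setT f.
Hypothesis f_bound : exists B, forall t, `|f t| <= B.
Hypothesis hi : U.-integrable setT (EFin \o h).
Hypothesis weak : forall th, time_test th ->
  \int[U]_t (f t * derive1 th t) = - \int[U]_t (h t * th t).

Let mh : measurable_fun setT h.
Proof. by have := measurable_int _ hi; move/measurable_EFinP. Qed.

Let fi : U.-integrable setT (EFin \o f).
Proof. by have [B hB] := f_bound; apply: (@integrable_bounded _ _ _ U _ B). Qed.

(** The integrand is the derivative of a step that climbs from 0 to 1 inside [(0, T)]; the factor
    [T] undoes the normalization of the uniform law. *)
Lemma Rintegral_bump n (s : R) : 0 < s -> s + n.+1%:R^-1 < T ->
  T * \int[U]_r (n.+1%:R * smooth_bump (n.+1%:R * (r - s))) = 1.
Proof.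
move=> s0 sT; rewrite uniform_Rintegral; last first.
  apply: continuous_measurable_fun; exact: continuous_bump_scale.
have cS : continuous (fun r => smooth_step (n.+1%:R * (r - s))).
  move=> x; apply: differentiable_continuous; apply/derivable1_diffP.
  by have [] := is_derive_step_scale n.+1%:R s x.
rewrite subr0 mulrA mulfV ?gt_eqF// mul1r /Rintegral.
rewrite (@continuous_FTC2 _ _ (fun r => smooth_step (n.+1%:R * (r - s))))//.
- have n1 : n.+1%:R * n.+1%:R^-1 = 1 :> R by rewrite mulfV.
  have h' : 0 <= n.+1%:R * (T - s - n.+1%:R^-1) by rewrite mulr_ge0//; move: (n.+1%:R^-1) sT => v; lra.
  rewrite mulrBr n1 in h'; rewrite smooth_step_ge1; last by lra.
  rewrite [smooth_step (_ * (0 - s))]smooth_step_le0; first by rewrite /= subr0.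
  by rewrite pmulr_rle0//; lra.
- exact/continuous_subspaceT/continuous_bump_scale.
- split=> [x _||]; first by have [] := is_derive_step_scale n.+1%:R s x.
    exact/cvg_at_right_filter/cS.
  exact/cvg_at_left_filter/cS.
- move=> x _; rewrite derive1E; have h' := is_derive_step_scale n.+1%:R s x.
  exact: derive_val.
Qed.

(** The scaled bumps are an approximate identity: mass one, concentrated on [[s, s + 1 / (n + 1)]],
    at a point where [f] is continuous. *)
Lemma cvg_bump (s : R) : 0 < s < T ->
  T * \int[U]_r (f r * (n.+1%:R * smooth_bump (n.+1%:R * (r - s)))) @[n --> \oo] --> f s.
Proof.
move=> /andP[s0 sT]; apply/cvgrPdist_le => e e0.
have fs : {for s, continuous f}.
  have := f_cont; rewrite continuous_within_itvP// => -[+ _ _]; apply.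
  by rewrite in_itv/= s0 sT.
have /cvgrPdist_le /(_ e e0) := fs; rewrite -near_nbhs; case/nbhs_ballP => dl /= dl0 hdl.
have sT' : 0 < T - s by lra.
near=> n.
have nd : n.+1%:R^-1 < dl by near: n; exact: near_infty_natSinv_lt (PosNum dl0).
have nT : s + n.+1%:R^-1 < T.
  suff : n.+1%:R^-1 < T - s by move: (n.+1%:R^-1) => v; lra.
  by near: n; exact: near_infty_natSinv_lt (PosNum sT').
pose b r := n.+1%:R * smooth_bump (n.+1%:R * (r - s)).
have cb : continuous b by exact: continuous_bump_scale.
have mb : measurable_fun setT (b : RR -> R) by exact: continuous_measurable_fun.
have b0 r : 0 <= b r by rewrite mulr_ge0// smooth_bump_ge0.
have bB r : `|b r| <= n.+1%:R * 4.
  rewrite ger0_norm// ler_wpM2l//.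
  have [u01|/smooth_bump_supp ->//] := boolP (0 <= n.+1%:R * (r - s) <= 1).
  move: u01; set u := _ * (r - s) => u01; rewrite /smooth_bump.
  rewrite [Num.max u 0]max_l; last by case/andP: u01.
  rewrite [Num.max (u - 1) 0]max_r; last by lra.
  have : 0 <= Num.max (u - 2^-1) 0 by rewrite le_max lexx orbT.
  by lra.
have bi : U.-integrable setT (EFin \o b) by exact: (@integrable_bounded _ _ _ U _ _ mb bB).
have fbi : U.-integrable setT (EFin \o (fun r => f r * b r)).
  have [B hB] := f_bound; apply: (@integrable_bounded _ _ _ U _ (B * (n.+1%:R * 4))).
    exact: measurable_funM.
  by move=> r; rewrite normrM ler_pM.
have -> : f s - T * \int[U]_r (f r * b r) = T * \int[U]_r (f s * b r - f r * b r).
  rewrite RintegralB//; last exact: integrableZlr.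
  by rewrite RintegralZl// mulrBr mulrCA (Rintegral_bump s0 nT) mulr1.
rewrite normrM (gtr0_norm T0).
apply: (@le_trans _ _ (T * \int[U]_r (e * b r))).
  apply: ler_wpM2l; first exact: ltW.
  have di : U.-integrable setT (EFin \o (fun r => f s * b r - f r * b r)).
    by apply: integrableBr => //; exact: integrableZlr.
  apply: le_trans (le_normr_Rintegral _ di) _ => //.
  apply: le_Rintegral => //; [exact: integrable_norm|exact: integrableZlr|].
  move=> r _; rewrite -mulrBl normrM (ger0_norm (b0 r)).
  have [u01|u01] := boolP (0 <= n.+1%:R * (r - s) <= 1); last first.
    by rewrite /b smooth_bump_supp// !mulr0.
  apply: ler_wpM2r => //; apply: hdl; rewrite /ball/=.
  case/andP: u01 => u0 u1.
  have r0 : 0 <= r - s by rewrite -(@pmulr_rge0 _ n.+1%:R).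
  rewrite distrC ger0_norm//; apply: le_lt_trans nd.
  by rewrite -[leRHS]mulr1 mulrC ler_pdivlMr// mulrC.
by rewrite RintegralZl// mulrCA (Rintegral_bump s0 nT) mulr1.
Unshelve. all: by end_near.
Qed.

(** Plateaus serve as test functions. Their derivatives tend to a unit mass at [s] minus one at [t],
    while the plateaus themselves tend to the indicator of []s, t]] and stay bounded by 1. *)
Lemma weak_increment (s t : R) : 0 < s -> s < t -> t < T ->
  f t - f s = T * (prim h t - prim h s).
Proof.
move=> s0 st tT.
have cl : T * \int[U]_r (f r * derive1 (plateau n.+1 s t) r) @[n --> \oo] --> f s - f t.
  have c1 := cvg_bump (s := s); have c2 := cvg_bump (s := t).
  have st0 : 0 < s < T by lra.
  have tt0 : 0 < t < T by lra.
  rewrite (_ : (fun n : nat => _) = (fun n : nat =>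
    T * \int[U]_r (f r * (n.+1%:R * smooth_bump (n.+1%:R * (r - s)))) -
    T * \int[U]_r (f r * (n.+1%:R * smooth_bump (n.+1%:R * (r - t)))))); last first.
    apply/funext => n.
    have bi (c : R) : U.-integrable setT
        (EFin \o (fun r => f r * (n.+1%:R * smooth_bump (n.+1%:R * (r - c))))).
      have mb : measurable_fun setT (fun r : RR => n.+1%:R * smooth_bump (n.+1%:R * (r - c))).
        by apply: continuous_measurable_fun; exact: continuous_bump_scale.
      have [B hB] := f_bound; apply: (@integrable_bounded _ _ _ U _ (B * (n.+1%:R * 4))).
        exact: measurable_funM.
      move=> r; rewrite normrM ler_pM// normrM ger0_norm// ler_wpM2l//.
      rewrite ger0_norm ?smooth_bump_ge0//.
      have [u01|/smooth_bump_supp ->//] := boolP (0 <= n.+1%:R * (r - c) <= 1).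
      move: u01; set u := _ * (r - c) => u01; rewrite /smooth_bump.
      rewrite [Num.max u 0]max_l; last by case/andP: u01.
      rewrite [Num.max (u - 1) 0]max_r; last by lra.
      have : 0 <= Num.max (u - 2^-1) 0 by rewrite le_max lexx orbT.
      by lra.
    rewrite -mulrBr -RintegralB//; congr (_ * _); apply: eq_Rintegral => r _.
    rewrite derive1E; have h' := is_derive_plateau n.+1 s t r; rewrite derive_val.
    by rewrite mulrBr.
  exact: cvgB (c1 st0) (c2 tt0).
have cr : - (T * \int[U]_r (h r * plateau n.+1 s t r)) @[n --> \oo] -->
    - (T * (prim h t - prim h s)).
  apply: cvgN; apply: cvgM; first exact: cvg_cst.
  rewrite /prim -RintegralB//; [|exact: integrable_le_ind..].
  apply: (@cvg_unif_dom _ _ (fun r => `|h r|)).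
  - move=> n; apply: measurable_funM => //; apply: continuous_measurable_fun => r.
    apply: differentiable_continuous; apply/derivable1_diffP.
    by have [] := is_derive_plateau n.+1 s t r.
  - by apply: measurable_funB; apply: measurable_funM => //; exact: measurable_le_ind.
  - exact: integrable_norm.
  - apply: aeW => r; rewrite -mulrBl mulrC; apply: cvgM; first exact: cvg_cst.
    have -> : (r <= t)%R%:R - (r <= s)%R%:R = (s < r)%R%:R - (t < r)%R%:R :> R.
      by rewrite !ltNge; case: (r <= t); case: (r <= s); rewrite /=; ring.
    by apply: cvgB; exact: cvg_smooth_step.
  - apply: aeW => r n; rewrite normrM ler_piMr// /plateau.
    have := smooth_step01 (n.+1%:R * (r - s)); have := smooth_step01 (n.+1%:R * (r - t)).
    by rewrite ler_norml; lra.
have tT'' : 0 < T - t by lra.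
have : f s - f t = - (T * (prim h t - prim h s)).
  apply: (cvg_unique _ cl); first exact: Rhausdorff.
  apply: (cvg_trans _ cr); apply: near_eq_cvg.
  near=> n; have tn : t + n.+1%:R^-1 < T.
    suff : n.+1%:R^-1 < T - t by move: (n.+1%:R^-1) => v; lra.
    by near: n; exact: near_infty_natSinv_lt (PosNum tT'').
  by rewrite (weak (time_test_plateau s0 st tn)) mulrN.
by lra.
Unshelve. all: by end_near.
Qed.

(** The test functions see interior points only; the endpoints are reached by continuity of [f] on
    [[0, T]] and of the primitive. *)
Lemma weak_primitive (t : R) : 0 <= t <= T -> f t = f 0 + T * prim h t.
Proof.
move=> t01.
have [a [a01 ac]] : exists a : nat -> R, (forall n, 0 < a n < T) /\ a n @[n --> \oo] --> (0 : R).
  (* The shift by 2 keeps the sequence strictly inside [(0, T)] from [n = 0] on. *)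
  exists (fun n => T * n.+2%:R^-1); split => [n|].
    rewrite mulr_gt0//= gtr_pMr// invf_lt1// ltr1n//.
  rewrite -[X in _ --> X](mulr0 T); apply: cvgM; first exact: cvg_cst.
  have := @cvg_harmonic R; rewrite /harmonic -(cvg_shiftS (fun n : nat => n.+1%:R^-1 : R)).
  by [].
have prim_a h' : U.-integrable setT (EFin \o h') -> prim h' (a n) @[n --> \oo] --> prim h' 0.
  move=> hi'; apply: cvg_prim_seq => //.
  apply: ae_imp (uniform_itv T0) => r /andP[r0 _]; rewrite leNgt r0.
  rewrite /=; apply: cvg_near_cst; move/cvgrPdist_lt : ac => /(_ r r0).
  apply: filterS => n; rewrite sub0r normrN => /(le_lt_trans (ler_norm _)) anr.
  by rewrite leNgt anr.
have prim_b h' : U.-integrable setT (EFin \o h') -> prim h' (T - a n) @[n --> \oo] --> prim h' T.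
  move=> hi'; apply: cvg_prim_seq => //.
  apply: ae_imp (uniform_itv T0) => r /andP[_ rT]; rewrite (ltW rT).
  rewrite /=; apply: cvg_near_cst; have rT0 : 0 < T - r by lra.
  move/cvgrPdist_lt : ac => /(_ _ rT0).
  apply: filterS => n; rewrite sub0r normrN => /(le_lt_trans (ler_norm _)) anr.
  by rewrite (_ : r <= T - a n)//; lra.
have := f_cont; rewrite continuous_within_itvP// => -[_ fc0 fcT].
have f_a : f (a n) @[n --> \oo] --> f 0.
  move/cvg_at_rightP : fc0; apply; split => // n; by case/andP: (a01 n).
have f_b : f (T - a n) @[n --> \oo] --> f T.
  move/cvg_at_leftP : fcT; apply; split => [n|]; first by have := a01 n; lra.
  rewrite -[X in _ --> X]subr0; apply: cvgB => //; exact: cvg_cst.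
have inc s u : 0 < s < T -> 0 < u < T -> f u - f s = T * (prim h u - prim h s).
  move=> s0 u0; case: (ltgtP s u) => [su|su|->].
  - by apply: weak_increment; lra.
  - have := @weak_increment u s; move=> /(_ _ _ _)E; rewrite -opprB E; lra.
  - by rewrite !subrr mulr0.
have inc0 u : 0 < u < T -> f u - f 0 = T * (prim h u - prim h 0).
  move=> u0; apply: (@cvg_unique _ (@Rhausdorff R) (f u - f (a n) @[n --> \oo])).
    by apply: cvgB => //; exact: cvg_cst.
  rewrite (_ : (fun n => _) = fun n => T * (prim h u - prim h (a n))); last first.
    by apply/funext => n; apply: inc.
  apply: cvgM; first exact: cvg_cst.
  by apply: cvgB; [exact: cvg_cst|exact: prim_a].
have p0 : prim h 0 = 0 by apply: prim0.
have [->|tn0] := eqVneq t 0; first by rewrite p0 mulr0 addr0.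
have [->|tnT] := eqVneq t T; last first.
  have t0 : 0 < t < T by rewrite !lt_neqAle eq_sym tn0 tnT.
  by have := inc0 t t0; rewrite p0; lra.
suff : f T - f 0 = T * (prim h T - prim h 0) by rewrite p0; lra.
apply: (@cvg_unique _ (@Rhausdorff R) (f (T - a n) - f 0 @[n --> \oo])).
  by apply: cvgB => //; exact: cvg_cst.
rewrite (_ : (fun n => _) = fun n => T * (prim h (T - a n) - prim h 0)); last first.
  by apply/funext => n; apply: inc0; have := a01 n; lra.
apply: cvgM; first exact: cvg_cst.
by apply: cvgB; [exact: prim_b|exact: cvg_cst].
Qed.

End ac.

(** The null function has weak derivative [c], so the primitive of [c] vanishes on [[0, T]];
    Lebesgue's differentiation theorem then gives [c = 0] almost everywhere. *)
Lemma weak_null (c : RR -> R) : U.-integrable setT (EFin \o c) ->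
  (forall th, time_test th -> \int[U]_t (c t * th t) = 0) -> {ae U, forall t, c t = 0}.
Proof.
move=> ci weak0.
have mc : measurable_fun setT c by have := measurable_int _ ci; move/measurable_EFinP.
have pc t : 0 <= t <= T -> prim c t = 0.
  move=> t01; have := @weak_primitive (fun=> 0) c _ _ _ ci _ t t01.
  rewrite add0r => H; have /esym/eqP : 0 = T * prim c t.
    apply: H.
    - exact/continuous_subspaceT/cst_continuous.
    - exact: measurable_cst.
    - by exists 0 => r; rewrite normr0.
    - move=> th tth; rewrite weak0// oppr0; under eq_Rintegral do rewrite mul0r.
      by rewrite Rintegral_cst// mul0r.
  by rewrite mulf_eq0 gt_eqF//= => /eqP.
have cmu : mu.-integrable `[0, T] (EFin \o c).
  apply/integrableP; split; first by apply: measurable_funTS; exact/measurable_EFinP.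
  have /integrableP[_] := ci; rewrite integral_uniform//; last first.
    by apply/measurable_EFinP; exact: measurableT_comp.
  rewrite subr0; case: (\int[mu]_(x in _) _)%E => [r| |] //.
  - by move=> _; exact: ltry.
  - by rewrite gt0_muley ?lte_fin ?invr_gt0.
(* The differentiation theorem concerns integrals over []-oo, x]] for Lebesgue measure, hence the
   extension by 0. *)
pose c0 := c \_ `[0, T].
have mI : measurable (`[0, T] : set RR) by exact: measurable_itv.
have c0i : mu.-integrable setT (EFin \o c0).
  have := cmu; rewrite integrable_mkcond//; apply: eq_integrable => // x _.
  by rewrite /c0 /= /patch; case: ifP.
have F0 x : \int[mu]_(r in `]-oo, x]) c0 r = 0.
  rewrite Rintegral_mkcond /c0.
  transitivity (T * prim c x).
    rewrite /prim uniform_Rintegral; last by apply: measurable_funM => //; exact: measurable_le_ind.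
    rewrite subr0 mulrA mulfV ?gt_eqF// mul1r [RHS]Rintegral_mkcond.
    apply: eq_Rintegral => r _; rewrite /patch !mem_setE !in_itv/=.
    by case: (r <= x); case: (0 <= r <= T); rewrite ?mul1r ?mul0r.
  have [x0|x0] := leP x 0.
    rewrite [prim c x](_ : _ = 0) ?mulr0//; transitivity (\int[U]_r (0 : R)); last first.
      by rewrite Rintegral_cst// mul0r.
    apply: ae_eq_Rintegral; [|exact: measurable_cst|].
    - by apply: measurable_funM => //; exact: measurable_le_ind.
    - by apply: ae_imp (uniform_itv T0) => r /andP[r0 _]; rewrite leNgt (le_lt_trans x0 r0) mul0r.
  have [xT|xT] := leP x T; first by rewrite pc ?mulr0// (ltW x0).
  rewrite [prim c x](_ : _ = prim c T); first by rewrite pc ?lexx ?mulr0// ltW.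
  apply: ae_eq_Rintegral.
  - by apply: measurable_funM => //; exact: measurable_le_ind.
  - by apply: measurable_funM => //; exact: measurable_le_ind.
  - by apply: ae_imp (uniform_itv T0) => r /andP[_ rT]; rewrite (ltW rT) (ltW (lt_trans rT xT)).
have c0y y : mu.-integrable `]-oo, y] (EFin \o c0).
  by apply: (integrableS _ _ _ c0i) => //; exact: measurable_itv.
have := FTC1Ny c0y (integrable_locally mI cmu); rewrite /=.
(* Absolute continuity carries the exceptional set back to the uniform law. *)
have dU : forall A : set RR, measurable A -> mu A = 0%E -> U A = 0%E.
  by apply/null_content_dominatesP; exact: dominates_uniform_prob.
case=> N [mN N0 sN].
have : {ae U, forall x : R, c0 x = 0}.
  exists N; split => //; first exact: dU.
  move=> x /= cx; apply: sN => /= h; apply: cx; have [_ <-] := h.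
  by rewrite (_ : (fun y => _) = cst 0) ?derive1_cst//; apply/funext => y; exact: F0.
move=> hc; apply: (@filterS2 _ _ (ae_filter_ringOfSetsType U) _ _ _ _ hc (uniform_itv T0)) => t + t01.
by rewrite /c0 /patch mem_set//= in_itv/=; case/andP: t01 => t0 tT; rewrite !ltW.
Qed.
End weak_derivative.

(** * The weighted energy inequality for one Fourier coefficient *)

Section energy.
Context {R : realType} (T a nu : R).
Hypotheses (T0 : 0 < T) (a0 : 0 < a) (nu1 : 1 < nu).
Local Notation RR := (measurableTypeR R).
Local Notation U := (uniform_prob T0).
Local Notation mu := (@lebesgue_measure R).
Local Notation prim := (prim T0).

Lemma eq_prim (h k : RR -> R) t : measurable_fun setT h -> measurable_fun setT k ->
  {ae U, forall r, h r = k r} -> prim h t = prim k t.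
Proof.
move=> mh mk hk; apply: ae_eq_Rintegral.
- by apply: measurable_funM => //; exact: measurable_le_ind.
- by apply: measurable_funM => //; exact: measurable_le_ind.
- by apply: ae_imp hk => r ->.
Qed.

(** Product rule for functions known through their primitives, obtained by expanding both and
    applying [prim_mul] to the product of the primitives. *)
Lemma primitive_mul (u v u' v' : RR -> R) : measurable_fun setT u -> measurable_fun setT v ->
  U.-integrable setT (EFin \o u') -> U.-integrable setT (EFin \o v') ->
  (forall t, 0 <= t <= T -> u t = u 0 + T * prim u' t) ->
  (forall t, 0 <= t <= T -> v t = v 0 + T * prim v' t) ->
  forall t, 0 <= t <= T ->
    u t * v t = u 0 * v 0 + T * prim (fun r => u' r * v r + v' r * u r) t.
Proof.
move=> mu_ mv u'i v'i uE vE t t01.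
have mu' : measurable_fun setT u' by have := measurable_int _ u'i; move/measurable_EFinP.
have mv' : measurable_fun setT v' by have := measurable_int _ v'i; move/measurable_EFinP.
rewrite (uE t)// (vE t)//.
have pri (h k : RR -> R) : U.-integrable setT (EFin \o h) -> U.-integrable setT (EFin \o k) ->
    U.-integrable setT (EFin \o (fun r => h r * prim k r)).
  move=> hi ki; have mh : measurable_fun setT h by have := measurable_int _ hi; move/measurable_EFinP.
  have mk : measurable_fun setT k by have := measurable_int _ ki; move/measurable_EFinP.
  apply: (@integrable_dom _ _ _ _ _ (fun r => (\int[U]_r `|k r|) * `|h r|)).
  - by apply: measurable_funM => //; exact: measurable_prim.
  - by move=> r; rewrite normrM mulrC ler_wpM2r// prim_bound.
  - by apply: integrableZlr; exact: integrable_norm.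
have -> : prim (fun r => u' r * v r + v' r * u r) t =
    prim (fun r => (v 0 * u' r + u 0 * v' r) + T * (u' r * prim v' r + v' r * prim u' r)) t.
  apply: eq_prim.
  - by apply: measurable_funD; exact: measurable_funM.
  - apply: measurable_funD; first by apply: measurable_funD; exact: measurable_funM.
    by apply: measurable_funM => //; apply: measurable_funD; apply: measurable_funM => //; exact: measurable_prim.
  - apply: ae_imp (uniform_itv T0) => r /andP[r0 rT].
    by rewrite (uE r) ?(vE r) ?(ltW r0) ?(ltW rT)//; ring.
have -> : prim (fun r => (v 0 * u' r + u 0 * v' r) + T * (u' r * prim v' r + v' r * prim u' r)) t =
    (v 0 * prim u' t + u 0 * prim v' t) + T * (prim u' t * prim v' t).
  have i1 := integrable_le_ind t u'i; have i2 := integrable_le_ind t v'i.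
  have i3 := integrable_le_ind t (integrableDr (pri _ _ u'i v'i) (pri _ _ v'i u'i)).
  rewrite prim_mul// /prim -!RintegralZl// -!RintegralD//.
  - by apply: eq_Rintegral => r _; ring.
  - by apply: integrableDr; exact: integrableZlr.
  - exact: integrableZlr.
  - exact: integrableZlr.
  - exact: integrableZlr.
by ring.
Qed.

Definition weight (lam t : R) : R := expR (2 * lam * ((t + a) `^ nu)).

Definition weight' (lam t : R) : R := 2 * lam * (nu * (t + a) `^ (nu - 1)) * weight lam t.

(** The constant [c] of the overview: the least value on [t >= 0] of [nu (t + a)^(nu - 1)], reached
    at [t = 0] because [nu > 1]. *)
Definition rate : R := nu * a `^ (nu - 1).

Lemma rate_gt0 : 0 < rate.
Proof. by have h := nu1; rewrite mulr_gt0 ?powR_gt0//; lra. Qed.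

Lemma weight_gt0 lam t : 0 < weight lam t. Proof. exact: expR_gt0. Qed.

Lemma is_derive_weight lam (t : R) : - a < t -> is_derive t (1 : R) (weight lam) (weight' lam t).
Proof.
move=> ta; have ta0 : 0 < t + a by lra.
have s1 : is_derive t (1 : R) (fun t => t + a) 1.
  by apply: is_derive_eq; rewrite addr0.
have h1 : is_derive t (1 : R) (fun t => (t + a) `^ nu) (nu * (t + a) `^ (nu - 1)).
  rewrite -[X in is_derive _ _ _ X]mulr1.
  have h := is_derive1_powR nu ta0.
  exact: (@is_derive1_comp R (fun x : R => x `^ nu) (fun t => t + a) _ _ _ h s1).
have h2 : is_derive t (1 : R) (fun t => 2 * lam * (t + a) `^ nu) (2 * lam * (nu * (t + a) `^ (nu - 1))).
  by apply: is_derive_eq; rewrite /GRing.scale/=.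
rewrite [weight' lam t]mulrC /weight.
have h3 := is_derive_expR (2 * lam * (t + a) `^ nu).
exact: (@is_derive1_comp R expR (fun t => 2 * lam * (t + a) `^ nu) _ _ _ h3 h2).
Qed.

Lemma measurable_weight lam : measurable_fun setT (weight lam : RR -> R).
Proof.
apply: measurableT_comp => //; apply: measurable_funM => //.
apply: (measurableT_comp (measurable_powR _)); exact: measurable_funD.
Qed.

Lemma measurable_weight' lam : measurable_fun setT (weight' lam : RR -> R).
Proof.
apply: measurable_funM; last exact: measurable_weight.
apply: measurable_funM => //; apply: measurable_funM => //.
apply: (measurableT_comp (measurable_powR _)); exact: measurable_funD.
Qed.

Lemma weight_le lam s t : 0 <= lam -> 0 <= s -> s <= t -> weight lam s <= weight lam t.
Proof.
have h1 := nu1; have h2 := a0.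
move=> l0 s0 st; rewrite ler_expR; apply: ler_wpM2l; first by rewrite mulr_ge0.
by apply: ge0_ler_powR; rewrite ?nnegrE; lra.
Qed.

Lemma powR_rate t : 0 <= t -> rate <= nu * (t + a) `^ (nu - 1).
Proof.
have h1 := nu1; have h2 := a0.
move=> t0; apply: ler_wpM2l; first by lra.
by apply: ge0_ler_powR; rewrite ?nnegrE; lra.
Qed.

Lemma weight'_bound lam t : 0 <= lam -> 0 <= t <= T ->
  2 * lam * rate * weight lam t <= weight' lam t <= 2 * lam * (nu * (T + a) `^ (nu - 1)) * weight lam T.
Proof.
have h1 := nu1; have h2 := a0.
move=> l0 /andP[t0 tT]; rewrite /weight'; apply/andP; split.
  apply: ler_wpM2r; first exact/ltW/weight_gt0.
  by apply: ler_wpM2l; [rewrite mulr_ge0|exact: powR_rate].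
apply: ler_pM.
- by rewrite !mulr_ge0 ?powR_ge0//; lra.
- exact/ltW/weight_gt0.
- apply: ler_wpM2l; first by rewrite mulr_ge0.
  by apply: ler_wpM2l; [lra|apply: ge0_ler_powR; rewrite ?nnegrE; lra].
- exact: weight_le.
Qed.

Lemma integrable_ae_bounded (f : RR -> R) B : measurable_fun setT f ->
  (forall t, 0 < t < T -> `|f t| <= B) -> U.-integrable setT (EFin \o f).
Proof.
move=> mf fB; apply/integrableP; split; first exact/measurable_EFinP.
apply: (@le_lt_trans _ _ (\int[U]_x (`|B|)%:E)%E); last first.
  by rewrite integral_cst//= (@probability_setT _ _ _ U) mule1 ltry.
apply: ae_ge0_le_integral => //.
- by apply/measurable_EFinP; exact: measurableT_comp.
- apply: ae_imp (uniform_itv T0) => t t01 _ /=.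
  by rewrite lee_fin (le_trans (fB t t01))// ler_norm.
Qed.

(** The fundamental theorem on [[0, t]], where [a > 0] keeps [t + a] in the range of
    differentiability of the power. The case [t = 0] is apart because that theorem wants a
    nondegenerate interval. *)
Lemma weight_primitive lam t : 0 <= lam -> 0 <= t <= T ->
  weight lam t = weight lam 0 + T * prim (weight' lam) t.
Proof.
move=> l0 /andP[t0 tT].
have [->|tn0] := eqVneq t 0; first by rewrite prim0 ?mulr0 ?addr0//; exact: measurable_weight'.
have {}t0 : 0 < t by rewrite lt_neqAle eq_sym tn0.
have h2 := a0; have d1 (s : R) : 0 <= s -> is_derive s (1 : R) (weight lam) (weight' lam s).
  by move=> s0; apply: is_derive_weight; lra.
have cw (s : R) : 0 <= s -> {for s, continuous (weight lam)}.
  move=> s0; apply: differentiable_continuous; apply/derivable1_diffP.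
  by have [] := d1 s s0.
have cw' : {within `[0, t], continuous (weight' lam)}.
  apply: continuous_in_subspaceT => s; rewrite inE/= in_itv/= => /andP[s0 _].
  apply: cvgM; last exact: cw.
  apply: cvgM; [exact: cvg_cst|apply: cvgM; [exact: cvg_cst|]].
  have sa : 0 < s + a by lra.
  apply: (@cvg_comp _ _ _ (fun r : R => r + a) (fun x : R => x `^ (nu - 1)) _ (nbhs (s + a))).
    by apply: cvgD; [exact: cvg_id|exact: cvg_cst].
  have cp : {for (s + a), continuous (fun x : R => x `^ (nu - 1))}.
    apply: differentiable_continuous; apply/derivable1_diffP.
    by have [] := is_derive1_powR (nu - 1) sa.
  exact: cp.
have : T * prim (weight' lam) t = weight lam t - weight lam 0; last by lra.
rewrite /prim uniform_Rintegral; last first.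
  by apply: measurable_funM; [exact: measurable_le_ind|exact: measurable_weight'].
rewrite subr0 mulrA mulfV ?gt_eqF// mul1r.
transitivity (\int[mu]_(x in `[0, t]) weight' lam x).
  rewrite Rintegral_mkcond [RHS]Rintegral_mkcond; apply: eq_Rintegral => r _.
  rewrite /patch !mem_setE !in_itv/=; have [rt|rt] := leP r t.
    by rewrite (le_trans rt tT) mul1r.
  by rewrite mul0r !andbF; case: ifP.
rewrite /Rintegral (@continuous_FTC2 _ _ (weight lam))//.
- split=> [s||]; first by rewrite in_itv/= => /andP[s0 _]; have [] := d1 s (ltW s0).
    exact/cvg_at_right_filter/cw.
  exact/cvg_at_left_filter/cw/ltW.
- by move=> s; rewrite in_itv/= => /andP[s0 _]; rewrite derive1E; have h := d1 s (ltW s0); exact: derive_val.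
Qed.

(** The derivative of [w f^2] is integrated up to [T]. Of the gain [2 lam rate w f^2] coming from
    the weight, one half is spent by Young's inequality on the cross term [2 f z]. *)
Lemma energy_ineq (lam m : R) (f z : RR -> R) : 0 < lam -> 0 <= m ->
  {within `[0, T], continuous f} -> measurable_fun setT f -> (exists B, forall t, `|f t| <= B) ->
  sqint U z ->
  (forall th, time_test T th ->
    \int[U]_t (f t * derive1 th t) = - \int[U]_t ((m * f t - z t) * th t)) ->
  (lam * rate + 2 * m) * \int[U]_t (weight lam t * f t ^+ 2) <=
    T^-1 * (weight lam T * f T ^+ 2) + (lam * rate)^-1 * \int[U]_t (weight lam t * z t ^+ 2).
Proof.
move=> l0 m0 cf mf [B fB] [mz z2] wk; have c0 := rate_gt0.
have z2' : sqint U z by [].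
have fsq : sqint U f by exact: (@sqint_bounded _ _ _ U _ B).
have oneq : sqint U (fun=> 1) by apply: (@sqint_bounded _ _ _ U _ 1) => // t; rewrite normr1.
have fi : U.-integrable setT (EFin \o f) by exact: (@integrable_bounded _ _ _ U _ B).
have zi : U.-integrable setT (EFin \o z).
  by have := sqint_mul z2' oneq; apply: eq_integrable => // t _; rewrite /= mulr1.
pose h t := m * f t - z t.
have hi : U.-integrable setT (EFin \o h) by apply: integrableBr => //; exact: integrableZlr.
have mh : measurable_fun setT h by have := measurable_int _ hi; move/measurable_EFinP.
have fE := @weak_primitive R T T0 f h cf mf (ex_intro _ B fB) hi wk.
have f2E := primitive_mul mf mf hi hi fE fE.
have w'i : U.-integrable setT (EFin \o weight' lam).
  apply: (@integrable_ae_bounded _ (2 * lam * (nu * (T + a) `^ (nu - 1)) * weight lam T)).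
    exact: measurable_weight'.
  move=> t /andP[t0 tT]; have t01 : 0 <= t <= T by rewrite !ltW.
  have /andP[b1 b2] := weight'_bound (ltW l0) t01.
  have b0 : 0 <= 2 * lam * rate * weight lam t.
    exact: mulr_ge0 (mulr_ge0 (mulr_ge0 (ler0n _ 2) (ltW l0)) (ltW c0)) (ltW (weight_gt0 lam t)).
  by rewrite ger0_norm ?(le_trans b0 b1).
have hfi : U.-integrable setT (EFin \o (fun r => h r * f r + h r * f r)).
  have i1 : U.-integrable setT (EFin \o (fun r => h r * f r)).
    apply: (@integrable_dom _ _ _ _ _ (fun r => B * `|h r|)).
    - exact: measurable_funM.
    - by move=> r; rewrite normrM mulrC ler_wpM2r.
    - by apply: integrableZlr; exact: integrable_norm.
  exact: integrableDr.
have mw := measurable_weight lam; have mw' := measurable_weight' lam.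
have mff : measurable_fun setT (fun t : RR => f t * f t) by exact: measurable_funM.
(* Second use of the product rule, for the weight times [f^2]; the first one produced [f^2]. *)
have wf2E := primitive_mul mw mff w'i hfi (fun t => weight_primitive (ltW l0)) f2E.
have TT : 0 <= T <= T by rewrite lexx ltW.
have := wf2E T TT; rewrite primT; last first.
  apply: measurable_funD; apply: measurable_funM => //.
  by apply: measurable_funD; exact: measurable_funM.
move=> wE.
have wbd t : 0 < t < T -> 0 <= weight lam t <= weight lam T.
  move=> /andP[t0 tT]; rewrite ltW ?weight_gt0//= weight_le//; exact: ltW.
have wf2i : U.-integrable setT (EFin \o (fun t => weight lam t * f t ^+ 2)).
  apply: (@integrable_ae_bounded _ (weight lam T * B ^+ 2)).
    by apply: measurable_funM => //; exact: measurable_funX.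
  move=> t /wbd wt; rewrite normrM normrX; apply: ler_pM => //.
    by rewrite ger0_norm; case/andP: wt.
  by rewrite lerXn2r ?nnegrE// (le_trans _ (fB t)).
have wz2i : U.-integrable setT (EFin \o (fun t => weight lam t * z t ^+ 2)).
  apply/integrableP; split.
    by apply/measurable_EFinP; apply: measurable_funM => //; exact: measurable_funX.
  apply: (@le_lt_trans _ _ (\int[U]_t ((weight lam T)%:E * (z t ^+ 2)%:E))%E); last first.
    rewrite ge0_integralZl ?lee_fin ?(ltW (weight_gt0 _ _))//; last 2 first.
      exact: meas_sq.
      by move=> t _; rewrite lee_fin sqr_ge0.
    by rewrite lte_mul_pinfty ?lee_fin ?(ltW (weight_gt0 _ _)).
  apply: ae_ge0_le_integral => //.
  - apply/measurable_EFinP; apply: measurableT_comp => //.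
    by apply: measurable_funM => //; exact: measurable_funX.
  - by move=> t _; rewrite mule_ge0 ?lee_fin ?sqr_ge0 ?(ltW (weight_gt0 _ _)).
  - by apply: measurable_funeM; exact: meas_sq.
  - apply: ae_imp (uniform_itv T0) => t /wbd /andP[w0 wT] _.
    rewrite /= -EFinM lee_fin normrM (ger0_norm w0) (ger0_norm (sqr_ge0 _)).
    by rewrite ler_wpM2r ?sqr_ge0.
have lc : 0 < lam * rate by rewrite mulr_gt0.
have G1 : U.-integrable setT (EFin \o (fun r : RR => weight' lam r * (f r * f r))).
  apply: (@integrable_dom _ _ _ U (fun r : RR => weight' lam r * (f r * f r)) (fun r : RR => B ^+ 2 * `|weight' lam r|)).
  - exact: measurable_funM.
  - move=> r; rewrite normrM mulrC ler_wpM2r// normrM -expr2 lerXn2r ?nnegrE//.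
    by rewrite (le_trans _ (fB r)).
  - by apply: integrableZlr; exact: integrable_norm.
have G2 : U.-integrable setT (EFin \o (fun r : RR => (h r * f r + h r * f r) * weight lam r)).
  have hf' := measurable_int _ hfi; move/measurable_EFinP in hf'.
  apply/integrableP; split; first by apply/measurable_EFinP; exact: measurable_funM.
  have /integrableP[_ hfoo] := hfi.
  apply: (@le_lt_trans _ _ (\int[U]_t ((weight lam T)%:E * `|(h t * f t + h t * f t)%:E|))%E); last first.
    rewrite ge0_integralZl ?lee_fin ?(ltW (weight_gt0 _ _))//; last first.
      by apply: measurableT_comp => //; exact/measurable_EFinP.
    by rewrite lte_mul_pinfty ?lee_fin ?(ltW (weight_gt0 _ _)).
  apply: ae_ge0_le_integral => //.
  - by apply/measurable_EFinP; apply: measurableT_comp => //; exact: measurable_funM.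
  - by move=> t _; rewrite mule_ge0 ?lee_fin ?(ltW (weight_gt0 _ _)).
  - by apply: measurable_funeM; apply: measurableT_comp => //; exact/measurable_EFinP.
  - apply: ae_imp (uniform_itv T0) => t /wbd /andP[w0 wT] _.
    by rewrite /= -EFinM lee_fin normrM mulrC (ger0_norm w0) ler_wpM2r.
have Gi := integrableDr G1 G2.
have key : (lam * rate + 2 * m) * \int[U]_t (weight lam t * f t ^+ 2) -
    (lam * rate)^-1 * \int[U]_t (weight lam t * z t ^+ 2) <=
    \int[U]_r (weight' lam r * (f r * f r) + (h r * f r + h r * f r) * weight lam r).
  rewrite -!RintegralZl// -RintegralB//; [|exact: integrableZlr..].
  apply: ae_le_Rintegral => //; first by apply: integrableBr; exact: integrableZlr.
  apply: ae_imp (uniform_itv T0) => t /andP[t0 tT].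
  have t01 : 0 <= t <= T by rewrite !ltW.
  have /andP[b1 _] := weight'_bound (ltW l0) t01.
  have fw : 2 * lam * rate * weight lam t * f t ^+ 2 <= weight' lam t * f t ^+ 2.
    by rewrite ler_wpM2r ?sqr_ge0.
  (* Young's inequality, in the form of a completed square. *)
  have yg : 0 <= weight lam t * (lam * rate * f t ^+ 2 + (lam * rate)^-1 * z t ^+ 2 - 2 * (f t * z t)).
    apply: mulr_ge0; first exact/ltW/weight_gt0.
    have -> : lam * rate * f t ^+ 2 + (lam * rate)^-1 * z t ^+ 2 - 2 * (f t * z t) =
        (lam * rate)^-1 * (lam * rate * f t - z t) ^+ 2.
      by field; rewrite gt_eqF//= gt_eqF.
    by rewrite mulr_ge0 ?sqr_ge0// ltW// invr_gt0.
  by rewrite /h; rewrite !expr2 in fw yg *; lra.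
(* The contribution of time 0 has the favourable sign and is dropped. *)
have w0 : 0 <= weight lam 0 * (f 0 * f 0) by rewrite mulr_ge0 -?expr2 ?sqr_ge0// ltW ?weight_gt0.
rewrite -lerBlDr; apply: le_trans key _.
rewrite -(ler_pM2l T0) [X in _ <= X]mulrA mulfV ?gt_eqF// mul1r expr2 wE.
by rewrite lerDr.
Qed.

End energy.

(** * Integration over the space-time cylinder *)

Definition torus2 (R : realType) (d : nat) : probability ('rV[R]_d * 'rV[R]_d)%type R :=
  (torus_leb R d \x torus_leb R d)%E.

(** The variables are grouped as [(t, (x, y))] instead of [((t, x), y)], so that a slice at fixed
    time is a function on [torus2]. *)
Definition cylinder (R : realType) (d : nat) (T : R) (T0 : 0 < T) :
  probability (measurableTypeR R * ('rV[R]_d * 'rV[R]_d))%type R :=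
  (uniform_prob T0 \x torus2 R d)%E.

Section lebesgue_torus.
Context (R : realType) (d : nat).

(** A name for the first factor of [leb_Q], so that it can carry the sigma-finite structure under
    which Tonelli is applied. *)
Definition lebesgue_torus : set (measurableTypeR R * 'rV[R]_d) -> \bar R :=
  (@lebesgue_measure R \x torus_leb R d)%E.

HB.instance Definition _ := Measure.on lebesgue_torus.

Let lebesgue_torus_sigma_finite : sigma_finite setT lebesgue_torus.
Proof.
have [F FT Foo] := sigma_finiteT (@lebesgue_measure R).
exists (fun n => F n `*` setT); first by rewrite -setX_bigcupl -FT setXTT.
move=> n; have [mF Fn] := Foo n; split; first exact: measurableX.
have -> : lebesgue_torus (F n `*` setT) = lebesgue_measure (F n).
  transitivity (lebesgue_measure (F n) * torus_leb R d setT)%E.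
    exact: product_measure1E.
  by rewrite (@probability_setT _ _ _ (torus_leb R d)) mule1.
exact: Fn.
Qed.

HB.instance Definition _ := Measure_isSigmaFinite.Build _ _ _ lebesgue_torus
  lebesgue_torus_sigma_finite.

End lebesgue_torus.

(** * Transfer between [leb_Q] and the normalized cylinder *)

Section slab.
Context {R : realType} (d : nat) (T : R).
Hypothesis T0 : 0 < T.
Local Notation RR := (measurableTypeR R).
Local Notation X := 'rV[R]_d.
Local Notation U := (uniform_prob T0).
Local Notation tau := (torus_leb R d).
Local Notation TT := (torus2 R d).
Local Notation PP := (cylinder d T0).
Local Notation Q := (@Q R d T).
Local Notation leb_Q := (leb_Q R d).

(** Extension by 0 outside [0 < t < T]: measurability on [Q] becomes measurability everywhere. *)
Definition slab (f : R -> X -> X -> R) (w : RR * (X * X)) : R :=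
  if 0 < w.1 < T then f w.1 w.2.1 w.2.2 else 0.

Lemma slabE f t z : 0 < t < T -> slab f (t, z) = f t z.1 z.2.
Proof. by rewrite /slab /= => ->. Qed.

Implicit Types f : R -> X -> X -> R.

Lemma slab_funE f w : slab f w =
  ((fun q => f q.1.1 q.1.2 q.2) \_ Q) ((w.1, w.2.1), w.2.2).
Proof.
rewrite /slab /patch; case: ifPn => h; first by rewrite mem_set.
by rewrite memNset//; exact/negP.
Qed.

Lemma measurable_Q : measurable Q.
Proof.
have -> : Q = (fun q : RR * X * X => q.1.1) @^-1` [set` `]0, T[].
  by apply/seteqP; split => q /=; rewrite in_itv.
rewrite -[X in measurable X]setTI.
have m : measurable_fun setT (fun q : RR * X * X => q.1.1).
  exact: (measurableT_comp measurable_fst measurable_fst).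
by apply: m => //; exact: measurable_itv.
Qed.

Lemma measurable_slab f : measurable_fun Q (fun q => f q.1.1 q.1.2 q.2) ->
  measurable_fun setT (slab f).
Proof.
move=> mf; have -> : slab f = (fun w => ((fun q => f q.1.1 q.1.2 q.2) \_ Q) ((w.1, w.2.1), w.2.2)).
  by apply/funext => w; exact: slab_funE.
have m1 : measurable_fun setT ((fun q => f q.1.1 q.1.2 q.2) \_ Q).
  by apply/(measurable_restrictT _ measurable_Q).
apply: (measurableT_comp m1); apply: measurable_fun_pair.
  apply: measurable_fun_pair; first exact: measurable_fst.
  exact: (measurableT_comp measurable_fst measurable_snd).
exact: (measurableT_comp measurable_snd measurable_snd).
Qed.

Lemma measurable_slab_inv f :
  measurable_fun setT (slab f) -> measurable_fun Q (fun q => f q.1.1 q.1.2 q.2).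
Proof.
move=> mF; apply/(measurable_restrictT _ measurable_Q).
have -> : (fun q : RR * X * X => f q.1.1 q.1.2 q.2) \_ Q = (fun q => slab f (q.1.1, (q.1.2, q.2))).
  by apply/funext => -[[t x] y]; rewrite slab_funE.
apply: (measurableT_comp mF); apply: measurable_fun_pair.
  exact: (measurableT_comp measurable_fst measurable_fst).
by apply: measurable_fun_pair => //; exact: (measurableT_comp measurable_snd measurable_fst).
Qed.

Lemma ge0_torus2 (F : X * X -> \bar R) : measurable_fun setT F ->
  (forall w, (0 <= F w)%E) -> (\int[TT]_w F w = \int[tau]_x \int[tau]_y F (x, y))%E.
Proof.
by move=> mF F0; have h := @fubini_tonelli1 _ _ _ _ R tau tau F mF F0; exact: h.
Qed.

Lemma ge0_torus2_swap (F : X * X -> \bar R) : measurable_fun setT F ->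
  (forall w, (0 <= F w)%E) -> (\int[TT]_w F w = \int[TT]_w F (w.2, w.1))%E.
Proof.
move=> mF F0; have h := @fubini_tonelli2 _ _ _ _ R tau tau F mF F0.
transitivity (\int[tau]_y fubini_G tau F y)%E; first exact: h.
rewrite [RHS]ge0_torus2//.
by apply: (measurableT_comp mF); apply: measurable_fun_pair; [exact: measurable_snd|exact: measurable_fst].
Qed.

Lemma ge0_cylinder (F : RR * (X * X) -> \bar R) : measurable_fun setT F ->
  (forall w, (0 <= F w)%E) -> (\int[PP]_w F w = \int[U]_t \int[TT]_z F (t, z))%E.
Proof.
by move=> mF F0; have h := @fubini_tonelli1 _ _ _ _ R U TT F mF F0; exact: h.
Qed.

(** Tonelli regroups the variables, and the factor [T] is the normalization of the uniform law. [G]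
    has to vanish off [Q], since that law does not see the times outside [[0, T]]. *)
Lemma ge0_integral_Q (G : RR * X * X -> \bar R) : measurable_fun setT G ->
  (forall q, (0 <= G q)%E) -> (forall q, ~ Q q -> G q = 0%E) ->
  (\int[leb_Q]_q G q = T%:E * \int[PP]_w G ((w.1, w.2.1), w.2.2))%E.
Proof.
move=> mG G0 GQ.
have mre : measurable_fun setT (fun w : RR * (X * X) => G ((w.1, w.2.1), w.2.2)).
  apply: (measurableT_comp mG); apply: measurable_fun_pair.
    apply: measurable_fun_pair; first exact: measurable_fst.
    exact: (measurableT_comp measurable_fst measurable_snd).
  exact: (measurableT_comp measurable_snd measurable_snd).
transitivity (\int[(@lebesgue_measure R \x tau)%E]_x fubini_F tau G x)%E.
  have h := @fubini_tonelli1 _ _ _ _ R (@lebesgue_torus R d) tau G mG G0.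
  exact: h.
rewrite ge0_cylinder//.
rewrite fubini_tonelli1; last 2 first.
- exact: measurable_fun_fubini_tonelli_F.
- by move=> x; apply: integral_ge0.
have E t : (\int[TT]_y G (t, y.1, y.2) = \int[tau]_x \int[tau]_y G (t, x, y))%E.
  have mt : measurable_fun setT (fun y : X * X => G (t, y.1, y.2)).
    apply: (measurableT_comp mG); apply: measurable_fun_pair => //.
    by apply: measurable_fun_pair => //; exact: measurable_fst.
  exact: (ge0_torus2 mt).
under [in RHS]eq_integral do rewrite E.
rewrite integral_uniform; last 2 first.
- have := @measurable_fun_fubini_tonelli_F _ _ _ _ _ TT _ mre (fun w => G0 _).
  apply: eq_measurable_fun => t _; rewrite /fubini_F/= E//.
- by move=> t; apply: integral_ge0 => x _; apply: integral_ge0.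
rewrite subr0 muleA -EFinM mulfV ?gt_eqF// mul1e [RHS]integral_mkcond.
apply: eq_integral => t _; rewrite /patch; case: ifPn => // tT.
apply: integral0_eq => x _; apply: integral0_eq => y _; apply: GQ => /andP[/= t0 t1].
by move/negP: tT; apply; rewrite mem_setE in_itv/= !ltW.
Qed.

Lemma ge0_integral_slab f : measurable_fun Q (fun q => f q.1.1 q.1.2 q.2) ->
  (forall q, Q q -> 0 <= f q.1.1 q.1.2 q.2) ->
  (\int[leb_Q]_(q in Q) (f q.1.1 q.1.2 q.2)%:E = T%:E * \int[PP]_w (slab f w)%:E)%E.
Proof.
move=> mf f0; rewrite integral_mkcond ge0_integral_Q.
- congr (_ * _)%E; apply: eq_integral => w _; rewrite slab_funE /patch.
  by case: ifPn.
- apply/(measurable_restrictT _ measurable_Q); exact/measurable_EFinP.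
- move=> q; rewrite /patch; case: ifPn => // h; rewrite lee_fin; apply: f0; exact: set_mem.
- by move=> q nq; rewrite /patch memNset.
Qed.

Lemma int_Q_slab f : measurable_fun Q (fun q => f q.1.1 q.1.2 q.2) ->
  PP.-integrable setT (EFin \o slab f) -> int_Q T f = T * \int[PP]_w slab f w.
Proof.
move=> mf fi; rewrite /int_Q /Rintegral.
have -> : T * fine (\int[PP]_w (slab f w)%:E) = fine (T%:E * \int[PP]_w (slab f w)%:E)%E.
  by rewrite fineM//; exact: integrable_fin_num.
congr fine; rewrite integral_mkcond integralE [in RHS]integralE.
have mF : measurable_fun setT (fun q : RR * X * X => ((fun q => (f q.1.1 q.1.2 q.2)%:E) \_ Q) q).
  by apply/(measurable_restrictT _ measurable_Q); exact/measurable_EFinP.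
rewrite muleBr//; last first.
  by apply: fin_num_adde_defr; exact: integrable_pos_fin_num.
rewrite !ge0_integral_Q//.
- by congr (_ * _ - _ * _)%E; apply: eq_integral => w _; rewrite ?funeposE ?funenegE /= slab_funE /patch;
  case: ifPn.
- exact: measurable_funeneg.
- by move=> q nq; rewrite funenegE /patch memNset// oppe0 maxxx.
- exact: measurable_funepos.
- by move=> q nq; rewrite funeposE /patch memNset// maxxx.
Qed.

End slab.

(** * Continuous functions are measurable for the coordinate sigma-algebra *)

Section continuous_measurable.
Context {R : realType}.
Local Notation RR := (measurableTypeR R).

(** Any preimage under [g \o k] is a countable union of fibres of [k], whatever [g] is. *)
Lemma measurable_countable_comp {disp : measure_display} {Y : measurableType disp}
    (K : countType) (k : Y -> K) (g : K -> R) :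
  (forall v, measurable (k @^-1` [set v])) -> measurable_fun setT (g \o k).
Proof.
move=> mk _ B mB; rewrite setTI.
have -> : (g \o k) @^-1` B = \bigcup_(v in [set v | B (g v)]) (k @^-1` [set v]).
  apply/seteqP; split => [y By|y [v Bv]]; first by exists (k y).
  by rewrite /preimage/= => ->.
have -> : \bigcup_(v in [set v | B (g v)]) (k @^-1` [set v]) =
    \bigcup_n (if unpickle n is Some v then
      if v \in [set v | B (g v)] then k @^-1` [set v] else set0 else set0).
  apply/seteqP; split => y.
    move=> [v Bv yv]; exists (pickle v) => //; rewrite pickleK mem_set//.
  move=> [n _]; case: unpickle => // v; case: ifPn => // /set_mem Bv yv; by exists v.
apply: bigcup_measurable => n _; case: unpickle => // v; case: ifPn => // _; exact: mk.
Qed.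

Definition grid (n : nat) (t : R) : int := Num.floor (t * (2 ^+ n)).

Definition grid_point (n : nat) (z : int) : R := z%:~R / 2 ^+ n.

Lemma measurable_grid n v : measurable ((grid n : RR -> int) @^-1` [set v]).
Proof.
have -> : (grid n : RR -> int) @^-1` [set v] =
    [set` `[(v%:~R / 2 ^+ n : R), ((v + 1)%:~R / 2 ^+ n : R)[ ].
  apply/seteqP; split => t /=; rewrite in_itv/=.
    by move=> <-; rewrite ler_pdivrMr ?exprn_gt0// ltr_pdivlMr ?exprn_gt0// floor_itv.
  rewrite ler_pdivrMr ?exprn_gt0// ltr_pdivlMr ?exprn_gt0// => h.
  exact/floor_def.
exact: measurable_itv.
Qed.

Lemma grid_cvg (t : R) : grid_point n (grid n t) @[n --> \oo] --> t.
Proof.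
have bd n : t - (2^-1) ^+ n <= grid_point n (grid n t) <= t.
  have p2 : 0 < 2 ^+ n :> R by rewrite exprn_gt0.
  rewrite /grid_point /grid; have /andP[h1 h2] := floor_itv (t * 2 ^+ n).
  rewrite ler_pdivrMr// h1 andbT ler_pdivlMr// mulrBl -exprMn mulVf// expr1n lerBlDr.
  by rewrite intrD in h2; exact: ltW.
apply: (@squeeze_cvgr _ _ _ _ (fun n => t - (2^-1) ^+ n) (fun=> t)).
- by near=> n; exact: bd.
- rewrite -[X in _ --> X]subr0; apply: cvgB; first exact: cvg_cst.
  by apply: cvg_expr; rewrite ger0_norm ?invr_ge0// invf_lt1// ltr1n.
- exact: cvg_cst.
Unshelve. all: by end_near.
Qed.

Context (d : nat).
Local Notation X := 'rV[R]_d.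

Definition row_grid n (x : X) : 'rV[int]_d := \row_i grid n (x 0 i).
Definition row_grid_point n (z : 'rV[int]_d) : X := \row_i grid_point n (z 0 i).

Lemma measurable_row_grid n v : measurable (row_grid n @^-1` [set v]).
Proof.
have -> : row_grid n @^-1` [set v] =
    \bigcap_(i in [set: 'I_d]) ((fun x : X => x 0 i : RR) @^-1` ((grid n : RR -> int) @^-1` [set v 0 i])).
  apply/seteqP; split => x /=.
    by move=> <- i _ /=; rewrite mxE.
  by move=> h; apply/rowP => i; rewrite mxE; exact: h.
apply: fin_bigcap_measurable => // i _; rewrite -[X in measurable X]setTI.
by apply: measurable_row_coord => //; exact: measurable_grid.
Qed.

Lemma cvg_row_fun (Y : Type) (F : set_system Y) {FF : Filter F} (g : Y -> X) (x : X) :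
  (forall i, g y 0 i @[y --> F] --> x 0 i) -> g y @[y --> F] --> x.
Proof.
move=> h; apply/cvgrPdist_le => e e0.
have : \forall y \near F, forall i : 'I_d, `|x 0 i - g y 0 i| <= e.
  by apply: filter_forall => i; have /cvgrPdist_le := h i; apply.
apply: filterS => n hn; rewrite /Num.norm/= mx_normrE.
apply: bigmax_le => [|[i j] _]; first exact: ltW.
by rewrite !mxE ord1; have := hn j; rewrite ?mxE.
Qed.

Lemma row_grid_cvg (x : X) : row_grid_point n (row_grid n x) @[n --> \oo] --> x.
Proof.
by apply: cvg_row_fun => i; under eq_fun do rewrite !mxE; exact: grid_cvg.
Qed.

(** Rounding every coordinate down to a dyadic grid gives functions that factor through a countable
    type and converge pointwise to [f] by continuity. Open sets and product sigma-algebras need not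
    be compared. *)
Lemma continuous_measurable_Q (T : R) (f : R * X * X -> R) :
  {within [set w : R * X * X | 0 < w.1.1 < T], continuous f} ->
  measurable_fun (@Q R d T) (f : RR * X * X -> R).
Proof.
move=> cf.
pose k n (w : RR * X * X) := (grid n w.1.1, row_grid n w.1.2, row_grid n w.2).
pose p n (v : int * 'rV[int]_d * 'rV[int]_d) : R * X * X :=
  (grid_point n v.1.1, row_grid_point n v.1.2, row_grid_point n v.2).
apply: (@measurable_fun_cvg _ _ _ _ (fun n => (f \o p n) \o k n)).
- move=> n; apply: measurable_funTS; apply: measurable_countable_comp => -[[v1 v2] v3].
  have -> : k n @^-1` [set (v1, v2, v3)] =
    ((grid n : RR -> int) @^-1` [set v1] `*` row_grid n @^-1` [set v2]) `*` row_grid n @^-1` [set v3].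
    by apply/seteqP; split => [[[a b] c] /= [<- <- <-]//|[[a b] c] /= [[<- <-] <-]].
  apply: measurableX; last exact: measurable_row_grid.
  apply: measurableX; [exact: measurable_grid|exact: measurable_row_grid].
- move=> w wQ; have := (iffLR (subspace_continuousP _ _) cf) w wQ.
  have cp : p n (k n w) @[n --> \oo] --> (w : R * X * X).
    case: w {wQ} => [[a b] c].
    apply: (@cvg_pair _ _ _ _ (nbhs (a, b)) (nbhs c)); last exact: row_grid_cvg.
    by apply: (@cvg_pair _ _ _ _ (nbhs a) (nbhs b)); [exact: grid_cvg|exact: row_grid_cvg].
  move=> cw; apply: (@cvg_comp _ _ _ _ f _ (within [set w : R * X * X | 0 < w.1.1 < T] (nbhs (w : R * X * X)))) cw.
  move=> S; rewrite /within/= => hS.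
  (* A rounded point may leave the slab, but not in the long run, the slab being open. *)
  have oQ : nbhs (w : R * X * X) [set w : R * X * X | 0 < w.1.1 < T].
    apply: open_nbhs_nbhs; split => //.
    have -> : [set w : R * X * X | 0 < w.1.1 < T] = (fun w : R * X * X => w.1.1) @^-1` [set` `]0, T[].
      by apply/seteqP; split => q /=; rewrite in_itv.
    apply: open_comp; last exact: itv_open.
    move=> q _; apply: (@cvg_comp _ _ _ fst fst _ (nbhs q.1)); exact: cvg_fst.
  have [N _ hN] := cp _ (filterI hS oQ).
  by exists N => // n Nn; have [h1 h2] := hN n Nn; exact: h1.
Qed.

End continuous_measurable.

(** * Test functions and weak derivatives in Fourier coordinates *)

Section test_functions.
Context {R : realType} (d : nat) (T : R).
Local Notation X := 'rV[R]_d.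
Local Notation RR := (measurableTypeR R).
Implicit Types (k l : d.-tuple nat) (x y : X).

(** The index of the basis function that the derivative in direction [i] produces; the accompanying
    factor is [row_rate k i]. *)
Definition row_swap k (i : 'I_d) : d.-tuple nat :=
  [tuple if j == i then trig_swap (tnth k j) else tnth k j | j < d].

Definition row_rate k (i : 'I_d) : R := trig_sgn (tnth k i) * freq (tnth k i).

Lemma tnth_row_swap k i j :
  tnth (row_swap k i) j = if j == i then trig_swap (tnth k j) else tnth k j.
Proof. by rewrite tnth_mktuple. Qed.

Lemma row_swapK i : involutive (row_swap ^~ i).
Proof.
move=> k; apply: eq_from_tnth => j; rewrite !tnth_row_swap.
by case: eqP => // _; rewrite trig_swapK.
Qed.

Lemma row_rate_swap k i : row_rate (row_swap k i) i ^+ 2 = row_rate k i ^+ 2.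
Proof.
rewrite /row_rate tnth_row_swap eqxx freq_swap !exprMn; congr (_ * _).
by rewrite /trig_sgn; do 2!case: ifP => _; rewrite ?expr1n ?sqrrN ?expr1n.
Qed.

(** Two derivatives in the same direction return to the initial function, with minus the squared
    rate as eigenvalue. *)
Lemma row_rate_mul_swap k i : row_rate k i * row_rate (row_swap k i) i = - row_rate k i ^+ 2.
Proof.
rewrite /row_rate tnth_row_swap eqxx freq_swap.
have -> : @trig_sgn R (trig_swap (tnth k i)) = - trig_sgn (tnth k i); last by ring.
by rewrite /trig_sgn odd_trig_swap; case: odd => //=; rewrite opprK.
Qed.

Lemma is_derive_row_basis k i x (t : R) :
  is_derive t (1 : R) (fun s => row_basis k (x + s *: delta_mx 0 i))
    (row_rate k i * row_basis (row_swap k i) (x + t *: delta_mx 0 i)).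
Proof.
have xE j s : (x + s *: delta_mx 0 i) 0 j = x 0 j + s * (j == i)%:R.
  by rewrite !mxE eqxx /=.
pose r := \prod_(j < d | j != i) trig_basis (tnth k j) (x 0 j).
have -> : (fun s => row_basis k (x + s *: delta_mx 0 i)) =
    (fun s => trig_basis (tnth k i) (s + x 0 i) * r).
  apply/funext => s; rewrite /row_basis (bigD1 i)//= xE eqxx mulr1 [x 0 i + s]addrC; congr (_ * _).
  by apply: eq_bigr => j ji; rewrite xE (negPf ji) mulr0 addr0.
have -> : row_basis (row_swap k i) (x + t *: delta_mx 0 i) =
    trig_basis (trig_swap (tnth k i)) (t + x 0 i) * r.
  rewrite /row_basis (bigD1 i)//= xE eqxx mulr1 [x 0 i + t]addrC tnth_row_swap eqxx; congr (_ * _).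
  by apply: eq_bigr => j ji; rewrite xE tnth_row_swap (negPf ji) mulr0 addr0.
have h1 : is_derive t (1 : R) (fun s => s + x 0 i) 1.
  by apply: is_derive_eq; rewrite addr0.
have h2 := is_derive_trig (tnth k i) (t + x 0 i).
have h3 := @is_derive1_comp R (trig_basis (tnth k i)) (fun s => s + x 0 i) _ _ _ h2 h1.
have h4 : is_derive t (1 : R) (fun=> r) 0 by exact: is_derive_cst.
have h5 := is_deriveM h3 h4.
apply: (is_derive_eq h5).
by rewrite /GRing.scale/= mulr0 add0r mulr1 mulrC !mulrA.
Qed.

(** Along a coordinate line the difference quotients are those of a function of one real
    variable. *)
Lemma derive_lineE (f : X -> R) x i (D : R -> R) :
  (forall t, is_derive t (1 : R) (fun s => f (x + s *: delta_mx 0 i)) (D t)) ->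
  derivable f x (delta_mx 0 i) /\ 'D_(delta_mx 0 i) f x = D 0.
Proof.
move=> h.
have E : (fun s : R => s^-1 *: ((f \o shift x) (s *: delta_mx 0 i) - f x)) =
    (fun s : R => s^-1 *: (((fun s => f (x + s *: delta_mx 0 i)) \o shift 0) (s *: 1) -
       (fun s => f (x + s *: delta_mx 0 i)) 0)).
  by apply/funext => s; rewrite /= addr0 scale0r addr0 [_ + x]addrC [s *: (1 : R)]mulr1.
have [h1 h2] := h 0.
split; first by rewrite /derivable E; exact: h1.
by rewrite -h2 /derive E.
Qed.

Lemma continuous_coord i : continuous (fun x : X => x 0 i).
Proof. exact: coord_continuous. Qed.

Lemma continuous_row_basis k : continuous (row_basis k : X -> R).
Proof.
rewrite (_ : row_basis k = fun x : X => \prod_(i < d) trig_basis (tnth k i) (x 0 i))//.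
apply: (@continuous_big R 'I_d *%R 1 predT) => [z|i _ x]; first exact: mul_continuous.
apply: (@cvg_comp _ _ _ (fun x : X => x 0 i) (trig_basis (tnth k i)) _ (nbhs (x 0 i))).
  exact: continuous_coord.
exact: continuous_trig.
Qed.

Lemma periodic_row_basis k : torus_periodic (row_basis k : X -> R).
Proof.
move=> x i; apply: eq_bigr => j _; rewrite !mxE eqxx/=.
by case: eqP => _; rewrite ?addr0// trig_periodic.
Qed.

(** Every use of weak derivatives on the cylinder tests against such a product: the mode extracts
    one Fourier coefficient and the cutoff tests it in time. *)
Definition tensor_test (th : R -> R) k l (t : R) x y : R :=
  th t * (row_basis k x * row_basis l y).

Variable th : R -> R.
Hypothesis tth : time_test T th.

Lemma Dt_tensor_test k l t x y :
  derivable (fun s => tensor_test th k l s x y) t 1 /\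
  Dt (tensor_test th k l) t x y = derive1 th t * (row_basis k x * row_basis l y).
Proof.
have h1 : is_derive t (1 : R) th (derive1 th t).
  by rewrite derive1E; apply/derivableP; exact: (time_test_derivable tth).
have h2 : is_derive t (1 : R) (fun=> row_basis k x * row_basis l y) 0 by exact: is_derive_cst.
have h : is_derive t (1 : R) (fun s => tensor_test th k l s x y)
    (derive1 th t * (row_basis k x * row_basis l y)).
  apply: (is_derive_eq (is_deriveM h1 h2)).
  by rewrite /GRing.scale/= mulr0 add0r mulrC.
by split; [have [] := h|rewrite /Dt derive1E; exact: derive_val].
Qed.

Lemma grad_scale_row_basis (c : R) k x : has_grad (fun z => c * row_basis k z) x /\
  forall i, grad (fun z => c * row_basis k z) x 0 i = row_rate k i * (c * row_basis (row_swap k i) x).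
Proof.
have h i := @derive_lineE (fun z => c * row_basis k z) x i
  (fun s => c * (row_rate k i * row_basis (row_swap k i) (x + s *: delta_mx 0 i)))
  (fun s => is_deriveZ c (is_derive_row_basis k i x s)).
split=> [i|i]; first by have [] := h i.
by rewrite mxE; have [_ ->] := h i; rewrite scale0r addr0; ring.
Qed.

Lemma Dx_tensor_test k l t x y : has_grad (fun z => tensor_test th k l t z y) x /\
  forall i, Dx (tensor_test th k l) t x y 0 i =
    row_rate k i * tensor_test th (row_swap k i) l t x y.
Proof.
rewrite /Dx (_ : (fun z => tensor_test th k l t z y) = (fun z => (th t * row_basis l y) * row_basis k z)).
  have [h1 h2] := grad_scale_row_basis (th t * row_basis l y) k x.
  by split=> // i; rewrite h2 /tensor_test; ring.
by apply/funext => z; rewrite /tensor_test; ring.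
Qed.

Lemma Dy_tensor_test k l t x y : has_grad (tensor_test th k l t x) y /\
  forall i, Dy (tensor_test th k l) t x y 0 i =
    row_rate l i * tensor_test th k (row_swap l i) t x y.
Proof.
rewrite /Dy (_ : tensor_test th k l t x = (fun z => (th t * row_basis k x) * row_basis l z)).
  have [h1 h2] := grad_scale_row_basis (th t * row_basis k x) l y.
  by split=> // i; rewrite h2 /tensor_test; ring.
by apply/funext => z; rewrite /tensor_test; ring.
Qed.

Lemma continuous_tensor (g : R -> R) k l : continuous g ->
  continuous (fun w : R * X * X => g w.1.1 * (row_basis k w.1.2 * row_basis l w.2)).
Proof.
move=> cg w; apply: cvgM; last apply: cvgM.
- apply: (@cvg_comp _ _ _ (fun w : R * X * X => w.1.1) g _ (nbhs w.1.1)); last exact: cg.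
  by apply: (@cvg_comp _ _ _ fst fst _ (nbhs w.1)); exact: cvg_fst.
- apply: (@cvg_comp _ _ _ (fun w : R * X * X => w.1.2) (row_basis k) _ (nbhs w.1.2)); last exact: continuous_row_basis.
  by apply: (@cvg_comp _ _ _ fst snd _ (nbhs w.1)); [exact: cvg_fst|exact: cvg_snd].
- apply: (@cvg_comp _ _ _ (fun w : R * X * X => w.2) (row_basis l) _ (nbhs w.2)); last exact: continuous_row_basis.
  exact: cvg_snd.
Qed.

Lemma test_Q_tensor k l : test_Q T (tensor_test th k l).
Proof.
have cth : continuous th.
  move=> t; apply: differentiable_continuous; apply/derivable1_diffP; exact: (time_test_derivable tth).
split.
- by move=> t y x i; rewrite /tensor_test periodic_row_basis.
- by move=> t x y i; rewrite /tensor_test periodic_row_basis.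
- have [s [s' [s0 s'T h]]] := time_test_supp tth; exists s, s'; split=> // t x y nt.
  by rewrite /tensor_test h// mul0r.
- by move=> t x y; have [] := Dt_tensor_test k l t x y.
- by move=> t x y; have [] := Dx_tensor_test k l t x y.
- by move=> t x y; have [] := Dy_tensor_test k l t x y.
- have -> : (fun w : R * X * X => Dt (tensor_test th k l) w.1.1 w.1.2 w.2) =
    (fun w => derive1 th w.1.1 * (row_basis k w.1.2 * row_basis l w.2)).
    by apply/funext => w; have [_ ->] := Dt_tensor_test k l w.1.1 w.1.2 w.2.
  apply: continuous_tensor; exact: (time_test_continuous tth).
- move=> w; apply: cvg_row_fun => i.
  have -> : (fun w : R * X * X => Dx (tensor_test th k l) w.1.1 w.1.2 w.2 0 i) =
      (fun w => row_rate k i * (th w.1.1 * (row_basis (row_swap k i) w.1.2 * row_basis l w.2))).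
    by apply/funext => w'; have [_ ->] := Dx_tensor_test k l w'.1.1 w'.1.2 w'.2.
  have [_ ->] := Dx_tensor_test k l w.1.1 w.1.2 w.2.
  by apply: cvgM; [exact: cvg_cst|exact: continuous_tensor].
- move=> w; apply: cvg_row_fun => i.
  have -> : (fun w : R * X * X => Dy (tensor_test th k l) w.1.1 w.1.2 w.2 0 i) =
      (fun w => row_rate l i * (th w.1.1 * (row_basis k w.1.2 * row_basis (row_swap l i) w.2))).
    by apply/funext => w'; have [_ ->] := Dy_tensor_test k l w'.1.1 w'.1.2 w'.2.
  have [_ ->] := Dy_tensor_test k l w.1.1 w.1.2 w.2.
  by apply: cvgM; [exact: cvg_cst|exact: continuous_tensor].
Qed.

End test_functions.

(** * Fourier coefficients of Sobolev functions *)

Section coefficients.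
Context {R : realType} (d : nat) (T : R).
Hypothesis T0 : 0 < T.
Local Notation RR := (measurableTypeR R).
Local Notation X := 'rV[R]_d.
Local Notation U := (uniform_prob T0).
Local Notation TT := (torus2 R d).
Local Notation PP := (cylinder d T0).
Local Notation Q := (@Q R d T).
Local Notation J := (d.-tuple nat * d.-tuple nat)%type.
Local Notation I := ('I_d + 'I_d)%type.
Implicit Types (j : J) (i : I) (F : RR * (X * X) -> R) (f g : R -> X -> X -> R).

Definition mode j (q : X * X) : R := row_basis j.1 q.1 * row_basis j.2 q.2.

(** Directions form a sum type, [inl] for the first spatial slot and [inr] for the second, so that
    both gradients are handled together. *)
Definition mode_swap j i : J :=
  match i with inl i => (row_swap j.1 i, j.2) | inr i => (j.1, row_swap j.2 i) end.

Definition mode_rate j i : R :=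
  match i with inl i => row_rate j.1 i | inr i => row_rate j.2 i end.

Definition mode_eigen j : R := \sum_i mode_rate j i ^+ 2.

Lemma parseval_mode : parseval TT mode.
Proof. exact: parseval_TT. Qed.

Lemma mode_swapK i : involutive (mode_swap ^~ i).
Proof. by case: i => i [k l] /=; rewrite row_swapK. Qed.

Lemma mode_rate_swap j i : mode_rate (mode_swap j i) i ^+ 2 = mode_rate j i ^+ 2.
Proof. by case: i => i /=; rewrite row_rate_swap. Qed.

Lemma mode_rate_mul_swap j i :
  mode_rate j i * mode_rate (mode_swap j i) i = - mode_rate j i ^+ 2.
Proof. by case: i => i /=; rewrite row_rate_mul_swap. Qed.

Lemma measurable_mode j : measurable_fun setT (mode j).
Proof. by have [h _ _] := parseval_mode; exact: h. Qed.

Lemma mode_bounded j : exists2 B, 0 <= B & forall q, `|mode j q| <= B.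
Proof.
have [_ h _] := parseval_mode; have [B hB] := h j; exists B => //.
by rewrite (le_trans _ (hB (0, 0))).
Qed.

Lemma sqint_mode j : sqint TT (mode j).
Proof.
have [B _ hB] := mode_bounded j.
by apply: (@sqint_bounded _ _ _ TT _ B) => //; exact: measurable_mode.
Qed.

Lemma L2_slab f : L2_Q T f -> sqint PP (slab T f).
Proof.
move=> [mf fi]; split; first exact: measurable_slab.
have T0e : (0 < T%:E)%E by rewrite lte_fin.
rewrite (ltey_eq _) in fi *; move: fi.
have := @ge0_integral_slab R d T T0 (fun t x y => f t x y ^+ 2).
rewrite /= => ->//; last 2 first.
- exact: measurable_funX.
- by move=> q _; exact: sqr_ge0.
have -> : (\int[PP]_w (slab T (fun t x y => f t x y ^+ 2) w)%:E =
    \int[PP]_w (slab T f w ^+ 2)%:E)%E.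
  by apply: eq_integral => w _; rewrite /slab; case: ifP => // _; rewrite expr0n.
set A := (\int[PP]_w (slab T f w ^+ 2)%:E)%E.
have A0 : (0 <= A)%E by apply: integral_ge0 => w _; rewrite lee_fin sqr_ge0.
case: A A0 => [r|//|//] _; first by rewrite ltry.
by rewrite gt0_muley.
Qed.

Lemma measurable_slice F t : measurable_fun setT F -> measurable_fun setT (fun z => F (t, z)).
Proof. by move=> mF; apply: (measurableT_comp mF); exact: measurable_fun_pair. Qed.

Lemma sqint_slice F : sqint PP F -> {ae U, forall t, sqint TT (fun z => F (t, z))}.
Proof.
move=> [mF Foo].
have mF2 : measurable_fun setT (fun w => (F w ^+ 2)%:E) by exact: meas_sq.
have F20 w : (0 <= (F w ^+ 2)%:E)%E by rewrite lee_fin sqr_ge0.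
have mI : measurable_fun setT (fun t => \int[TT]_z (F (t, z) ^+ 2)%:E)%E.
  exact: (@measurable_fun_fubini_tonelli_F _ _ _ _ _ TT _ mF2 F20).
have ii : U.-integrable setT (fun t => \int[TT]_z (F (t, z) ^+ 2)%:E)%E.
  apply/integrableP; split => //; rewrite ge0_cylinder// in Foo.
  by under eq_integral do rewrite gee0_abs ?integral_ge0//.
have := integrable_ae measurableT ii; apply: ae_imp => t /(_ Logic.I) ft.
split; first exact: measurable_slice.
by rewrite ltey_eq ft.
Qed.

Definition coef F j (t : R) : R := ip TT (fun z => F (t, z)) (mode j).

Lemma measurable_coef F j : measurable_fun setT F -> measurable_fun setT (coef F j : RR -> R).
Proof.
move=> mF; apply: (@measurable_Rintegral _ _ _ _ _ TT (fun w => F w * mode j w.2)).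
apply: measurable_funM => //; exact: (measurableT_comp (measurable_mode j) measurable_snd).
Qed.

Lemma sqint_coef F j : sqint PP F -> sqint U (coef F j : RR -> R).
Proof.
move=> [mF Foo]; have [B B0 hB] := mode_bounded j.
have mm : measurable_fun setT (fun w : RR * (X * X) => F w * mode j w.2).
  by apply: measurable_funM => //; exact: (measurableT_comp (measurable_mode j) measurable_snd).
split; first exact: measurable_coef.
have s : sqint PP (fun w => F w * mode j w.2).
  apply: (@sqint_dom _ _ _ PP _ (fun w => B * F w)) => //; first by apply: (@sqintZ _ _ _ PP).
  by move=> w; rewrite normrM [X in _ <= X]normrM (ger0_norm B0) mulrC ler_wpM2r.
have [_ s2] := s; apply: le_lt_trans s2; rewrite ge0_cylinder; last 2 first.
- exact: meas_sq.
- by move=> w; rewrite lee_fin sqr_ge0.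
apply: ge0_le_integral => //.
- by move=> t _; rewrite lee_fin sqr_ge0.
- by apply: meas_sq; exact: measurable_coef.
- apply: (@measurable_fun_fubini_tonelli_F _ _ _ _ _ TT (fun w => ((F w * mode j w.2) ^+ 2)%:E)) => //.
    exact: meas_sq.
  by move=> w; rewrite lee_fin sqr_ge0.
- by move=> t _; apply: jensen_sq; exact: (measurable_slice t mm).
Qed.

Lemma integrable_coef F j : sqint PP F -> U.-integrable setT (EFin \o (coef F j : RR -> R)).
Proof.
move=> /(sqint_coef j) h.
have oneq : sqint U (fun=> 1) by apply: (@sqint_bounded _ _ _ U _ 1) => // t; rewrite normr1.
by have := sqint_mul h oneq; apply: eq_integrable => // t _; rewrite /= mulr1.
Qed.

(** Composition with this retraction turns data meaningful on [[0, T]] into functions that are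
    bounded and continuous on the whole line. *)
Definition clampT (t : R) : R := Num.min (Num.max t 0) T.

Lemma clampT_itv t : 0 <= clampT t <= T.
Proof. by rewrite /clampT le_min le_max lexx orbT (ltW T0)/= ge_min lexx orbT. Qed.

Lemma clampTE t : 0 <= t <= T -> clampT t = t.
Proof. by move=> /andP[t0 tT]; rewrite /clampT max_l// min_l. Qed.

Lemma continuous_clampT : continuous clampT.
Proof.
move=> t; rewrite /clampT.
apply: (@continuous_min R R (fun t => Num.max t 0) (fun=> T) t); last exact: cst_continuous.
apply: (@continuous_max R R id (fun=> 0) t); last exact: cst_continuous.
exact: cvg_id.
Qed.

Lemma clampT_bounded (h : R -> R) : continuous (h \o clampT) ->
  exists2 B, 0 <= B & forall t, `|h (clampT t)| <= B.
Proof.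
move=> ch; have cn : {within `[0, T], continuous (fun t => `|h (clampT t)|)}.
  apply: continuous_subspaceT => t.
  by apply: (@cvg_comp _ _ _ (h \o clampT) Num.norm _ (nbhs (h (clampT t)))); [exact: ch|exact: norm_continuous].
have [c _ hc] := EVT_max (ltW T0) cn.
exists `|h (clampT c)| => // t; rewrite -(clampTE (clampT_itv t)); apply: hc.
by rewrite in_itv/= clampT_itv.
Qed.

(** Fubini with the space integral inside. The clamped [h] is bounded, which makes the integrand
    integrable, and it agrees with [h] on the slab. *)
Lemma int_Q_mode f (h : R -> R) j : L2_Q T f -> continuous h ->
  int_Q T (fun t x y => f t x y * (h t * (row_basis j.1 x * row_basis j.2 y))) =
  T * \int[U]_t (coef (slab T f) j t * h t).
Proof.
move=> fL ch; have sf := L2_slab fL; have [mf _] := fL; have [msf _] := sf.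
have chc : continuous (h \o clampT).
  move=> t; apply: (@cvg_comp _ _ _ clampT h _ (nbhs (clampT t))); [exact: continuous_clampT|exact: ch].
have [B B0 hB] := clampT_bounded chc.
have [C C0 hC] := mode_bounded j.
have mh : measurable_fun setT (h : RR -> R) by exact: continuous_measurable_fun.
have mhc : measurable_fun setT (h \o clampT : RR -> R) by exact: continuous_measurable_fun.
pose H (w : RR * (X * X)) := h (clampT w.1) * mode j w.2.
have mH : measurable_fun setT H.
  apply: measurable_funM; first exact: (measurableT_comp mhc measurable_fst).
  exact: (measurableT_comp (measurable_mode j) measurable_snd).
have sH : sqint PP H.
  by apply: (@sqint_bounded _ _ _ PP _ (B * C)) => // w; rewrite normrM ler_pM.
have E : slab T (fun t x y => f t x y * (h t * (row_basis j.1 x * row_basis j.2 y))) =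
    (fun w => slab T f w * H w).
  apply/funext => w; rewrite /slab /H /mode; case: ifP => [/andP[t0 tT]|_]; last by rewrite mul0r.
  by rewrite clampTE// !ltW.
have iH := sqint_mul sf sH.
rewrite int_Q_slab; last 2 first.
- apply: measurable_funM => //; apply: measurable_funTS; apply: measurable_funM.
    apply: (measurableT_comp mh); exact: (measurableT_comp measurable_fst measurable_fst).
  apply: measurable_funM.
    apply: (measurableT_comp (measurable_row_basis j.1)).
    exact: (measurableT_comp measurable_snd measurable_fst).
  exact: (measurableT_comp (measurable_row_basis j.2) measurable_snd).
- by rewrite E.
congr (_ * _); rewrite E Rintegral_prod//; apply: ae_eq_Rintegral.
- by apply: (@measurable_Rintegral _ _ _ _ _ TT (fun w => slab T f w * H w)); apply: measurable_funM.
- by apply: measurable_funM => //; exact: measurable_coef.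
- have := sqint_slice sf.
  apply: (@filterS2 _ _ (ae_filter_ringOfSetsType U)) (uniform_itv T0) => t t01 st.
  rewrite mulrC /coef /ip -RintegralZl//; last exact: (sqint_mul st (sqint_mode j)).
  apply: eq_Rintegral => z _; rewrite /H /= clampTE; first by ring.
  by case/andP: t01 => *; rewrite !ltW.
Qed.

Lemma ae_forall_count (K : countType) (P : K -> RR -> Prop) :
  (forall k, {ae U, forall t, P k t}) -> {ae U, forall t, forall k, P k t}.
Proof.
move=> h.
have : {ae U, forall t, forall n, if unpickle n is Some k then P k t else True}.
  apply/ae_foralln => n; case: unpickle => [k|]; first exact: h.
  exact: (@filterE _ _ (ae_filter_ringOfSetsType U)).
by apply: ae_imp => t hn k; have := hn (pickle k); rewrite pickleK.
Qed.

(** The weak derivative in direction [i], read on Fourier coefficients: the derivative of the mode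
    has become a rate and a swapped index. *)
Definition weak_dir f g i := forall th j, time_test T th ->
  mode_rate j i * \int[U]_t (coef (slab T f) (mode_swap j i) t * th t) =
  - \int[U]_t (coef (slab T g) j t * th t).

Lemma time_test_cont (th : R -> R) : time_test T th -> continuous th.
Proof.
move=> tth t; apply: differentiable_continuous; apply/derivable1_diffP.
exact: (time_test_derivable tth).
Qed.

Lemma time_test_bounded (th : R -> R) : time_test T th -> exists2 B, 0 <= B & forall t, `|th t| <= B.
Proof.
move=> tth; have cth := time_test_cont tth; have [s [s' [s0 s'T h]]] := time_test_supp tth.
have chc : continuous (th \o clampT).
  move=> t; apply: (@cvg_comp _ _ _ clampT th _ (nbhs (clampT t))); [exact: continuous_clampT|exact: cth].
have [B B0 hB] := clampT_bounded chc; exists B => // t.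
have [/andP[st ts']|nt] := boolP (s <= t <= s'); last by rewrite h// normr0.
by rewrite -(@clampTE t) ?hB// (ltW (lt_le_trans s0 st)) (ltW (le_lt_trans ts' s'T)).
Qed.

Lemma integrable_time_test (c : RR -> R) (th : R -> R) : time_test T th ->
  U.-integrable setT (EFin \o c) -> U.-integrable setT (EFin \o (fun t : RR => c t * th t)).
Proof.
move=> tth ci; have [B B0 hB] := time_test_bounded tth.
have mc : measurable_fun setT c by have := measurable_int _ ci; move/measurable_EFinP.
apply: (@integrable_dom _ _ _ U (fun t : RR => c t * th t) (fun t : RR => B * `|c t|)).
- apply: measurable_funM => //; apply: continuous_measurable_fun; exact: time_test_cont.
- by move=> t; rewrite normrM mulrC ler_wpM2r.
- by apply: integrableZlr; exact: integrable_norm.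
Qed.

Lemma weak_Dx_dir f (Gv : R -> X -> X -> X) (i : 'I_d) : L2_Q T f -> L2_Q T (fun t x y => Gv t x y 0 i) ->
  weak_Dx T f Gv -> weak_dir f (fun t x y => Gv t x y 0 i) (inl i).
Proof.
move=> fL gL w th j tth; have cth := time_test_cont tth.
have := w _ i (test_Q_tensor tth j.1 j.2).
rewrite (int_Q_mode j gL cth).
rewrite (_ : (fun t x y => f t x y * Dx _ t x y 0 i) = (fun t x y => f t x y *
  ((row_rate j.1 i * th t) * (row_basis (mode_swap j (inl i)).1 x * row_basis (mode_swap j (inl i)).2 y)))); last first.
  apply/funext => t; apply/funext => x; apply/funext => y.
  by have [_ ->] := Dx_tensor_test th j.1 j.2 t x y; congr (_ * _); rewrite /tensor_test mulrA.
rewrite (@int_Q_mode _ (fun t => row_rate j.1 i * th t) (mode_swap j (inl i)) fL); last first.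
  by move=> t; apply: cvgM; [exact: cvg_cst|exact: cth].
rewrite -mulrN => /(mulfI (lt0r_neq0 T0)) <-.
rewrite -RintegralZl//; last first.
  by apply: integrable_time_test => //; apply: integrable_coef; exact: L2_slab.
by apply: eq_Rintegral => t _ /=; ring.
Qed.

Lemma weak_Dy_dir f (Gv : R -> X -> X -> X) (i : 'I_d) : L2_Q T f -> L2_Q T (fun t x y => Gv t x y 0 i) ->
  weak_Dy T f Gv -> weak_dir f (fun t x y => Gv t x y 0 i) (inr i).
Proof.
move=> fL gL w th j tth; have cth := time_test_cont tth.
have := w _ i (test_Q_tensor tth j.1 j.2).
rewrite (int_Q_mode j gL cth).
rewrite (_ : (fun t x y => f t x y * Dy _ t x y 0 i) = (fun t x y => f t x y *
  ((row_rate j.2 i * th t) * (row_basis (mode_swap j (inr i)).1 x * row_basis (mode_swap j (inr i)).2 y)))); last first.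
  apply/funext => t; apply/funext => x; apply/funext => y.
  by have [_ ->] := Dy_tensor_test th j.1 j.2 t x y; congr (_ * _); rewrite /tensor_test mulrA.
rewrite (@int_Q_mode _ (fun t => row_rate j.2 i * th t) (mode_swap j (inr i)) fL); last first.
  by move=> t; apply: cvgM; [exact: cvg_cst|exact: cth].
rewrite -mulrN => /(mulfI (lt0r_neq0 T0)) <-.
rewrite -RintegralZl//; last first.
  by apply: integrable_time_test => //; apply: integrable_coef; exact: L2_slab.
by apply: eq_Rintegral => t _ /=; ring.
Qed.

(** [weak_null] in time for each mode; the modes are countably many and so share one null set. *)
Lemma weak_dir_coef f g i : L2_Q T f -> L2_Q T g -> weak_dir f g i ->
  {ae U, forall t, forall j, coef (slab T g) j t = - (mode_rate j i * coef (slab T f) (mode_swap j i) t)}.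
Proof.
move=> /L2_slab fL /L2_slab gL w; apply: ae_forall_count => j.
pose c (t : RR) := coef (slab T g) j t + mode_rate j i * coef (slab T f) (mode_swap j i) t.
have i1 := integrable_coef j gL.
have i2 := integrableZlr (mode_rate j i) (integrable_coef (mode_swap j i) fL).
have : {ae U, forall t, c t = 0}.
  apply: (@weak_null _ _ T0 c); first exact: integrableDr.
  move=> th tth; transitivity (\int[U]_t (coef (slab T g) j t * th t +
      mode_rate j i * (coef (slab T f) (mode_swap j i) t * th t))).
    by apply: eq_Rintegral => t _; rewrite /c; ring.
  have k1 := integrable_time_test tth i1.
  have k2 := integrable_time_test tth (integrable_coef (mode_swap j i) fL).
  by rewrite RintegralD ?RintegralZl//; [rewrite w// subrr|exact: integrableZlr].
by apply: ae_imp => t /eqP; rewrite addr_eq0 => /eqP.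
Qed.

Variables (V : R -> X -> X -> R) (S : sobolev T V).

Definition sob_dir i : R -> X -> X -> R :=
  match i with inl i => fun t x y => sob_x S t x y 0 i | inr i => fun t x y => sob_y S t x y 0 i end.

Definition sob_dir2 i : R -> X -> X -> R :=
  match i with inl i => fun t x y => sob_xx S t x y i i | inr i => fun t x y => sob_yy S t x y i i end.

Lemma sob_dir_L2 i : L2_Q T (sob_dir i).
Proof. by case: i => i; [exact: (sob_x_L2 S)|exact: (sob_y_L2 S)]. Qed.

Lemma sob_dir2_L2 i : L2_Q T (sob_dir2 i).
Proof. by case: i => i; [exact: (sob_xx_L2 S)|exact: (sob_yy_L2 S)]. Qed.

Lemma sob_dir_weak i : weak_dir V (sob_dir i) i.
Proof.
case: i => i.
- apply: weak_Dx_dir; [exact: (sob_L2 S)|exact: (sob_x_L2 S)|exact: (sob_x_weak S)].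
- apply: weak_Dy_dir; [exact: (sob_L2 S)|exact: (sob_y_L2 S)|exact: (sob_y_weak S)].
Qed.

Lemma sob_dir2_weak i : weak_dir (sob_dir i) (sob_dir2 i) i.
Proof.
case: i => i.
- have E : (fun t x y => sob_xx S t x y i i) = (fun t x y => row i (sob_xx S t x y) 0 i).
    by apply/funext => t; apply/funext => x; apply/funext => y; rewrite mxE.
  rewrite /sob_dir /sob_dir2 E; apply: weak_Dx_dir; [exact: (sob_x_L2 S)| |exact: (sob_xx_weak S i)].
  by rewrite -E; exact: (sob_xx_L2 S).
- have E : (fun t x y => sob_yy S t x y i i) = (fun t x y => row i (sob_yy S t x y) 0 i).
    by apply/funext => t; apply/funext => x; apply/funext => y; rewrite mxE.
  rewrite /sob_dir /sob_dir2 E; apply: weak_Dy_dir; [exact: (sob_y_L2 S)| |exact: (sob_yy_weak S i)].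
  by rewrite -E; exact: (sob_yy_L2 S).
Qed.

Definition slice t (z : X * X) : R := V (clampT t) z.1 z.2.

Lemma sqint_Vslice t : sqint TT (slice t).
Proof. by have [m f] := sob_slice_L2 S (clampT_itv t). Qed.

(** The continuous representative of the coefficient, defined at every time through the clamp;
    [energy_ineq] needs its value at [T], its continuity and its boundedness. *)
Definition vcoef j (t : R) : R := ip TT (slice t) (mode j).

Lemma vcoefE j t : 0 < t < T -> vcoef j t = coef (slab T V) j t.
Proof.
move=> t01; apply: eq_Rintegral => z _; rewrite /slice slabE// clampTE//.
by case/andP: t01 => *; rewrite !ltW.
Qed.

Lemma ip_sq_le (f g : X * X -> R) B : sqint TT f -> measurable_fun setT g -> 0 <= B ->
  (forall z, `|g z| <= B) -> ((ip TT f g ^+ 2)%:E <= (B ^+ 2)%:E * \int[TT]_z (f z ^+ 2)%:E)%E.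
Proof.
move=> [mf f2] mg B0 gB; have mfg : measurable_fun setT (fun z => f z * g z) by exact: measurable_funM.
apply: (le_trans (@jensen_sq _ _ _ TT _ mfg)).
rewrite -ge0_integralZl//; last 3 first.
- exact: meas_sq.
- by move=> z _; rewrite lee_fin sqr_ge0.
- by rewrite lee_fin sqr_ge0.
apply: ge0_le_integral => //.
- by move=> z _; rewrite lee_fin sqr_ge0.
- exact: meas_sq.
- by apply: measurable_funeM; exact: meas_sq.
- move=> z _; rewrite -EFinM lee_fin exprMn mulrC ler_wpM2r ?sqr_ge0//.
  by rewrite -[g z ^+ 2]real_normK ?num_real// lerXn2r ?nnegrE.
Qed.

(** [V] is continuous from [[0, T]] to [L^2], and pairing with a bounded mode is continuous on
    [L^2]. *)
Lemma continuous_vcoef j : continuous (vcoef j).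
Proof.
have [B B0 hB] := mode_bounded j.
have cw t : 0 <= t <= T -> vcoef j s @[s --> within [set s | 0 <= s <= T] (nbhs t)] --> vcoef j t.
  move=> t01; apply/cvgrPdist_le => e e0.
  (* The pairing costs a factor [B ^+ 2]; the added 1 guards against [B = 0]. *)
  have e2 : 0 < e ^+ 2 / (B ^+ 2 + 1) by rewrite divr_gt0 ?exprn_gt0// ltr_wpDl ?sqr_ge0.
  have hc := sob_slice_cont S t01.
  have Ie : nbhs (0%E : \bar R) [set x : \bar R | (x < (e ^+ 2 / (B ^+ 2 + 1))%:E)%E].
    by apply: open_nbhs_nbhs; split; [exact: open_ereal_lt_ereal|rewrite /= lte_fin].
  have Hn : nbhs t [set s | 0 <= s <= T ->
    (\int[leb_TT R d]_q ((V s q.1 q.2 - V t q.1 q.2) ^+ 2)%:E < (e ^+ 2 / (B ^+ 2 + 1))%:E)%E] := hc _ Ie.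
  change (nbhs t [set s | 0 <= s <= T -> `|vcoef j t - vcoef j s| <= e]).
  apply: filterS Hn => s hs s01; have {}hs := hs s01.
  have E : vcoef j t - vcoef j s = - ip TT (fun z => slice s z - slice t z) (mode j).
    by rewrite ipBl ?opprB//; [exact: sqint_Vslice|exact: sqint_Vslice|exact: sqint_mode].
  rewrite E normrN.
  have hi := @ip_sq_le _ _ B (sqintB (sqint_Vslice s) (sqint_Vslice t)) (measurable_mode j) B0 hB.
  have : ((ip TT (fun z => slice s z - slice t z) (mode j) ^+ 2)%:E <= (e ^+ 2)%:E)%E.
    apply: (le_trans hi); rewrite /slice !clampTE//.
    apply: (@le_trans _ _ ((B ^+ 2)%:E * (e ^+ 2 / (B ^+ 2 + 1))%:E)%E).
      by apply: lee_wpmul2l; [rewrite lee_fin sqr_ge0|exact: ltW hs].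
    rewrite -EFinM lee_fin mulrCA ger_pMr ?exprn_gt0//.
    by rewrite ler_pdivrMr ?mul1r ?lerDl// ltr_wpDl ?sqr_ge0.
  rewrite lee_fin -[X in X <= _]real_normK ?num_real// => h2.
  by rewrite -(@ler_pXn2r _ 2) ?nnegrE// ltW.
move=> t; rewrite (_ : vcoef j = vcoef j \o clampT); last first.
  by apply/funext => s /=; rewrite /vcoef /slice (clampTE (clampT_itv s)).
apply: (@cvg_comp _ _ _ clampT (vcoef j) _ (within [set s | 0 <= s <= T] (nbhs (clampT t)))).
  move=> A hA.
  have hB' : nbhs t (clampT @^-1` [set s | 0 <= s <= T -> A s]) := @continuous_clampT t _ hA.
  change (nbhs t (clampT @^-1` A)).
  by apply: filterS hB' => s; apply; exact: clampT_itv.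
exact: cw (clampT_itv t).
Qed.

Lemma vcoef_bounded j : exists B, forall t, `|vcoef j t| <= B.
Proof.
have E : vcoef j = vcoef j \o clampT.
  by apply/funext => s /=; rewrite /vcoef /slice (clampTE (clampT_itv s)).
have c := @continuous_vcoef j; rewrite E in c.
by have [B _ hB] := clampT_bounded c; exists B => t; rewrite E; exact: hB.
Qed.

Lemma ae_vcoef_dir : {ae U, forall t, forall i j,
  coef (slab T (sob_dir i)) j t = - (mode_rate j i * vcoef (mode_swap j i) t)}.
Proof.
apply: ae_forall_count => i.
have := weak_dir_coef (sob_L2 S) (sob_dir_L2 i) (sob_dir_weak i).
apply: (@filterS2 _ _ (ae_filter_ringOfSetsType U)) (uniform_itv T0) => t t01 h j.
by rewrite h vcoefE.
Qed.

Lemma ae_vcoef_dir2 : {ae U, forall t, forall i j,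
  coef (slab T (sob_dir2 i)) j t = - (mode_rate j i ^+ 2 * vcoef j t)}.
Proof.
have h2 : {ae U, forall t, forall i j, coef (slab T (sob_dir2 i)) j t =
    - (mode_rate j i * coef (slab T (sob_dir i)) (mode_swap j i) t)}.
  apply: ae_forall_count => i.
  exact: weak_dir_coef (sob_dir_L2 i) (sob_dir2_L2 i) (sob_dir2_weak i).
apply: (@filterS2 _ _ (ae_filter_ringOfSetsType U)) ae_vcoef_dir h2 => t h1 h2 i j.
rewrite h2 h1 mode_swapK mulrN opprK mulrA mode_rate_mul_swap.
by rewrite mulNr.
Qed.

(** The weak form of [f_j' = mu_j f_j - Z_j]. [Z] is a parameter because the heat operator is
    computed once with weak and once with classical derivatives. *)
Definition weak_heat (Z : RR * (X * X) -> R) := forall j th, time_test T th ->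
  \int[U]_t (vcoef j t * derive1 th t) =
  - \int[U]_t ((mode_eigen j * vcoef j t - coef Z j t) * th t).

Definition sob_heat (t : R) x y : R := - sob_t S t x y - \tr (sob_xx S t x y) - \tr (sob_yy S t x y).

Lemma slab_sob_heat w : slab T sob_heat w = - slab T (sob_t S) w - \sum_i slab T (sob_dir2 i) w.
Proof.
rewrite /slab; case: ifP => _; last by rewrite big1// oppr0 addr0.
by rewrite big_sumType/= /sob_heat /mxtrace opprD addrA.
Qed.

Lemma sqint_sob_heat : sqint PP (slab T sob_heat).
Proof.
rewrite (_ : slab T sob_heat = (fun w => (-1) * slab T (sob_t S) w - \sum_i slab T (sob_dir2 i) w)); last first.
  by apply/funext => w; rewrite slab_sob_heat mulN1r.
apply: sqintB; first by apply: sqintZ; apply: L2_slab; exact: (sob_t_L2 S).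
by apply: sqint_sum => i; apply: L2_slab; exact: sob_dir2_L2.
Qed.

Lemma sob_weak_heat : weak_heat (slab T sob_heat).
Proof.
move=> j th tth.
have cdth := time_test_continuous tth.
have e1 := int_Q_mode j (sob_L2 S) cdth.
have e2 := int_Q_mode j (sob_t_L2 S) (time_test_cont tth).
have := sob_t_weak S (test_Q_tensor tth j.1 j.2).
rewrite (_ : (fun t x y => V t x y * Dt _ t x y) =
   (fun t x y => V t x y * (derive1 th t * (row_basis j.1 x * row_basis j.2 y)))); last first.
  apply/funext => t; apply/funext => x; apply/funext => y.
  by have [_ ->] := Dt_tensor_test tth j.1 j.2 t x y.
rewrite e1 e2 -mulrN => /(mulfI (lt0r_neq0 T0)) e3.
have st := L2_slab (sob_t_L2 S).
have sd2 i := L2_slab (sob_dir2_L2 i).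
have mv : measurable_fun setT (vcoef j : RR -> R) by apply: continuous_measurable_fun; exact: continuous_vcoef.
have mth : measurable_fun setT (th : RR -> R).
  by apply: continuous_measurable_fun; exact: time_test_cont.
have mdth : measurable_fun setT (derive1 th : RR -> R) by exact: continuous_measurable_fun.
transitivity (\int[U]_t (coef (slab T V) j t * derive1 th t)).
  apply: ae_eq_Rintegral.
  - exact: measurable_funM.
  - by apply: measurable_funM => //; apply: measurable_coef; have [] := L2_slab (sob_L2 S).
  - by apply: ae_imp (uniform_itv T0) => t t01; rewrite vcoefE.
rewrite e3; congr (- _); apply: ae_eq_Rintegral.
- by apply: measurable_funM => //; apply: measurable_coef; have [] := st.
- apply: measurable_funM => //; apply: measurable_funB; first exact: measurable_funM.
  by apply: measurable_coef; have [] := sqint_sob_heat.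
(* Splitting the coefficient of a sum requires square integrable slices, which are available at
   almost every time. *)
have sd2t : {ae U, forall t, forall i, sqint TT (fun z => slab T (sob_dir2 i) (t, z))}.
  by apply: ae_forall_count => i; exact: sqint_slice.
have stt := sqint_slice st.
have := @filterS2 _ _ (ae_filter_ringOfSetsType U) _ _ _ _ stt sd2t.
move=> /(_ _ (fun t a b => conj a b)) hh.
apply: (@filterS2 _ _ (ae_filter_ringOfSetsType U)) ae_vcoef_dir2 hh => t h2 [s1 s2].
congr (_ * _); have sm := sqint_mode j.
have -> : coef (slab T sob_heat) j t = - coef (slab T (sob_t S)) j t - \sum_i coef (slab T (sob_dir2 i)) j t.
  rewrite /coef -(@ip_suml _ _ _ TT _ (index_enum I) (fun i z => slab T (sob_dir2 i) (t, z)))//.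
  rewrite -mulN1r -ipZl// -ipBl//; [|exact: sqintZ|exact: sqint_sum].
  by congr (ip TT _ _); apply/funext => z; rewrite slab_sob_heat mulN1r.
under eq_bigr do rewrite h2.
rewrite sumrN -mulr_suml /mode_eigen; ring.
Qed.

Lemma esumZ (K : countType) (c : R) (a : K -> \bar R) : (forall k, 0 <= a k)%E -> 0 <= c ->
  (\esum_(k in [set: K]) (c%:E * a k) = c%:E * \esum_(k in [set: K]) a k)%E.
Proof.
move=> a0 c0; rewrite !esum_pickle//; last by move=> k; rewrite mule_ge0.
rewrite -nneseriesZl; last by move=> n _; case: pickle_inv.
by apply: eq_eseriesr => n _; case: pickle_inv => [k//|]; rewrite mule0.
Qed.

Variables (a nu lam : R).
Hypotheses (a0 : 0 < a) (nu1 : 1 < nu) (l0 : 0 < lam).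
Local Notation wt := (weight a nu lam).
Local Notation rate := (rate a nu).

Lemma measurable_wt : measurable_fun setT (wt : RR -> R).
Proof. exact: measurable_weight. Qed.

Lemma weighted_parseval F : sqint PP F ->
  (\int[PP]_w (wt w.1 * F w ^+ 2)%:E = \esum_(j in [set: J]) \int[U]_t (wt t * coef F j t ^+ 2)%:E)%E.
Proof.
move=> sF; have [mF _] := sF.
have mI : measurable_fun setT (fun w : RR * (X * X) => (wt w.1 * F w ^+ 2)%:E).
  apply/measurable_EFinP; apply: measurable_funM; last exact: measurable_funX.
  exact: (measurableT_comp measurable_wt measurable_fst).
have I0 (w : RR * (X * X)) : (0 <= (wt w.1 * F w ^+ 2)%:E)%E.
  by rewrite lee_fin mulr_ge0 ?sqr_ge0// ltW// weight_gt0.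
have mc j : measurable_fun setT (fun t : RR => (wt t * coef F j t ^+ 2)%:E).
  apply/measurable_EFinP; apply: measurable_funM; first exact: measurable_wt.
  by apply: measurable_funX; exact: measurable_coef.
have c0 j t : (0 <= (wt t * coef F j t ^+ 2)%:E)%E.
  by rewrite lee_fin mulr_ge0 ?sqr_ge0// ltW// weight_gt0.
rewrite ge0_cylinder// -integral_esum//.
apply: ae_eq_integral => //.
- exact: (@measurable_fun_fubini_tonelli_F _ _ _ _ _ TT _ mI I0).
- exact: measurable_esum.
apply: ae_imp (sqint_slice sF) => t st _.
(* At fixed time the weight is a constant, so its root can be put into the function to which
   Parseval is applied. *)
pose s := Num.sqrt (wt t); have s2 : s ^+ 2 = wt t by rewrite sqr_sqrtr// ltW// weight_gt0.
have ss := sqintZ s st; have [_ _ pv] := parseval_mode.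
transitivity (\int[TT]_z ((s * F (t, z)) ^+ 2)%:E)%E.
  by apply: eq_integral => z _; rewrite exprMn s2.
rewrite (pv _ ss); apply: eq_esum => j _.
by rewrite ipZl ?exprMn ?s2//; exact: sqint_mode.
Qed.

Lemma measurable_vcoef j : measurable_fun setT (vcoef j : RR -> R).
Proof. by apply: continuous_measurable_fun; exact: continuous_vcoef. Qed.

Lemma measurable_wvcoef j (c : R) : measurable_fun setT (fun t : RR => (wt t * (c * vcoef j t) ^+ 2)%:E).
Proof.
apply/measurable_EFinP; apply: measurable_funM; first exact: measurable_wt.
by apply: measurable_funX; apply: measurable_funM => //; exact: measurable_vcoef.
Qed.

Lemma wvcoefZ j (c : R) : (\int[U]_t (wt t * (c * vcoef j t) ^+ 2)%:E =
  (c ^+ 2)%:E * \int[U]_t (wt t * vcoef j t ^+ 2)%:E)%E.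
Proof.
rewrite -ge0_integralZl//; last 3 first.
- have := measurable_wvcoef j 1; apply: eq_measurable_fun => t _; by rewrite mul1r.
- by move=> t _; rewrite lee_fin mulr_ge0 ?sqr_ge0// ltW// weight_gt0.
- by rewrite lee_fin sqr_ge0.
by apply: eq_integral => t _; rewrite -EFinM exprMn mulrCA.
Qed.

Lemma weighted_V : (\int[PP]_w (wt w.1 * slab T V w ^+ 2)%:E =
  \esum_(j in [set: J]) \int[U]_t (wt t * vcoef j t ^+ 2)%:E)%E.
Proof.
rewrite weighted_parseval; last exact: L2_slab (sob_L2 S).
apply: eq_esum => j _; apply: ae_eq_integral => //.
- apply/measurable_EFinP; apply: measurable_funM; first exact: measurable_wt.
  by apply: measurable_funX; apply: measurable_coef; have [] := L2_slab (sob_L2 S).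
- have := measurable_wvcoef j 1; apply: eq_measurable_fun => t _; by rewrite mul1r.
- by apply: ae_imp (uniform_itv T0) => t t01 _; rewrite vcoefE.
Qed.

(** [mode_swap] is an involution that preserves the squared rate, so reindexing Parseval's sum by it
    brings back [vcoef j]. *)
Lemma weighted_dir i (F : RR * (X * X) -> R) : sqint PP F ->
  {ae U, forall t, forall j, coef F j t = - (mode_rate j i * vcoef (mode_swap j i) t)} ->
  (\int[PP]_w (wt w.1 * F w ^+ 2)%:E =
  \esum_(j in [set: J]) ((mode_rate j i ^+ 2)%:E * \int[U]_t (wt t * vcoef j t ^+ 2)%:E))%E.
Proof.
move=> sF hF; rewrite weighted_parseval//.
have bij : set_bij [set: J] [set: J] (mode_swap ^~ i).
  split=> //; first by move=> j k _ _ /(inv_inj (mode_swapK i)).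
  by move=> j _; exists (mode_swap j i) => //; rewrite mode_swapK.
rewrite (@reindex_esum R J J setT setT (mode_swap ^~ i) _ bij); apply: eq_esum => j _; rewrite -wvcoefZ.
apply: ae_eq_integral => //.
- apply/measurable_EFinP; apply: measurable_funM; first exact: measurable_wt.
  by apply: measurable_funX; apply: measurable_coef; have [] := sF.
- exact: measurable_wvcoef.
- by apply: ae_imp hF => t h _; rewrite h mode_swapK sqrrN !exprMn mode_rate_swap.
Qed.

Lemma weighted_sob_dir i : (\int[PP]_w (wt w.1 * slab T (sob_dir i) w ^+ 2)%:E =
  \esum_(j in [set: J]) ((mode_rate j i ^+ 2)%:E * \int[U]_t (wt t * vcoef j t ^+ 2)%:E))%E.
Proof.
apply: weighted_dir; first exact: L2_slab (sob_dir_L2 i).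
by apply: ae_imp ae_vcoef_dir => t h j; exact: h.
Qed.

(** [energy_ineq] carried to the extended reals, where the [esum] over the modes is taken. The
    eigenvalue is spread over the directions so that this sum recovers each directional
    derivative. *)
Lemma vcoef_energy j (z : RR -> R) : sqint U z ->
  (forall th, time_test T th ->
    \int[U]_t (vcoef j t * derive1 th t) = - \int[U]_t ((mode_eigen j * vcoef j t - z t) * th t)) ->
  ((lam * rate)%:E * \int[U]_t (wt t * vcoef j t ^+ 2)%:E +
     \sum_i (2%:E * ((mode_rate j i ^+ 2)%:E * \int[U]_t (wt t * vcoef j t ^+ 2)%:E)) <=
   (T^-1 * wt T)%:E * (vcoef j T ^+ 2)%:E + ((lam * rate)^-1)%:E * \int[U]_t (wt t * z t ^+ 2)%:E)%E.
Proof.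
move=> sz wk; have [mz _] := sz; have c0 := rate_gt0 a0 nu1.
have lc : 0 < lam * rate by rewrite mulr_gt0.
have m0 : 0 <= mode_eigen j by apply: sumr_ge0 => i _; rewrite sqr_ge0.
have cv : {within `[0, T], continuous (vcoef j)} by apply: continuous_subspaceT; exact: continuous_vcoef.
have h := energy_ineq a0 nu1 l0 m0 cv (measurable_vcoef j) (vcoef_bounded j) sz wk.
have [B hB] := vcoef_bounded j.
have wi : U.-integrable setT (EFin \o (fun t : RR => wt t * vcoef j t ^+ 2)).
  apply: (@integrable_ae_bounded R T T0 _ (wt T * B ^+ 2)).
    apply: measurable_funM; first exact: measurable_wt.
    by apply: measurable_funX; exact: measurable_vcoef.
  move=> t /andP[t0 tT]; rewrite normrM normrX; apply: ler_pM => //.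
    by rewrite ger0_norm ?(ltW (weight_gt0 _ _ _ _))// weight_le// ltW.
  by rewrite lerXn2r ?nnegrE// (le_trans _ (hB t)).
have EA : (\int[U]_t (wt t * vcoef j t ^+ 2)%:E = (\int[U]_t (wt t * vcoef j t ^+ 2))%:E)%E.
  by rewrite /Rintegral fineK//; exact: integrable_fin_num.
set A := \int[U]_t (wt t * vcoef j t ^+ 2) in h EA.
set Zq := (\int[U]_t (wt t * z t ^+ 2)%:E)%E.
have Z0 : (0 <= Zq)%E.
  by apply: integral_ge0 => t _; rewrite lee_fin mulr_ge0 ?sqr_ge0// ltW// weight_gt0.
have Zfin : (Zq < +oo)%E -> Zq = (\int[U]_t (wt t * z t ^+ 2))%:E.
  by move=> zf; rewrite /Rintegral fineK// ge0_fin_numE.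
rewrite EA -ge0_sume_distrr; last by move=> i _; rewrite -EFinM lee_fin mulr_ge0 ?sqr_ge0// Rintegral_ge0// => t _; rewrite mulr_ge0 ?sqr_ge0// ltW// weight_gt0.
rewrite -ge0_sume_distrl; last by move=> i _; rewrite lee_fin sqr_ge0.
rewrite sumEFin -!EFinM -EFinD.
have [zf|] := ltP Zq +oo%E; last first.
  rewrite leye_eq => /eqP ->; rewrite gt0_muley ?lte_fin ?invr_gt0// addey// leey.
  done.
rewrite (Zfin zf) -EFinM -EFinD lee_fin.
by move: h; rewrite mulrDl [2 * (_ * A)]mulrA [T^-1 * (_ * _)]mulrA; apply.
Qed.

Lemma terminal_bessel : (\esum_(j in [set: J]) (vcoef j T ^+ 2)%:E <= \int[TT]_z (V T z.1 z.2 ^+ 2)%:E)%E.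
Proof.
have [_ _ pv] := parseval_mode; have h := pv _ (sqint_Vslice T).
have TT' : clampT T = T by apply: clampTE; rewrite lexx ltW.
by rewrite /vcoef -h /slice TT'.
Qed.

Lemma carleman_heat Z : sqint PP Z -> weak_heat Z ->
  ((lam * rate)%:E * \int[PP]_w (wt w.1 * slab T V w ^+ 2)%:E +
     \sum_i (2%:E * \int[PP]_w (wt w.1 * slab T (sob_dir i) w ^+ 2)%:E) <=
   (T^-1 * wt T)%:E * \int[TT]_z (V T z.1 z.2 ^+ 2)%:E +
     ((lam * rate)^-1)%:E * \int[PP]_w (wt w.1 * Z w ^+ 2)%:E)%E.
Proof.
move=> sZ wZ; have c0 := rate_gt0 a0 nu1; have lc : 0 < lam * rate by rewrite mulr_gt0.
have A0 j : (0 <= \int[U]_t (wt t * vcoef j t ^+ 2)%:E)%E.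
  by apply: integral_ge0 => t _; rewrite lee_fin mulr_ge0 ?sqr_ge0// ltW// weight_gt0.
have Z0 j : (0 <= \int[U]_t (wt t * coef Z j t ^+ 2)%:E)%E.
  by apply: integral_ge0 => t _; rewrite lee_fin mulr_ge0 ?sqr_ge0// ltW// weight_gt0.
have wT0 : 0 <= T^-1 * wt T by rewrite mulr_ge0 ?invr_ge0 ?(ltW T0)// ltW// weight_gt0.
apply: (@le_trans _ _ (\esum_(j in [set: J]) ((T^-1 * wt T)%:E * (vcoef j T ^+ 2)%:E +
    ((lam * rate)^-1)%:E * \int[U]_t (wt t * coef Z j t ^+ 2)%:E))%E); last first.
  rewrite esumD; last 2 first.
  - by move=> j _; rewrite mule_ge0 ?lee_fin ?sqr_ge0.
  - by move=> j _; rewrite mule_ge0 ?lee_fin ?invr_ge0 ?(ltW lc).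
  rewrite esumZ//; last by move=> j; rewrite lee_fin sqr_ge0.
  rewrite esumZ//; last by rewrite invr_ge0 ltW.
  rewrite -weighted_parseval//; apply: leeD => //.
  by apply: lee_wpmul2l; [rewrite lee_fin|exact: terminal_bessel].
apply: (@le_trans _ _ (\esum_(j in [set: J]) ((lam * rate)%:E * \int[U]_t (wt t * vcoef j t ^+ 2)%:E +
     \sum_i (2%:E * ((mode_rate j i ^+ 2)%:E * \int[U]_t (wt t * vcoef j t ^+ 2)%:E))))%E); last first.
  apply: le_esum => j _; apply: vcoef_energy; first exact: sqint_coef.
  by move=> th tth; exact: wZ.
rewrite esumD; last 2 first.
- by move=> j _; rewrite mule_ge0 ?lee_fin ?(ltW lc).
- by move=> j _; apply: sume_ge0 => i _; rewrite !mule_ge0 ?lee_fin ?sqr_ge0.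
rewrite esumZ//; last exact: ltW.
rewrite esum_sum; last by move=> j i _ _; rewrite !mule_ge0 ?lee_fin ?sqr_ge0.
rewrite weighted_V; apply: leeD => //; apply: lee_sum => i _.
rewrite weighted_sob_dir esumZ//.
by move=> j; rewrite mule_ge0 ?lee_fin ?sqr_ge0.
Qed.

End coefficients.

(** * Lower order terms *)

Section essential_bounds.
Context {R : realType} (d : nat) (T : R).
Hypothesis T0 : 0 < T.
Local Notation RR := (measurableTypeR R).
Local Notation X := 'rV[R]_d.
Local Notation U := (uniform_prob T0).
Local Notation tau := (torus_leb R d).
Local Notation TT := (torus2 R d).
Local Notation PP := (cylinder d T0).
Local Notation Q := (@Q R d T).

(** On a space of measure 0 the norm is 0 by convention, and there everything holds almost
    everywhere. *)
Lemma Lnorm_ae {disp : measure_display} {Y : measurableType disp}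
    (mu : {measure set Y -> \bar R}) (f : Y -> \bar R) (M : R) :
  (Lnorm mu +oo f <= M%:E)%E -> {ae mu, forall y, (`|f y| <= M%:E)%E}.
Proof.
rewrite unlock; case: ifPn => [_ /ess_supP //|mu0 _].
exists setT; split=> //; apply/eqP; rewrite eq_le measure_ge0 andbT.
by rewrite leNgt.
Qed.

(** The measure of a set is the integral of the measures of its sections; this converts an essential
    bound on a product into one on almost every slice. *)
Lemma ae_section_null {d1 d2 : measure_display} {Y1 : measurableType d1} {Y2 : measurableType d2}
    (m1 : {sigma_finite_measure set Y1 -> \bar R}) (m2 : {sigma_finite_measure set Y2 -> \bar R})
    (N : set (Y1 * Y2)) : measurable N -> (m1 \x m2)%E N = 0%E ->
  {ae m1, forall y, m2 (xsection N y) = 0%E}.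
Proof.
move=> mN N0; have mf := measurable_fun_xsection m2 mN.
have /(ae_eq_integral_abs m1 measurableT mf) : (\int[m1]_y `|(m2 \o xsection N) y| = 0)%E.
  by rewrite -[RHS]N0; apply: eq_integral => y _; rewrite gee0_abs.
by apply: ae_imp => y /(_ Logic.I).
Qed.

Lemma uniform_ac (A : RR -> Prop) : {ae (@lebesgue_measure R), forall t, A t} -> {ae U, forall t, A t}.
Proof.
move=> [N [mN N0 sub]]; exists N; split=> //.
rewrite -[N]setIT -integral_indic// integral_uniform//; last first.
  by apply/measurable_EFinP; exact: measurable_indic.
rewrite integral_indic//.
have NT0 : lebesgue_measure (N `&` `[0, T]) = 0%E; last first.
  by transitivity (((T - 0)^-1)%:E * 0)%E; [congr (_ * _)%E; exact: NT0|rewrite mule0].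
apply: (subset_measure0 _ mN _ N0); last by move=> x [].
by apply: measurableI => //; exact: measurable_itv.
Qed.

Lemma norm_Linf_QT_ae (f : R -> X -> R) (M : R) : (norm_Linf_QT T f <= M%:E)%E ->
  {ae U, forall t, 0 < t < T -> {ae tau, forall x, `|f t x| <= M}}.
Proof.
move=> /Lnorm_ae [N [mN N0 sub]].
have := @ae_section_null _ _ _ _ (@lebesgue_measure R) tau N mN N0.
move=> /uniform_ac; apply: ae_imp => t Nt t01; exists (xsection N t); split => //.
- exact: measurable_xsection.
- move=> x /= nx; rewrite /xsection/= inE; apply: sub => /= h; apply: nx.
  by move: h; rewrite /patch/= mem_set.
Qed.

Lemma norm_Linf_Q_ae (f : R -> X -> X -> R) (M : R) : (norm_Linf_Q T f <= M%:E)%E ->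
  {ae U, forall t, 0 < t < T -> {ae TT, forall z, `|f t z.1 z.2| <= M}}.
Proof.
move=> /Lnorm_ae [N [mN N0 sub]].
pose re (w : RR * (X * X)) : RR * X * X := ((w.1, w.2.1), w.2.2).
have mre : measurable_fun setT re.
  apply: measurable_fun_pair; last exact: (measurableT_comp measurable_snd measurable_snd).
  apply: measurable_fun_pair; first exact: measurable_fst.
  exact: (measurableT_comp measurable_fst measurable_snd).
(* [ge0_integral_Q] compares the two measures for functions that vanish off [Q]. *)
pose N1 : set (RR * X * X) := N `&` Q.
have mN1 : measurable N1 by apply: measurableI => //; exact: measurable_Q.
have N10 : leb_Q R d N1 = 0%E by apply: (subset_measure0 mN1 mN _ N0) => x [].
have mN2 : measurable (re @^-1` N1) by rewrite -[X in measurable X]setTI; exact: mre.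
have PN : PP (re @^-1` N1) = 0%E.
  have := @ge0_integral_Q R d T T0 (fun q => (\1_N1 q)%:E).
  rewrite integral_indic// setIT N10 => h.
  have {}h : (0 = T%:E * \int[PP]_w (\1_N1 (re w))%:E)%E.
    apply: h => //.
    - by apply/measurable_EFinP; exact: measurable_indic.
    - by move=> q nq; rewrite indicE memNset// => -[].
  have E : (\int[PP]_w (\1_N1 (re w))%:E = PP (re @^-1` N1))%E.
    by rewrite -[X in PP X]setIT -integral_indic.
  move/esym/eqP: h; rewrite E mule_eq0 => /orP[|/eqP//].
  by rewrite eqe gt_eqF.
have := @ae_section_null _ _ _ _ U TT _ mN2 PN.
apply: ae_imp => t Nt t01; exists (xsection (re @^-1` N1) t); split => //.
- exact: measurable_xsection.
- move=> z /= nz; rewrite /xsection/= inE; split => //; apply: sub => /= h; apply: nz.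
  by move: h; rewrite /patch/= mem_set.
Qed.

Lemma ae_torus2_fst (A : X -> Prop) : {ae tau, forall x, A x} -> {ae TT, forall z, A z.1}.
Proof.
move=> [N [mN N0 sub]]; exists (N `*` setT); split.
- exact: measurableX.
- transitivity (tau N * tau setT)%E; last by rewrite N0 mul0e.
  exact: product_measure1E.
- by move=> z /= nz; split => //; apply: sub.
Qed.

Lemma ae_torus2_snd (A : X -> Prop) : {ae tau, forall x, A x} -> {ae TT, forall z, A z.2}.
Proof.
move=> [N [mN N0 sub]]; exists (setT `*` N); split.
- exact: measurableX.
- transitivity (tau setT * tau N)%E; last by rewrite N0 mule0.
  exact: product_measure1E.
- by move=> z /= nz; split => //; apply: sub.
Qed.

Lemma ae_torus2_swap (A : X * X -> Prop) : {ae TT, forall z, A z} -> {ae TT, forall z, A (z.2, z.1)}.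
Proof.
move=> [N [mN N0 sub]]; pose sw (z : X * X) := (z.2, z.1).
have msw : measurable_fun setT sw.
  by apply: measurable_fun_pair; [exact: measurable_snd|exact: measurable_fst].
have mN2 : measurable (sw @^-1` N) by rewrite -[X in measurable X]setTI; exact: msw.
exists (sw @^-1` N); split => //; last by move=> z nz; apply: sub.
have := @ge0_torus2_swap R d (fun z => (\1_N z)%:E).
move=> h; have {}h : (\int[TT]_z (\1_N z)%:E = \int[TT]_z (\1_N (z.2, z.1))%:E)%E.
  by apply: h => //; apply/measurable_EFinP; exact: measurable_indic.
have E1 : (\int[TT]_z (\1_N z)%:E = 0)%E by rewrite integral_indic// setIT.
have E2 : (\int[TT]_z (\1_N (z.2, z.1))%:E = TT (sw @^-1` N))%E.
  by rewrite -[X in TT X]setIT -integral_indic.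
by rewrite -E2 -h.
Qed.

Lemma fnorm_coef m n (A : 'M[R]_(m, n)) i j : `|A i j| <= fnorm A.
Proof.
rewrite -sqrtr_sqr; apply: ler_wsqrtr.
rewrite (bigD1 i)//= (bigD1 j)//= -addrA lerDl addr_ge0//; first by apply: sumr_ge0 => k _; exact: sqr_ge0.
by apply: sumr_ge0 => k _; apply: sumr_ge0 => l _; exact: sqr_ge0.
Qed.

(** Cauchy-Schwarz against the constant 1, read off from the nonnegative sum of the [(n u_i - s)^2],
    where [n] is the cardinal and [s] the sum. *)
Lemma sqr_sum_le (I : finType) (u : I -> R) : (\sum_i u i) ^+ 2 <= #|I|%:R * \sum_i u i ^+ 2.
Proof.
set s := \sum_i u i; have [n0|n0] := eqVneq #|I| 0%N.
  by rewrite /s !big_pred0 ?expr0n ?mulr0// => i; have := fintype0 i n0.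
have n1 : 0 < #|I|%:R :> R by rewrite ltr0n lt0n.
have : 0 <= \sum_i (#|I|%:R * u i - s) ^+ 2 by apply: sumr_ge0 => i _; exact: sqr_ge0.
rewrite (eq_bigr (fun i => #|I|%:R ^+ 2 * u i ^+ 2 - 2 * #|I|%:R * s * u i + s ^+ 2)); last first.
  by move=> i _; ring.
set A := \sum_i u i ^+ 2.
have -> : \sum_i (#|I|%:R ^+ 2 * u i ^+ 2 - 2 * #|I|%:R * s * u i + s ^+ 2) =
    #|I|%:R ^+ 2 * A - 2 * #|I|%:R * s * s + #|I|%:R * s ^+ 2.
  have k : \sum_(i : I) s ^+ 2 = #|I|%:R * s ^+ 2 by rewrite big_const iter_addr_0 mulr_natl.
  by rewrite big_split/= k sumrB -!mulr_sumr.
move=> h; rewrite -(ler_pM2l n1) -subr_ge0; move: h; congr (_ <= _); ring.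
Qed.

Section nonlocal_slice.
Variables (I : finType) (p c : I -> X * X -> R) (D : R).
Hypotheses (mp : forall k, measurable_fun setT (p k)) (mc : forall k, measurable_fun setT (c k)).
Hypothesis D0 : 0 <= D.
Hypothesis cD : {ae TT, forall z, forall k, `|c k z| <= D}.

(** Jensen in [z] moves the square inside, the factors [c k (z, y)] are replaced by their essential
    bound [D], and the free variable [y] integrates to 1. No derivative of the kernel is
    involved. *)
Lemma nonlocal_slice :
  (\int[TT]_w ((\int[tau]_z \sum_k p k (w.1, z) * c k (z, w.2)) ^+ 2)%:E <=
   (#|I|%:R * D ^+ 2)%:E * \sum_k \int[TT]_w (p k w ^+ 2)%:E)%E.
Proof.
pose g (v : X * X * X) : R := \sum_k p k (v.1.1, v.2) * c k (v.2, v.1.2).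
have mg : measurable_fun setT g.
  apply: measurable_sum => k; apply: measurable_funM.
    apply: (measurableT_comp (mp k)); apply: measurable_fun_pair; last exact: measurable_snd.
    exact: (measurableT_comp measurable_fst measurable_fst).
  apply: (measurableT_comp (mc k)); apply: measurable_fun_pair; first exact: measurable_snd.
  exact: (measurableT_comp measurable_snd measurable_fst).
have mI : measurable_fun setT (fun w : X * X => \int[tau]_z g (w, z)).
  exact: (@measurable_Rintegral _ _ _ _ _ tau g mg).
have mI2 : measurable_fun setT (fun w : X * X => \int[tau]_z (g (w, z) ^+ 2)%:E)%E.
  apply: (@measurable_fun_fubini_tonelli_F _ _ _ _ _ tau (fun v => (g v ^+ 2)%:E)).
    exact: meas_sq.
  by move=> v; rewrite lee_fin sqr_ge0.
apply: (@le_trans _ _ (\int[TT]_w \int[tau]_z (g (w, z) ^+ 2)%:E)%E).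
  apply: ge0_le_integral => //.
  - by move=> w _; rewrite lee_fin sqr_ge0.
  - exact: meas_sq.
  - move=> w _; apply: (@jensen_sq _ _ _ tau (fun z => g (w, z))).
    by apply: (measurableT_comp mg); exact: measurable_fun_pair.
rewrite (@ge0_torus2 R d (fun w => \int[tau]_z (g (w, z) ^+ 2)%:E)%E)//; last first.
  by move=> w; apply: integral_ge0 => z _; rewrite lee_fin sqr_ge0.
have mps k : measurable_fun setT (fun w => (p k w ^+ 2)%:E) by exact: meas_sq.
have ps0 k w : (0 <= (p k w ^+ 2)%:E)%E by rewrite lee_fin sqr_ge0.
have C0 : 0 <= #|I|%:R * D ^+ 2 by rewrite mulr_ge0 ?sqr_ge0.
have -> : (\sum_k \int[TT]_w (p k w ^+ 2)%:E = \int[tau]_x \int[tau]_z (\sum_k p k (x, z) ^+ 2)%:E)%E.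
  rewrite -ge0_integral_sum// (@ge0_torus2 R d (fun w => \sum_k (p k w ^+ 2)%:E)%E).
  - by apply: eq_integral => x _; apply: eq_integral => z _; rewrite sumEFin.
  - by apply: emeasurable_sum => k.
  - by move=> w; apply: sume_ge0.
have mS : measurable_fun setT (fun w : X * X => (\sum_k p k w ^+ 2)%:E).
  by apply/measurable_EFinP; apply: measurable_sum => k; exact: measurable_funX.
have S0 w : (0 <= (\sum_k p k w ^+ 2)%:E)%E by rewrite lee_fin sumr_ge0// => k _; exact: sqr_ge0.
rewrite -ge0_integralZl//; last 2 first.
- exact: (@measurable_fun_fubini_tonelli_F _ _ _ _ _ tau (fun w => (\sum_k p k w ^+ 2)%:E) mS S0).
- by move=> x _; apply: integral_ge0.
have mH x : measurable_fun setT (fun v : X * X => (g ((x, v.1), v.2) ^+ 2)%:E).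
  apply/measurable_EFinP; apply: measurable_funX; apply: (measurableT_comp mg).
  by apply: measurable_fun_pair => //; apply: measurable_fun_pair => //; exact: measurable_fst.
have H0 x (v : X * X) : (0 <= (g ((x, v.1), v.2) ^+ 2)%:E)%E by rewrite lee_fin sqr_ge0.
have mSz x : measurable_fun setT (fun z : X => (\sum_k p k (x, z) ^+ 2)%:E).
  by apply: (measurableT_comp mS); exact: measurable_fun_pair.
apply: ge0_le_integral => //.
- by move=> x _; apply: integral_ge0 => y _; apply: integral_ge0 => z _; rewrite lee_fin sqr_ge0.
- apply: (@measurable_fun_fubini_tonelli_F _ _ _ _ _ tau (fun w => \int[tau]_z (g (w, z) ^+ 2)%:E)%E mI2).
  by move=> w; apply: integral_ge0 => z _; rewrite lee_fin sqr_ge0.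
- apply: measurable_funeM.
  exact: (@measurable_fun_fubini_tonelli_F _ _ _ _ _ tau (fun w => (\sum_k p k w ^+ 2)%:E) mS S0).
move=> x _.
(* After the swap the integration variable is [(z, y)], the argument of [c k], so the almost
   everywhere bound [cD] applies directly. *)
rewrite -(@ge0_torus2 R d (fun v => (g ((x, v.1), v.2) ^+ 2)%:E)%E)// ge0_torus2_swap//.
rewrite -ge0_integralZl//.
have -> : (\int[tau]_z ((#|I|%:R * D ^+ 2)%:E * (\sum_k p k (x, z) ^+ 2)%:E) =
    \int[TT]_v ((#|I|%:R * D ^+ 2)%:E * (\sum_k p k (x, v.1) ^+ 2)%:E))%E.
  rewrite (@ge0_torus2 R d (fun v => (#|I|%:R * D ^+ 2)%:E * (\sum_k p k (x, v.1) ^+ 2)%:E)%E).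
  - apply: eq_integral => z _; rewrite /= integral_cst//.
    rewrite -[LHS]mule1; congr (_ * _)%E; exact/esym/(@probability_setT _ _ _ tau).
  - apply: measurable_funeM; exact: (measurableT_comp (mSz x) measurable_fst).
  - by move=> v; apply: mule_ge0; [rewrite lee_fin|exact: (S0 (x, v.1))].
apply: ae_ge0_le_integral => //.
- by apply: (measurableT_comp (mH x)); apply: measurable_fun_pair; [exact: measurable_snd|exact: measurable_fst].
- by move=> v _; apply: mule_ge0; [rewrite lee_fin|exact: (S0 (x, v.1))].
- apply: measurable_funeM; exact: (measurableT_comp (mSz x) measurable_fst).
- apply: ae_imp cD => v cv _; rewrite -EFinM lee_fin /g/=.
  apply: (le_trans (sqr_sum_le _)); rewrite -mulrA ler_wpM2l// mulr_sumr; apply: ler_sum => k _.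
  rewrite exprMn mulrC ler_wpM2r ?sqr_ge0// -[c k _ ^+ 2]real_normK ?num_real//.
  by rewrite lerXn2r ?nnegrE//; case: v cv.
Qed.

End nonlocal_slice.

End essential_bounds.

(** * First order and nonlocal terms of the operator *)

Section lower_order.
Context {R : realType} (d : nat) (T : R).
Hypothesis T0 : 0 < T.
Local Notation RR := (measurableTypeR R).
Local Notation X := 'rV[R]_d.
Local Notation U := (uniform_prob T0).
Local Notation tau := (torus_leb R d).
Local Notation TT := (torus2 R d).
Local Notation PP := (cylinder d T0).
Local Notation Q := (@Q R d T).
Local Notation mQ := (fun f : R -> X -> X -> R => measurable_fun Q (fun q => f q.1.1 q.1.2 q.2)).

(** The gradients [gx] and [gy] are parameters: they stand for the weak gradients of [V] in the
    first estimate and for the classical ones of [K] in the second. *)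
Definition lower (b : R -> X -> X) (A : R -> X -> 'M[R]_d) (m : R -> X -> R)
    (q1 p2 gx gy : R -> X -> X -> X) (t : R) (x y : X) : R :=
  dot (b t x) (gx t x y) + dot (b t y) (gy t x y) + nonlocal m A gy q1 t x y
  + nonlocal m A p2 gx t x y.

Lemma dot_mul_tr (p q : X) (A : 'M[R]_d) : dot p (q *m A^T) = \sum_k \sum_l p 0 k * (A k l * q 0 l).
Proof.
apply: eq_bigr => k _; rewrite mxE mulr_sumr; apply: eq_bigr => l _.
by rewrite mxE [q 0 l * _]mulrC.
Qed.

Variables (b : R -> X -> X) (A : R -> X -> 'M[R]_d) (m : R -> X -> R) (q1 p2 : R -> X -> X -> X).
Variables (gx gy : R -> X -> X -> X) (M : R).
Hypothesis mb : forall i, mQ (fun t x y => b t x 0 i).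
Hypothesis mA : forall i j, mQ (fun t x y => A t x i j).
Hypothesis mm : mQ (fun t x y => m t x).
Hypothesis mq1 : forall i, mQ (fun t x y => q1 t x y 0 i).
Hypothesis mp2 : forall i, mQ (fun t x y => p2 t x y 0 i).
Hypothesis mgx : forall i, mQ (fun t x y => gx t x y 0 i).
Hypothesis mgy : forall i, mQ (fun t x y => gy t x y 0 i).

Lemma mQ_slice f t : mQ f -> 0 < t < T -> measurable_fun setT (fun z : X * X => f t z.1 z.2).
Proof.
move=> mf t01; have := measurable_slab mf => /(@measurable_slice R d (slab T f) t).
by apply: eq_measurable_fun => z _; rewrite slabE.
Qed.

Lemma mQ_slice1 (f : R -> X -> R) t : mQ (fun t x y => f t x) -> 0 < t < T -> measurable_fun setT (f t).
Proof.
move=> mf t01; have h := mQ_slice mf t01.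
exact: (measurableT_comp h (measurable_fun_pair (@measurable_id _ _ setT) (@measurable_id _ _ setT))).
Qed.

Lemma measurable_slab_nonlocal (p q : R -> X -> X -> X) :
  (forall i, mQ (fun t x y => p t x y 0 i)) -> (forall i, mQ (fun t x y => q t x y 0 i)) ->
  measurable_fun setT (slab T (nonlocal m A p q)).
Proof.
move=> mp mq.
pose g (v : RR * (X * X) * X) : R := slab T (fun t x y => m t x) (v.1.1, (v.2, v.2)) *
  \sum_k \sum_l slab T (fun t x y => p t x y 0 k) (v.1.1, (v.1.2.1, v.2)) *
   (slab T (fun t x y => A t x k l) (v.1.1, (v.2, v.2)) *
    slab T (fun t x y => q t x y 0 l) (v.1.1, (v.2, v.1.2.2))).
have m11 : measurable_fun setT (fun v : RR * (X * X) * X => v.1.1).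
  exact: (measurableT_comp measurable_fst measurable_fst).
have m121 : measurable_fun setT (fun v : RR * (X * X) * X => v.1.2.1).
  exact: (measurableT_comp measurable_fst (measurableT_comp measurable_snd measurable_fst)).
have m122 : measurable_fun setT (fun v : RR * (X * X) * X => v.1.2.2).
  exact: (measurableT_comp measurable_snd (measurableT_comp measurable_snd measurable_fst)).
have m2 : measurable_fun setT (fun v : RR * (X * X) * X => v.2) by exact: measurable_snd.
have mg : measurable_fun setT g.
  apply: measurable_funM.
    apply: (measurableT_comp (measurable_slab mm)).
    by apply: measurable_fun_pair => //; exact: measurable_fun_pair.
  apply: measurable_sum => k; apply: measurable_sum => l; apply: measurable_funM.
    apply: (measurableT_comp (measurable_slab (mp k))).
    by apply: measurable_fun_pair => //; exact: measurable_fun_pair.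
  apply: measurable_funM.
    apply: (measurableT_comp (measurable_slab (mA k l))).
    by apply: measurable_fun_pair => //; exact: measurable_fun_pair.
  apply: (measurableT_comp (measurable_slab (mq l))).
  by apply: measurable_fun_pair => //; exact: measurable_fun_pair.
have := @measurable_Rintegral _ _ _ _ _ tau g mg.
apply: eq_measurable_fun => w _; rewrite /slab; case: ifP => h.
  apply: eq_Rintegral => z _; rewrite /g /slab/= h dot_mul_tr; congr (_ * _).
transitivity (\int[tau]_(z in setT) (0 : R)); last by rewrite /Rintegral integral0.
by apply: eq_Rintegral => z _; rewrite /g /slab/= h mul0r.
Qed.

Lemma measurable_slab_lower : measurable_fun setT (slab T (lower b A m q1 p2 gx gy)).
Proof.
pose f (w : RR * (X * X)) := \sum_i slab T (fun t x y => b t x 0 i) w * slab T (fun t x y => gx t x y 0 i) w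
  + \sum_i slab T (fun t x y => b t x 0 i) (w.1, (w.2.2, w.2.2)) * slab T (fun t x y => gy t x y 0 i) w
  + slab T (nonlocal m A gy q1) w + slab T (nonlocal m A p2 gx) w.
have -> : slab T (lower b A m q1 p2 gx gy) = f.
  apply/funext => w; rewrite /f /slab; case: ifP => // h.
  by rewrite !big1 ?addr0// => i _; rewrite mul0r.
apply: measurable_funD; last exact: measurable_slab_nonlocal.
apply: measurable_funD; last exact: measurable_slab_nonlocal.
apply: measurable_funD; apply: measurable_sum => i; apply: measurable_funM; try exact: measurable_slab.
apply: (measurableT_comp (measurable_slab (mb i))); apply: measurable_fun_pair => //.
have m22 : measurable_fun setT (fun w : RR * (X * X) => w.2.2).
  exact: (measurableT_comp measurable_snd measurable_snd).
exact: measurable_fun_pair.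
Qed.

Hypothesis M0 : 0 < M.

(** The 4 comes from squaring a sum of four terms. A drift term costs [d M^2]. In a nonlocal term
    the kernel entries are at most [d M^3], a sum of [d] products of [m], [A] and a gradient, and
    the outer [d] is again Cauchy-Schwarz. *)
Definition lower_const : R := 4 * (d%:R * M ^+ 2 + d%:R * (d%:R * M ^+ 3) ^+ 2).

Lemma lower_const_ge0 : 0 <= lower_const.
Proof. by rewrite mulr_ge0// addr_ge0// mulr_ge0// ?sqr_ge0// exprn_ge0. Qed.

Lemma ae_all_fin {disp : measure_display} {Y : measurableType disp} (mu : {measure set Y -> \bar R})
    (I : finType) (P : I -> Y -> Prop) :
  (forall i, {ae mu, forall y, P i y}) -> {ae mu, forall y, forall i, P i y}.
Proof. by move=> h; apply: (@filter_forall _ _ _ _ (ae_filter_ringOfSetsType mu)). Qed.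

Section slice_bound.
Variable t : R.
Hypothesis t01 : 0 < t < T.
Hypothesis bM : {ae tau, forall x, `|fnorm (b t x)| <= M}.
Hypothesis AM : {ae tau, forall x, `|fnorm (A t x)| <= M}.
Hypothesis mM : {ae tau, forall x, `|m t x| <= M}.
Hypothesis q1M : {ae TT, forall z, `|fnorm (q1 t z.1 z.2)| <= M}.
Hypothesis p2M : {ae TT, forall z, `|fnorm (p2 t z.1 z.2)| <= M}.

Lemma dot_bound (h : X * X -> X) (be : X * X -> X) :
  (forall i, measurable_fun setT (fun z => h z 0 i)) ->
  (forall i, measurable_fun setT (fun z => be z 0 i)) ->
  {ae TT, forall z, `|fnorm (be z)| <= M} ->
  (\int[TT]_z (dot (be z) (h z) ^+ 2)%:E <=
   (d%:R * M ^+ 2)%:E * \sum_i \int[TT]_z (h z 0 i ^+ 2)%:E)%E.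
Proof.
move=> mh mbe hb.
have C0 : 0 <= d%:R * M ^+ 2 by rewrite mulr_ge0// sqr_ge0.
have mhs i : measurable_fun setT (fun z => (h z 0 i ^+ 2)%:E) by exact: meas_sq.
have hs0 i z : (0 <= (h z 0 i ^+ 2)%:E)%E by rewrite lee_fin sqr_ge0.
rewrite -ge0_integral_sum//.
have mS : measurable_fun setT (fun z => \sum_i (h z 0 i ^+ 2)%:E)%E by exact: emeasurable_sum.
have S0 z : (0 <= \sum_i (h z 0 i ^+ 2)%:E)%E by exact: sume_ge0.
rewrite -ge0_integralZl//; apply: ae_ge0_le_integral => //.
- by move=> z _; rewrite lee_fin sqr_ge0.
- by apply: meas_sq; apply: measurable_sum => i; exact: measurable_funM.
- by move=> z _; rewrite mule_ge0 ?lee_fin.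
- exact: measurable_funeM.
apply: ae_imp hb => z hz _; rewrite sumEFin -EFinM lee_fin.
apply: (le_trans (sqr_sum_le _)); rewrite card_ord -mulrA ler_wpM2l// mulr_sumr; apply: ler_sum => i _.
rewrite exprMn ler_wpM2r ?sqr_ge0// -[be z 0 i ^+ 2]real_normK ?num_real// lerXn2r ?nnegrE ?(ltW M0)//.
by apply: (le_trans (fnorm_coef _ _ _)); rewrite (le_trans _ hz)// ler_norm.
Qed.

(** The boolean selects a row or a column: the two nonlocal terms contract the matrix with the known
    gradient on opposite sides. *)
Lemma coef_bound (u : R) (B : 'M[R]_d) (v : X) (k : 'I_d) (s : bool) :
  `|u| <= M -> `|fnorm B| <= M -> `|fnorm v| <= M ->
  `|u * \sum_l (if s then B k l else B l k) * v 0 l| <= d%:R * M ^+ 3.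
Proof.
move=> hu hB hv; rewrite normrM (_ : d%:R * M ^+ 3 = M * (d%:R * M ^+ 2)); last by ring.
apply: ler_pM => //; apply: (le_trans (ler_norm_sum _ _ _)).
apply: (@le_trans _ _ (\sum_(l < d) M ^+ 2)); last by rewrite sumr_const card_ord mulr_natl.
apply: ler_sum => l _; rewrite normrM expr2; apply: ler_pM => //.
  have h := le_trans (ler_norm _) hB.
  by case: s; exact: le_trans (fnorm_coef _ _ _) h.
exact: le_trans (fnorm_coef _ _ _) (le_trans (ler_norm _) hv).
Qed.

Lemma nonlocal_bound1 : (\int[TT]_z (nonlocal m A gy q1 t z.1 z.2 ^+ 2)%:E <=
   (d%:R * (d%:R * M ^+ 3) ^+ 2)%:E * \sum_i \int[TT]_z (gy t z.1 z.2 0 i ^+ 2)%:E)%E.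
Proof.
pose c k (v : X * X) := m t v.1 * \sum_l (if true then A t v.1 k l else A t v.1 l k) * q1 t v.1 v.2 0 l.
have mc k : measurable_fun setT (c k).
  apply: measurable_funM; first exact: (measurableT_comp (mQ_slice1 mm t01) measurable_fst).
  apply: measurable_sum => l; apply: measurable_funM; last exact: mQ_slice (mq1 l) t01.
  exact: (measurableT_comp (mQ_slice1 (mA k l) t01) measurable_fst).
have cD : {ae TT, forall z, forall k, `|c k z| <= d%:R * M ^+ 3}.
  have h1 := ae_torus2_fst mM; have h2 := ae_torus2_fst AM.
  have h12 := @filterS2 _ _ (ae_filter_ringOfSetsType TT) _ _ _ (fun z a b => conj a b) h1 h2.
  apply: (@filterS2 _ _ (ae_filter_ringOfSetsType TT)) h12 q1M => z [a1 a2] a3 k.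
  exact: (coef_bound k true a1 a2 a3).
have D0 : 0 <= d%:R * M ^+ 3 by rewrite mulr_ge0// exprn_ge0// ltW.
have := nonlocal_slice (fun k => mQ_slice (mgy k) t01) mc D0 cD.
rewrite card_ord => h; apply: le_trans h; rewrite le_eqVlt; apply/orP; left; apply/eqP.
apply: eq_integral => w _; congr ((_ ^+ 2)%:E).
apply: eq_Rintegral => z _; rewrite dot_mul_tr mulr_sumr; apply: eq_bigr => k _.
by rewrite /c/= mulrCA; congr (_ * _); rewrite mulr_sumr.
Qed.

(** Here the unknown gradient is the right factor, at [(z, y)]. Exchanging [x] and [y] moves it to
    the left position that [nonlocal_slice] expects, the kernel being made of the transpose of [A]
    and of [p2]. *)
Lemma nonlocal_bound2 : (\int[TT]_z (nonlocal m A p2 gx t z.1 z.2 ^+ 2)%:E <=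
   (d%:R * (d%:R * M ^+ 3) ^+ 2)%:E * \sum_i \int[TT]_z (gx t z.1 z.2 0 i ^+ 2)%:E)%E.
Proof.
pose c k (v : X * X) := m t v.1 * \sum_l (if false then A t v.1 k l else A t v.1 l k) * p2 t v.2 v.1 0 l.
pose p k (v : X * X) := gx t v.2 v.1 0 k.
have msw : measurable_fun setT (fun v : X * X => (v.2, v.1)).
  by apply: measurable_fun_pair; [exact: measurable_snd|exact: measurable_fst].
have mp k : measurable_fun setT (p k) by exact: (measurableT_comp (mQ_slice (mgx k) t01) msw).
have mc k : measurable_fun setT (c k).
  apply: measurable_funM; first exact: (measurableT_comp (mQ_slice1 mm t01) measurable_fst).
  apply: measurable_sum => l; apply: measurable_funM.
    exact: (measurableT_comp (mQ_slice1 (mA l k) t01) measurable_fst).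
  exact: (measurableT_comp (mQ_slice (mp2 l) t01) msw).
have cD : {ae TT, forall z, forall k, `|c k z| <= d%:R * M ^+ 3}.
  have h1 := ae_torus2_fst mM; have h2 := ae_torus2_fst AM.
  have h12 := @filterS2 _ _ (ae_filter_ringOfSetsType TT) _ _ _ (fun z a b => conj a b) h1 h2.
  apply: (@filterS2 _ _ (ae_filter_ringOfSetsType TT)) h12 (ae_torus2_swap p2M) => z [a1 a2] a3 k.
  exact: (coef_bound k false a1 a2 a3).
have D0 : 0 <= d%:R * M ^+ 3 by rewrite mulr_ge0// exprn_ge0// ltW.
have mnl : measurable_fun setT (fun z : X * X => (nonlocal m A p2 gx t z.1 z.2 ^+ 2)%:E).
  apply/measurable_EFinP; apply: measurable_funX.
  have := measurable_slice t (measurable_slab_nonlocal mp2 mgx).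
  by apply: eq_measurable_fun => z _; rewrite slabE.
rewrite ge0_torus2_swap//; last by move=> w; rewrite lee_fin sqr_ge0.
have := nonlocal_slice mp mc D0 cD.
rewrite card_ord => h; apply: le_trans (le_trans _ h) _.
  rewrite le_eqVlt; apply/orP; left; apply/eqP.
  apply: eq_integral => w _; congr ((_ ^+ 2)%:E).
  apply: eq_Rintegral => z _; rewrite dot_mul_tr exchange_big mulr_sumr/=; apply: eq_bigr => k _.
  rewrite /c /p/= [RHS]mulrCA; congr (_ * _).
  by rewrite mulr_sumr; apply: eq_bigr => l _; ring.
rewrite le_eqVlt; apply/orP; left; apply/eqP; congr (_ * _)%E; apply: eq_bigr => k _.
by rewrite [RHS]ge0_torus2_swap//; [apply: meas_sq; exact: mQ_slice (mgx k) t01|move=> w; rewrite lee_fin sqr_ge0].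
Qed.

Lemma lower_slice : (\int[TT]_z (lower b A m q1 p2 gx gy t z.1 z.2 ^+ 2)%:E <=
   lower_const%:E * (\sum_i \int[TT]_z (gx t z.1 z.2 0 i ^+ 2)%:E + \sum_i \int[TT]_z (gy t z.1 z.2 0 i ^+ 2)%:E))%E.
Proof.
have mnl1 : measurable_fun setT (fun z : X * X => nonlocal m A gy q1 t z.1 z.2).
  have := measurable_slice t (measurable_slab_nonlocal mgy mq1).
  by apply: eq_measurable_fun => z _; rewrite slabE.
have mnl2 : measurable_fun setT (fun z : X * X => nonlocal m A p2 gx t z.1 z.2).
  have := measurable_slice t (measurable_slab_nonlocal mp2 mgx).
  by apply: eq_measurable_fun => z _; rewrite slabE.
have mb1 i : measurable_fun setT (fun z : X * X => b t z.1 0 i).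
  exact: (measurableT_comp (mQ_slice1 (mb i) t01) measurable_fst).
have mb2 i : measurable_fun setT (fun z : X * X => b t z.2 0 i).
  exact: (measurableT_comp (mQ_slice1 (mb i) t01) measurable_snd).
have mgxt i := mQ_slice (mgx i) t01; have mgyt i := mQ_slice (mgy i) t01.
have md1 : measurable_fun setT (fun z : X * X => dot (b t z.1) (gx t z.1 z.2)).
  by apply: measurable_sum => i; exact: measurable_funM.
have md2 : measurable_fun setT (fun z : X * X => dot (b t z.2) (gy t z.1 z.2)).
  by apply: measurable_sum => i; exact: measurable_funM.
have B1 := @dot_bound (fun z => gx t z.1 z.2) (fun z => b t z.1) mgxt mb1 (ae_torus2_fst bM).
have B2 := @dot_bound (fun z => gy t z.1 z.2) (fun z => b t z.2) mgyt mb2 (ae_torus2_snd bM).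
have B3 := nonlocal_bound1; have B4 := nonlocal_bound2.
have sq0 (f : X * X -> R) z : (0 <= (f z ^+ 2)%:E)%E by rewrite lee_fin sqr_ge0.
set Gx := (\sum_i \int[TT]_z (gx t z.1 z.2 0 i ^+ 2)%:E)%E in B1 B4 *.
set Gy := (\sum_i \int[TT]_z (gy t z.1 z.2 0 i ^+ 2)%:E)%E in B2 B3 *.
have Gx0 : (0 <= Gx)%E by apply: sume_ge0 => i _; apply: integral_ge0 => z _; rewrite lee_fin sqr_ge0.
have Gy0 : (0 <= Gy)%E by apply: sume_ge0 => i _; apply: integral_ge0 => z _; rewrite lee_fin sqr_ge0.
have mE (f : X * X -> R) : measurable_fun setT f -> measurable_fun setT (fun z => (f z ^+ 2)%:E).
  by move=> mf; exact: meas_sq.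
apply: (@le_trans _ _ (4%:E * (\int[TT]_z (dot (b t z.1) (gx t z.1 z.2) ^+ 2)%:E +
  \int[TT]_z (dot (b t z.2) (gy t z.1 z.2) ^+ 2)%:E +
  \int[TT]_z (nonlocal m A gy q1 t z.1 z.2 ^+ 2)%:E + \int[TT]_z (nonlocal m A p2 gx t z.1 z.2 ^+ 2)%:E))%E).
  pose F1 (z : X * X) := (dot (b t z.1) (gx t z.1 z.2) ^+ 2)%:E.
  pose F2 (z : X * X) := (dot (b t z.2) (gy t z.1 z.2) ^+ 2)%:E.
  pose F3 (z : X * X) := (nonlocal m A gy q1 t z.1 z.2 ^+ 2)%:E.
  pose F4 (z : X * X) := (nonlocal m A p2 gx t z.1 z.2 ^+ 2)%:E.
  have m1 : measurable_fun setT F1 by exact: mE.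
  have m2 : measurable_fun setT F2 by exact: mE.
  have m3 : measurable_fun setT F3 by exact: mE.
  have m4 : measurable_fun setT F4 by exact: mE.
  have p1 z : setT z -> (0 <= F1 z)%E by move=> _; rewrite lee_fin sqr_ge0.
  have p2' z : setT z -> (0 <= F2 z)%E by move=> _; rewrite lee_fin sqr_ge0.
  have p3 z : setT z -> (0 <= F3 z)%E by move=> _; rewrite lee_fin sqr_ge0.
  have p4 z : setT z -> (0 <= F4 z)%E by move=> _; rewrite lee_fin sqr_ge0.
  have m12 : measurable_fun setT (fun z => F1 z + F2 z)%E by exact: emeasurable_funD.
  have p12 z : setT z -> (0 <= F1 z + F2 z)%E by move=> h; rewrite adde_ge0 ?p1 ?p2'.
  have m123 : measurable_fun setT (fun z => F1 z + F2 z + F3 z)%E by exact: emeasurable_funD.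
  have p123 z : setT z -> (0 <= F1 z + F2 z + F3 z)%E by move=> h; rewrite adde_ge0 ?p12 ?p3.
  have m1234 : measurable_fun setT (fun z => F1 z + F2 z + F3 z + F4 z)%E by exact: emeasurable_funD.
  have p1234 z : setT z -> (0 <= F1 z + F2 z + F3 z + F4 z)%E by move=> h; rewrite adde_ge0 ?p123 ?p4.
  have -> : (\int[TT]_z F1 z + \int[TT]_z F2 z + \int[TT]_z F3 z + \int[TT]_z F4 z =
      \int[TT]_z (F1 z + F2 z + F3 z + F4 z))%E.
    rewrite (@ge0_integralD _ _ _ TT _ measurableT (fun z => F1 z + F2 z + F3 z)%E F4)//.
    rewrite (@ge0_integralD _ _ _ TT _ measurableT (fun z => F1 z + F2 z)%E F3)//.
    by rewrite (@ge0_integralD _ _ _ TT _ measurableT F1 F2).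
  rewrite -ge0_integralZl//.
  apply: ge0_le_integral => //.
  - by move=> z _; rewrite lee_fin sqr_ge0.
  - by apply: mE; rewrite /lower; do 3!apply: measurable_funD => //.
  - exact: measurable_funeM.
  move=> z _; rewrite /F1 /F2 /F3 /F4 -!EFinD -EFinM lee_fin /lower.
  move: (dot _ _) (dot _ _) (nonlocal _ _ _ _ _ _ _) (nonlocal _ _ _ _ _ _ _) => x1 x2 x3 x4.
  have h1 := sqr_ge0 (x1 - x2); have h2 := sqr_ge0 (x1 - x3); have h3 := sqr_ge0 (x1 - x4).
  have h4 := sqr_ge0 (x2 - x3); have h5 := sqr_ge0 (x2 - x4); have h6 := sqr_ge0 (x3 - x4).
  by nra.
rewrite /lower_const EFinM -muleA; apply: lee_wpmul2l; first by rewrite lee_fin.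
set c1 := d%:R * M ^+ 2 in B1 B2 *; set c2 := d%:R * _ ^+ 2 in B3 B4 *.
have c10 : 0 <= c1 by rewrite mulr_ge0// sqr_ge0.
have c20 : 0 <= c2 by rewrite mulr_ge0// sqr_ge0.
apply: (@le_trans _ _ (c1%:E * Gx + c1%:E * Gy + c2%:E * Gy + c2%:E * Gx)%E).
  by do 3!apply: leeD => //.
rewrite EFinD ge0_muleDl ?lee_fin// !ge0_muleDr// -!addeA; apply: leeD => //; apply: leeD => //.
by rewrite addeC.
Qed.

End slice_bound.

Variables (wt : RR -> R).
Hypotheses (mwt : measurable_fun setT wt) (wt0 : forall t, 0 <= wt t).
Hypothesis bM : {ae U, forall t, 0 < t < T -> {ae tau, forall x, `|fnorm (b t x)| <= M}}.
Hypothesis AM : {ae U, forall t, 0 < t < T -> {ae tau, forall x, `|fnorm (A t x)| <= M}}.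
Hypothesis mM : {ae U, forall t, 0 < t < T -> {ae tau, forall x, `|m t x| <= M}}.
Hypothesis q1M : {ae U, forall t, 0 < t < T -> {ae TT, forall z, `|fnorm (q1 t z.1 z.2)| <= M}}.
Hypothesis p2M : {ae U, forall t, 0 < t < T -> {ae TT, forall z, `|fnorm (p2 t z.1 z.2)| <= M}}.

(** The weight factors out of each time slice, so [lower_slice] can be integrated in time; the five
    essential bounds hold together at almost every time. *)
Lemma lower_bound : (\int[PP]_w (wt w.1 * slab T (lower b A m q1 p2 gx gy) w ^+ 2)%:E <=
   lower_const%:E * (\sum_i \int[PP]_w (wt w.1 * slab T (fun t x y => gx t x y 0 i) w ^+ 2)%:E +
     \sum_i \int[PP]_w (wt w.1 * slab T (fun t x y => gy t x y 0 i) w ^+ 2)%:E))%E.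
Proof.
have mW (f : RR * (X * X) -> R) : measurable_fun setT f ->
    measurable_fun setT (fun w : RR * (X * X) => (wt w.1 * f w ^+ 2)%:E).
  move=> mf; apply/measurable_EFinP; apply: measurable_funM; last exact: measurable_funX.
  exact: (measurableT_comp mwt measurable_fst).
have W0 (f : RR * (X * X) -> R) w : (0 <= (wt w.1 * f w ^+ 2)%:E)%E.
  by rewrite lee_fin mulr_ge0 ?sqr_ge0.
have mI (f : RR * (X * X) -> R) : measurable_fun setT f ->
    measurable_fun setT (fun t : RR => \int[TT]_z (wt t * f (t, z) ^+ 2)%:E)%E.
  move=> mf.
  exact: (@measurable_fun_fubini_tonelli_F _ _ _ _ _ TT (fun w : RR * (X * X) => (wt w.1 * f w ^+ 2)%:E) (mW f mf) (W0 f)).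
have I0 (f : RR * (X * X) -> R) t : (0 <= \int[TT]_z (wt t * f (t, z) ^+ 2)%:E)%E.
  by apply: integral_ge0 => z _; exact: (W0 f (t, z)).
have mx i := measurable_slab (mgx i); have my i := measurable_slab (mgy i).
have ml := measurable_slab_lower.
rewrite (_ : (\int[PP]_w _ = \int[U]_t \int[TT]_z
  (wt t * slab T (lower b A m q1 p2 gx gy) (t, z) ^+ 2)%:E)%E); last by rewrite ge0_cylinder//; exact: mW.
have cylE (g : R -> X -> X -> X) : (forall i, measurable_fun setT (slab T (fun t x y => g t x y 0 i))) ->
    (\sum_i \int[PP]_w (wt w.1 * slab T (fun t x y => g t x y 0 i) w ^+ 2)%:E =
     \sum_i \int[U]_t \int[TT]_z (wt t * slab T (fun t x y => g t x y 0 i) (t, z) ^+ 2)%:E)%E.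
  by move=> mg; apply: eq_bigr => i _; rewrite ge0_cylinder//; exact: mW.
rewrite !cylE//.
have sumI (g : 'I_d -> RR * (X * X) -> R) : (forall i, measurable_fun setT (g i)) ->
    (\sum_i \int[U]_t \int[TT]_z (wt t * g i (t, z) ^+ 2)%:E =
     \int[U]_t \sum_i \int[TT]_z (wt t * g i (t, z) ^+ 2)%:E)%E.
  by move=> mg; rewrite -ge0_integral_sum// => i; exact: mI.
rewrite (sumI _ mx) (sumI _ my).
pose ggx i := slab T (fun t x y => gx t x y 0 i); pose ggy i := slab T (fun t x y => gy t x y 0 i).
have S0 (g : 'I_d -> RR * (X * X) -> R) t : (0 <= \sum_i \int[TT]_z (wt t * g i (t, z) ^+ 2)%:E)%E.
  by apply: sume_ge0 => i _; exact: I0.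
have mS (g : 'I_d -> RR * (X * X) -> R) : (forall i, measurable_fun setT (g i)) ->
    measurable_fun setT (fun t : RR => \sum_i \int[TT]_z (wt t * g i (t, z) ^+ 2)%:E)%E.
  by move=> mg; apply: emeasurable_sum => i; exact: mI.
have Sx := mS _ mx; have Sy := mS _ my.
rewrite -ge0_integralD//; last 2 first.
- by move=> t _; exact: (S0 ggx t).
- by move=> t _; exact: (S0 ggy t).
rewrite -ge0_integralZl//; last 3 first.
- exact: emeasurable_funD.
- by move=> t _; apply: adde_ge0; [exact: (S0 ggx t)|exact: (S0 ggy t)].
- by rewrite lee_fin lower_const_ge0.
apply: ae_ge0_le_integral => //.
- exact: (mI _ ml).
- by move=> t _; rewrite mule_ge0 ?lee_fin ?lower_const_ge0//; apply: adde_ge0; [exact: (S0 ggx t)|exact: (S0 ggy t)].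
- by apply: measurable_funeM; exact: emeasurable_funD.
have F5 : {ae U, forall t, [/\ 0 < t < T -> {ae tau, forall x, `|fnorm (b t x)| <= M},
    0 < t < T -> {ae tau, forall x, `|fnorm (A t x)| <= M},
    0 < t < T -> {ae tau, forall x, `|m t x| <= M},
    0 < t < T -> {ae TT, forall z, `|fnorm (q1 t z.1 z.2)| <= M} &
    0 < t < T -> {ae TT, forall z, `|fnorm (p2 t z.1 z.2)| <= M}]}.
  pose FF := ae_filter_ringOfSetsType U.
  have h1 := @filterS2 _ _ FF _ _ _ (fun z a b => conj a b) bM AM.
  have h2 := @filterS2 _ _ FF _ _ _ (fun z a b => conj a b) h1 mM.
  have h3 := @filterS2 _ _ FF _ _ _ (fun z a b => conj a b) q1M p2M.
  by apply: (@filterS2 _ _ FF) h2 h3 => t [[? ?] ?] [? ?].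
apply: (@filterS2 _ _ (ae_filter_ringOfSetsType U)) F5 (uniform_itv T0) => t [f1 f2 f3 f4 f5] t01 _.
have wtE (f : R -> X -> X -> R) : mQ f ->
    (\int[TT]_z (wt t * slab T f (t, z) ^+ 2)%:E = (wt t)%:E * \int[TT]_z (f t z.1 z.2 ^+ 2)%:E)%E.
  move=> mf; rewrite -ge0_integralZl//.
  - by apply: eq_integral => z _; rewrite slabE// EFinM.
  - by apply: meas_sq; exact: mQ_slice.
  - by move=> z _; rewrite lee_fin sqr_ge0.
  - by rewrite lee_fin.
have -> : (\int[TT]_z (wt t * slab T (lower b A m q1 p2 gx gy) (t, z) ^+ 2)%:E =
    (wt t)%:E * \int[TT]_z (lower b A m q1 p2 gx gy t z.1 z.2 ^+ 2)%:E)%E.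
  rewrite -ge0_integralZl//.
  - by apply: eq_integral => z _; rewrite slabE// EFinM.
  - apply: meas_sq; have := measurable_slice t ml.
    by apply: eq_measurable_fun => z _; rewrite slabE.
  - by move=> z _; rewrite lee_fin sqr_ge0.
  - by rewrite lee_fin.
have sE (g : R -> X -> X -> X) : (forall i, mQ (fun t x y => g t x y 0 i)) ->
    (\sum_i \int[TT]_z (wt t * slab T (fun t x y => g t x y 0 i) (t, z) ^+ 2)%:E =
     \sum_i ((wt t)%:E * \int[TT]_z (g t z.1 z.2 0 i ^+ 2)%:E))%E.
  by move=> mg; apply: eq_bigr => i _; rewrite wtE.
rewrite !sE//.
have n0 (g : R -> X -> X -> X) i : (0 <= \int[TT]_z (g t z.1 z.2 0 i ^+ 2)%:E)%E.
  by apply: integral_ge0 => z _; rewrite lee_fin sqr_ge0.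
rewrite -!ge0_sume_distrr//; try by [move=> i _; exact: n0].
rewrite -ge0_muleDr; try by [apply: sume_ge0 => i _; exact: n0].
rewrite muleCA; apply: lee_wpmul2l; first by rewrite lee_fin.
exact: lower_slice (f1 t01) (f2 t01) (f3 t01) (f4 t01) (f5 t01).
Qed.

End lower_order.

(** * The Carleman estimate for Sobolev functions *)

Section assembly.
Context {R : realType} (d : nat) (T a nu : R).
Hypotheses (T0 : 0 < T) (a0 : 0 < a) (nu1 : 1 < nu).
Local Notation RR := (measurableTypeR R).
Local Notation X := 'rV[R]_d.
Local Notation U := (uniform_prob T0).
Local Notation TT := (torus2 R d).
Local Notation PP := (cylinder d T0).
Local Notation Q := (@Q R d T).
Local Notation mQ := (fun f : R -> X -> X -> R => measurable_fun Q (fun q => f q.1.1 q.1.2 q.2)).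
Local Notation rate := (rate a nu).

(** The first factor passes from [lam^2 rate x + lam y] to [lam^2 x + lam y]. The second one covers
    the two coefficients left by the absorption, [2 / rate] for the source and 1 for the terminal
    term. *)
Definition carleman_const : R := (1 + rate^-1) * (1 + 2 * rate^-1).

(** Beyond [2 B / rate] the lower order terms fit into one of the two copies of [lam y] on the left;
    the summand 1 ensures [lam >= 1]. *)
Definition carleman_lam (B : R) : R := 1 + 2 * B / rate.

Lemma carleman_arith (lam wT B x y F Z L VT : R) : 0 <= B -> carleman_lam B <= lam ->
  0 <= wT -> 0 <= x -> 0 <= y -> 0 <= F -> 0 <= VT ->
  (lam * rate) * x + 2 * y <= T^-1 * wT * VT + (lam * rate)^-1 * Z ->
  Z <= 2 * F + 2 * L -> L <= B * y ->
  lam * (T * y) + lam ^+ 2 * (T * x) <= carleman_const * (T * F) + carleman_const * wT * (lam * VT).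
Proof.
rewrite /carleman_const /carleman_lam; move: (rate) (rate_gt0 a0 nu1) => c c0 B0.
have k0 : 0 < c^-1 by rewrite invr_gt0.
have ck : c * c^-1 = 1 by rewrite mulfV// gt_eqF.
rewrite invfM; move: (c^-1) k0 ck => k k0 ck hl w0 x0 y0 F0 v0 h hZ hL.
have Bk0 : 0 <= 2 * B * k by rewrite !mulr_ge0// ltW.
have l1 : 1 <= lam by apply: le_trans hl; rewrite lerDl.
have l0 : 0 < lam by lra.
have T1 := ltW T0; have l1' := ltW l0; have c1 := ltW c0; have k1 := ltW k0.
have {}hl : 2 * B * k <= lam by apply: le_trans hl; lra.
(* The absorption, and the place where the threshold on [lam] enters. *)
have Bl : 2 * B * k * y <= lam * y by exact: ler_wpM2r.
have h1 : lam ^+ 2 * c * x + 2 * (lam * y) <= lam * (T^-1 * wT * VT) + k * Z.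
  have := ler_wpM2l (ltW l0) h.
  have -> : lam * (lam * c * x + 2 * y) = lam ^+ 2 * c * x + 2 * (lam * y) by ring.
  have -> // : lam * (T^-1 * wT * VT + lam^-1 * k * Z) = lam * (T^-1 * wT * VT) + k * Z.
  by rewrite mulrDr; congr (_ + _); rewrite !mulrA mulfV ?mul1r// gt_eqF.
have h2 : k * Z <= 2 * k * F + 2 * B * k * y.
  apply: (@le_trans _ _ (k * (2 * F + 2 * (B * y)))); last by lra.
  by apply: ler_wpM2l; [exact: ltW|lra].
have h3 : lam ^+ 2 * c * x + lam * y <= lam * (T^-1 * wT * VT) + 2 * k * F by lra.
(* Since [c * k = 1], the part with factor [k] supplies [lam^2 x] and the part with factor 1
   supplies [lam y]; the rest is nonnegative. *)
have h4 : lam * (T * y) + lam ^+ 2 * (T * x) <= T * ((1 + k) * (lam ^+ 2 * c * x + lam * y)).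
  rewrite [T * (_ * _)](_ : _ = T * (lam ^+ 2 * c * x + lam * y + (lam ^+ 2 * (c * k) * x) + k * (lam * y))); last by ring.
  rewrite ck mulr1.
  have e1 : 0 <= T * (lam ^+ 2 * c * x) by rewrite !mulr_ge0 ?exprn_ge0.
  have e2 : 0 <= T * (k * (lam * y)) by exact: mulr_ge0 (ltW T0) (mulr_ge0 (ltW k0) (mulr_ge0 (ltW l0) y0)).
  by rewrite !mulrDr; lra.
apply: (le_trans h4).
apply: (@le_trans _ _ (T * ((1 + k) * (lam * (T^-1 * wT * VT) + 2 * k * F)))).
  by apply: ler_wpM2l; [by []|apply: ler_wpM2l => //; rewrite addr_ge0].
have -> : T * ((1 + k) * (lam * (T^-1 * wT * VT) + 2 * k * F)) =
    (1 + k) * (wT * (lam * VT)) + (1 + k) * (2 * k) * (T * F).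
  by field; rewrite gt_eqF.
have e1 : 0 <= (1 + k) * (T * F) by rewrite !mulr_ge0 ?addr_ge0.
have e2 : 0 <= (1 + k) * (2 * k) * (wT * (lam * VT)) by rewrite !mulr_ge0 ?addr_ge0 ?mulr_ge0.
by rewrite -subr_ge0; move: (addr_ge0 e1 e2); congr (_ <= _); ring.
Qed.

Variables (V : R -> X -> X -> R) (S : sobolev T V) (lam B : R).
Hypothesis B0 : 0 <= B.
Hypothesis hlam : carleman_lam B <= lam.
Local Notation wt := (weight a nu lam).

Let c0 : 0 < rate. Proof. exact: rate_gt0 a0 nu1. Qed.

Let l1 : 1 <= lam.
Proof. by apply: le_trans hlam; rewrite lerDl divr_ge0//; [exact: mulr_ge0|exact: ltW]. Qed.

Let l0 : 0 < lam. Proof. exact: lt_le_trans ltr01 l1. Qed.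

(** Lets plain square integrability be read off from the weighted one. *)
Lemma wt_ge1 t : 1 <= wt t.
Proof. by rewrite /weight -expR0 ler_expR !mulr_ge0 ?powR_ge0// ltW. Qed.

Let mwt : measurable_fun setT (wt : RR -> R). Proof. exact: measurable_weight. Qed.

Let wt0 t : 0 <= wt t. Proof. exact/ltW/weight_gt0. Qed.

Lemma measurable_wt_sq (F : RR * (X * X) -> R) : measurable_fun setT F ->
  measurable_fun setT (fun w : RR * (X * X) => (wt w.1 * F w ^+ 2)%:E).
Proof.
move=> mf; apply/measurable_EFinP; apply: measurable_funM; last exact: measurable_funX.
exact: (measurableT_comp mwt measurable_fst).
Qed.

Lemma wt_sq_ge0 (F : RR * (X * X) -> R) w : (0 <= (wt w.1 * F w ^+ 2)%:E)%E.
Proof. by rewrite lee_fin mulr_ge0 ?sqr_ge0. Qed.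

Lemma wt_sq_fin f : L2_Q T f -> (\int[PP]_w (wt w.1 * slab T f w ^+ 2)%:E < +oo)%E.
Proof.
move=> /(L2_slab T0) [ms fin].
have mm := meas_sq ms; have wT0 : (0 <= (wt T)%:E)%E by rewrite lee_fin.
have nn (w : RR * (X * X)) : setT w -> (0 <= (slab T f w ^+ 2)%:E)%E by rewrite lee_fin sqr_ge0.
apply: (@le_lt_trans _ _ (\int[PP]_w ((wt T)%:E * (slab T f w ^+ 2)%:E))%E); last first.
  by rewrite ge0_integralZl// lte_mul_pinfty.
apply: ge0_le_integral => //.
- by move=> w _; exact: wt_sq_ge0.
- exact: measurable_wt_sq.
- by apply: measurable_funeM; exact: meas_sq.
move=> w _; rewrite -EFinM lee_fin /slab; case: ifP => [/andP[w0 wT]|_]; last by rewrite expr0n !mulr0.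
by rewrite ler_wpM2r ?sqr_ge0// weight_le// ltW.
Qed.

Lemma slab_sqE (f : R -> X -> X -> R) w : slab T (fun t x y => wt t * f t x y ^+ 2) w = wt w.1 * slab T f w ^+ 2.
Proof. by rewrite /slab; case: ifP => // _; rewrite expr0n mulr0. Qed.

Lemma integral_Q_sq f : mQ f -> (\int[leb_Q R d]_(q in Q) (wt q.1.1 * f q.1.1 q.1.2 q.2 ^+ 2)%:E =
  T%:E * \int[PP]_w (wt w.1 * slab T f w ^+ 2)%:E)%E.
Proof.
move=> mf; have := @ge0_integral_slab R d T T0 (fun t x y => wt t * f t x y ^+ 2).
have -> : (\int[PP]_w (slab T (fun t x y => wt t * f t x y ^+ 2) w)%:E =
    \int[PP]_w (wt w.1 * slab T f w ^+ 2)%:E)%E.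
  by apply: eq_integral => w _; rewrite slab_sqE.
apply.
- apply: measurable_funM; last exact: measurable_funX.
  apply: measurable_funTS; apply: (measurableT_comp mwt).
  exact: (measurableT_comp measurable_fst measurable_fst).
- by move=> q _; rewrite mulr_ge0 ?sqr_ge0.
Qed.

Lemma fnorm_row_sq (v : X) : fnorm v ^+ 2 = \sum_i v 0 i ^+ 2.
Proof.
rewrite sqr_sqrtr; first by rewrite big_ord1.
by apply: sumr_ge0 => i _; apply: sumr_ge0 => j _; exact: sqr_ge0.
Qed.

Lemma integral_Q_grad : (\int[leb_Q R d]_(q in Q)
     (wt q.1.1 * (fnorm (sob_x S q.1.1 q.1.2 q.2) ^+ 2 + fnorm (sob_y S q.1.1 q.1.2 q.2) ^+ 2))%:E =
  T%:E * \sum_i \int[PP]_w (wt w.1 * slab T (sob_dir S i) w ^+ 2)%:E)%E.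
Proof.
have E t x y : wt t * (fnorm (sob_x S t x y) ^+ 2 + fnorm (sob_y S t x y) ^+ 2) =
    \sum_i wt t * sob_dir S i t x y ^+ 2.
  by rewrite -mulr_sumr big_sumType/= !fnorm_row_sq.
under eq_integral do rewrite E.
have mdir i : mQ (sob_dir S i) by have [] := sob_dir_L2 S i.
have := @ge0_integral_slab R d T T0 (fun t x y => \sum_i wt t * sob_dir S i t x y ^+ 2).
have -> : (\int[PP]_w (slab T (fun t x y => \sum_i wt t * sob_dir S i t x y ^+ 2) w)%:E =
    \sum_i \int[PP]_w (wt w.1 * slab T (sob_dir S i) w ^+ 2)%:E)%E.
  rewrite -ge0_integral_sum//; last 2 first.
  - by move=> i; apply: measurable_wt_sq; exact: measurable_slab.
  - by move=> i w _; exact: wt_sq_ge0.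
  apply: eq_integral => w _; rewrite sumEFin.
  rewrite -(eq_bigr _ (fun i _ => slab_sqE (sob_dir S i) w)).
  by rewrite /slab; case: ifP => // _; rewrite big1.
apply.
- apply: measurable_sum => i; apply: measurable_funM; last exact: measurable_funX.
  apply: measurable_funTS; apply: (measurableT_comp mwt).
  exact: (measurableT_comp measurable_fst measurable_fst).
- by move=> q _; apply: sumr_ge0 => i _; rewrite mulr_ge0 ?sqr_ge0.
Qed.

(** The squared gradients at time [T] are nonnegative; measurability is all that has to be checked
    before comparing the integrals. *)
Lemma terminal_ge : (lam%:E * \int[TT]_z (V T z.1 z.2 ^+ 2)%:E <=
  \int[leb_TT R d]_q (fnorm (sob_x S T q.1 q.2) ^+ 2 + fnorm (sob_y S T q.1 q.2) ^+ 2 +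
      lam * V T q.1 q.2 ^+ 2)%:E)%E.
Proof.
have [mV _] : L2_TT (V T) by apply: (sob_slice_L2 S); rewrite lexx ltW.
have mx i : measurable_fun setT (fun q : X * X => sob_x S T q.1 q.2 0 i) by have [] := sob_xT_L2 S i.
have my i : measurable_fun setT (fun q : X * X => sob_y S T q.1 q.2 0 i) by have [] := sob_yT_L2 S i.
rewrite -ge0_integralZl//; last 3 first.
- exact: meas_sq.
- by move=> z _; rewrite lee_fin sqr_ge0.
- by rewrite lee_fin ltW.
apply: (@ge0_le_integral _ _ _ TT) => //.
- by move=> z _; rewrite mule_ge0 ?lee_fin ?sqr_ge0 ?(ltW l0).
- by apply: measurable_funeM; exact: meas_sq.
- apply/measurable_EFinP; apply: measurable_funD; last first.
    by apply: measurable_funM => //; exact: measurable_funX.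
  apply: measurable_funD.
    have -> : (fun q : X * X => fnorm (sob_x S T q.1 q.2) ^+ 2) = (fun q => \sum_i sob_x S T q.1 q.2 0 i ^+ 2).
      by apply/funext => q; rewrite fnorm_row_sq.
    by apply: measurable_sum => i; exact: measurable_funX.
  have -> : (fun q : X * X => fnorm (sob_y S T q.1 q.2) ^+ 2) = (fun q => \sum_i sob_y S T q.1 q.2 0 i ^+ 2).
    by apply/funext => q; rewrite fnorm_row_sq.
  by apply: measurable_sum => i; exact: measurable_funX.
- by move=> z _; rewrite -EFinM lee_fin lerDr addr_ge0 ?sqr_ge0.
Qed.

Variables (f : R -> X -> X -> R) (Z L : RR * (X * X) -> R).
Hypothesis mf : mQ f.
Hypotheses (mZ : measurable_fun setT Z) (mL : measurable_fun setT L).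
Hypothesis fE : forall w, slab T f w = Z w + L w.
Hypothesis wZ : sqint PP Z -> weak_heat T0 V Z.
Hypothesis LB : (\int[PP]_w (wt w.1 * L w ^+ 2)%:E <=
  B%:E * \sum_i \int[PP]_w (wt w.1 * slab T (sob_dir S i) w ^+ 2)%:E)%E.

(** Once every quantity is known to be finite, the claim is the real inequality [carleman_arith].
    Finiteness of the [Z] term comes from [Z = f - L], after the case of an infinite source is set
    aside. *)
Lemma carleman_of_heat : carleman a nu lam carleman_const S f.
Proof.
have Cc : 0 < carleman_const.
  by rewrite mulr_gt0 ?addr_gt0 ?mulr_gt0 ?invr_gt0.
have [mV _] := sob_L2 S.
rewrite /carleman/= -/(weight a nu lam) -/(wt T).
have -> : (\int[leb_Q R d]_(q in Q) (expR (2 * lam * ((q.1.1 + a) `^ nu)) *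
    (fnorm (sob_x S q.1.1 q.1.2 q.2) ^+ 2 + fnorm (sob_y S q.1.1 q.1.2 q.2) ^+ 2))%:E =
    T%:E * \sum_i \int[PP]_w (wt w.1 * slab T (sob_dir S i) w ^+ 2)%:E)%E by exact: integral_Q_grad.
have -> : (\int[leb_Q R d]_(q in Q) (expR (2 * lam * ((q.1.1 + a) `^ nu)) * V q.1.1 q.1.2 q.2 ^+ 2)%:E =
    T%:E * \int[PP]_w (wt w.1 * slab T V w ^+ 2)%:E)%E by exact: integral_Q_sq.
have -> : (\int[leb_Q R d]_(q in Q) (expR (2 * lam * ((q.1.1 + a) `^ nu)) * f q.1.1 q.1.2 q.2 ^+ 2)%:E =
    T%:E * \int[PP]_w (wt w.1 * slab T f w ^+ 2)%:E)%E by exact: integral_Q_sq.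
set F := (\int[PP]_w (wt w.1 * slab T f w ^+ 2)%:E)%E.
set G := (\int[leb_TT R d]_q _)%E.
have tg : (lam%:E * \int[TT]_z (V T z.1 z.2 ^+ 2)%:E <= G)%E by exact: terminal_ge.
have VT0 : (0 <= \int[TT]_z (V T z.1 z.2 ^+ 2)%:E)%E.
  by apply: integral_ge0 => z _; rewrite lee_fin sqr_ge0.
have G0 : (0 <= G)%E by apply: le_trans tg; rewrite mule_ge0 ?lee_fin ?(ltW l0).
have F0 : (0 <= F)%E by apply: integral_ge0 => w _; exact: wt_sq_ge0.
(* With an infinite source integral the right-hand side is [+oo], as its other term is
   nonnegative. *)
have [Ffin|] := ltP F +oo%E; last first.
  rewrite leye_eq => /eqP ->; rewrite gt0_muley ?lte_fin// gt0_muley ?lte_fin//.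
  rewrite addye ?leey// gt_eqF// (lt_le_trans (ltNyr 0))// mule_ge0// lee_fin mulr_ge0 ?(ltW Cc)//.
have msf : measurable_fun setT (slab T f) by exact: measurable_slab.
have LBh := LB.
set Y := (\sum_i \int[PP]_w (wt w.1 * slab T (sob_dir S i) w ^+ 2)%:E)%E in LBh *.
have Yi0 i : (0 <= \int[PP]_w (wt w.1 * slab T (sob_dir S i) w ^+ 2)%:E)%E.
  by apply: integral_ge0 => w _; exact: wt_sq_ge0.
have Y0 : (0 <= Y)%E by apply: sume_ge0.
have Yfin : Y \is a fin_num.
  rewrite /Y sum_fin_num; apply/allP => /= _ /mapP[i _ ->].
  by rewrite ge0_fin_numE//; apply: wt_sq_fin; exact: sob_dir_L2.
set L2 := (\int[PP]_w (wt w.1 * L w ^+ 2)%:E)%E in LBh.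
have L20 : (0 <= L2)%E by apply: integral_ge0 => w _; exact: wt_sq_ge0.
have L2fin : L2 \is a fin_num.
  rewrite ge0_fin_numE//; apply: (le_lt_trans LBh).
  by rewrite -(fineK Yfin) -EFinM ltry.
set Z2 := (\int[PP]_w (wt w.1 * Z w ^+ 2)%:E)%E.
have Z20 : (0 <= Z2)%E by apply: integral_ge0 => w _; exact: wt_sq_ge0.
have ZFL : (Z2 <= 2%:E * F + 2%:E * L2)%E.
  rewrite -!ge0_integralZl//; last 4 first.
  - exact: measurable_wt_sq.
  - by move=> w _; exact: wt_sq_ge0.
  - exact: measurable_wt_sq.
  - by move=> w _; exact: wt_sq_ge0.
  rewrite -ge0_integralD//; last 4 first.
  - by move=> w _; rewrite mule_ge0 ?wt_sq_ge0.
  - by apply: measurable_funeM; exact: measurable_wt_sq.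
  - by move=> w _; rewrite mule_ge0 ?wt_sq_ge0.
  - by apply: measurable_funeM; exact: measurable_wt_sq.
  apply: ge0_le_integral => //.
  - by move=> w _; exact: wt_sq_ge0.
  - exact: measurable_wt_sq.
  - by apply: emeasurable_funD; apply: measurable_funeM; exact: measurable_wt_sq.
  move=> w _; rewrite -!EFinM -EFinD lee_fin.
  have -> : Z w = slab T f w - L w by rewrite fE addrK.
  have -> : 2 * (wt w.1 * slab T f w ^+ 2) + 2 * (wt w.1 * L w ^+ 2) =
    wt w.1 * (2 * slab T f w ^+ 2 + 2 * L w ^+ 2) by ring.
  apply: ler_wpM2l => //.
  by rewrite -subr_ge0 (_ : _ - _ = (slab T f w + L w) ^+ 2) ?sqr_ge0//; ring.
have Ffn : F \is a fin_num by rewrite ge0_fin_numE.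
have Z2fin : Z2 \is a fin_num.
  rewrite ge0_fin_numE//; apply: (le_lt_trans ZFL).
  by rewrite -(fineK Ffn) -(fineK L2fin) -!EFinM -EFinD ltry.
(* The weighted integral is finite and the weight is at least 1. *)
have sZ : sqint PP Z.
  split => //; apply: (@le_lt_trans _ _ Z2); last by rewrite -ge0_fin_numE.
  apply: ge0_le_integral => //.
  - by move=> w _; rewrite lee_fin sqr_ge0.
  - exact: meas_sq.
  - exact: measurable_wt_sq.
  - by move=> w _; rewrite lee_fin ler_peMl ?sqr_ge0// wt_ge1.
have core := carleman_heat S a0 nu1 l0 sZ (wZ sZ).
rewrite -ge0_sume_distrr// -/Y -/Z2 in core.
set Xe := (\int[PP]_w (wt w.1 * slab T V w ^+ 2)%:E)%E in core *.
have X0 : (0 <= Xe)%E by apply: integral_ge0 => w _; exact: wt_sq_ge0.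
have Xfin : Xe \is a fin_num by rewrite ge0_fin_numE//; apply: wt_sq_fin; exact: (sob_L2 S).
set VT := (\int[TT]_z (V T z.1 z.2 ^+ 2)%:E)%E in tg VT0 core.
have VTfin : VT \is a fin_num.
  by rewrite ge0_fin_numE//; have [] := sob_slice_L2 S (t := T); rewrite ?lexx ?ltW.
apply: (@le_trans _ _ (carleman_const%:E * (T%:E * F) + (carleman_const * wt T)%:E * (lam%:E * VT))%E); last first.
  by apply: leeD => //; apply: lee_wpmul2l => //; rewrite lee_fin mulr_ge0 ?(ltW Cc).
move: core ZFL LBh X0 Y0 F0 VT0 L20.
rewrite -(fineK Xfin) -(fineK Yfin) -(fineK Ffn) -(fineK L2fin) -(fineK Z2fin) -(fineK VTfin).
rewrite -!EFinM -!EFinD !lee_fin => core ZFL LB' X0 Y0 F0 VT0 L20.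
exact: carleman_arith ZFL LB'.
Qed.

End assembly.

(** * The estimate for the operator applied to a Sobolev function *)

Section sobolev_estimate.
Context {R : realType} (d : nat) (T a nu M : R).
Hypotheses (T0 : 0 < T) (a0 : 0 < a) (nu1 : 1 < nu) (M0 : 0 < M).
Local Notation RR := (measurableTypeR R).
Local Notation X := 'rV[R]_d.
Local Notation U := (uniform_prob T0).
Local Notation tau := (torus_leb R d).
Local Notation TT := (torus2 R d).
Local Notation PP := (cylinder d T0).
Local Notation Q := (@Q R d T).
Local Notation mQ := (fun f : R -> X -> X -> R => measurable_fun Q (fun q => f q.1.1 q.1.2 q.2)).

(** Extracts the five separate bounds by [M] from the single bound on the sum of the norms. *)
Lemma adde5_le (n1 n2 n3 n4 n5 n : \bar R) : (n1 + n2 + n3 + n4 + n5 <= n)%E ->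
  (0 <= n1)%E -> (0 <= n2)%E -> (0 <= n3)%E -> (0 <= n4)%E -> (0 <= n5)%E ->
  [/\ (n1 <= n)%E, (n2 <= n)%E, (n3 <= n)%E, (n4 <= n)%E & (n5 <= n)%E].
Proof.
move=> h p1 p2 p3 p4 p5.
have q2 := adde_ge0 p1 p2; have q3 := adde_ge0 q2 p3; have q4 := adde_ge0 q3 p4.
have h5 : (n5 <= n)%E by apply: le_trans h; rewrite leeDr.
have {}h : (n1 + n2 + n3 + n4 <= n)%E by apply: le_trans h; rewrite leeDl.
have h4 : (n4 <= n)%E by apply: le_trans h; rewrite leeDr.
have {}h : (n1 + n2 + n3 <= n)%E by apply: le_trans h; rewrite leeDl.
have h3 : (n3 <= n)%E by apply: le_trans h; rewrite leeDr.
have {}h : (n1 + n2 <= n)%E by apply: le_trans h; rewrite leeDl.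
have h2 : (n2 <= n)%E by apply: le_trans h; rewrite leeDr.
by have h1 : (n1 <= n)%E by apply: le_trans h; rewrite leeDl.
Qed.

Lemma coefficient_bound_ae (b : R -> X -> X) (A : R -> X -> 'M[R]_d) (m : R -> X -> R)
    (K : R -> X -> X -> R) : coefficient_bound T M b A m K ->
  [/\ {ae U, forall t, 0 < t < T -> {ae tau, forall x, `|fnorm (b t x)| <= M}},
      {ae U, forall t, 0 < t < T -> {ae tau, forall x, `|fnorm (A t x)| <= M}},
      {ae U, forall t, 0 < t < T -> {ae tau, forall x, `|m t x| <= M}},
      {ae U, forall t, 0 < t < T -> {ae TT, forall z, `|fnorm (Dx K t z.1 z.2)| <= M}} &
      {ae U, forall t, 0 < t < T -> {ae TT, forall z, `|fnorm (Dy K t z.1 z.2)| <= M}}].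
Proof.
rewrite /coefficient_bound.
set n1 := norm_Linf_QT T (fun t x => fnorm (b t x)).
set n2 := norm_Linf_QT T (fun t x => fnorm (A t x)).
set n3 := norm_Linf_QT T m.
set n4 := norm_Linf_Q T (fun t x y => fnorm (Dx K t x y)).
set n5 := norm_Linf_Q T (fun t x y => fnorm (Dy K t x y)).
move=> h; have [h1 h2 h3 h4 h5] := adde5_le h (Lnorm_ge0 _ _ _) (Lnorm_ge0 _ _ _) (Lnorm_ge0 _ _ _) (Lnorm_ge0 _ _ _) (Lnorm_ge0 _ _ _).
split.
- exact: norm_Linf_QT_ae h1.
- exact: norm_Linf_QT_ae h2.
- exact: norm_Linf_QT_ae h3.
- exact: norm_Linf_Q_ae h4.
- exact: norm_Linf_Q_ae h5.
Qed.

Variables (b : R -> X -> X) (A : R -> X -> 'M[R]_d) (m : R -> X -> R) (K1 K2 : R -> X -> X -> R).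
Hypothesis mb : forall i, mQ (fun t x y => b t x 0 i).
Hypothesis mA : forall i j, mQ (fun t x y => A t x i j).
Hypothesis mm : mQ (fun t x y => m t x).
Hypothesis mq1 : forall i, mQ (fun t x y => Dx K1 t x y 0 i).
Hypothesis mp2 : forall i, mQ (fun t x y => Dy K2 t x y 0 i).
Hypothesis bd1 : coefficient_bound T M b A m K1.
Hypothesis p2M : {ae U, forall t, 0 < t < T -> {ae TT, forall z, `|fnorm (Dy K2 t z.1 z.2)| <= M}}.
Local Notation B := (lower_const d M).

Lemma sum_sob_dir (V : R -> X -> X -> R) (S : sobolev T V) lam :
  (\sum_i \int[PP]_w (weight a nu lam w.1 * slab T (sob_dir S i) w ^+ 2)%:E =
   \sum_i \int[PP]_w (weight a nu lam w.1 * slab T (fun t x y => sob_x S t x y 0 i) w ^+ 2)%:E +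
   \sum_i \int[PP]_w (weight a nu lam w.1 * slab T (fun t x y => sob_y S t x y 0 i) w ^+ 2)%:E)%E.
Proof. by rewrite big_sumType. Qed.

Lemma carleman_sobolev (V : R -> X -> X -> R) (S : sobolev T V) (lam : R) :
  carleman_lam a nu B <= lam -> carleman a nu lam (carleman_const a nu) S (LK b A m K1 K2 S).
Proof.
move=> hlam; have [e1 e2 e3 e4 _] := coefficient_bound_ae bd1.
have mx i : mQ (fun t x y => sob_x S t x y 0 i) by have [] := sob_x_L2 S i.
have my i : mQ (fun t x y => sob_y S t x y 0 i) by have [] := sob_y_L2 S i.
have sZ := sqint_sob_heat T0 S; have [mZ _] := sZ.
have mL := measurable_slab_lower mb mA mm mq1 mp2 mx my.
have E w : slab T (LK b A m K1 K2 S) w =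
    slab T (sob_heat S) w + slab T (lower b A m (Dx K1) (Dy K2) (sob_x S) (sob_y S)) w.
  by rewrite /slab; case: ifP => _; [rewrite /LK /sob_heat /lower !addrA|rewrite addr0].
have B0 := lower_const_ge0 d M.
have mw := measurable_weight a nu lam.
have w0 (t : RR) : 0 <= weight a nu lam t by exact/ltW/weight_gt0.
have LB := lower_bound mb mA mm mq1 mp2 mx my M0 mw w0 e1 e2 e3 e4 p2M.
rewrite -sum_sob_dir in LB.
have mf : mQ (LK b A m K1 K2 S).
  apply: measurable_slab_inv.
  by apply: (@eq_measurable_fun _ _ _ _ _ _ _ (fun w _ => esym (E w))); exact: measurable_funD.
exact: (carleman_of_heat a0 nu1 B0 hlam mf mZ mL E (fun _ => sob_weak_heat T0 S) LB).
Qed.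

End sobolev_estimate.

(** * Classical integration by parts *)

Lemma Rintegral_prod2 {R : realType} {d1 d2 : measure_display} {X1 : measurableType d1} {X2 : measurableType d2}
    (m1 : probability X1 R) (m2 : probability X2 R) (f : X1 * X2 -> R) B :
  measurable_fun setT f -> (forall z, `|f z| <= B) ->
  \int[(m1 \x m2)%E]_z f z = \int[m2]_y \int[m1]_x f (x, y).
Proof.
move=> mf fB; have fi := @integrable_bounded _ _ _ (m1 \x m2)%E f B mf fB.
rewrite /Rintegral; congr fine; rewrite -integral21_prod_meas1//.
apply: eq_integral => y _; rewrite /fubini_G fineK//.
apply: integrable_fin_num => //; apply: (@integrable_bounded _ _ _ m1 (fun x => f (x, y)) B) => //.
by apply: (measurableT_comp mf); exact: measurable_fun_pair.
Qed.

(** * Integration in a single coordinate of the torus *)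

Section cube_resampling.
Context {R : realType}.
Local Notation RR := (measurableTypeR R).
Local Notation U01 := (uniform_prob (@ltr01 R)).

Definition tuple_set n (p : n.-tuple RR) (i : 'I_n) (s : RR) : n.-tuple RR :=
  [tuple if j == i then s else tnth p j | j < n].

Lemma tuple_set_cons0 n (p : n.-tuple RR) (r s : RR) :
  tuple_set (tuple_cons (r, p)) ord0 s = tuple_cons (s, p).
Proof.
apply: eq_from_tnth => j; rewrite tnth_mktuple.
case: (unliftP ord0 j) => [k|] ->; last by rewrite eqxx tnth0.
by rewrite eq_sym (negPf (neq_lift _ _)) !tnthS.
Qed.

Lemma tuple_set_consS n (p : n.-tuple RR) (i : 'I_n) (r s : RR) :
  tuple_set (tuple_cons (r, p)) (lift ord0 i) s = tuple_cons (r, tuple_set p i s).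
Proof.
apply: eq_from_tnth => j; rewrite tnth_mktuple.
case: (unliftP ord0 j) => [k|] ->; last by rewrite (negPf (neq_lift _ _)) !tnth0.
by rewrite (inj_eq lift_inj) !tnthS tnth_mktuple.
Qed.

(* The cube measure is unchanged when a coordinate is resampled. *)
Lemma cube_null n (i : 'I_n) (G : n.-tuple RR -> R) B : measurable_fun setT G ->
  (forall p, `|G p| <= B) -> (forall p, \int[U01]_s G (tuple_set p i s) = 0) ->
  \int[unit_cube R n]_p G p = 0.
Proof.
elim: n => [|n ih] in i G B *; first by case: i.
move=> mG GB G0; pose P : probability (RR * n.-tuple RR)%type R := (U01 \x unit_cube R n)%E.
have mc : measurable_fun setT (fun w : RR * n.-tuple RR => G (tuple_cons w)).
  exact: (measurableT_comp mG (@measurable_tuple_cons R n)).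
transitivity (\int[P]_w G (tuple_cons w)).
  exact: (@Rintegral_distribution _ _ _ _ _ P (@tuple_cons R n) G mG).
have ic : P.-integrable setT (EFin \o (fun w => G (tuple_cons w))).
  exact: (@integrable_bounded _ _ _ P _ B).
case: (unliftP ord0 i) => [k|] ik.
  rewrite (Rintegral_prod ic) -[RHS](_ : \int[U01]_s (0 : R) = 0); last by rewrite /Rintegral integral0.
  apply: eq_Rintegral => s _; apply: (ih k _ B).
  - by apply: (measurableT_comp mc); exact: measurable_fun_pair.
  - by move=> p; exact: GB.
  - move=> p; rewrite -[RHS](G0 (tuple_cons (s, p))); apply: eq_Rintegral => r _.
    by rewrite ik tuple_set_consS.
rewrite (@Rintegral_prod2 _ _ _ _ _ U01 (unit_cube R n) _ B mc)// -[RHS](_ : \int[unit_cube R n]_s (0 : R) = 0); last by rewrite /Rintegral integral0.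
apply: eq_Rintegral => p _; rewrite -[RHS](G0 (tuple_cons (0, p))); apply: eq_Rintegral => r _.
by rewrite ik tuple_set_cons0.
Qed.

Variable n : nat.
Local Notation X := 'rV[R]_n.
Local Notation tau := (torus_leb R n).

Definition row_set (x : X) (i : 'I_n) (s : R) : X := x + (s - x 0 i) *: delta_mx 0 i.

Lemma row_setE x i s j : row_set x i s 0 j = if j == i then s else x 0 j.
Proof.
rewrite !mxE eqxx/=; case: eqP => [->|_]; last by rewrite mulr0 addr0.
by rewrite mulr1 addrC subrK.
Qed.

(** Fubini in the coordinate [i] alone, phrased so that the torus need not be split into a
    product. *)
Lemma torus_null (i : 'I_n) (F : X -> R) B : measurable_fun setT F -> (forall x, `|F x| <= B) ->
  (forall x, \int[U01]_s F (row_set x i s) = 0) -> \int[tau]_x F x = 0.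
Proof.
move=> mF FB F0; transitivity (\int[unit_cube R n]_p F (tuple_row p)).
  exact: (@Rintegral_distribution _ _ _ _ _ (unit_cube R n) (@tuple_row R n) F mF).
apply: (@cube_null n i _ B) => //.
  exact: (measurableT_comp mF (@measurable_tuple_row R n)).
move=> p; rewrite -[RHS](F0 (tuple_row p)); apply: eq_Rintegral => s _; congr F.
by apply/rowP => j; rewrite row_setE !mxE tnth_mktuple.
Qed.

Definition box : set X := [set x | forall i, 0 <= x 0 i <= 1].

(** For each coordinate, [torus_null] applies to the indicator of the points where it leaves
    [[0, 1]], because a resampled coordinate almost surely lies in [[0, 1]]. *)
Lemma torus_box : {ae tau, forall x, box x}.
Proof.
suff h (i : 'I_n) : {ae tau, forall x : X, 0 <= x 0 i <= 1}.
  exact: ae_all_fin.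
pose N := (fun x : X => x 0 i : RR) @^-1` (~` [set` `[0, 1]]).
have mI : measurable (~` [set` `[(0 : R), 1]] : set RR) by apply: measurableC; exact: measurable_itv.
have mN : measurable N by rewrite -[X in measurable X]setTI; apply: measurable_row_coord.
suff N0 : tau N = 0%E.
  by exists N; split=> // x /= hx; rewrite /N/= in_itv.
have iN : \int[tau]_x (\1_N x : R) = 0.
  apply: (@torus_null i _ 1); first exact: measurable_indic.
    by move=> x; rewrite indicE ger0_norm//; case: (_ \in _).
  move=> x; transitivity (\int[U01]_(s in setT) (0 : R)); last by rewrite /Rintegral integral0.
  apply: ae_eq_Rintegral => //.
    rewrite (_ : (fun s : RR => \1_N (row_set x i s)) = \1_(~` [set` `[(0 : R), 1]])); first exact: measurable_indic.
    apply/funext => s; rewrite !indicE; congr (nat_of_bool _)%:R.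
    by apply/idP/idP => /set_mem h; apply/mem_set; move: h; rewrite /N/= row_setE eqxx.
  apply: ae_imp (uniform_itv (@ltr01 R)) => s /andP[s0 s1].
  rewrite indicE memNset// /N/= row_setE eqxx in_itv/= => h; apply: h.
  by rewrite !ltW.
have : (\int[tau]_x (\1_N x)%:E)%E = 0%E.
  have fin : (\int[tau]_x (\1_N x)%:E)%E \is a fin_num.
    by rewrite integral_indic// setIT fin_num_measure.
  by rewrite -(fineK fin) -/(Rintegral tau setT \1_N) iN.
by rewrite integral_indic// setIT.
Qed.

(** Retraction onto the compact box: it makes continuous functions bounded on the whole space
    without changing them almost everywhere. *)
Definition clamp_row (x : X) : X := \row_i clampT 1 (x 0 i).

Lemma clamp_row_box x : box (clamp_row x).
Proof. by move=> i; rewrite mxE; exact: (clampT_itv ltr01). Qed.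

Lemma clamp_rowE x : box x -> clamp_row x = x.
Proof. by move=> bx; apply/rowP => i; rewrite mxE clampTE. Qed.

Lemma continuous_clamp_row : continuous clamp_row.
Proof.
move=> x; have FF : Filter (nbhs x) by exact: nbhs_filter.
apply: cvg_row_fun => i; under eq_fun do rewrite mxE; rewrite mxE.
apply: (@cvg_comp _ _ _ (fun x : X => x 0 i) (clampT 1) _ (nbhs (x 0 i))).
  exact: coord_continuous.
exact: (@continuous_clampT R 1).
Qed.

Lemma compact_box : compact box.
Proof.
have := @rV_compact R n (fun=> [set` `[(0 : R), 1]]) (fun=> @segment_compact R 0 1).
congr compact; apply/seteqP; split => x h i; have := h i; by rewrite /= in_itv.
Qed.

End cube_resampling.

(** * Continuous functions on the open cylinder *)

Section continuous_slices.
Context {R : realType} (d : nat) (T : R).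
Hypothesis T0 : 0 < T.
Local Notation RR := (measurableTypeR R).
Local Notation X := 'rV[R]_d.
Local Notation U01 := (uniform_prob (@ltr01 R)).
Local Notation tau := (torus_leb R d).
Local Notation TT := (torus2 R d).
Implicit Types f g : R -> X -> X -> R.

Definition contQ f := {within [set w : R * X * X | 0 < w.1.1 < T],
  continuous (fun w : R * X * X => f w.1.1 w.1.2 w.2)}.

Lemma open_slab : open [set w : R * X * X | 0 < w.1.1 < T].
Proof.
have -> : [set w : R * X * X | 0 < w.1.1 < T] = (fun w : R * X * X => w.1.1) @^-1` [set` `]0, T[].
  by apply/seteqP; split => q /=; rewrite in_itv.
apply: open_comp; last exact: itv_open.
by move=> q _; apply: (@cvg_comp _ _ _ fst fst _ (nbhs q.1)); exact: cvg_fst.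
Qed.

Lemma contQP f : contQ f <-> forall w : R * X * X, 0 < w.1.1 < T ->
  {for w, continuous (fun w : R * X * X => f w.1.1 w.1.2 w.2)}.
Proof.
rewrite /contQ continuous_open_subspace; last exact: open_slab.
by split=> h w hw; apply: h; [exact: mem_set|exact: set_mem].
Qed.

Lemma contQB f g : contQ f -> contQ g -> contQ (fun t x y => f t x y - g t x y).
Proof. by move=> /contQP cf /contQP cg; apply/contQP => w hw; apply: cvgB; [exact: cf|exact: cg]. Qed.

Lemma contQN f : contQ f -> contQ (fun t x y => - f t x y).
Proof. by move=> /contQP cf; apply/contQP => w hw; apply: cvgN; exact: cf. Qed.

Lemma contQ_sum (I : finType) (f : I -> R -> X -> X -> R) : (forall i, contQ (f i)) ->
  contQ (fun t x y => \sum_i f i t x y).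
Proof.
move=> cf; apply/contQP => w hw.
apply: (@cvg_big R I +%R 0 predT) => [z|i _]; first exact: add_continuous.
by have /contQP := cf i; apply.
Qed.

Lemma contQ_slice f t : contQ f -> 0 < t < T -> continuous (fun z : X * X => f t z.1 z.2).
Proof.
move=> /contQP cf t01 z.
apply: (@cvg_comp _ _ _ (fun z : X * X => (t, z.1, z.2)) (fun w : R * X * X => f w.1.1 w.1.2 w.2) _ (nbhs (t, z.1, z.2))).
  apply: (@cvg_pair _ _ _ _ (nbhs (t, z.1)) (nbhs z.2)); last exact: cvg_snd.
  by apply: (@cvg_pair _ _ _ _ (nbhs t) (nbhs z.1)); [exact: cvg_cst|exact: cvg_fst].
exact: (cf (t, z.1, z.2)).
Qed.

Lemma contQ_time f x y t : contQ f -> 0 < t < T -> {for t, continuous (fun t => f t x y)}.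
Proof.
move=> /contQP cf t01.
apply: (@cvg_comp _ _ _ (fun t : R => (t, x, y)) (fun w : R * X * X => f w.1.1 w.1.2 w.2) _ (nbhs (t, x, y))).
  apply: (@cvg_pair _ _ _ _ (nbhs (t, x)) (nbhs y)); last exact: cvg_cst.
  by apply: (@cvg_pair _ _ _ _ (nbhs t) (nbhs x)); [exact: cvg_id|exact: cvg_cst].
exact: (cf (t, x, y)).
Qed.

(** The time window is closed inside [(0, T)], where continuity is known. The two space sets are
    free, so that fixed points outside the box are covered as well. *)
Lemma contQ_bounded_on f s s' (C1 C2 : set X) : compact C1 -> compact C2 -> contQ f -> 0 < s -> s' < T ->
  exists2 B, 0 <= B & forall t x y, s <= t <= s' -> C1 x -> C2 y -> `|f t x y| <= B.
Proof.
move=> c1 c2 /contQP cf s0 s'T; pose K : set (R * X * X) := ([set` `[s, s']] `*` C1) `*` C2.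
have cK : compact K by apply: compact_setX => //; apply: compact_setX => //; exact: segment_compact.
have cfK : {within K, continuous (fun w : R * X * X => f w.1.1 w.1.2 w.2)}.
  apply: continuous_in_subspaceT => w /set_mem [[/= hw _] _]; apply: cf.
  by move: hw; rewrite in_itv/= => /andP[h1 h2]; rewrite (lt_le_trans s0)//= (le_lt_trans h2).
have [M [_ hM]] := compact_bounded (continuous_compact cfK cK).
exists `|M + 1| => // t x y ts bx bY; apply: le_trans (ler_norm _).
apply: (hM (M + 1)); first by rewrite ltrDl.
by exists (t, x, y) => //; split => //; split => //=; rewrite in_itv.
Qed.

Lemma contQ_bounded f s s' : contQ f -> 0 < s -> s' < T ->
  exists2 B, 0 <= B & forall t x y, s <= t <= s' -> box x -> box y -> `|f t x y| <= B.
Proof. exact: contQ_bounded_on (@compact_box R d) (@compact_box R d). Qed.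

Lemma contQ_measurable f : contQ f -> measurable_fun (@Q R d T) (fun q => f q.1.1 q.1.2 q.2).
Proof. exact: continuous_measurable_Q. Qed.

Lemma ae_box2 : {ae TT, forall z, box z.1 /\ box z.2}.
Proof.
have h := @torus_box R d.
exact: (@filterS2 _ _ (ae_filter_ringOfSetsType TT) _ _ _ (fun z a b => conj a b) (ae_torus2_fst h) (ae_torus2_snd h)).
Qed.

Lemma contQ_sqint f t : contQ f -> 0 < t < T -> sqint TT (fun z => f t z.1 z.2).
Proof.
move=> cf t01; have /andP[t0 tT] := t01.
have mf := mQ_slice (contQ_measurable cf) t01.
have [B B0 hB] := contQ_bounded cf t0 tT.
split => //; apply: (@le_lt_trans _ _ (\int[TT]_z (B ^+ 2)%:E)%E); last first.
  have -> : (\int[TT]_z (B ^+ 2)%:E = (B ^+ 2)%:E)%E; last by rewrite ltry.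
  by rewrite integral_cst// -[RHS]mule1; congr (_ * _)%E; exact: (@probability_setT _ _ _ TT).
apply: ae_ge0_le_integral => //.
- by move=> z _; rewrite lee_fin sqr_ge0.
- exact: meas_sq.
- by move=> z _; rewrite lee_fin sqr_ge0.
- apply: ae_imp ae_box2 => z [b1 b2] _; rewrite lee_fin -[X in X <= _]real_normK ?num_real//.
  by rewrite lerXn2r ?nnegrE// hB// !lexx.
Qed.

Lemma is_derive_row_set (G : X -> R) (D : X -> R) (y : X) (i : 'I_d) (s : R) :
  derivable G (row_set y i s) (delta_mx 0 i) -> 'D_(delta_mx 0 i) G (row_set y i s) = D (row_set y i s) ->
  is_derive s (1 : R) (fun s => G (row_set y i s)) (D (row_set y i s)).
Proof.
move=> h1 h2.
have E : (fun h : R => h^-1 *: (((fun s => G (row_set y i s)) \o shift s) (h *: (1 : R)) - (fun s => G (row_set y i s)) s)) =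
    (fun h : R => h^-1 *: ((G \o shift (row_set y i s)) (h *: delta_mx 0 i) - G (row_set y i s))).
  apply/funext => h; congr (_ *: (G _ - _)).
  by rewrite /row_set /= [h *: (1 : R)]mulr1 addrCA -scalerDl; congr (_ + _ *: _); ring.
by split; rewrite /derivable /derive E.
Qed.

(** In the coordinate [i] alone, the integral over [[0, 1]] is an increment of [G] over one period,
    hence 0; [torus_null] extends this to the torus. *)
Lemma torus_ibp (G D : X -> R) (i : 'I_d) : continuous D ->
  (forall x, derivable G x (delta_mx 0 i) /\ 'D_(delta_mx 0 i) G x = D x) ->
  (forall x, G (x + delta_mx 0 i) = G x) -> \int[tau]_x D x = 0.
Proof.
move=> cD dG pG.
(* [D] is regarded as a function on the cylinder, constant in [t] and [y], so that the measurability
   and bounds proved there apply; [T / 2] is just some interior time. *)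
have cD3 : contQ (fun _ x _ => D x).
  apply/contQP => w _; apply: (@cvg_comp _ _ _ (fun w : R * X * X => w.1.2) D _ (nbhs w.1.2)); last exact: cD.
  by apply: (@cvg_comp _ _ _ fst snd _ (nbhs w.1)); [exact: cvg_fst|exact: cvg_snd].
have Th : 0 < T / 2 < T by have h := T0; apply/andP; split; lra.
have mD : measurable_fun setT D by exact: mQ_slice1 (contQ_measurable cD3) Th.
have [h1 h2] := andP Th; have [B B0 hB] := contQ_bounded cD3 h1 h2.
have cDc : contQ (fun _ x _ => D (clamp_row x)).
  apply/contQP => w _; apply: (@cvg_comp _ _ _ (fun w : R * X * X => clamp_row w.1.2) D _ (nbhs (clamp_row w.1.2))); last exact: cD.
  apply: (@cvg_comp _ _ _ (fun w : R * X * X => w.1.2) (@clamp_row R d) _ (nbhs w.1.2)); last exact: continuous_clamp_row.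
  by apply: (@cvg_comp _ _ _ fst snd _ (nbhs w.1)); [exact: cvg_fst|exact: cvg_snd].
have mDc : measurable_fun setT (fun x => D (clamp_row x)) by apply: (@mQ_slice1 R d T (fun _ x => D (clamp_row x)) (T / 2)) => //; exact: (contQ_measurable cDc).
(* [torus_null] wants a bound on the whole space, which [D] has on the box only. *)
transitivity (\int[tau]_x D (clamp_row x)).
  apply: ae_eq_Rintegral => //.
  by apply: ae_imp (@torus_box R d) => x bx; rewrite clamp_rowE.
apply: (@torus_null R d i _ B) => //.
  move=> x; apply: (hB (T / 2) (clamp_row x) (clamp_row x)); [by rewrite lexx|exact: clamp_row_box|exact: clamp_row_box].
move=> x; pose y := clamp_row x.
have crs : continuous (row_set y i).
  move=> s; apply: cvg_row_fun => j; rewrite row_setE; under eq_fun do rewrite row_setE.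
  by case: ifP => _; [exact: cvg_id|exact: cvg_cst].
have cDr : continuous (fun s : R => D (row_set y i s)).
  move=> s; apply: (@cvg_comp _ _ _ (row_set y i) D _ (nbhs (row_set y i s))); [exact: crs|exact: cD].
transitivity (\int[U01]_s D (row_set y i s)).
  apply: ae_eq_Rintegral.
  - apply: continuous_measurable_fun => s.
    apply: (@cvg_comp _ _ _ (fun s => clamp_row (row_set x i s)) D _ (nbhs (clamp_row (row_set x i s)))); last exact: cD.
    apply: (@cvg_comp _ _ _ (row_set x i) (@clamp_row R d) _ (nbhs (row_set x i s))); last exact: continuous_clamp_row.
    apply: cvg_row_fun => j; rewrite row_setE; under eq_fun do rewrite row_setE.
    by case: ifP => _; [exact: cvg_id|exact: cvg_cst].
  - exact: continuous_measurable_fun.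
  - apply: ae_imp (uniform_itv (@ltr01 R)) => s /andP[s0 s1]; congr D.
    apply/rowP => j; rewrite mxE !row_setE mxE; case: ifP => // _.
    by rewrite clampTE// !ltW.
apply: (@unif_Rintegral_derive0 R (fun s => G (row_set y i s))) => // [s|].
  by have [e1 e2] := dG (row_set y i s); exact: is_derive_row_set.
rewrite -(pG (row_set y i 0)); congr G.
by apply/rowP => j; rewrite !mxE; ring.
Qed.

End continuous_slices.

(** * Classical derivatives in Fourier coordinates *)

Section classical_coefficients.
Context {R : realType} (d : nat) (T : R).
Hypothesis T0 : 0 < T.
Local Notation RR := (measurableTypeR R).
Local Notation X := 'rV[R]_d.
Local Notation U := (uniform_prob T0).
Local Notation tau := (torus_leb R d).
Local Notation TT := (torus2 R d).
Local Notation PP := (cylinder d T0).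
Local Notation J := (d.-tuple nat * d.-tuple nat)%type.
Local Notation I := ('I_d + 'I_d)%type.
Local Notation contQ := (@contQ R d T).
Implicit Types (j : J) (u v : R -> X -> X -> R).

Lemma Rintegral_torus2_swap (f : X * X -> R) : measurable_fun setT f ->
  \int[TT]_z f z = \int[TT]_z f (z.2, z.1).
Proof.
move=> mf; have me : measurable_fun setT (EFin \o f) by exact/measurable_EFinP.
rewrite /Rintegral integralE [in RHS]integralE; congr (fine (_ - _)%E).
- rewrite ge0_torus2_swap//; last exact: measurable_funepos.
  by apply: eq_integral => z _; rewrite !funeposE.
- rewrite ge0_torus2_swap//; last exact: measurable_funeneg.
  by apply: eq_integral => z _; rewrite !funenegE.
Qed.

(** Symmetry between the two slots, by which integration by parts in [x] follows from that in
    [y]. *)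
Lemma ip_mode_swap (f : X * X -> R) j : measurable_fun setT f ->
  ip TT f (mode j) = ip TT (fun z => f (z.2, z.1)) (mode (j.2, j.1)).
Proof.
move=> mf; rewrite /ip Rintegral_torus2_swap.
  by apply: eq_Rintegral => z _; rewrite /mode/= [row_basis j.1 _ * _]mulrC.
by apply: measurable_funM => //; exact: measurable_mode.
Qed.

Lemma contQ_swap u : contQ u -> contQ (fun t x y => u t y x).
Proof.
move=> /contQP cu; apply/contQP => w hw.
apply: (@cvg_comp _ _ _ (fun w : R * X * X => (w.1.1, w.2, w.1.2)) (fun w : R * X * X => u w.1.1 w.1.2 w.2) _
  (nbhs (w.1.1, w.2, w.1.2))); last exact: (cu (w.1.1, w.2, w.1.2)).
have c11 : w'.1.1 @[w' --> w] --> w.1.1.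
  by apply: (@cvg_comp _ _ _ fst fst _ (nbhs w.1)); exact: cvg_fst.
have c12 : w'.1.2 @[w' --> w] --> w.1.2.
  by apply: (@cvg_comp _ _ _ fst snd _ (nbhs w.1)); [exact: cvg_fst|exact: cvg_snd].
have c2 : w'.2 @[w' --> w] --> w.2 by exact: cvg_snd.
apply: (@cvg_pair _ _ _ _ (nbhs (w.1.1, w.2)) (nbhs w.1.2)) => //.
exact: (@cvg_pair _ _ _ _ (nbhs w.1.1) (nbhs w.2)).
Qed.

(** For fixed [x], [v e_j + r u e_j'] is the derivative in [y_i] of the periodic function [u e_j],
    so [torus_ibp] makes its integral vanish. *)
Lemma mode_ibp_y u v (i : 'I_d) t j : contQ u -> contQ v -> 0 < t < T ->
  (forall x y, derivable (u t x) y (delta_mx 0 i) /\ 'D_(delta_mx 0 i) (u t x) y = v t x y) ->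
  (forall x y, u t x (y + delta_mx 0 i) = u t x y) ->
  ip TT (fun z => v t z.1 z.2) (mode j) =
  - (mode_rate j (inr i) * ip TT (fun z => u t z.1 z.2) (mode (mode_swap j (inr i)))).
Proof.
move=> cu cv t01 du pu; set j' := mode_swap j (inr i); set r := mode_rate j (inr i).
have su := contQ_sqint cu t01; have sv := contQ_sqint cv t01.
have iu := sqint_mul su (sqint_mode j'); have iv := sqint_mul sv (sqint_mode j).
have ih : TT.-integrable setT (EFin \o (fun z : X * X => v t z.1 z.2 * mode j z + r * (u t z.1 z.2 * mode j' z))).
  by apply: integrableDr => //; exact: integrableZlr.
have : \int[TT]_z (v t z.1 z.2 * mode j z + r * (u t z.1 z.2 * mode j' z)) = 0.
  transitivity (\int[tau]_x \int[tau]_y (v t x y * mode j (x, y) + r * (u t x y * mode j' (x, y)))).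
    exact: (@Rintegral_prod _ _ _ _ _ tau tau _ ih).
  transitivity (\int[tau]_x (0 : R)); last by rewrite /Rintegral integral0.
  apply: eq_Rintegral => x _.
  apply: (@torus_ibp R d T T0 (fun y => u t x y * (row_basis j.1 x * row_basis j.2 y)) _ i).
  - have cxy (f : X * X -> R) : continuous f -> continuous (fun y => f (x, y)).
      move=> cf y; apply: (@cvg_comp _ _ _ (fun y : X => (x, y)) f _ (nbhs (x, y))); last exact: cf.
      move=> A [[B C] /= [Bx Cy] BC]; apply: filterS Cy => z Cz; apply: BC; split => //=.
      exact: nbhs_singleton Bx.
    have cm (k : J) : continuous (mode k : X * X -> R).
      move=> z; apply: cvgM.
        apply: (@cvg_comp _ _ _ (fun z : X * X => z.1) (row_basis k.1) _ (nbhs z.1)); [exact: cvg_fst|exact: continuous_row_basis].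
      by apply: (@cvg_comp _ _ _ (fun z : X * X => z.2) (row_basis k.2) _ (nbhs z.2)); [exact: cvg_snd|exact: continuous_row_basis].
    apply: (cxy (fun z => v t z.1 z.2 * mode j z + r * (u t z.1 z.2 * mode j' z))) => z.
    apply: cvgD; first by apply: cvgM; [exact: (contQ_slice cv t01)|exact: cm].
    by apply: cvgM; [exact: cvg_cst|apply: cvgM; [exact: (contQ_slice cu t01)|exact: cm]].
  - move=> y; have [d1 d2] := du x y.
    have [g1 g2] := grad_scale_row_basis (row_basis j.1 x) j.2 y.
    split; first by apply: derivableM => //; exact: g1.
    have e2 := g2 i; rewrite mxE in e2.
    rewrite (deriveM d1 (g1 i)) e2 d2 /GRing.scale/= /r /j' /mode/=.
    by ring.
  - by move=> y; rewrite pu periodic_row_basis.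
rewrite RintegralD ?RintegralZl//; last exact: integrableZlr.
by move/eqP; rewrite addr_eq0 => /eqP.
Qed.

Lemma mode_ibp_x u v (i : 'I_d) t j : contQ u -> contQ v -> 0 < t < T ->
  (forall x y, derivable (u t ^~ y) x (delta_mx 0 i) /\ 'D_(delta_mx 0 i) (u t ^~ y) x = v t x y) ->
  (forall x y, u t (x + delta_mx 0 i) y = u t x y) ->
  ip TT (fun z => v t z.1 z.2) (mode j) =
  - (mode_rate j (inl i) * ip TT (fun z => u t z.1 z.2) (mode (mode_swap j (inl i)))).
Proof.
move=> cu cv t01 du pu.
have := @mode_ibp_y _ _ i t (j.2, j.1) (contQ_swap cu) (contQ_swap cv) t01 (fun x y => du y x) (fun x y => pu y x).
have mu := mQ_slice (contQ_measurable cu) t01; have mv := mQ_slice (contQ_measurable cv) t01.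
by rewrite (ip_mode_swap _ mv) (ip_mode_swap _ mu) => ->.
Qed.

Lemma derive_periodic (f : X -> R) (v w x : X) : (forall z, f (z + w) = f z) ->
  'D_v f (x + w) = 'D_v f x.
Proof.
move=> pf; have E : (fun h : R => h^-1 *: ((f \o shift (x + w)) (h *: v) - f (x + w))) =
    (fun h : R => h^-1 *: ((f \o shift x) (h *: v) - f x)).
  by apply/funext => h /=; rewrite addrA !pf.
by rewrite /derive E.
Qed.

Variable K : R -> X -> X -> R.
Hypothesis cK : contQ K.
Hypothesis cKt : contQ (Dt K).
Hypothesis dKt : forall t x y, 0 < t < T -> derivable (fun s => K s x y) t 1.
Hypothesis cKx : forall i, contQ (fun t x y => Dx K t x y 0 i).
Hypothesis cKy : forall i, contQ (fun t x y => Dy K t x y 0 i).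
Hypothesis dKx : forall t x y, 0 < t < T -> has_grad (fun z => K t z y) x.
Hypothesis dKy : forall t x y, 0 < t < T -> has_grad (K t x) y.
Hypothesis cKxx : forall i, contQ (fun t x y => hess (fun z => K t z y) x i i).
Hypothesis cKyy : forall i, contQ (fun t x y => hess (K t x) y i i).
Hypothesis dKxx : forall t x y, 0 < t < T -> has_hess (fun z => K t z y) x.
Hypothesis dKyy : forall t x y, 0 < t < T -> has_hess (K t x) y.
Hypothesis pKx : forall t y, 0 < t < T -> torus_periodic (fun x => K t x y).
Hypothesis pKy : forall t x, 0 < t < T -> torus_periodic (K t x).

Definition cls_dir (i : I) : R -> X -> X -> R :=
  match i with inl i => fun t x y => Dx K t x y 0 i | inr i => fun t x y => Dy K t x y 0 i end.

Definition cls_dir2 (i : I) : R -> X -> X -> R :=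
  match i with inl i => fun t x y => hess (fun z => K t z y) x i i
  | inr i => fun t x y => hess (K t x) y i i end.

Lemma contQ_cls_dir i : contQ (cls_dir i).
Proof. by case: i => i; [exact: cKx|exact: cKy]. Qed.

Lemma contQ_cls_dir2 i : contQ (cls_dir2 i).
Proof. by case: i => i; [exact: cKxx|exact: cKyy]. Qed.

Lemma coef_slabE u j t : 0 < t < T -> coef (slab T u) j t = ip TT (fun z => u t z.1 z.2) (mode j).
Proof. by move=> t01; apply: eq_Rintegral => z _; rewrite slabE. Qed.

(** The formula of [ae_vcoef_dir], now at every interior time; this is the link between classical
    and weak derivatives. *)
Lemma coef_cls_dir i j t : 0 < t < T ->
  coef (slab T (cls_dir i)) j t = - (mode_rate j i * vcoef T K (mode_swap j i) t).
Proof.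
move=> t01; rewrite vcoefE// !coef_slabE//; case: i => i.
- refine (@mode_ibp_x K (fun t x y => Dx K t x y 0 i) i t j cK (@cKx i) t01 _ _) => x y; last exact: pKx.
  by split; [exact: dKx|rewrite /Dx mxE].
- apply: (@mode_ibp_y K (fun t x y => Dy K t x y 0 i) i t j cK (@cKy i) t01) => x y; last exact: pKy.
  by split; [exact: dKy|rewrite /Dy mxE].
Qed.

Lemma coef_cls_dir2 i j t : 0 < t < T ->
  coef (slab T (cls_dir2 i)) j t = - (mode_rate j i ^+ 2 * vcoef T K j t).
Proof.
move=> t01.
have -> : coef (slab T (cls_dir2 i)) j t = - (mode_rate j i * coef (slab T (cls_dir i)) (mode_swap j i) t).
  rewrite !coef_slabE//; case: i => i.
  - refine (@mode_ibp_x (fun t x y => Dx K t x y 0 i) (fun t x y => hess (fun z => K t z y) x i i) i t j (@cKx i) (@cKxx i) t01 _ _) => x y.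
      by split; [exact: dKxx|rewrite /hess mxE].
    by rewrite /Dx !mxE; apply: derive_periodic => z; exact: pKx.
  - apply: (@mode_ibp_y (fun t x y => Dy K t x y 0 i) (fun t x y => hess (K t x) y i i) i t j (@cKy i) (@cKyy i) t01) => x y.
      by split; [exact: dKyy|rewrite /hess mxE].
    by rewrite /Dy !mxE; apply: derive_periodic => z; exact: pKy.
by rewrite coef_cls_dir// mode_swapK mulrN opprK mulrA mode_rate_mul_swap mulNr.
Qed.

(** If the given interval is empty the cutoff is identically 0 and any interior point serves;
    [clampI] is a retraction only when [s <= s']. *)
Lemma time_test_supp_le th : time_test T th -> exists s s', [/\ 0 < s, s <= s', s' < T &
  forall t, ~~ (s <= t <= s') -> th t = 0].
Proof.
move=> tth; have [s [s' [s0 s'T h]]] := time_test_supp tth.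
have [ss'|s's] := leP s s'; first by exists s, s'.
exists (T / 2), (T / 2); have hT := T0; split => //; [lra|lra|] => t _; apply: h.
by apply/negP => /andP[h1 h2]; have := le_lt_trans h2 (lt_le_trans s's h1); rewrite ltxx.
Qed.

Lemma near_zero_derive1 (f : R -> R) t : (\forall s \near t, f s = 0) -> is_derive t (1 : R) f 0.
Proof.
move=> fn; have f0 := nbhs_singleton fn.
have c : h^-1 *: ((f \o shift t) (h *: (1 : R)) - f t) @[h --> (0 : R)^'] --> (0 : R).
  apply: cvg_near_cst; rewrite f0.
  have : \forall h \near (0 : R)^', f (h *: (1 : R) + t) = 0.
    apply: nbhs_dnbhs; have cs : (h *: (1 : R) + t) @[h --> (0 : R)] --> t.
      rewrite -[X in _ --> X](add0r t) -[X in X + t](scale0r (1 : R)).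
      by apply: cvgD; [apply: cvgZr_tmp; exact: cvg_id|exact: cvg_cst].
    exact: cs _ fn.
  by apply: filterS => h /= ->; rewrite subrr scaler0.
by split; [apply/cvg_ex; exists 0|exact: cvg_lim c].
Qed.

Definition clampI (s s' t : R) : R := Num.min (Num.max t s) s'.

Lemma clampI_itv s s' t : s <= s' -> s <= clampI s s' t <= s'.
Proof. by move=> ss; rewrite /clampI le_min le_max lexx orbT ss/= ge_min lexx orbT. Qed.

Lemma clampIE s s' t : s <= t <= s' -> clampI s s' t = t.
Proof. by move=> /andP[h1 h2]; rewrite /clampI max_l// min_l. Qed.

Lemma continuous_clampI s s' : continuous (clampI s s').
Proof.
move=> t; rewrite /clampI.
apply: (@continuous_min R R (fun t => Num.max t s) (fun=> s') t); last exact: cst_continuous.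
apply: (@continuous_max R R id (fun=> s) t); last exact: cst_continuous.
exact: cvg_id.
Qed.

Section time_parts.
Variables (th : R -> R) (s s' : R).
Hypotheses (tth : time_test T th) (s0 : 0 < s) (ss' : s <= s') (s'T : s' < T).
Hypothesis th0 : forall t, ~~ (s <= t <= s') -> th t = 0.

Lemma time_test_derive0 t : ~~ (s <= t <= s') -> derive1 th t = 0.
Proof.
move=> nt; suff h : is_derive t (1 : R) th 0 by rewrite derive1E; exact: derive_val.
apply: near_zero_derive1.
have oI : nbhs t (~` [set` `[s, s']]).
  apply: open_nbhs_nbhs; split; last by rewrite /= in_itv; exact/negP.
  by apply: closed_openC; exact: itv_closed.
by apply: filterS oI => r; rewrite /= in_itv => nr; apply: th0; exact/negP.
Qed.

(** A bounded function on the whole space that agrees with [f] at times in [[s, s']] and at points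
    of the box, that is, wherever the cutoff lives up to a null set. *)
Definition tfun (f : R -> X -> X -> R) t x y : R := f (clampI s s' t) (clamp_row x) (clamp_row y).

Lemma contQ_tfun f : contQ f -> contQ (tfun f).
Proof.
move=> /contQP cf; apply/contQP => w _.
pose p (w : R * X * X) : R * X * X := (clampI s s' w.1.1, clamp_row w.1.2, clamp_row w.2).
apply: (@cvg_comp _ _ _ p (fun w : R * X * X => f w.1.1 w.1.2 w.2) _ (nbhs (p w))); last first.
  apply: (cf (p w)); rewrite /p/=; have /andP[h1 h2] := clampI_itv w.1.1 ss'.
  by rewrite (lt_le_trans s0)//= (le_lt_trans h2).
have c11 : clampI s s' w'.1.1 @[w' --> w] --> clampI s s' w.1.1.
  apply: (@cvg_comp _ _ _ (fun w : R * X * X => w.1.1) (clampI s s') _ (nbhs w.1.1)); last exact: continuous_clampI.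
  by apply: (@cvg_comp _ _ _ fst fst _ (nbhs w.1)); exact: cvg_fst.
have c12 : clamp_row w'.1.2 @[w' --> w] --> clamp_row w.1.2.
  apply: (@cvg_comp _ _ _ (fun w : R * X * X => w.1.2) (@clamp_row R d) _ (nbhs w.1.2)); last exact: continuous_clamp_row.
  by apply: (@cvg_comp _ _ _ fst snd _ (nbhs w.1)); [exact: cvg_fst|exact: cvg_snd].
have c2 : clamp_row w'.2 @[w' --> w] --> clamp_row w.2.
  by apply: (@cvg_comp _ _ _ (fun w : R * X * X => w.2) (@clamp_row R d) _ (nbhs w.2)); [exact: cvg_snd|exact: continuous_clamp_row].
apply: (@cvg_pair _ _ _ _ (nbhs (clampI s s' w.1.1, clamp_row w.1.2)) (nbhs (clamp_row w.2))) => //.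
exact: (@cvg_pair _ _ _ _ (nbhs (clampI s s' w.1.1)) (nbhs (clamp_row w.1.2))).
Qed.

Lemma tfun_bounded f : contQ f -> exists2 B, 0 <= B & forall t x y, `|tfun f t x y| <= B.
Proof.
move=> cf; have [B B0 hB] := contQ_bounded cf s0 s'T; exists B => // t x y.
by apply: hB; [exact: clampI_itv|exact: clamp_row_box|exact: clamp_row_box].
Qed.

(** The integrand is the time derivative of [K * th], which vanishes at both ends. *)
Lemma Rintegral_time_parts x y : box x -> box y ->
  \int[U]_t (tfun (Dt K) t x y * th t + tfun K t x y * derive1 th t) = 0.
Proof.
move=> bx bY; pose q (t : R) := tfun (Dt K) t x y * th t + tfun K t x y * derive1 th t.
have ct f : contQ f -> continuous (fun t => tfun f t x y).
  move=> cf t.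
  apply: (@cvg_comp _ _ _ (clampI s s') (fun t => f t (clamp_row x) (clamp_row y)) _ (nbhs (clampI s s' t))).
    exact: continuous_clampI.
  apply: (@contQ_time R d T f (clamp_row x) (clamp_row y) _ cf).
  have /andP[h1 h2] := clampI_itv t ss'.
  by rewrite (lt_le_trans s0)//= (le_lt_trans h2).
have cth := time_test_cont tth; have cdth := time_test_continuous tth.
have cq : continuous q.
  by move=> t; apply: cvgD; apply: cvgM; [exact: (ct _ cKt)|exact: cth|exact: (ct _ cK)|exact: cdth].
pose g (t : R) := K t x y * th t.
have gd (t : R) : 0 < t < T -> is_derive t (1 : R) g (q t).
  move=> t01.
  have h1 : is_derive t (1 : R) (fun s => K s x y) (Dt K t x y).
    by rewrite /Dt derive1E; apply/derivableP; exact: dKt.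
  have h2 : is_derive t (1 : R) th (derive1 th t).
    by rewrite derive1E; apply/derivableP; exact: (time_test_derivable tth).
  apply: (is_derive_eq (is_deriveM h1 h2)).
  rewrite /q /tfun !clamp_rowE// /GRing.scale/=.
  have [ht|nt] := boolP (s <= t <= s'); first by rewrite clampIE//; ring.
  by rewrite th0// time_test_derive0// !mulr0 mul0r addr0.
(* Continuity of [K] is known on the open interval. Near 0 and [T] the product is 0, which gives the
   continuity at the ends that the fundamental theorem asks for. *)
have g0 (t : R) : t < s \/ s' < t -> \forall r \near t, g r = 0.
  have z r : ~~ (s <= r <= s') -> g r = 0 by move=> nr; rewrite /g th0// mulr0.
  move=> ts; have oI : nbhs t (~` [set` `[s, s']]).
    apply: open_nbhs_nbhs; split; last first.
      by rewrite /= in_itv/= => /andP[h1 h2]; case: ts => ts; [move: (lt_le_trans ts h1)|move: (lt_le_trans ts h2)]; rewrite ltxx.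
    by apply: closed_openC; exact: itv_closed.
  by apply: filterS oI => r; rewrite /= in_itv => nr; apply: z; exact/negP.
have c0 (t : R) : t < s \/ s' < t -> {for t, continuous g}.
  move=> h; have := g0 t h => hn; rewrite /prop_for /continuous_at (nbhs_singleton hn).
  by apply: cvg_near_cst.
have cw : {within `[0, T], continuous q} by exact: continuous_subspaceT.
rewrite uniform_Rintegral//; last exact: continuous_measurable_fun.
have -> : \int[@lebesgue_measure R]_(t in `[0, T]) q t = g T - g 0.
  rewrite /Rintegral (@continuous_FTC2 _ _ g)//.
  - split=> [t||].
    + by rewrite in_itv/= => ht; have [] := gd t ht.
    + by apply/cvg_at_right_filter; apply: c0; left.
    + by apply/cvg_at_left_filter; apply: c0; right.
  - by move=> t; rewrite in_itv/= => ht; rewrite derive1E; have h := gd t ht; exact: derive_val.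
rewrite (nbhs_singleton (g0 T (or_intror s'T))) (nbhs_singleton (g0 0 (or_introl s0))).
by rewrite subrr mulr0.
Qed.

Section piece.
Variables (f : R -> X -> X -> R) (h : R -> R) (j : J).
Hypotheses (cf : contQ f) (ch : continuous h) (h0 : forall t, ~~ (s <= t <= s') -> h t = 0).

(** The integrand behind the integral of [coef] against [h], written as one bounded function on the
    cylinder so that Fubini applies in either order. *)
Definition piece : RR * (X * X) -> R :=
  slab T (fun t x y => tfun f t x y * h t * (row_basis j.1 x * row_basis j.2 y)).

Lemma cutoff_bounded : exists2 B, 0 <= B & forall t, `|h t| <= B.
Proof.
have chc : continuous (h \o clampT T).
  move=> t; apply: (@cvg_comp _ _ _ (clampT T) h _ (nbhs (clampT T t))); last exact: ch.
  exact: (@continuous_clampT R T).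
have [B B0 hB] := clampT_bounded T0 chc; exists B => // t.
have [/andP[st ts']|nt] := boolP (s <= t <= s'); last by rewrite h0// normr0.
by rewrite -(@clampTE R T t) ?hB// (ltW (lt_le_trans s0 st)) (ltW (le_lt_trans ts' s'T)).
Qed.

Lemma measurable_piece : measurable_fun setT piece.
Proof.
apply: measurable_slab; apply: measurable_funM.
  apply: measurable_funM; first exact: contQ_measurable (contQ_tfun cf).
  apply: measurable_funTS; apply: (@measurableT_comp _ _ _ _ _ _ (h : RR -> R)).
    exact: continuous_measurable_fun.
  exact: (measurableT_comp measurable_fst measurable_fst).
apply: measurable_funTS; apply: measurable_funM.
  apply: (measurableT_comp (measurable_row_basis j.1)).
  exact: (measurableT_comp measurable_snd measurable_fst).
exact: (measurableT_comp (measurable_row_basis j.2) measurable_snd).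
Qed.

Lemma piece_bounded : exists B, forall w, `|piece w| <= B.
Proof.
have [B1 B10 hB1] := tfun_bounded cf; have [B2 B20 hB2] := cutoff_bounded.
have [B3 B30 hB3] := @mode_bounded R d j.
exists (B1 * B2 * B3) => w; rewrite /piece /slab; case: ifP => _; last by rewrite normr0 !mulr_ge0.
by rewrite !normrM; apply: ler_pM => //; [exact: ler_pM|rewrite -normrM; exact: (hB3 w.2)].
Qed.

Lemma piece_coef : measurable_fun setT (slab T f) ->
  \int[U]_t (coef (slab T f) j t * h t) = \int[PP]_w piece w.
Proof.
move=> mf; have [B hB] := piece_bounded; have mp := measurable_piece.
have ip := @integrable_bounded _ _ _ PP piece B mp hB.
transitivity (\int[U]_t \int[TT]_z piece (t, z)); last first.
  exact/esym/(@Rintegral_prod _ _ _ _ _ TT U piece ip).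
apply: ae_eq_Rintegral.
- by apply: measurable_funM; [exact: measurable_coef|exact: continuous_measurable_fun].
- exact: (@measurable_Rintegral _ _ _ _ _ TT piece mp).
apply: ae_imp (uniform_itv T0) => t t01.
have sf := contQ_sqint cf t01.
rewrite coef_slabE// /ip mulrC -RintegralZl//; last exact: sqint_mul sf (sqint_mode j).
have [ht|nt] := boolP (s <= t <= s'); last first.
  by apply: eq_Rintegral => z _; rewrite /piece slabE// h0// mulr0 !mul0r.
apply: ae_eq_Rintegral.
- apply: measurable_funM => //; apply: measurable_funM; first by have [] := sf.
  exact: measurable_mode.
- exact: measurable_slice.
- apply: ae_imp (@ae_box2 R d) => z [b1 b2].
  by rewrite /piece slabE// /tfun !clamp_rowE// clampIE// /mode; ring.
Qed.

End piece.

(** Both sides are integrals of [piece]s. With the time integral taken first, their sum vanishes at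
    almost every [(x, y)] by [Rintegral_time_parts]. *)
Lemma vcoef_time_parts (S : sobolev T K) j : \int[U]_t (vcoef T K j t * derive1 th t) =
  - \int[U]_t (coef (slab T (Dt K)) j t * th t).
Proof.
have cth := time_test_cont tth; have cdth := time_test_continuous tth.
have mK := measurable_slab (contQ_measurable cK); have mKt := measurable_slab (contQ_measurable cKt).
pose p1 := piece K (derive1 th) j; pose p2 := piece (Dt K) th j.
have m1 : measurable_fun setT p1 by exact: measurable_piece.
have m2 : measurable_fun setT p2 by exact: measurable_piece.
have [B1 hB1] := piece_bounded j cK cdth time_test_derive0.
have [B2 hB2] := piece_bounded j cKt cth th0.
have i1 := @integrable_bounded _ _ _ PP p1 B1 m1 hB1.
have i2 := @integrable_bounded _ _ _ PP p2 B2 m2 hB2.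
transitivity (\int[U]_t (coef (slab T K) j t * derive1 th t)).
  apply: ae_eq_Rintegral.
  - by apply: measurable_funM; [exact: measurable_vcoef|exact: continuous_measurable_fun].
  - by apply: measurable_funM; [exact: measurable_coef|exact: continuous_measurable_fun].
  - by apply: ae_imp (uniform_itv T0) => t t01; rewrite vcoefE.
rewrite (piece_coef j cK cdth time_test_derive0 mK) (piece_coef j cKt cth th0 mKt).
apply/eqP; rewrite -addr_eq0 -RintegralD//; apply/eqP.
have ms : measurable_fun setT (fun w => p1 w + p2 w) by exact: measurable_funD.
have bs w : `|p1 w + p2 w| <= B1 + B2 by rewrite (le_trans (ler_normD _ _))// lerD.
transitivity (\int[TT]_z \int[U]_t (p1 (t, z) + p2 (t, z))).
  exact: (@Rintegral_prod2 _ _ _ _ _ U TT (fun w => p1 w + p2 w) (B1 + B2) ms bs).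
transitivity (\int[TT]_z (0 : R)); last by rewrite /Rintegral integral0.
apply: ae_eq_Rintegral => //.
  apply: (@measurable_Rintegral _ _ _ _ _ U (fun v : (X * X) * RR => p1 (v.2, v.1) + p2 (v.2, v.1))).
  apply: (measurableT_comp ms).
  by apply: measurable_fun_pair; [exact: measurable_snd|exact: measurable_fst].
apply: ae_imp (@ae_box2 R d) => z [b1 b2].
have mq : measurable_fun setT (fun t : RR => p1 (t, z) + p2 (t, z)).
  by apply: (measurableT_comp ms); exact: measurable_fun_pair.
transitivity (\int[U]_t (mode j z * (tfun (Dt K) t z.1 z.2 * th t + tfun K t z.1 z.2 * derive1 th t))).
  have ct f : contQ f -> measurable_fun setT (fun t : RR => tfun f t z.1 z.2).
    move=> cf; apply: continuous_measurable_fun => t.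
    apply: (@cvg_comp _ _ _ (clampI s s') (fun t => f t (clamp_row z.1) (clamp_row z.2)) _ (nbhs (clampI s s' t))).
      exact: continuous_clampI.
    apply: (@contQ_time R d T f (clamp_row z.1) (clamp_row z.2) _ cf).
    have /andP[h1 h2] := clampI_itv t ss'.
    by rewrite (lt_le_trans s0)//= (le_lt_trans h2).
  apply: ae_eq_Rintegral => //.
  - apply: measurable_funM => //; apply: measurable_funD; apply: measurable_funM;
      try exact: ct; exact: continuous_measurable_fun.
  - apply: ae_imp (uniform_itv T0) => t t01.
    by rewrite /p1 /p2 /piece !slabE// /mode; ring.
have ct f : contQ f -> measurable_fun setT (fun t : RR => tfun f t z.1 z.2).
  move=> cf; apply: continuous_measurable_fun => t.
  apply: (@cvg_comp _ _ _ (clampI s s') (fun t => f t (clamp_row z.1) (clamp_row z.2)) _ (nbhs (clampI s s' t))).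
    exact: continuous_clampI.
  apply: (@contQ_time R d T f (clamp_row z.1) (clamp_row z.2) _ cf).
  have /andP[h1 h2] := clampI_itv t ss'.
  by rewrite (lt_le_trans s0)//= (le_lt_trans h2).
have [C1 C10 hC1] := tfun_bounded cK; have [C2 C20 hC2] := tfun_bounded cKt.
have [D1 D10 hD1] := cutoff_bounded cdth time_test_derive0; have [D2 D20 hD2] := cutoff_bounded cth th0.
rewrite RintegralZl//; first by rewrite Rintegral_time_parts// mulr0.
apply: (@integrable_bounded _ _ _ U _ (C2 * D2 + C1 * D1)).
- apply: measurable_funD; apply: measurable_funM; try exact: ct; exact: continuous_measurable_fun.
- by move=> t; rewrite (le_trans (ler_normD _ _))// lerD// normrM ler_pM.
Qed.

End time_parts.

Definition cls_heat t x y : R := - Dt K t x y - lapx K t x y - lapy K t x y.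

Lemma cls_heatE t x y : cls_heat t x y = - Dt K t x y - \sum_i cls_dir2 i t x y.
Proof.
rewrite big_sumType/= /cls_heat opprD addrA; congr (_ - _ - _).
- by apply: eq_bigr => i _; rewrite /hess mxE.
- by apply: eq_bigr => i _; rewrite /hess mxE.
Qed.

Lemma cls_weak_heat (S : sobolev T K) : weak_heat T0 K (slab T cls_heat).
Proof.
move=> j th tth; have [s [s' [s0 ss' s'T th0]]] := time_test_supp_le tth.
rewrite (vcoef_time_parts tth s0 ss' s'T th0 S); congr (- _).
have c2 : contQ (fun t x y => \sum_i cls_dir2 i t x y) by apply: contQ_sum => i; exact: contQ_cls_dir2.
have cH : contQ cls_heat.
  rewrite (_ : cls_heat = (fun t x y => - Dt K t x y - \sum_i cls_dir2 i t x y)).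
    by apply: contQB => //; exact: contQN.
  by apply/funext => t; apply/funext => x; apply/funext => y; exact: cls_heatE.
have mth : measurable_fun setT (th : RR -> R).
  by apply: continuous_measurable_fun; exact: (time_test_cont tth).
apply: ae_eq_Rintegral.
- by apply: measurable_funM => //; apply: measurable_coef; apply: measurable_slab; exact: contQ_measurable.
- apply: measurable_funM => //; apply: measurable_funB; first by apply: measurable_funM => //; exact: measurable_vcoef.
  by apply: measurable_coef; apply: measurable_slab; exact: contQ_measurable.
apply: ae_imp (uniform_itv T0) => t t01; congr (_ * _).
have sm := sqint_mode j; have st := contQ_sqint cKt t01.
have s2 i := contQ_sqint (@contQ_cls_dir2 i) t01.
have -> : coef (slab T cls_heat) j t = - coef (slab T (Dt K)) j t - \sum_i coef (slab T (cls_dir2 i)) j t.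
  rewrite !coef_slabE//.
  under eq_bigr => i _ do rewrite coef_slabE//.
  rewrite -(@ip_suml _ _ _ TT _ (index_enum I) (fun i z => cls_dir2 i t z.1 z.2))//.
  rewrite -mulN1r -ipZl// -ipBl//; [|exact: sqintZ|exact: sqint_sum].
  by congr (ip TT _ _); apply/funext => z; rewrite cls_heatE mulN1r.
under eq_bigr => i _ do rewrite coef_cls_dir2//.
rewrite sumrN -mulr_suml /mode_eigen; ring.
Qed.

(** At almost every time the two derivatives have the same Fourier coefficients, hence by Parseval
    the same norm. *)
Lemma weighted_cls_dir a nu lam (S : sobolev T K) i :
  (\int[PP]_w (weight a nu lam w.1 * slab T (cls_dir i) w ^+ 2)%:E =
   \int[PP]_w (weight a nu lam w.1 * slab T (sob_dir S i) w ^+ 2)%:E)%E.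
Proof.
have ms := measurable_slab (contQ_measurable (@contQ_cls_dir i)).
have mw := measurable_weight a nu lam.
have mW (F : RR * (X * X) -> R) : measurable_fun setT F ->
    measurable_fun setT (fun w : RR * (X * X) => (weight a nu lam w.1 * F w ^+ 2)%:E).
  move=> mF; apply/measurable_EFinP; apply: measurable_funM; last exact: measurable_funX.
  exact: (measurableT_comp mw measurable_fst).
have W0 (F : RR * (X * X) -> R) w : (0 <= (weight a nu lam w.1 * F w ^+ 2)%:E)%E.
  by rewrite lee_fin mulr_ge0 ?sqr_ge0// ltW// weight_gt0.
have sd := L2_slab T0 (sob_dir_L2 S i); have [md _] := sd.
rewrite (ge0_cylinder T0 (mW _ ms) (W0 _)) (ge0_cylinder T0 (mW _ md) (W0 _)).
apply: ae_eq_integral => //.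
- exact: (@measurable_fun_fubini_tonelli_F _ _ _ _ _ TT _ (mW _ ms) (W0 _)).
- exact: (@measurable_fun_fubini_tonelli_F _ _ _ _ _ TT _ (mW _ md) (W0 _)).
have hh := @filterS2 _ _ (ae_filter_ringOfSetsType U) _ _ _ (fun z a b => conj a b) (sqint_slice sd) (ae_vcoef_dir T0 S).
apply: (@filterS2 _ _ (ae_filter_ringOfSetsType U)) hh (uniform_itv T0) => t [st hv] t01 _.
have sc := contQ_sqint (@contQ_cls_dir i) t01.
have sc' : sqint TT (fun z => slab T (cls_dir i) (t, z)).
  by rewrite (_ : (fun z => _) = (fun z => cls_dir i t z.1 z.2))//; apply/funext => z; rewrite slabE.
have E (F : X * X -> R) : sqint TT F ->
    (\int[TT]_z (weight a nu lam t * F z ^+ 2)%:E =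
     (weight a nu lam t)%:E * \esum_(j in [set: J]) ((ip TT F (mode j)) ^+ 2)%:E)%E.
  move=> sF; have [_ _ pv] := @parseval_mode R d; rewrite -(pv _ sF) -ge0_integralZl//.
  - by have [mF _] := sF; exact: meas_sq.
  - by move=> z _; rewrite lee_fin sqr_ge0.
  - by rewrite lee_fin ltW// weight_gt0.
rewrite (E (fun z => slab T (cls_dir i) (t, z)))// (E (fun z => slab T (sob_dir S i) (t, z)))//.
congr (_ * _)%E; apply: eq_esum => j _; congr ((_ ^+ 2)%:E).
transitivity (coef (slab T (cls_dir i)) j t) => //.
by rewrite coef_cls_dir// -hv.
Qed.

End classical_coefficients.

(** * Kernels of classical solutions *)

Section regularity.
Context {R : realType} (d : nat) (T : R).
Hypothesis T0 : 0 < T.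
Local Notation RR := (measurableTypeR R).
Local Notation X := 'rV[R]_d.
Local Notation P := (prob_torus R d).
Local Notation tau := (torus_leb R d).
Local Notation contQ := (@contQ R d T).
Local Notation mQ := (fun f : R -> X -> X -> R => measurable_fun (@Q R d T) (fun q => f q.1.1 q.1.2 q.2)).

(** Solutions are continuous only within the admissible times. This passes to a composition as soon
    as the inner map stays in that set near the point. *)
Lemma continuous_comp_within {A B C : topologicalType} (phi : A -> B) (S : set B) (g : B -> C) (x : A) :
  {within S, continuous g} -> S (phi x) -> phi y @[y --> x] --> phi x ->
  (\forall y \near x, S (phi y)) -> g (phi y) @[y --> x] --> g (phi x).
Proof.
move=> cg Sx cphi nS.
have h := (iffLR (subspace_continuousP _ _) cg) _ Sx.
apply: (@cvg_comp _ _ _ phi g _ (within S (nbhs (phi x)))); last exact: h.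
move=> N hN; have h1 : nbhs x (phi @^-1` [set y | S y -> N y]) := cphi _ hN.
by apply: filterS2 nS h1 => y Sy; apply.
Qed.

Lemma contQ_eq f g : contQ f -> (forall t x y, 0 < t < T -> f t x y = g t x y) -> contQ g.
Proof.
move=> cf fg; apply: subspace_eq_continuous cf.
by move=> w /set_mem hw; exact: fg.
Qed.

Lemma contQ_coord m n (f : R -> X -> X -> 'M[R]_(m, n)) i j :
  {within [set w : R * X * X | 0 < w.1.1 < T], continuous (fun w : R * X * X => f w.1.1 w.1.2 w.2)} ->
  contQ (fun t x y => f t x y i j).
Proof.
rewrite continuous_open_subspace; last exact: open_slab.
move=> cf; apply/contQP => w hw.
apply: (@cvg_comp _ _ _ (fun w : R * X * X => f w.1.1 w.1.2 w.2) (fun A : 'M[R]_(m, n) => A i j) _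
  (nbhs (f w.1.1 w.1.2 w.2))); last exact: coord_continuous.
by apply: cf; exact: mem_set.
Qed.

Lemma near_slab (w : R * X * X) : 0 < w.1.1 < T -> \forall w' \near w, 0 < w'.1.1 < T.
Proof. by move=> hw; apply: (open_nbhs_nbhs (A := [set w : R * X * X | 0 < w.1.1 < T])); split=> //; exact: open_slab. Qed.

(** * Coefficients and kernels along the flow of measures *)

Section along_flow.
Variables (H : X -> X -> R) (F G : X -> P -> R) (Us : R -> X -> P -> R) (dU : R -> X -> P -> X -> R).
Variables (m0 : P) (mu : R -> P) (m : R -> X -> R).
Hypotheses (hH : hamiltonian H) (hU : classical_solution T H F G Us dU) (hm : flow T H Us m0 mu m).

Lemma cvg_mu (w : R * X * X) : 0 < w.1.1 < T -> mu w'.1.1 @[w' --> w] --> mu w.1.1.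
Proof.
move=> hw; have le t : 0 < t < T -> 0 <= t <= T by case/andP => *; rewrite !ltW.
apply: (@continuous_comp_within _ _ _ (fun w : R * X * X => w.1.1) [set t | 0 <= t <= T] mu w (flow_cont hm)).
- exact: le.
- by apply: (@cvg_comp _ _ _ fst fst _ (nbhs w.1)); exact: cvg_fst.
- by apply: filterS (near_slab hw) => w'; exact: le.
Qed.

Lemma cvg_along_flow (w : R * X * X) : 0 < w.1.1 < T ->
  ((w'.1.1, w'.1.2, mu w'.1.1) : R * X * P) @[w' --> w] --> ((w.1.1, w.1.2, mu w.1.1) : R * X * P).
Proof.
move=> hw.
apply: (@cvg_pair _ _ _ _ (nbhs (w.1.1, w.1.2)) (nbhs (mu w.1.1))); last exact: cvg_mu.
apply: (@cvg_pair _ _ _ _ (nbhs w.1.1) (nbhs w.1.2)).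
  by apply: (@cvg_comp _ _ _ fst fst _ (nbhs w.1)); exact: cvg_fst.
by apply: (@cvg_comp _ _ _ fst snd _ (nbhs w.1)); [exact: cvg_fst|exact: cvg_snd].
Qed.

Lemma cvg_grad_value (w : R * X * X) : 0 < w.1.1 < T ->
  ((w'.1.2, grad (value Us mu w'.1.1) w'.1.2) : X * X) @[w' --> w] -->
  ((w.1.2, grad (value Us mu w.1.1) w.1.2) : X * X).
Proof.
move=> hw; have le t : 0 < t < T -> 0 <= t <= T by case/andP => *; rewrite !ltW.
apply: (@cvg_pair _ _ _ _ (nbhs w.1.2) (nbhs (grad (value Us mu w.1.1) w.1.2))).
  by apply: (@cvg_comp _ _ _ fst snd _ (nbhs w.1)); [exact: cvg_fst|exact: cvg_snd].
apply: (@continuous_comp_within _ _ _ (fun w : R * X * X => (w.1.1, w.1.2, mu w.1.1) : R * X * P)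
  [set w | 0 <= w.1.1 <= T] (fun w => DxU Us w.1.1 w.1.2 w.2) w (cs_grad_cont hU)).
- exact: le.
- exact: cvg_along_flow.
- by apply: filterS (near_slab hw) => w'; exact: le.
Qed.

Lemma contQ_coef_b i : contQ (fun t x y => coef_b H Us mu t x 0 i).
Proof.
apply: (@contQ_coord _ _ (fun t x y => coef_b H Us mu t x)).
rewrite continuous_open_subspace; last exact: open_slab.
move=> w /set_mem hw.
apply: (@cvg_comp _ _ _ (fun w : R * X * X => (w.1.2, grad (value Us mu w.1.1) w.1.2) : X * X)
  (fun w : X * X => DpH H w.1 w.2) _ (nbhs ((w.1.2, grad (value Us mu w.1.1) w.1.2) : X * X))).
  exact: cvg_grad_value.
have h : continuous (fun w : X * X => DpH H w.1 w.2) := hamiltonian_DpH hH.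
exact: (h (w.1.2, grad (value Us mu w.1.1) w.1.2)).
Qed.

Lemma contQ_coef_A i j : contQ (fun t x y => coef_A H Us mu t x i j).
Proof.
apply: (@contQ_coord _ _ (fun t x y => coef_A H Us mu t x)).
rewrite continuous_open_subspace; last exact: open_slab.
move=> w /set_mem hw.
apply: (@cvg_comp _ _ _ (fun w : R * X * X => (w.1.2, grad (value Us mu w.1.1) w.1.2) : X * X)
  (fun w : X * X => DppH H w.1 w.2) _ (nbhs ((w.1.2, grad (value Us mu w.1.1) w.1.2) : X * X))).
  exact: cvg_grad_value.
have h : continuous (fun w : X * X => DppH H w.1 w.2) := hamiltonian_DppH hH.
exact: (h (w.1.2, grad (value Us mu w.1.1) w.1.2)).
Qed.

Lemma contQ_flow_kernel : contQ (flow_kernel dU mu).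
Proof.
apply/contQP => w hw; have le t : 0 < t < T -> 0 <= t <= T by case/andP => *; rewrite !ltW.
apply: (@continuous_comp_within _ _ _ (fun w : R * X * X => (w.1.1, w.1.2, mu w.1.1, w.2) : R * X * P * X)
  [set w | 0 <= w.1.1.1 <= T] (fun w => dU w.1.1.1 w.1.1.2 w.1.2 w.2) w (cs_dm_cont hU)).
- exact: le.
- apply: (@cvg_pair _ _ _ _ (nbhs ((w.1.1, w.1.2, mu w.1.1) : R * X * P)) (nbhs w.2)); last exact: cvg_snd.
  exact: cvg_along_flow.
- by apply: filterS (near_slab hw) => w'; exact: le.
Qed.

Lemma flow_kernel_perx t y : 0 < t < T -> torus_periodic (fun x => flow_kernel dU mu t x y).
Proof. by move=> /andP[t0 tT]; apply: (cs_dm_per hU); rewrite !ltW. Qed.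

Lemma flow_kernel_pery t x : 0 < t < T -> torus_periodic (flow_kernel dU mu t x).
Proof. by move=> /andP[t0 tT]; have [h _ _ _] := @cs_dm _ _ _ _ _ _ _ _ hU t x (introT andP (conj (ltW t0) (ltW tT))); exact: h. Qed.

(** A probability density has total mass 1. This holds at every interior time, while the essential
    bound on [m] speaks of almost every time only. *)
Lemma flow_integrable t : 0 < t < T -> tau.-integrable setT (EFin \o m t).
Proof.
move=> t01; have [mt mB] := flow_density hm t01.
apply/integrableP; split; first exact/measurable_EFinP.
have := mB setT measurableT; rewrite (@probability_setT _ _ _ (mu t)) => h.
rewrite (eq_integral (fun x => (m t x)%:E)) ?h -?h ?ltry//.
by move=> x _; rewrite /= ger0_norm// (flow_ge0 hm).
Qed.

Lemma mQ_density : mQ (fun t x y => m t x).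
Proof.
have mQT : measurable (@QT R d T).
  have -> : @QT R d T = (fun q : RR * X => q.1) @^-1` [set` `]0, T[].
    by apply/seteqP; split => q /=; rewrite in_itv.
  rewrite -[X in measurable X]setTI; apply: measurable_fst => //; exact: measurable_itv.
apply: (@measurable_comp _ _ _ _ _ _ (@QT R d T) (fun q : RR * X => m q.1 q.2) _ fst mQT).
- by move=> _ [q hq <-].
- exact: (flow_meas hm).
- apply: measurable_funTS; exact: measurable_fst.
Qed.

End along_flow.

(** * Regularity of the difference of the kernels *)

Section kernels.
Variables K1 K2 : R -> X -> X -> R.
Hypotheses (h1 : C12_Q T K1) (h2 : C12_Q T K2).
Let K t x y := K1 t x y - K2 t x y.

Lemma gradB (f g : X -> R) x : has_grad f x -> has_grad g x ->
  has_grad (fun z => f z - g z) x /\ grad (fun z => f z - g z) x = grad f x - grad g x.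
Proof.
move=> df dg; split=> [i|]; first exact: derivableB.
by apply/rowP => i; rewrite !mxE; exact: (deriveB (df i) (dg i)).
Qed.

Lemma hessB (f g : X -> R) x : (forall z, has_grad f z) -> (forall z, has_grad g z) ->
  has_hess f x -> has_hess g x ->
  has_hess (fun z => f z - g z) x /\ hess (fun z => f z - g z) x = hess f x - hess g x.
Proof.
move=> df dg hf hg.
have E i : (fun z => grad (fun z => f z - g z) z 0 i) = (fun z => grad f z 0 i - grad g z 0 i).
  by apply/funext => z; have [_ ->] := gradB (df z) (dg z); rewrite !mxE.
split=> [i|]; first by rewrite E; have [] := gradB (hf i) (hg i).
apply/matrixP => i j; rewrite !mxE E; exact: (deriveB (hf i j) (hg i j)).
Qed.

Lemma DtB t x y : 0 < t < T -> derivable (fun s => K s x y) t 1 /\ Dt K t x y = Dt K1 t x y - Dt K2 t x y.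
Proof.
move=> t01; have d1 : derivable (fun s => K1 s x y) t 1 by exact: (C12_dt h1).
have d2 : derivable (fun s => K2 s x y) t 1 by exact: (C12_dt h2).
by split; [exact: derivableB|rewrite /Dt !derive1E; exact: deriveB].
Qed.

Lemma DxB t x y : 0 < t < T -> has_grad (fun z => K t z y) x /\ Dx K t x y = Dx K1 t x y - Dx K2 t x y.
Proof. by move=> t01; apply: gradB; [exact: (C12_gradx h1)|exact: (C12_gradx h2)]. Qed.

Lemma DyB t x y : 0 < t < T -> has_grad (K t x) y /\ Dy K t x y = Dy K1 t x y - Dy K2 t x y.
Proof. by move=> t01; apply: gradB; [exact: (C12_grady h1)|exact: (C12_grady h2)]. Qed.

Lemma hessxB t x y : 0 < t < T -> has_hess (fun z => K t z y) x /\
  hess (fun z => K t z y) x = hess (fun z => K1 t z y) x - hess (fun z => K2 t z y) x.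
Proof.
move=> t01; apply: hessB => [z|z||]; [exact: (C12_gradx h1)|exact: (C12_gradx h2)|exact: (C12_hessx h1)|exact: (C12_hessx h2)].
Qed.

Lemma hessyB t x y : 0 < t < T -> has_hess (K t x) y /\ hess (K t x) y = hess (K1 t x) y - hess (K2 t x) y.
Proof.
move=> t01; apply: hessB => [z|z||]; [exact: (C12_grady h1)|exact: (C12_grady h2)|exact: (C12_hessy h1)|exact: (C12_hessy h2)].
Qed.

Lemma contQ_Dt : contQ (Dt K).
Proof.
apply: (contQ_eq (contQB (C12_dt_cont h1) (C12_dt_cont h2))) => t x y t01.
by have [_ ->] := DtB x y t01.
Qed.

Lemma contQ_Dx i : contQ (fun t x y => Dx K t x y 0 i).
Proof.
apply: (contQ_eq (contQB (@contQ_coord  1 d (Dx K1) 0 i (C12_gradx_cont h1)) (@contQ_coord  1 d (Dx K2) 0 i (C12_gradx_cont h2)))) => t x y t01.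
by have [_ ->] := DxB x y t01; rewrite !mxE.
Qed.

Lemma contQ_Dy i : contQ (fun t x y => Dy K t x y 0 i).
Proof.
apply: (contQ_eq (contQB (@contQ_coord  1 d (Dy K1) 0 i (C12_grady_cont h1)) (@contQ_coord  1 d (Dy K2) 0 i (C12_grady_cont h2)))) => t x y t01.
by have [_ ->] := DyB x y t01; rewrite !mxE.
Qed.

Lemma submxE m n (A B : 'M[R]_(m, n)) i j : (A - B) i j = A i j - B i j.
Proof. by rewrite !mxE. Qed.

Lemma contQ_hessx i : contQ (fun t x y => hess (fun z => K t z y) x i i).
Proof.
apply: (contQ_eq (contQB (@contQ_coord _ _ (fun t x y => hess (fun z => K1 t z y) x) i i (C12_hessx_cont h1))
  (@contQ_coord _ _ (fun t x y => hess (fun z => K2 t z y) x) i i (C12_hessx_cont h2)))) => t x y t01.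
by have [_ e] := hessxB x y t01; rewrite e submxE.
Qed.

Lemma contQ_hessy i : contQ (fun t x y => hess (K t x) y i i).
Proof.
apply: (contQ_eq (contQB (@contQ_coord _ _ (fun t x y => hess (K1 t x) y) i i (C12_hessy_cont h1))
  (@contQ_coord _ _ (fun t x y => hess (K2 t x) y) i i (C12_hessy_cont h2)))) => t x y t01.
by have [_ e] := hessyB x y t01; rewrite e submxE.
Qed.

Lemma lapxB t x y : 0 < t < T -> lapx K t x y = lapx K1 t x y - lapx K2 t x y.
Proof.
move=> t01; have [_ e] := hessxB x y t01; rewrite /lapx /lap /div -sumrB; apply: eq_bigr => i _.
by have := congr1 (fun A : 'M[R]_d => A i i) e; rewrite !mxE.
Qed.

Lemma lapyB t x y : 0 < t < T -> lapy K t x y = lapy K1 t x y - lapy K2 t x y.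
Proof.
move=> t01; have [_ e] := hessyB x y t01; rewrite /lapy /lap /div -sumrB; apply: eq_bigr => i _.
by have := congr1 (fun A : 'M[R]_d => A i i) e; rewrite !mxE.
Qed.

End kernels.

(** The density is integrable and the other factors are bounded for [z] in the box, hence for almost
    every [z]. *)
Lemma nonlocal_integrable (m : R -> X -> R) (A : R -> X -> 'M[R]_d) (p q : R -> X -> X -> X) t x y :
  0 < t < T -> tau.-integrable setT (EFin \o m t) ->
  (forall i j, contQ (fun t x y => A t x i j)) -> (forall i, contQ (fun t x y => p t x y 0 i)) ->
  (forall i, contQ (fun t x y => q t x y 0 i)) ->
  tau.-integrable setT (EFin \o (fun z => m t z * dot (p t x z) (q t z y *m (A t z)^T))).
Proof.
move=> t01 mi cA cp cq; have /andP[t0 tT] := t01.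
have mm : measurable_fun setT (m t) by have := measurable_int _ mi; move/measurable_EFinP.
rewrite (_ : (fun z => _) = (fun z => \sum_k \sum_l m t z * (p t x z 0 k * (A t z k l * q t z y 0 l)))); last first.
  by apply/funext => z; rewrite dot_mul_tr mulr_sumr; apply: eq_bigr => k _; rewrite mulr_sumr.
apply: (@integrable_sumr _ _ _ tau) => k; apply: (@integrable_sumr _ _ _ tau) => l.
have mpair1 : measurable_fun setT (fun z : X => (x, z)) by exact: measurable_fun_pair.
have mpair2 : measurable_fun setT (fun z : X => (z, y)) by exact: measurable_fun_pair.
have mp : measurable_fun setT (fun z => p t x z 0 k).
  exact: (measurableT_comp (mQ_slice (contQ_measurable (@cp k)) t01) mpair1).
have mq : measurable_fun setT (fun z => q t z y 0 l).
  exact: (measurableT_comp (mQ_slice (contQ_measurable (@cq l)) t01) mpair2).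
have mA : measurable_fun setT (fun z => A t z k l).
  exact: (measurableT_comp (mQ_slice (contQ_measurable (@cA k l)) t01) mpair2).
(* [x] and [y] are arbitrary points, possibly outside the box, so they enter the compactness
   argument as singletons. *)
have cx : compact [set x] by exact: compact_set1.
have cy : compact [set y] by exact: compact_set1.
have [B1 B10 b1] := contQ_bounded_on cx (@compact_box R d) (@cp k) t0 tT.
have [B2 B20 b2] := contQ_bounded_on (@compact_box R d) cy (@cA k l) t0 tT.
have [B3 B30 b3] := contQ_bounded_on (@compact_box R d) cy (@cq l) t0 tT.
have tt : t <= t <= t by rewrite lexx.
pose B := B1 * (B2 * B3).
have /integrableP[_ fin] := integrableZlr B (integrable_norm mi).
have mF : measurable_fun setT (fun z => m t z * (p t x z 0 k * (A t z k l * q t z y 0 l))).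
  by apply: measurable_funM => //; apply: measurable_funM => //; exact: measurable_funM.
apply/integrableP; split; first exact/measurable_EFinP.
apply: le_lt_trans fin; apply: ae_ge0_le_integral => //.
- by apply/measurable_EFinP; exact: measurableT_comp.
- apply/measurable_EFinP; apply: measurableT_comp => //; apply: measurable_funM => //; exact: measurableT_comp.
- apply: ae_imp (@torus_box R d) => z bz _ /=; rewrite lee_fin !normrM normr_id mulrC.
  apply: ler_wpM2r => //; rewrite /B ?normrM (ger0_norm B10) (ger0_norm B20) (ger0_norm B30).
  by apply: ler_pM => //; [exact: b1|apply: ler_pM => //; [exact: b2|exact: b3]].
Qed.

End regularity.

(** * The equation satisfied by the difference of the kernels *)

Section source_term.
Context {R : realType} (d : nat) (T : R).
Hypothesis T0 : 0 < T.
Local Notation RR := (measurableTypeR R).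
Local Notation X := 'rV[R]_d.
Local Notation P := (prob_torus R d).
Local Notation tau := (torus_leb R d).
Local Notation contQ := (@contQ R d T).
Variables (dF : X -> P -> X -> R) (mu1 mu2 : R -> P) (m1 m2 : R -> X -> R) (b1 b2 : R -> X -> X).
Variables (A1 A2 : R -> X -> 'M[R]_d) (K1 K2 : R -> X -> X -> R).
Hypothesis m1i : forall t, 0 < t < T -> tau.-integrable setT (EFin \o m1 t).
Hypothesis m2i : forall t, 0 < t < T -> tau.-integrable setT (EFin \o m2 t).
Hypothesis cA1 : forall i j, contQ (fun t x y => A1 t x i j).
Hypothesis cA2 : forall i j, contQ (fun t x y => A2 t x i j).
Hypotheses (h1 : C12_Q T K1) (h2 : C12_Q T K2).
Hypothesis e1 : kernel_equation T dF b1 A1 mu1 m1 K1.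
Hypothesis e2 : kernel_equation T dF b2 A2 mu2 m2 K2.
Let K t x y := K1 t x y - K2 t x y.

Lemma dotBl (p q v : X) : dot (p - q) v = dot p v - dot q v.
Proof. by rewrite /dot -sumrB; apply: eq_bigr => i _; rewrite !mxE mulrBl. Qed.

Lemma dotBr (v p q : X) : dot v (p - q) = dot v p - dot v q.
Proof. by rewrite /dot -sumrB; apply: eq_bigr => i _; rewrite !mxE mulrBr. Qed.

(** Two telescopings. The nonlocal terms of the operator share the integral of [m1], [A1], [Dy K2],
    [Dx K1]; those of the source share the one of [m2], [A1], [Dy K2], [Dx K2]. What remains is the
    difference of the two kernel equations. *)
Lemma source_eq t x y : 0 < t < T ->
  source dF mu1 mu2 m1 m2 b1 b2 A1 A2 K2 t x y =
  cls_heat K t x y + lower b1 A1 m1 (Dx K1) (Dy K2) (Dx K) (Dy K) t x y.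
Proof.
move=> t01.
have cx1 i := @contQ_coord R d T 1 d (Dx K1) 0 i (C12_gradx_cont h1); have cx2 i := @contQ_coord R d T 1 d (Dx K2) 0 i (C12_gradx_cont h2).
have cy1 i := @contQ_coord R d T 1 d (Dy K1) 0 i (C12_grady_cont h1); have cy2 i := @contQ_coord R d T 1 d (Dy K2) 0 i (C12_grady_cont h2).
have DxE z w : Dx K t z w = Dx K1 t z w - Dx K2 t z w by have [] := DxB h1 h2 z w t01.
have DyE z w : Dy K t z w = Dy K1 t z w - Dy K2 t z w by have [] := DyB h1 h2 z w t01.
have i11 := nonlocal_integrable x y t01 (m1i t01) cA1 cy1 cx1.
have i21 := nonlocal_integrable x y t01 (m1i t01) cA1 cy2 cx1.
have i22 := nonlocal_integrable x y t01 (m1i t01) cA1 cy2 cx2.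
have j22 := nonlocal_integrable x y t01 (m2i t01) cA1 cy2 cx2.
have k22 := nonlocal_integrable x y t01 (m2i t01) cA2 cy2 cx2.
have Ic : nonlocal m1 A1 (Dy K) (Dx K1) t x y =
    nonlocal m1 A1 (Dy K1) (Dx K1) t x y - nonlocal m1 A1 (Dy K2) (Dx K1) t x y.
  by rewrite /nonlocal -RintegralB//; apply: eq_Rintegral => z _; rewrite DyE dotBl mulrBr.
have Id : nonlocal m1 A1 (Dy K2) (Dx K) t x y =
    nonlocal m1 A1 (Dy K2) (Dx K1) t x y - nonlocal m1 A1 (Dy K2) (Dx K2) t x y.
  by rewrite /nonlocal -RintegralB//; apply: eq_Rintegral => z _; rewrite DxE mulmxBl dotBr mulrBr.
have Ia : nonlocal (fun t z => m1 t z - m2 t z) A1 (Dy K2) (Dx K2) t x y =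
    nonlocal m1 A1 (Dy K2) (Dx K2) t x y - nonlocal m2 A1 (Dy K2) (Dx K2) t x y.
  by rewrite /nonlocal -RintegralB//; apply: eq_Rintegral => z _; rewrite mulrBl.
have Ib : nonlocal m2 (fun t z => A1 t z - A2 t z) (Dy K2) (Dx K2) t x y =
    nonlocal m2 A1 (Dy K2) (Dx K2) t x y - nonlocal m2 A2 (Dy K2) (Dx K2) t x y.
  rewrite /nonlocal -RintegralB//; apply: eq_Rintegral => z _.
  by rewrite linearB/= mulmxBr dotBr mulrBr.
have [_ eT] := DtB h1 h2 x y t01.
rewrite /source /lower /cls_heat Ia Ib Ic Id DxE DyE eT (lapxB h1 h2)// (lapyB h1 h2)// !dotBl !dotBr.
move: (e1 x y t01) (e2 x y t01) => <- <-.
move: (dot (b1 t x) (Dx K1 t x y)) (dot (b1 t x) (Dx K2 t x y)) (dot (b2 t x) (Dx K2 t x y)).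
move: (dot (b1 t y) (Dy K1 t x y)) (dot (b1 t y) (Dy K2 t x y)) (dot (b2 t y) (Dy K2 t x y)).
move: (nonlocal m1 A1 (Dy K1) (Dx K1) t x y) (nonlocal m1 A1 (Dy K2) (Dx K1) t x y).
move: (nonlocal m1 A1 (Dy K2) (Dx K2) t x y) (nonlocal m2 A1 (Dy K2) (Dx K2) t x y).
move: (nonlocal m2 A2 (Dy K2) (Dx K2) t x y) (Dt K1 t x y) (Dt K2 t x y).
move: (lapx K1 t x y) (lapx K2 t x y) (lapy K1 t x y) (lapy K2 t x y).
by move=> *; ring.
Qed.

End source_term.

Theorem theorem4p2 (R : realType) (d : nat) (T a nu M : R)
    (d_gt0 : (0 < d)%N) (T_gt0 : 0 < T) (a_gt0 : 0 < a) (nu_gt1 : 1 < nu)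
    (M_gt0 : 0 < M) :
  exists lam1 C : R, [/\ 1 <= lam1, 0 < C &
    forall (H : 'rV[R]_d -> 'rV[R]_d -> R)
      (F : 'rV[R]_d -> prob_torus R d -> R)
      (dF : 'rV[R]_d -> prob_torus R d -> 'rV[R]_d -> R)
      (G1 G2 : 'rV[R]_d -> prob_torus R d -> R)
      (U1 U2 : R -> 'rV[R]_d -> prob_torus R d -> R)
      (dU1 dU2 : R -> 'rV[R]_d -> prob_torus R d -> 'rV[R]_d -> R)
      (m0 : prob_torus R d) (mu1 mu2 : R -> prob_torus R d)
      (m1 m2 : R -> 'rV[R]_d -> R),
    let b1 := coef_b H U1 mu1 in let b2 := coef_b H U2 mu2 in
    let A1 := coef_A H U1 mu1 in let A2 := coef_A H U2 mu2 in
    let K1 := flow_kernel dU1 mu1 in let K2 := flow_kernel dU2 mu2 in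
    let K := fun t x y => K1 t x y - K2 t x y in
    hamiltonian H ->
    running_cost F dF -> terminal_cost G1 -> terminal_cost G2 ->
    classical_solution T H F G1 U1 dU1 ->
    classical_solution T H F G2 U2 dU2 ->
    flow T H U1 m0 mu1 m1 -> flow T H U2 m0 mu2 m2 ->
    C12_Q T K1 -> kernel_equation T dF b1 A1 mu1 m1 K1 ->
    C12_Q T K2 -> kernel_equation T dF b2 A2 mu2 m2 K2 ->
    coefficient_bound T M b1 A1 m1 K1 ->
    coefficient_bound T M b2 A2 m2 K2 ->
    (forall (V : R -> 'rV[R]_d -> 'rV[R]_d -> R) (S : sobolev T V) (lam : R),
       lam1 <= lam ->
       carleman a nu lam C S (LK b1 A1 m1 K1 K2 S)) /\
    (forall (S : sobolev T K) (lam : R), lam1 <= lam ->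
       carleman a nu lam C S (source dF mu1 mu2 m1 m2 b1 b2 A1 A2 K2))].
Proof.
have B0 := lower_const_ge0 d M; have c0 := rate_gt0 a_gt0 nu_gt1.
(* The witnesses precede all the data: the threshold is computed from [a], [nu], [d], [M], the
   constant from [a] and [nu]. *)
exists (carleman_lam a nu (lower_const d M)), (carleman_const a nu); split.
- by rewrite /carleman_lam lerDl divr_ge0//; [exact: mulr_ge0|exact: ltW].
- by rewrite /carleman_const mulr_gt0// addr_gt0// ?mulr_gt0// invr_gt0.
move=> H F dF G1 G2 U1 U2 dU1 dU2 m0 mu1 mu2 m1 m2 b1 b2 A1 A2 K1 K2 K hH _ _ _ hU1 hU2 hm1 hm2 h1 e1 h2 e2 bd1 bd2.
have cb i : contQ T (fun t x y => b1 t x 0 i) by exact: (contQ_coef_b hH hU1 hm1).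
have cA1 i j : contQ T (fun t x y => A1 t x i j) by exact: (contQ_coef_A hH hU1 hm1).
have cA2 i j : contQ T (fun t x y => A2 t x i j) by exact: (contQ_coef_A hH hU2 hm2).
have mb i := contQ_measurable (@cb i).
have mA i j := contQ_measurable (@cA1 i j).
have mm := mQ_density hm1.
have mq1 i := contQ_measurable (@contQ_coord R d T 1 d (Dx K1) 0 i (C12_gradx_cont h1)).
have mp2 i := contQ_measurable (@contQ_coord R d T 1 d (Dy K2) 0 i (C12_grady_cont h2)).
have [_ _ _ _ p2M] := coefficient_bound_ae T_gt0 bd2.
(* The second estimate is not deduced from the first. There [LK] is built on the weak derivatives
   carried by [S], whereas [source_eq] involves the classical derivatives of [K], so the heat
   argument is run again with the latter. *)
split=> [V S lam hlam|S lam hlam].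
  exact: (@carleman_sobolev R d T a nu M T_gt0 a_gt0 nu_gt1 M_gt0 b1 A1 m1 K1 K2 mb mA mm mq1 mp2 bd1 p2M V S lam hlam).
have [f1 f2 f3 f4 _] := coefficient_bound_ae T_gt0 bd1.
have cK : contQ T K by apply: contQB; [exact: (contQ_flow_kernel hU1 hm1)|exact: (contQ_flow_kernel hU2 hm2)].
have cKt : contQ T (Dt K) := contQ_Dt h1 h2.
have cKx i : contQ T (fun t x y => Dx K t x y 0 i) by exact: (contQ_Dx h1 h2).
have cKy i : contQ T (fun t x y => Dy K t x y 0 i) by exact: (contQ_Dy h1 h2).
have cKxx i : contQ T (fun t x y => hess (fun z => K t z y) x i i) by exact: (contQ_hessx h1 h2).
have cKyy i : contQ T (fun t x y => hess (K t x) y i i) by exact: (contQ_hessy h1 h2).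
have dKt t x y (t01 : 0 < t < T) : derivable (fun s => K s x y) t 1 by have [] := DtB h1 h2 x y t01.
have dKx t x y (t01 : 0 < t < T) : has_grad (fun z => K t z y) x by have [] := DxB h1 h2 x y t01.
have dKy t x y (t01 : 0 < t < T) : has_grad (K t x) y by have [] := DyB h1 h2 x y t01.
have dKxx t x y (t01 : 0 < t < T) : has_hess (fun z => K t z y) x by have [] := hessxB h1 h2 x y t01.
have dKyy t x y (t01 : 0 < t < T) : has_hess (K t x) y by have [] := hessyB h1 h2 x y t01.
have pKx t y (t01 : 0 < t < T) : torus_periodic (fun x => K t x y).
  have p1 : torus_periodic (fun x => K1 t x y) by exact: (flow_kernel_perx mu1 hU1 y t01).
  have p2 : torus_periodic (fun x => K2 t x y) by exact: (flow_kernel_perx mu2 hU2 y t01).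
  by move=> x i; rewrite /K p1 p2.
have pKy t x (t01 : 0 < t < T) : torus_periodic (K t x).
  have p1 : torus_periodic (K1 t x) by exact: (flow_kernel_pery mu1 hU1 x t01).
  have p2 : torus_periodic (K2 t x) by exact: (flow_kernel_pery mu2 hU2 x t01).
  by move=> y i; rewrite /K p1 p2.
have mx i := contQ_measurable (@cKx i); have my i := contQ_measurable (@cKy i).
have mL := measurable_slab_lower mb mA mm mq1 mp2 mx my.
have cH : contQ T (cls_heat K).
  have c2 : contQ T (fun t x y => \sum_i cls_dir2 K i t x y).
    by apply: contQ_sum => -[i|i]; [exact: cKxx|exact: cKyy].
  apply: (contQ_eq (contQB (contQN cKt) c2)) => t x y _; exact/esym/cls_heatE.
have mZ := measurable_slab (contQ_measurable cH).
have E w : slab T (source dF mu1 mu2 m1 m2 b1 b2 A1 A2 K2) w =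
    slab T (cls_heat K) w + slab T (lower b1 A1 m1 (Dx K1) (Dy K2) (Dx K) (Dy K)) w.
  rewrite /slab; case: ifP => [t01|_]; last by rewrite addr0.
  have m1i t : 0 < t < T -> (torus_leb R d).-integrable setT (EFin \o m1 t) by exact: (flow_integrable hm1).
  have m2i t : 0 < t < T -> (torus_leb R d).-integrable setT (EFin \o m2 t) by exact: (flow_integrable hm2).
  exact: (@source_eq R d T dF mu1 mu2 m1 m2 b1 b2 A1 A2 K1 K2 m1i m2i cA1 cA2 h1 h2 e1 e2 w.1 w.2.1 w.2.2 t01).
have mw := measurable_weight a nu lam.
have w0 t : 0 <= weight a nu lam t by exact/ltW/weight_gt0.
have LB := lower_bound mb mA mm mq1 mp2 mx my M_gt0 mw w0 f1 f2 f3 f4 p2M.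
(* The lower order terms are bounded by classical gradients, but the estimate is stated with the
   weak ones; their weighted norms coincide. *)
have sE : (\sum_i \int[cylinder d T_gt0]_w (weight a nu lam w.1 * slab T (fun t x y => Dx K t x y 0 i) w ^+ 2)%:E +
    \sum_i \int[cylinder d T_gt0]_w (weight a nu lam w.1 * slab T (fun t x y => Dy K t x y 0 i) w ^+ 2)%:E =
    \sum_i \int[cylinder d T_gt0]_w (weight a nu lam w.1 * slab T (sob_dir S i) w ^+ 2)%:E)%E.
  rewrite big_sumType/=; congr (_ + _)%E; apply: eq_bigr => i _.
    exact: (weighted_cls_dir T_gt0 cK cKx cKy dKx dKy pKx pKy a nu lam S (inl i)).
  exact: (weighted_cls_dir T_gt0 cK cKx cKy dKx dKy pKx pKy a nu lam S (inr i)).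
rewrite sE in LB.
have mf : measurable_fun (@Q R d T) (fun q => source dF mu1 mu2 m1 m2 b1 b2 A1 A2 K2 q.1.1 q.1.2 q.2).
  apply: measurable_slab_inv.
  by apply: (@eq_measurable_fun _ _ _ _ _ _ _ (fun w _ => esym (E w))); exact: measurable_funD.
have wh := cls_weak_heat T_gt0 cK cKt dKt cKx cKy dKx dKy cKxx cKyy dKxx dKyy pKx pKy S.
exact: (carleman_of_heat a_gt0 nu_gt1 B0 hlam mf mZ mL E (fun _ => wh) LB).
Qed.
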